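(* Let $G$ be a finite group and let $V$ be a finite-dimensional representation of $G$ over a field $\Bbbk$. If there exists a graded geometric separating algebra $A\subseteq\Bbbk[V]^G$ which is a complete intersection, then the action of $G$ on $V$ is generated by bireflections.
   Context: $\Bbbk[V]$ denotes the symmetric algebra on the dual space $V^*$ (standard grading), with $G$ acting by $(\sigma\cdot f)(u)=f(\sigma^{-1}u)$; $\Bbbk[V]^G$ is the (graded) ring of invariants. Let $\overline{\Bbbk}$ be an algebraic closure of $\Bbbk$ and $\overline V=V\otimes_\Bbbk\overline{\Bbbk}$, with the extended $G$-action; elements of $\Bbbk[V]$ are regarded as functions $\overline V\to\overline{\Bbbk}$. A subalgebra $A\subseteq\Bbbk[V]^G$ is a geometric separating algebra if for all $u,v\in\overline V$: $f(u)=f(v)$ for all $f\in\Bbbk[V]^G$ if and only if $h(u)=h(v)$ for all $h\in A$. ''Graded'' means $A$ is a graded subalgebra of $\Bbbk[V]^G$. A bireflection is an element of $G$ fixing (pointwise) a subspace of codimension $2$ in $V$ (equivalently, its fixed space has codimension at most $2$); ''the action is generated by bireflections'' means the image of $G$ in $GL(V)$ is generated by the images of such elements. *)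

(* Defs.v *)
From mathcomp Require Import all_boot all_order all_algebra all_fingroup all_field.
From mathcomp Require Import mxrepresentation.
From mathcomp Require Import mpoly.
Set Implicit Arguments. Unset Strict Implicit. Unset Printing Implicit Defensive.
Import GRing.Theory.
Local Open Scope ring_scope.

(* V = k^n (row vectors), G acts on V by v |-> v *m rG g.
   k[V] = {mpoly k[n]}, 'X_i = i-th coordinate function. *)

(* the linear substitution x_i |-> (x *m M)_i = \sum_j M j i x_j *)
Definition lin_subst (k : fieldType) (n : nat) (M : 'M[k]_n)
  : n.-tuple {mpoly k[n]} := [tuple \sum_(j < n) M j i *: 'X_j | i < n].

Definition invariant (k : fieldType) (gT : finGroupType) (G : {group gT})
  (n : nat) (rG : mx_representation k G n) (f : {mpoly k[n]}) : Prop :=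
  forall g, g \in G -> f \mPo lin_subst (rG g) = f.

Definition graded_subalgebra_of_invariants (k : fieldType) (gT : finGroupType)
  (G : {group gT}) (n : nat) (rG : mx_representation k G n)
  (A : {mpoly k[n]} -> Prop) : Prop :=
  [/\ forall f, A f -> invariant rG f,
      A 1 /\ (forall c f, A f -> A (c *: f)),
      (forall f h, A f -> A h -> A (f + h)),
      (forall f h, A f -> A h -> A (f * h)) &
      (forall f d, A f -> A (pihomog mdeg d f))].

Definition is_algebraic_closure (k : fieldType) (L : closedFieldType)
  (iota : {rmorphism k -> L}) : Prop :=
  forall x : L, exists p : {poly k}, p != 0 /\ root (map_poly iota p) x.

Definition evalbar (k : fieldType) (L : closedFieldType) (iota : {rmorphism k -> L})
  (n : nat) (f : {mpoly k[n]}) (u : 'I_n -> L) : L :=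
  (map_mpoly iota f).@[u].

Definition geometric_separating (k : fieldType) (gT : finGroupType)
  (G : {group gT}) (n : nat) (rG : mx_representation k G n)
  (L : closedFieldType) (iota : {rmorphism k -> L})
  (A : {mpoly k[n]} -> Prop) : Prop :=
  forall u v : 'I_n -> L,
    (forall f, invariant rG f -> evalbar iota f u = evalbar iota f v) <->
    (forall h, A h -> evalbar iota h u = evalbar iota h v).

Definition in_ideal_prefix (R : comNzRingType) (c : nat) (r : 'I_c -> R)
  (i : nat) (h : R) : Prop :=
  exists a : 'I_c -> R, h = \sum_(j < c | (j < i)%N) a j * r j.

Definition regular_sequence (R : comNzRingType) (c : nat) (r : 'I_c -> R) : Prop :=
  ~ in_ideal_prefix r c 1 /\
  forall (i : 'I_c) (h : R),
    in_ideal_prefix r i (h * r i) -> in_ideal_prefix r i h.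

(* A is a (graded) complete intersection: A = k[Y_1..Y_m]/(r_1..r_c) where the
   Y_i are sent to homogeneous elements f_i of positive degree generating A
   and r is a regular sequence generating the kernel of the presentation. *)
Definition graded_complete_intersection (k : fieldType) (n : nat)
  (A : {mpoly k[n]} -> Prop) : Prop :=
  exists (m : nat) (f : 'I_m -> {mpoly k[n]}) (d : 'I_m -> nat)
         (c : nat) (r : 'I_c -> {mpoly k[m]}),
  [/\ forall i, [/\ (0 < d i)%N, f i \is (d i).-homog & A (f i)],
      forall h, A h <-> exists p : {mpoly k[m]}, h = p \mPo [tuple f i | i < m],
      forall p : {mpoly k[m]}, p \mPo [tuple f i | i < m] = 0 <-> in_ideal_prefix r c p
    & regular_sequence r].

Definition bireflection (k : fieldType) (gT : finGroupType) (G : {group gT})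
  (n : nat) (rG : mx_representation k G n) (g : gT) : bool :=
  (n - \rank (kermx (rG g - 1%:M)) <= 2)%N.

(* the image of G in GL(V) is generated by the images of bireflections *)
Definition generated_by_bireflections (k : fieldType) (gT : finGroupType)
  (G : {group gT}) (n : nat) (rG : mx_representation k G n) : Prop :=
  forall g, g \in G ->
    exists2 h, h \in <<[set b in G | bireflection rG b]>>%g & rG g = rG h.

(* Main.v *)
Require Import Defs.
From HB Require Import structures.
From mathcomp Require Import all_boot all_order all_algebra all_fingroup all_field.
From mathcomp Require Import mxrepresentation.
From mathcomp Require Import mpoly.
From mathcomp Require Import zify ring.
From Stdlib Require Import Classical ClassicalEpsilon.
Set Implicit Arguments. Unset Strict Implicit. Unset Printing Implicit Defensive.
Import GRing.Theory.
Local Open Scope ring_scope.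

(* Over an algebraically closed field of characteristic p, write A = P/(r_1..r_c) with P polynomial in
   m >= c + n variables, and let H be generated by the bireflections.  Since A separates orbits, a fixed power
   p^Q0 sends invariants into A.  If H <> G, elements outside H move a space of dimension at least three, and
   Galois coordinates give a trace from H-invariants to A together with parameters g_0, g_1, g_2,.. of A such that
   g_0, g_1, g_2 are combinations of traces.  The ring B of the H-invariants b with Tr(s^(p^Q0) b) in A for
   all s strictly contains A.  In the fibre product of P/(r^q) and the truncated extension of B, q = p^e, one counts the
   families (x_a) with r_i x_a = x_(a - e_i): the three parameters make local lifts glue (a cocycle argument on
   A/(g_0, g_1)), so adding an exponent of r never loses dimension, and the extra part B/A forces the counts
   to grow exponentially in the degree, whereas they grow polynomially.
   In characteristic zero everything is witnessed by finitely many polynomial identities and is specialised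
   to a large prime characteristic; the kernel of the presentation is controlled there by the leading
   monomials of the graph ideal and a count of standard monomials, which is the same in both characteristics. *)

(** * Exchange arguments and Frobenius powers *)

(** The argument is a hands-on form of purity: a complete intersection has no proper connected cover
    unramified outside codimension three, and up to Frobenius powers [B] over [A] would be one. The
    obstacle is that only [A] is known to be Cohen-Macaulay, so that a compatible family with values
    in the twist of [B] may fail to extend. Extending it costs one factor [h 0], of degree [gam]
    independent of q, and dividing by that factor is obstructed in copies of A/(g_0). Gains are thus
    Hilbert functions of [B], losses are Hilbert functions of a ring of one dimension less. The
    Frobenius twist makes the comparison rigid: P/(r^q) is the twist of [A], the annihilator of r in
    it is again a copy of [A], and below degree q the twist of [B] is no larger than that of [A],
    because a q-th power of positive degree has degree at least q. Apart from the count giving m >=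
    c + n, regularity enters only through one fact, that a polynomial ring is free over homogeneous
    parameters; this too is proved by counting box monomials modulo q-th powers. *)

Section LinearAlgebra.
Variables (K : fieldType) (V : lmodType K).
Implicit Types (W : V -> Prop) (I J : finType).

Definition subsp W :=
  [/\ W 0, forall x y, W x -> W y -> W (x + y) & forall c x, W x -> W (c *: x)].

(** No quotient space is formed: with [W] an ideal, or equality with 0, one exchange argument serves
    counts modulo an ideal and plain dimension counts. *)
Definition indep_mod W I (u : I -> V) :=
  forall c : I -> K, W (\sum_i c i *: u i) -> forall i, c i = 0.


Lemma subsp_sum W (hW : subsp W) I (P : pred I) (F : I -> V) :
  (forall i, P i -> W (F i)) -> W (\sum_(i | P i) F i).
Proof.
by case: hW => W0 WD _ WF; elim/big_ind: _ => //; exact: WD.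
Qed.

Lemma subsp0 : subsp (fun x => x = 0).
Proof. by split=> // [x y -> ->|c x ->]; rewrite ?addr0 ?scaler0. Qed.

Section Exchange.
Variables (W : V -> Prop) (I J : finType) (u : I -> V) (v : J -> V).
Hypotheses (hW : subsp W) (ind_u : indep_mod W u)
  (span_v : forall i, exists C : J -> K, W (u i - \sum_j C j *: v j)).

(** The coordinates of the [u i] on the [v j] form a matrix; a row vector killed by it is a relation
    among the [u i] modulo [W], so independence makes its rows free. *)
Let exM : exists2 M : 'M[K]_(#|I|, #|J|), row_free M &
  forall x : 'rV_#|I|, W (\sum_i x 0 (enum_rank i) *: u i
     - \sum_j (x *m M) 0 (enum_rank j) *: v j).
Proof.
have [C hC] := fin_all_exists span_v.
pose M : 'M[K]_(#|I|, #|J|) := \matrix_(i, j) C (enum_val i) (enum_val j).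
have key (x : 'rV_#|I|) : W (\sum_i x 0 (enum_rank i) *: u i
     - \sum_j (x *m M) 0 (enum_rank j) *: v j).
  have -> : \sum_j (x *m M) 0 (enum_rank j) *: v j =
      \sum_i x 0 (enum_rank i) *: \sum_j C i j *: v j.
    under [RHS]eq_bigr => i _ do rewrite scaler_sumr.
    rewrite [RHS]exchange_big /=; apply: eq_bigr => j _.
    rewrite mxE scaler_suml (reindex (@enum_rank I)) /=; last first.
      by exists enum_val => i _; rewrite ?enum_rankK ?enum_valK.
    by apply: eq_bigr => i _; rewrite mxE !enum_rankK scalerA.
  rewrite -sumrB; apply: subsp_sum => // i _; rewrite -scalerBr.
  by case: hW => _ _; apply.
exists M => //; apply: inj_row_free => x xM0.
have := key x; rewrite xM0 [X in _ - X]big1 ?subr0; last first.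
  by move=> j _; rewrite mxE scale0r.
move=> /(@ind_u (fun i => x 0 (enum_rank i))) x0.
by apply/rowP => i; rewrite mxE -(enum_valK i) x0.
Qed.

Lemma exchange_leq : (#|I| <= #|J|)%N.
Proof.
by case: exM => M /eqP fM _; rewrite -[X in (X <= _)%N]fM rank_leq_col.
Qed.

(** Equal sizes make the coordinate matrix invertible, so a relation among the [v j] pulls back to
    one among the [u i]. *)
Lemma exchange_indep : (#|J| <= #|I|)%N -> indep_mod W v.
Proof.
move=> leJI; case: exM => M fM key d Wd.
have fullM : row_full M.
  by rewrite /row_full eqn_leq rank_leq_col (eqP fM) leJI.
have [x dE] := submxP (submx_full (\row_j d (enum_val j)) fullM).
have Wx : W (\sum_i x 0 (enum_rank i) *: u i).
  have := key x; rewrite -dE => Wd'.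
  case: hW => _ WD _; have := WD _ _ Wd' Wd; rewrite -addrA [X in _ + X](_ : _ = 0) ?addr0 //.
  rewrite addrC; apply/eqP; rewrite subr_eq0; apply/eqP.
  by apply: eq_bigr => j _; rewrite mxE enum_rankK.
have x0 : x = 0.
  by apply/rowP => i; rewrite mxE -(enum_valK i); apply: (@ind_u (fun i => x 0 (enum_rank i)) Wx).
move=> j; have := congr1 (fun M : 'rV_#|J| => M 0 (enum_rank j)) dE.
by rewrite x0 mul0mx !mxE enum_rankK.
Qed.
End Exchange.
End LinearAlgebra.

(** * The polynomial ring over its subring of q-th powers *)

Section FrobeniusSplitting.
Variables (K : closedFieldType) (p : nat).
Hypothesis charK : p \in [pchar K].
Implicit Types (n m l e : nat).

Lemma pchar_mpoly n : p \in [pchar {mpoly K[n]}].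
Proof. exact: (rmorph_pchar (@mpolyC n K)). Qed.

Lemma pchar_expD (R : comNzRingType) e (x y : R) : p \in [pchar R] ->
  (x + y) ^+ (p ^ e) = x ^+ (p ^ e) + y ^+ (p ^ e).
Proof.
move=> pR; apply: exprDn_pchar; rewrite pnatX; apply/orP; left.
by rewrite pnatE // (pcharf_prime pR).
Qed.

Lemma pchar_exp_sum (R : comNzRingType) e (I : Type) (r : seq I) (P : pred I) (F : I -> R) :
  p \in [pchar R] ->
  (\sum_(i <- r | P i) F i) ^+ (p ^ e) = \sum_(i <- r | P i) F i ^+ (p ^ e).
Proof.
move=> pR; have q0 : (0 < p ^ e)%N by rewrite expn_gt0 prime_gt0 ?(pcharf_prime pR).
elim/big_rec2: _ => [|i x y _ <-]; first by rewrite expr0n -[_ == _]negbK -lt0n q0.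
by rewrite pchar_expD.
Qed.

Lemma pchar_expB (R : comNzRingType) e (x y : R) : p \in [pchar R] ->
  (x - y) ^+ (p ^ e) = x ^+ (p ^ e) - y ^+ (p ^ e).
Proof.
by move=> pR; have := pchar_expD e (x - y) y pR; rewrite subrK => ->; rewrite addrK.
Qed.

Lemma pchar_exp_inj (R : idomainType) e : p \in [pchar R] ->
  injective (fun x : R => x ^+ (p ^ e)).
Proof.
move=> pR x y /= /eqP; rewrite -subr_eq0 -pchar_expB // expf_eq0 => /andP[_].
by rewrite subr_eq0 => /eqP.
Qed.

Lemma closed_root (q : nat) (c : K) : (0 < q)%N -> exists d : K, d ^+ q = c.
Proof.
move=> q0; have [d dE] := solve_monicpoly (fun i => if i == 0%N then c else 0) q0.
exists d; rewrite dE (bigD1 (Ordinal q0)) //= expr0 mulr1 big1 ?addr0 // => i.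
by rewrite -val_eqE /= => /negPf ->; rewrite mul0r.
Qed.

(** Exponents below q; for q a power of p their monomials form the basis of the polynomial ring over
    its q-th powers, and most finite counts of the proof run over such boxes. *)
Definition mbox q m (a : {ffun 'I_m -> 'I_q}) : 'X_{1..m} := [multinom (a i : nat) | i < m].

Lemma mbox_split q m (q0 : (0 < q)%N) (mu : 'X_{1..m}) :
  exists (a : {ffun 'I_m -> 'I_q}) (nu : 'X_{1..m}), mu = (mbox a + nu *+ q)%MM.
Proof.
exists [ffun i => Ordinal (ltn_pmod (mu i) q0)], [multinom (mu i %/ q)%N | i < m].
apply/mnmP => i; rewrite mnmDE mulmnE !mnmE ffunE /= addnC; exact: divn_eq.
Qed.

Lemma mbox_inj q m (a b : {ffun 'I_m -> 'I_q}) mu nu :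
  (mbox a + mu *+ q)%MM = (mbox b + nu *+ q)%MM -> a = b /\ mu = nu.
Proof.
move=> /mnmP E; have E1 i : (a i = b i :> nat) /\ mu i = nu i.
  have := E i; rewrite !mnmDE !mulmnE !mnmE => Ei.
  have q0 : (0 < q)%N by apply: leq_ltn_trans (ltn_ord (a i)).
  split; first by have := congr1 (modn^~ q) Ei; rewrite /= !(addnC _ (_ * q)%N) !modnMDl !modn_small.
  have := congr1 (divn^~ q) Ei; rewrite /= !(addnC _ (_ * q)%N) !divnMDl //.
  by rewrite !divn_small // !addn0.
split; first by apply/ffunP => i; apply/val_inj; case: (E1 i).
by apply/mnmP => i; case: (E1 i).
Qed.

Lemma mpoly_expq n e (u : {mpoly K[n]}) :
  u ^+ (p ^ e) = \sum_(mu <- msupp u) u@_mu ^+ (p ^ e) *: 'X_[mu *+ (p ^ e)].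
Proof.
rewrite {1}(mpolyE u) pchar_exp_sum; last exact: pchar_mpoly.
by apply: eq_bigr => mu _; rewrite exprZn mpolyXn.
Qed.

Lemma mcoeff_split n e (a b : {ffun 'I_n -> 'I_(p ^ e)}) (u : {mpoly K[n]}) mu :
  ('X_[mbox b] * u ^+ (p ^ e))@_(mbox a + mu *+ (p ^ e))
    = if a == b then u@_mu ^+ (p ^ e) else 0.
Proof.
rewrite mpoly_expq mulr_sumr raddf_sum /=.
under eq_bigr => nu _ do rewrite -scalerAr -mpolyXD mcoeffZ mcoeffX.
have [->|nab] := eqVneq a b.
  have [mu_u|mu_u] := boolP (mu \in msupp u); last first.
    rewrite (memN_msupp_eq0 mu_u) expr0n expn_eq0 -[p == 0%N]negbK -lt0n.
    rewrite prime_gt0 ?(pcharf_prime charK) //= big1_seq // => nu /andP[_ nu_u].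
    case: eqP => [/mbox_inj[_ E]|_]; last by rewrite mulr0.
    by rewrite -E nu_u in mu_u.
  rewrite (bigD1_seq mu) ?msupp_uniq //= eqxx mulr1 big1 ?addr0 // => nu nu_mu.
  case: eqP => [/mbox_inj[_ E]|_]; last by rewrite mulr0.
  by rewrite E eqxx in nu_mu.
rewrite big1 // => nu _; case: eqP => [/mbox_inj[E _]|_]; last by rewrite mulr0.
by rewrite E eqxx in nab.
Qed.

(** The exponents of ['X_[mbox a]] times a q-th power are congruent to [a] modulo q, so distinct [a]
    have disjoint supports and nothing cancels. *)
Lemma frob_split_uniq n e (u : {ffun 'I_n -> 'I_(p ^ e)} -> {mpoly K[n]}) :
  \sum_a 'X_[mbox a] * u a ^+ (p ^ e) = 0 -> forall a, u a = 0.
Proof.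
move=> /mpolyP E a; apply/mpolyP => mu; rewrite mcoeff0.
have := E (mbox a + mu *+ (p ^ e))%MM; rewrite mcoeff0 raddf_sum /=.
under eq_bigr => b _ do rewrite mcoeff_split.
rewrite (bigD1 a) //= eqxx big1 ?addr0; last by move=> b /negPf; rewrite eq_sym => ->.
by move/eqP; rewrite expf_eq0 => /andP[_ /eqP].
Qed.

(** Coefficients have q-th roots in the closed field, so each term is a box monomial times a q-th
    power. *)
Lemma frob_split_ex n e (x : {mpoly K[n]}) :
  exists u : {ffun 'I_n -> 'I_(p ^ e)} -> {mpoly K[n]},
    x = \sum_a 'X_[mbox a] * u a ^+ (p ^ e).
Proof.
have q0 : (0 < p ^ e)%N by rewrite expn_gt0 prime_gt0 ?(pcharf_prime charK).
elim/mpolyind: x => [|c mu x _ _ [u ->]].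
  exists (fun=> 0); rewrite big1 // => a _.
  by rewrite expr0n -[_ == _]negbK -lt0n q0 mulr0.
have [d <-] := closed_root c q0; have [a [nu ->]] := mbox_split q0 mu.
exists (fun b => u b + (if b == a then d *: 'X_[nu] else 0)).
under [RHS]eq_bigr => b _ do rewrite /= (pchar_expD e _ _ (pchar_mpoly n)) mulrDr.
rewrite big_split /= addrC; congr (_ + _).
rewrite (bigD1 a) //= eqxx big1 ?addr0 => [|b /negPf->].
  by rewrite exprZn mpolyXn mpolyXD scalerAr.
by rewrite expr0n -[_ == _]negbK -lt0n q0 mulr0.
Qed.
End FrobeniusSplitting.

(** * Freeness over parameters *)

Notation "p ^$ f" := (p \mPo [tuple f i | i < _]) (at level 9, f at level 8).

Section Subst.
Variables (R : comNzRingType) (n m : nat) (f : 'I_m -> {mpoly R[n]}).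

Lemma substX mu : ('X_[mu] : {mpoly R[m]})^$ f = \prod_(i < m) f i ^+ mu i.
Proof. by rewrite comp_mpolyX; apply: eq_bigr => i _; rewrite tnth_mktuple. Qed.

Lemma substXU i : ('X_i : {mpoly R[m]})^$ f = f i.
Proof. by rewrite comp_mpolyXU -tnth_nth tnth_mktuple. Qed.

Lemma subst_ind (A : {mpoly R[n]} -> Prop) (F : {mpoly R[m]}) : A 0 ->
  (forall c mu x, A x -> A (c *: (\prod_(i < m) f i ^+ mu i) + x)) ->
  A (F^$ f).
Proof.
move=> A0 AS; elim/mpolyind: F => [|c mu F _ _ IH]; first by rewrite comp_mpoly0.
by rewrite comp_mpolyD comp_mpolyZ substX; apply: AS.
Qed.
End Subst.

Definition in_ideal (R : pzSemiRingType) (l : nat) (t : 'I_l -> R) (x : R) :=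
  exists q : 'I_l -> R, x = \sum_j t j * q j.

Section InIdeal.
Variables (R : comNzRingType) (l : nat) (t : 'I_l -> R).
Local Notation W := (in_ideal t).

Lemma in_ideal0 : W 0.
Proof. by exists (fun=> 0); rewrite big1 // => i _; rewrite mulr0. Qed.

Lemma in_idealD x y : W x -> W y -> W (x + y).
Proof.
move=> [q ->] [r ->]; exists (fun i => q i + r i).
by rewrite -big_split; apply: eq_bigr => i _; rewrite mulrDr.
Qed.

Lemma in_idealMr x y : W x -> W (x * y).
Proof.
move=> [q ->]; exists (fun i => q i * y).
by rewrite mulr_suml; apply: eq_bigr => i _; rewrite mulrA.
Qed.

Lemma in_idealMl x y : W y -> W (x * y).
Proof. by rewrite mulrC; apply: in_idealMr. Qed.

Lemma in_idealN x : W x -> W (- x).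
Proof. by rewrite -mulrN1; apply: in_idealMr. Qed.


Lemma in_ideal_gen j : W (t j).
Proof.
exists (fun i => (i == j)%:R); rewrite (bigD1 j) //= eqxx mulr1 big1 ?addr0 //.
by move=> i /negPf ->; rewrite mulr0.
Qed.

Lemma in_ideal_sum I (r : seq I) (P : pred I) F :
  (forall i, P i -> W (F i)) -> W (\sum_(i <- r | P i) F i).
Proof. by move=> WF; elim/big_ind: _ => //; [apply: in_ideal0|apply: in_idealD]. Qed.

End InIdeal.

Lemma in_ideal_subsp (K : fieldType) (R : comAlgType K) l (t : 'I_l -> R) :
  subsp (in_ideal t).
Proof.
split; [exact: in_ideal0|exact: in_idealD|move=> c x].
by rewrite -mulr_algl; apply: in_idealMl.
Qed.

Lemma sum_pair (V : nmodType) (I J : finType) (F : I * J -> V) :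
  \sum_ij F ij = \sum_i \sum_j F (i, j).
Proof. by rewrite pair_bigA; apply: eq_bigr => [[]]. Qed.

Section FreeOverParameters.
Variables (K : closedFieldType) (p : nat) (m l : nat).
Hypothesis charK : p \in [pchar K].
Variables (t : 'I_l -> {mpoly K[m]}) (I : finType) (b : I -> {mpoly K[m]}).
Hypothesis span_b : forall x, exists F : I -> {mpoly K[l]},
  x = \sum_i b i * (F i)^$ t.
Hypothesis ind_b : indep_mod (in_ideal t) b.
Hypothesis leq_lm : (l <= m)%N.

Let pp : prime p. Proof. exact: pcharf_prime charK. Qed.

Let W e := in_ideal (fun j => t j ^+ (p ^ e)).

Let tpow (e : nat) (a : {ffun 'I_l -> 'I_(p ^ e)}) := \prod_(i < l) t i ^+ a i.

Let red_monomial e (F : {mpoly K[l]}) :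
  exists C : {ffun 'I_l -> 'I_(p ^ e)} -> K,
    W e (F^$ t - \sum_a C a *: tpow a).
Proof.
have q0 : (0 < p ^ e)%N by rewrite expn_gt0 prime_gt0.
have hW : subsp (W e) by apply: in_ideal_subsp.
elim/subst_ind: _ => [|c mu x [C WC]].
  by exists (fun=> 0); rewrite big1 ?subr0 => [|a _]; [case: hW|rewrite scale0r].
have [/existsP[j mu_j]|/existsPn mu_lt] := boolP [exists j, (p ^ e <= mu j)%N].
  exists C; rewrite -addrA; apply: in_idealD => //.
  rewrite -mulr_algl; apply: in_idealMl; rewrite (bigD1 j) //=; apply: in_idealMr.
  rewrite -(subnKC mu_j) exprD; apply: in_idealMr.
  exact: (in_ideal_gen (fun j => t j ^+ (p ^ e))).
pose a : {ffun 'I_l -> 'I_(p ^ e)} := [ffun i => Ordinal (ltn_pmod (mu i) q0)].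
exists (fun a' => C a' + c * (a' == a)%:R).
have -> : \sum_a' (C a' + c * (a' == a)%:R) *: tpow a' = c *: tpow a + \sum_a' C a' *: tpow a'.
  under eq_bigr => a' _ do rewrite scalerDl.
  rewrite big_split /= addrC; congr (_ + _).
  rewrite (bigD1 a) //= eqxx mulr1 big1 ?addr0 // => a' /negPf->.
  by rewrite mulr0 scale0r.
rewrite opprD addrACA; apply: in_idealD => //.
rewrite -scalerBr -mulr_algl; apply: in_idealMl; rewrite [X in in_ideal _ X](_ : _ = 0); first exact: in_ideal0.
apply/eqP; rewrite subr_eq0; apply/eqP/eq_bigr => i _.
by rewrite ffunE /= modn_small // ltnNge mu_lt.
Qed.

(** A relation modulo the [t j ^+ (p ^ e)] splits along the box monomials; taking q-th roots of each
    component gives a relation among the [b i] modulo the [t j]. *)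
Let ind_frob e :
  indep_mod (W e) (fun ia : I * {ffun 'I_m -> 'I_(p ^ e)} =>
     'X_[mbox ia.2] * b ia.1 ^+ (p ^ e)).
Proof.
have q0 : (0 < p ^ e)%N by rewrite expn_gt0 prime_gt0.
move=> c [q]; rewrite sum_pair exchange_big /=.
have [u uE] := fin_all_exists (fun j => frob_split_ex charK e (q j)).
under [X in _ = X]eq_bigr => j _ do rewrite uE mulr_sumr.
rewrite [X in _ = X]exchange_big /=.
have [d dE] := fin_all_exists (fun ia => closed_root (c ia) q0).
move/eqP; rewrite -subr_eq0 -sumrB => /eqP E [i a].
have ua0 := frob_split_uniq charK (e := e)
  (u := fun a => \sum_i d (i, a) *: b i - \sum_j t j * u j a) _ a.
have : \sum_i d (i, a) *: b i - \sum_j t j * u j a = 0.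
  apply: ua0; rewrite -[RHS]E; apply: eq_bigr => a' _.
  rewrite (pchar_expB _ _ _ (pchar_mpoly charK m)) mulrBr.
  rewrite !(pchar_exp_sum _ _ _ _ (pchar_mpoly charK m)) !mulr_sumr; congr (_ - _).
    by apply: eq_bigr => i' _; rewrite exprZn dE scalerAr.
  by apply: eq_bigr => j _; rewrite exprMn mulrCA.
move/eqP; rewrite subr_eq0 => /eqP E2.
have d0 := ind_b (ex_intro _ _ E2) i.
by rewrite -dE d0 expr0n expn_eq0 -[p == 0%N]negbK -lt0n prime_gt0.
Qed.

(** Modulo the q-th powers of the [t j] there are at least |I| q^m independent elements, by
    [ind_frob], while the |I| q^l products [tpow a * b i] span. As l <= m, the spanning family must
    be independent, and a relation whose coefficients have exponents below q is trivial. *)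
Theorem free_over_parameters (F : I -> {mpoly K[l]}) :
  \sum_i b i * (F i)^$ t = 0 -> forall i, F i = 0.
Proof.
move=> F0 i0.
(* Chosen so that [p ^ e] exceeds every exponent occurring in the [F i]: then no coefficient is lost
   modulo the powers of the [t j]. *)
pose e := \max_i msize (F i).
have Fe i mu j : mu \in msupp (F i) -> (mu j < p ^ e)%N.
  move=> mu_i; apply: leq_ltn_trans (ltn_expl e (prime_gt1 pp)).
  apply: leq_trans (leq_bigmax (F := fun i => msize (F i)) i).
  apply/ltnW/(leq_trans _ (msize_mdeg_lt mu_i)).
  by rewrite ltnS mdegE (bigD1 j) //= leq_addr.
have card_le : (#|{: I * {ffun 'I_l -> 'I_(p ^ e)}}| <=
                #|{: I * {ffun 'I_m -> 'I_(p ^ e)}}|)%N.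
  rewrite !card_prod !card_ffun !card_ord leq_mul2l leq_pexp2l ?orbT //.
  by rewrite expn_gt0 prime_gt0.
have ind_v : indep_mod (W e) (fun ia : I * {ffun 'I_l -> 'I_(p ^ e)} => tpow ia.2 * b ia.1).
  apply: (exchange_indep (in_ideal_subsp _) (@ind_frob e) _ card_le) => -[i a] /=.
  have [G ->] := span_b ('X_[mbox a] * b i ^+ (p ^ e)).
  have [C CE] := fin_all_exists (fun i => red_monomial e (G i)).
  exists (fun ia => C ia.1 ia.2).
  rewrite sum_pair /= -sumrB.
  apply: in_ideal_sum => j _.
  have -> : \sum_a' C j a' *: (tpow a' * b j) = b j * \sum_a' C j a' *: tpow a'.
    by rewrite mulr_sumr; apply: eq_bigr => a' _; rewrite -scalerAr mulrC.
  by rewrite -mulrBr; apply: in_idealMl; exact: CE.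
apply/mpolyP => mu; rewrite mcoeff0.
have [mu_i|] := boolP (mu \in msupp (F i0)); last exact: memN_msupp_eq0.
pose bx (a : {ffun 'I_l -> 'I_(p ^ e)}) := mbox a.
have supp_sum i : (F i)^$ t = \sum_(a : {ffun 'I_l -> 'I_(p ^ e)}) (F i)@_(bx a) *: tpow a.
  rewrite {1}(mpolyE (F i)) raddf_sum /=.
  under eq_bigr => nu _ do rewrite comp_mpolyZ substX.
  rewrite (eq_bigr (fun a => \sum_(nu <- msupp (F i) | nu == bx a)
     (F i)@_nu *: \prod_(i < l) t i ^+ nu i)) => [|a _].
    rewrite (exchange_big_dep predT) //= big_seq [RHS]big_seq.
    apply: eq_bigr => nu nu_i.
    pose a := [ffun j => Ordinal (Fe i nu j nu_i)].
    have nuE : nu = bx a by apply/mnmP => j; rewrite mnmE ffunE.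
    rewrite (big_pred1 a) // => a' /=; rewrite nuE; apply/eqP/eqP => [/mnmP E|->//].
    by apply/ffunP => j; apply/val_inj; have := E j; rewrite !mnmE.
  have [ai|ai] := boolP (bx a \in msupp (F i)).
    rewrite big_mkcond (bigD1_seq (bx a)) ?msupp_uniq //= eqxx.
    rewrite [X in _ + X]big1 ?addr0; last by move=> nu /negPf->.
    by congr (_ *: _); apply: eq_bigr => j _; rewrite mnmE.
  rewrite (memN_msupp_eq0 ai) scale0r big1_seq // => nu /andP[/eqP-> nu_i].
  by rewrite nu_i in ai.
have W0 : W e (\sum_(ia : I * {ffun 'I_l -> 'I_(p ^ e)})
   (F ia.1)@_(bx ia.2) *: (tpow ia.2 * b ia.1)).
  rewrite sum_pair /=.
  rewrite (eq_bigr (fun i => b i * (F i)^$ t)) ?F0; first exact: in_ideal0.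
  move=> i _; rewrite supp_sum mulr_sumr; apply: eq_bigr => a _.
  by rewrite -scalerAr mulrC.
have := ind_v _ W0 (i0, [ffun j => Ordinal (Fe i0 mu j mu_i)]) => /=.
by move=> <-; congr (_ @_ _); apply/mnmP => j; rewrite mnmE ffunE.
Qed.
End FreeOverParameters.

(** * Families compatible with multiplication by a regular sequence *)

Section Lifting.
Variables (R S : comNzRingType) (phi : {rmorphism R -> S}).
Variables (c Q : nat) (r : 'I_c -> R) (h : 'I_3 -> R) (J : finType).
Variables (PQ KK : R -> Prop) (A B : S -> Prop).
Variables (al : 'I_3 -> J -> {additive R -> R}) (X : 'I_3 -> J -> R).
Variables (tr : 'I_3 -> J -> {additive S -> S}) (xi : 'I_3 -> J -> S).

Let hQ k := h k ^+ Q.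
Let g k := phi (h k).
Let gQ k := g k ^+ Q.
Let rho := \prod_i r i ^+ Q.-1.

Hypothesis Q_gt0 : (0 < Q)%N.
Hypothesis PQ0 : PQ 0.
Hypothesis PQB : forall x y, PQ x -> PQ y -> PQ (x - y).
Hypothesis PQM : forall x y, PQ x -> PQ y -> PQ (x * y).
Hypothesis PQr : forall i, PQ (r i).
Hypothesis PQh : forall k, PQ (h k).
Hypothesis PQ1 : PQ 1.
Hypothesis KK0 : KK 0.
Hypothesis KKB : forall x y, KK x -> KK y -> KK (x - y).
Hypothesis KKM : forall p x, PQ p -> KK x -> KK (p * x).
Hypothesis A0 : A 0.
Hypothesis AB : forall x y, A x -> A y -> A (x - y).
Hypothesis A1 : A 1.
Hypothesis AM : forall x y, A x -> A y -> A (x * y).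
Hypothesis B0 : B 0.
Hypothesis BB : forall x y, B x -> B y -> B (x - y).
Hypothesis BM : forall a x, A a -> B x -> B (a * x).
Hypothesis Ag : forall k, A (g k).
Hypothesis al_PQ : forall k j x, KK x -> PQ (al k j x).
Hypothesis al_lin : forall k j p x, PQ p -> KK x -> al k j (p * x) = p * al k j x.
Hypothesis X_KK : forall k j p, PQ p -> KK (X k j * p).
Hypothesis alK : forall k x, KK x -> \sum_j X k j * al k j x = hQ k * x.
Hypothesis tr_A : forall k j x, B x -> A (tr k j x).
Hypothesis tr_lin : forall k j a x, A a -> B x -> tr k j (a * x) = a * tr k j x.
Hypothesis xi_B : forall k j a, A a -> B (xi k j * a).
Hypothesis trK : forall k x, B x -> \sum_j xi k j * tr k j x = g k * x.
Hypothesis phi_KK : forall x, KK x -> B (phi x).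
Hypothesis rho_phi : forall x, KK x -> (rho * x = 0) <-> (phi x = 0).
Hypothesis ann_PQ : forall p, PQ p -> (forall i, r i * p = 0) ->
  exists2 q, PQ q & p = rho * q.
Hypothesis r_nil : forall i, r i ^+ Q = 0.
Hypothesis KK_sat : forall e x y, KK x -> KK y -> hQ 1 ^+ e * x = hQ 0 * y ->
  exists2 z, KK z & x = hQ 0 * z.
Hypothesis h_reg : forall k x, h k * x = 0 -> x = 0.
Hypothesis g_reg : forall k x, g k * x = 0 -> x = 0.
Hypothesis B_sat : forall x y, B x -> B y -> gQ 1 * x = gQ 0 * y ->
  exists2 z, B z & x = gQ 0 * z.
Hypothesis A_koszul : forall x y z, A x -> A y -> A z ->
  gQ 2 * x + gQ 0 * y + gQ 1 * z = 0 ->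
  exists a : 'I_3 -> S, (forall k, A (a k)) /\
   [/\ x = gQ 1 * a 0 - gQ 0 * a 1, y = gQ 2 * a 1 - gQ 1 * a 2 &
       z = gQ 0 * a 2 - gQ 2 * a 0].
Hypothesis A_reg : forall x y z, A x -> A y -> A z -> gQ 2 * x - gQ 1 * y = g 0 * z ->
  exists a a', [/\ A a, A a' & x = gQ 1 * a + g 0 * a'].
Hypothesis B_phi : forall k b, B b -> exists2 x, KK x & phi x = gQ k * b.

Local Notation T := {ffun 'I_c -> 'I_Q}.

(** The predecessor saturates at 0; [shiftf] therefore tests for 0 separately and returns the value
    0 there, as families are extended by 0 outside the box. *)
Definition decr (i : 'I_c) (a : T) : T :=
  [ffun j => if j == i then Ordinal (leq_ltn_trans (leq_pred (a j)) (ltn_ord (a j)))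
             else a j].

Definition shiftf (V : nmodType) (x : T -> V) (i : 'I_c) (a : T) : V :=
  if a i == 0%N :> nat then 0 else x (decr i a).

Definition downset (Lam : {set T}) := forall a i, a \in Lam -> decr i a \in Lam.

(** The universal compatible family: multiplying by [r i] lowers [a i] by one, and from [a i = 0] it
    reaches [r i ^+ Q = 0]. *)
Let rc (a : T) := \prod_i r i ^+ (Q.-1 - a i).

Lemma PQD x y : PQ x -> PQ y -> PQ (x + y).
Proof. by move=> Px Py; rewrite -[y]opprK -[- y]sub0r; apply: PQB => //; apply: PQB. Qed.
Lemma KKD x y : KK x -> KK y -> KK (x + y).
Proof. by move=> Px Py; rewrite -[y]opprK -[- y]sub0r; apply: KKB => //; apply: KKB. Qed.
Lemma BD x y : B x -> B y -> B (x + y).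
Proof. by move=> Px Py; rewrite -[y]opprK -[- y]sub0r; apply: BB => //; apply: BB. Qed.
Lemma PQX x e : PQ x -> PQ (x ^+ e).
Proof. by move=> Px; elim: e => [|e IH]; rewrite ?expr0 // exprS; apply: PQM. Qed.
Lemma PQ_prod (e : 'I_c -> nat) : PQ (\prod_i r i ^+ e i).
Proof. by elim/big_ind: _ => // i _; apply: PQX. Qed.
Lemma KK_sum I (s : seq I) F : (forall i, KK (F i)) -> KK (\sum_(i <- s) F i).
Proof. by move=> HF; elim/big_ind: _ => //; apply: KKD. Qed.
Lemma B_sum I (s : seq I) F : (forall i, B (F i)) -> B (\sum_(i <- s) F i).
Proof. by move=> HF; elim/big_ind: _ => //; apply: BD. Qed.
Lemma PQhQ k : PQ (hQ k). Proof. exact: PQX. Qed.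

Lemma hQ_reg k x : hQ k * x = 0 -> x = 0.
Proof.
rewrite /hQ; elim: Q x => [|n IH] x; first by rewrite expr0 mul1r.
by rewrite exprSr -mulrA => /IH /h_reg.
Qed.

Lemma hQ_inj k x y : hQ k * x = hQ k * y -> x = y.
Proof.
by move=> E; apply/eqP; rewrite -subr_eq0; apply/eqP/(@hQ_reg k); rewrite mulrBr E subrr.
Qed.

Lemma r_rc i a : r i * rc a = shiftf rc i a.
Proof.
rewrite /shiftf /rc (bigD1 i) //= mulrA -exprS.
have [a0|a0] := eqVneq (a i : nat) 0%N.
  by rewrite a0 subn0 prednK // r_nil mul0r.
rewrite [RHS](bigD1 i) //=; congr (_ * _).
  rewrite ffunE eqxx /=; congr (_ ^+ _); rewrite -lt0n in a0.
  have := ltn_ord (a i); lia.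
by apply: eq_bigr => j /negPf ji; rewrite ffunE ji.
Qed.

Lemma r_rho i : r i * rho = 0.
Proof. by rewrite /rho (bigD1 i) //= mulrA -exprS prednK // r_nil mul0r. Qed.

Lemma rho_ann x : forall i, r i * (rho * x) = 0.
Proof. by move=> i; rewrite mulrA r_rho mul0r. Qed.

(** A form of Macaulay's inverse systems: in P/(r^Q) every compatible family on a downset is a
    multiple of the universal one. An exponent [b] of maximal weight is removed; at [b] the solution
    found for the rest is off by an element killed by all [r i], hence by a multiple of [rho], and
    this is corrected without disturbing the other exponents. *)
Lemma inverse_system (Lam : {set T}) (x : T -> R) : downset Lam ->
  (forall a, a \in Lam -> PQ (x a) /\ forall i, r i * x a = shiftf x i a) ->
  exists2 s, PQ s & forall a, a \in Lam -> x a = rc a * s.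
Proof.
have [n] := ubnP #|Lam|; elim: n Lam => // n IH Lam ltn dL Lx.
have [->|[b0 b0L]] := set_0Vmem Lam.
  by exists 0 => // a; rewrite inE.
pose wt (a : T) := \sum_i (a i : nat).
pose b := [arg max_(a > b0 | a \in Lam) wt a].
have [bL bmax] : b \in Lam /\ forall a, a \in Lam -> (wt a <= wt b)%N.
  by rewrite /b; case: arg_maxnP => // b1 ? ?; split.
have dec_lt i (a : T) : (0 < a i)%N -> (wt (decr i a) < wt a)%N.
  move=> a0; rewrite /wt (bigD1 i) //= [in X in (_ < X)%N](bigD1 i) //=.
  rewrite ffunE eqxx /= -(ltn_predK a0) -addSn leq_add // leq_sum // => j /negPf ji.
  by rewrite ffunE ji.
have decE i (a : T) : a i = 0%N :> nat -> decr i a = a.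
  move=> a0; apply/ffunP => j; rewrite ffunE; case: eqP => // ->.
  by apply/val_inj; rewrite /= a0.
have dL' : downset (Lam :\ b).
  move=> a i /setD1P[ab aL]; apply/setD1P; split; last exact: dL.
  have [a0|a0] := posnP (a i); first by rewrite decE.
  by apply: contraTneq (bmax _ aL) => <-; rewrite -ltnNge dec_lt.
have [|||s Ps sE] := IH (Lam :\ b) => //.
- by move: ltn; rewrite (cardsD1 b Lam) bL.
- by move=> a /setD1P[_]; apply: Lx.
have [Pxb rxb] := Lx _ bL.
have Prc a : PQ (rc a) by apply: PQ_prod.
have [||t Pt tE] := ann_PQ (p := x b - rc b * s).
- by apply: PQB => //; apply: PQM.
- move=> i; rewrite mulrBr rxb mulrA r_rc /shiftf; case: posnP => [|b0i]; first by rewrite mul0r subrr.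
  apply/eqP; rewrite subr_eq0; apply/eqP/sE/setD1P; split; last exact: dL.
  by apply/eqP => E; have := dec_lt _ _ b0i; rewrite E ltnn.
(* [rc b] times the added product is [rho], which absorbs the error at [b]. *)
exists (s + (\prod_i r i ^+ b i) * t).
  by apply: PQD => //; apply: PQM => //; apply: PQ_prod.
move=> a aL; rewrite mulrDr mulrA.
have [->|ab] := eqVneq a b.
  have -> : rc b * (\prod_i r i ^+ b i) = rho.
    rewrite -big_split; apply: eq_bigr => i _ /=; rewrite -exprD subnK //.
    by rewrite -ltnS prednK.
  by rewrite -tE addrC subrK.
rewrite sE; last by apply/setD1P.
(* [b] has maximal weight, so some [a i < b i], and the exponent of [r i] reaches at least [Q]. *)
suff -> : rc a * (\prod_i r i ^+ b i) = 0 by rewrite mul0r addr0.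
have [/existsP[i lt_ab]|/existsPn le_ba] := boolP [exists i, (a i < b i)%N].
  rewrite -big_split (bigD1 i) //= -exprD.
  have -> : (Q.-1 - a i + b i = Q + (b i - (a i).+1))%N.
    by have := ltn_ord (a i); have := ltn_ord (b i); lia.
  by rewrite exprD r_nil !mul0r.
have le_ba' i : (b i <= a i)%N by rewrite leqNgt le_ba.
case/eqP: ab; apply/ffunP => i; apply/val_inj/eqP; rewrite eq_sym.
have /leqifP := leqif_sum (I := 'I_c) (P := predT) (fun i _ => leqif_eq (le_ba' i)).
case: forall_inP => [Ha _|_]; first by rewrite Ha.
by rewrite ltnNge -[X in (X <= _)%N]/(wt a) bmax.
Qed.

(** Expresses x = rho b for [b] in [B]. The product makes sense only for elements that lift along
    [phi], so [b] is first multiplied by [gQ 0] and lifted to [k]; the factor [hQ 0] on the left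
    compensates. *)
Definition corr (x : R) (b : S) := exists2 k, KK k & hQ 0 * x = rho * k /\ phi k = gQ 0 * b.

Lemma phi_hQ k : phi (hQ k) = gQ k. Proof. exact: rmorphXn. Qed.

Lemma gQ_reg k x : gQ k * x = 0 -> x = 0.
Proof.
rewrite /gQ; elim: Q x => [|n IH] x; first by rewrite expr0 mul1r.
by rewrite exprSr -mulrA => /IH /g_reg.
Qed.

Lemma AgQ k : A (gQ k).
Proof. by rewrite /gQ; elim: Q => [|n IH]; rewrite ?expr0 // exprS; apply: AM. Qed.

Lemma corrB x y b d : corr x b -> corr y d -> corr (x - y) (b - d).
Proof.
move=> [k Kk [kE pk]] [l Kl [lE pl]]; exists (k - l); first exact: KKB.
by rewrite !mulrBr kE lE rmorphB pk pl.
Qed.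

Lemma corr0 : corr 0 0.
Proof. by exists 0; rewrite ?mulr0 ?rmorph0. Qed.

Lemma corrM p x b : PQ p -> corr x b -> corr (p * x) (phi p * b).
Proof.
move=> Pp [k Kk [kE pk]]; exists (p * k); first exact: KKM.
by rewrite rmorphM pk mulrCA kE mulrCA; split=> //; rewrite mulrCA.
Qed.

Lemma corr_fun0 b : corr 0 b -> b = 0.
Proof.
move=> [k Kk []]; rewrite mulr0 => /esym /(rho_phi Kk) -> /esym; exact: gQ_reg.
Qed.

Lemma corr_inj0 x : corr x 0 -> x = 0.
Proof.
move=> [k Kk [kE]]; rewrite mulr0 => /(rho_phi Kk) E; move: kE; rewrite E; exact: hQ_reg.
Qed.

Lemma corr_rho k : KK k -> corr (rho * k) (phi k).
Proof.
move=> Kk; exists (hQ 0 * k); first by apply: KKM => //; apply: PQhQ.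
by rewrite mulrCA rmorphM phi_hQ.
Qed.

Lemma corr_ann x b : corr x b -> forall i, r i * x = 0.
Proof.
move=> [k _ [kE _]] i; apply: (@hQ_reg 0).
by rewrite mulrCA kE rho_ann.
Qed.

(** Lifts of [gQ 0 * b] and [gQ 1 * b] give two expressions for rho b, with denominators [hQ 0] and
    [hQ 1]; saturation of [KK] removes the denominators. *)
Lemma corr_KK b : B b -> exists2 x, KK x & corr x b.
Proof.
move=> Bb; have [k0 K0 p0] := B_phi 0 Bb; have [k1 K1 p1] := B_phi 1 Bb.
have KKh k x : KK x -> KK (hQ k * x) by apply: KKM; apply: PQhQ.
have Prho : PQ rho by apply: PQ_prod.
have E : hQ 1 ^+ 1 * (rho * k0) = hQ 0 * (rho * k1).
  apply/eqP; rewrite expr1 -subr_eq0 !(mulrCA _ rho) -mulrBr; apply/eqP/rho_phi.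
    by apply: KKB; apply: KKh.
  by rewrite rmorphB !rmorphM !phi_hQ p0 p1 mulrCA subrr.
have [||x Kx xE] := KK_sat _ _ E; try exact: KKM.
by exists x => //; exists k0; rewrite // -xE.
Qed.

(** Together with [corr_KK] this identifies the common annihilator of the [r i] in [KK] with [B].
    The maps [al] carry [x] into [PQ], where the annihilator is generated by [rho]; the answers for
    two parameters agree and [B_sat] glues them. *)
Lemma ann_corr x : KK x -> (forall i, r i * x = 0) -> exists2 b, B b & corr x b.
Proof.
move=> Kx rx.
have key k : exists2 y, KK y & hQ k * x = rho * y.
  have qP j : exists q, PQ q /\ al k j x = rho * q.
    have [||q Pq qE] := ann_PQ (p := al k j x); first exact: al_PQ; last by exists q.
    by move=> i; rewrite -al_lin // rx raddf0.
  have [q qE] := fin_all_exists qP.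
  exists (\sum_j X k j * q j); first by apply: KK_sum => j; apply: X_KK; case: (qE j).
  rewrite -alK // mulr_sumr; apply: eq_bigr => j _; case: (qE j) => _ ->.
  by rewrite mulrCA.
have [k0 K0 e0] := key 0; have [k1 K1 e1] := key 1.
have KKh k y : KK y -> KK (hQ k * y) by apply: KKM; apply: PQhQ.
have E : gQ 1 * phi k0 = gQ 0 * phi k1.
  apply/eqP; rewrite -subr_eq0 -!phi_hQ -!rmorphM -rmorphB; apply/eqP/rho_phi.
    by apply: KKB; apply: KKh.
  by rewrite mulrBr !(mulrCA rho) -e0 -e1 mulrCA subrr.
have [b Bb bE] := B_sat (phi_KK K0) (phi_KK K1) E.
by exists b => //; exists k0.
Qed.

Section Extend.
Variables (Lam : {set T}) (b : T) (u : T -> R).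
Hypothesis dLam : downset Lam.
Hypothesis decb : forall i, (0 < b i)%N -> decr i b \in Lam.
Hypothesis famu : forall a, a \in Lam -> KK (u a) /\ forall i, r i * u a = shiftf u i a.

Let sol k : exists s : J -> R, (forall j, PQ (s j)) /\
  forall j a, a \in Lam -> al k j (u a) = rc a * s j.
Proof.
have sP j : exists s, PQ s /\ forall a, a \in Lam -> al k j (u a) = rc a * s.
  have [||s Ps sE] := @inverse_system Lam (fun a => al k j (u a)) => //.
    move=> a aL; have [Ka ra] := famu aL; split; first exact: al_PQ.
    move=> i; rewrite -al_lin // ra /shiftf; case: eqP => // _; exact: raddf0.
  by exists s.
have [s sE] := fin_all_exists sP; exists s; split=> j; by case: (sE j).
Qed.

Let sol_r k s : (forall j, PQ (s j)) ->
    (forall j a, a \in Lam -> al k j (u a) = rc a * s j) ->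
  let z := rc b * \sum_j X k j * s j in
  KK z /\ forall i, r i * z = hQ k * shiftf u i b.
Proof.
move=> Ps sE z; split.
  by apply: KKM; [apply: PQ_prod|apply: KK_sum => j; apply: X_KK].
move=> i; rewrite /z mulrA r_rc /shiftf; case: posnP => [|bi]; first by rewrite mul0r mulr0.
have [Ku _] := famu (decb bi); rewrite -(alK k Ku) mulr_sumr.
by apply: eq_bigr => j _; rewrite sE ?decb // mulrCA.
Qed.

(** [inverse_system] lifts after multiplication by each [hQ k]; the local lifts, [z k] over [hQ k],
    differ by a Cech cocycle in [B]. Applying [tr 0] puts it in [A], where the three powers [gQ] are
    regular and it bounds. Reassembling by [trK] costs the factor [h 0] and not its power [hQ 0], so
    the loss of degree does not depend on [Q]. *)
Lemma lift_family : exists2 y, KK y & forall i, r i * y = h 0 * shiftf u i b.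
Proof.
have KKh k y : KK y -> KK (hQ k * y) by apply: KKM; apply: PQhQ.
have zP k : exists z, KK z /\ forall i, r i * z = hQ k * shiftf u i b.
  have [s [Ps sE]] := sol k; exists (rc b * \sum_j X k j * s j).
  exact: sol_r.
have [z zE] := fin_all_exists zP.
have eP k l : exists2 e, B e & corr (hQ l * z k - hQ k * z l) e.
  have [Kk rk] := zE k; have [Kl rl] := zE l.
  apply: ann_corr; first by apply: KKB; apply: KKh.
  by move=> i; rewrite mulrBr !(mulrCA (r i)) rk rl mulrCA subrr.
have [e01 B01 re01] := eP 0 1; have [e12 B12 re12] := eP 1 2.
have [e20 B20 re20] := eP 2 0.
(* The same combination of the differences of lifts vanishes identically in [R]; [corr_fun0]
   transports this to [B]. *)
have cocycle : gQ 2 * e01 + gQ 0 * e12 + gQ 1 * e20 = 0.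
  have := corrB (corrB corr0 (corrM (PQhQ 2) re01)) (corrM (PQhQ 0) re12).
  move/(fun H => corrB H (corrM (PQhQ 1) re20)); rewrite !phi_hQ.
  have -> : 0 - hQ 2 * (hQ 1 * z 0 - hQ 0 * z 1) - hQ 0 * (hQ 2 * z 1 - hQ 1 * z 2)
     - hQ 1 * (hQ 0 * z 2 - hQ 2 * z 0) = 0 by ring.
  by move/corr_fun0 => E; apply/eqP; rewrite -oppr_eq0 -[X in _ == X]E; apply/eqP; ring.
have aP j : exists a : 'I_3 -> S, (forall k, A (a k)) /\
   tr 0 j e01 = gQ 1 * a 0 - gQ 0 * a 1.
  have [|a [Aa [aE _ _]]] := @A_koszul (tr 0 j e01) (tr 0 j e12) (tr 0 j e20)
    (tr_A _ _ B01) (tr_A _ _ B12) (tr_A _ _ B20); last by exists a.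
  rewrite -(tr_lin _ _ (AgQ 2) B01) -(tr_lin _ _ (AgQ 0) B12) -(tr_lin _ _ (AgQ 1) B20).
  by rewrite -!raddfD cocycle raddf0.
have [a aE] := fin_all_exists aP.
have thP k : exists2 t, KK t & corr t (\sum_j xi 0 j * a j k).
  by apply: corr_KK; apply: B_sum => j; apply: xi_B; case: (aE j).
have [t0 Kt0 rt0] := thP 0; have [t1 Kt1 rt1] := thP 1.
(* After multiplication by [h 0] the cocycle is the coboundary of [t0] and [t1], so the elements
   [h 0 * z k - t k] are local expressions of a single one. *)
have E : h 0 * (hQ 1 * z 0 - hQ 0 * z 1) = hQ 1 * t0 - hQ 0 * t1.
  apply/eqP; rewrite -subr_eq0; apply/eqP/corr_inj0.
  have := corrB (corrM (PQh 0) re01) (corrB (corrM (PQhQ 1) rt0) (corrM (PQhQ 0) rt1)).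
  rewrite !phi_hQ -[phi (h 0)]/(g 0) -trK // !mulr_sumr -!sumrB.
  rewrite [X in corr _ X]big1 // => j _; case: (aE j) => _ ->; ring.
have [K0 r0] := zE 0; have [K1 r1] := zE 1.
have KKz : KK (h 0 * z 0 - t0) by apply: KKB => //; apply: KKM.
have KKz1 : KK (h 0 * z 1 - t1) by apply: KKB => //; apply: KKM.
have [|y Ky yE] := @KK_sat 1 _ _ KKz KKz1.
  apply/eqP; rewrite -subr_eq0 expr1.
  have -> : hQ 1 * (h 0 * z 0 - t0) - hQ 0 * (h 0 * z 1 - t1) =
    h 0 * (hQ 1 * z 0 - hQ 0 * z 1) - (hQ 1 * t0 - hQ 0 * t1) by ring.
  by rewrite E subrr.
exists y => // i; apply: (@hQ_inj 0); rewrite mulrCA -yE mulrBr (corr_ann rt0) subr0.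
by rewrite mulrCA r0 mulrCA.
Qed.

(** Measures whether [x] is divisible by [h 0] in [KK]: modulo [g 0], the [v j] are the traces of
    the part [k] of [x] along [rho], divided by [gQ 1]. *)
Definition obst (x : R) (v : J -> S) := exists y k,
  [/\ KK y, KK k, hQ 1 * x = h 0 * y + rho * k &
   forall j, A (v j) /\ exists2 a, A a & tr 1 j (phi k) = gQ 1 * v j + g 0 * a].

(** Both [hQ 1 * x] and [hQ 2 * x] are a multiple of [h 0] plus a multiple of [rho]; comparing them
    gives, after traces, a relation between [gQ 2], [gQ 1] and [g 0] in [A], and regularity allows
    the division by [gQ 1]. *)
Lemma obst_ex x : KK x -> (forall i, r i * x = h 0 * shiftf u i b) ->
  exists v, obst x v.
Proof.
move=> Kx rx.
have key k : exists y l, [/\ KK y, KK l & hQ k * x = h 0 * y + rho * l].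
  have [s [Ps sE]] := sol k; have [Kz rz] := sol_r Ps sE.
  have tP j : exists t, PQ t /\ al k j x = h 0 * (rc b * s j) + rho * t.
    have [||t Pt tE] := ann_PQ (p := al k j x - h 0 * (rc b * s j)).
    - by apply: PQB; [exact: al_PQ|do 2?apply: PQM => //; apply: PQ_prod].
    - move=> i; rewrite mulrBr -al_lin // rx (mulrCA (r i)) (mulrA (r i)) r_rc /shiftf.
      case: posnP => [|bi]; first by rewrite mulr0 raddf0 mul0r mulr0 subrr.
      by have [Ku _] := famu (decb bi); rewrite al_lin // sE ?decb // subrr.
    by exists t; split=> //; rewrite -tE addrC subrK.
  have [t tE] := fin_all_exists tP.
  exists (rc b * \sum_j X k j * s j), (\sum_j X k j * t j); split=> //.
    by apply: KK_sum => j; apply: X_KK; case: (tE j).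
  rewrite -alK // !mulr_sumr -big_split; apply: eq_bigr => j _ /=.
  by case: (tE j) => _ ->; ring.
have [y1 [k1 [Ky1 Kk1 E1]]] := key 1; have [y2 [k2 [Ky2 Kk2 E2]]] := key 2.
have KKh k y : KK y -> KK (hQ k * y) by apply: KKM; apply: PQhQ.
pose y := hQ 1 * y2 - hQ 2 * y1.
have Ky : KK y by apply: KKB; apply: KKh.
have KK12 : KK (hQ 2 * k1 - hQ 1 * k2) by apply: KKB; apply: KKh.
have yE : rho * (hQ 2 * k1 - hQ 1 * k2) = h 0 * y.
  have E : hQ 2 * (h 0 * y1 + rho * k1) = hQ 1 * (h 0 * y2 + rho * k2).
    by rewrite -E1 -E2 mulrCA.
  rewrite /y; apply/eqP; rewrite -subr_eq0; apply/eqP.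
  have -> : rho * (hQ 2 * k1 - hQ 1 * k2) - h 0 * (hQ 1 * y2 - hQ 2 * y1) =
    hQ 2 * (h 0 * y1 + rho * k1) - hQ 1 * (h 0 * y2 + rho * k2) by ring.
  by rewrite E subrr.
have [|d Bd rd] := ann_corr Ky.
  by move=> i; apply: (@h_reg 0); rewrite mulrCA -yE rho_ann.
have E : gQ 2 * phi k1 - gQ 1 * phi k2 = g 0 * d.
  have := corrB (corr_rho KK12) (corrM (PQh 0) rd); rewrite yE subrr => /corr_fun0 /eqP.
  by rewrite subr_eq0 rmorphB !rmorphM !phi_hQ => /eqP.
have vP j : exists v, A v /\ exists2 a, A a & tr 1 j (phi k1) = gQ 1 * v + g 0 * a.
  have [|v [a [Av Aa E']]] := @A_reg (tr 1 j (phi k1)) (tr 1 j (phi k2)) (tr 1 j d)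
    (tr_A _ _ (phi_KK Kk1)) (tr_A _ _ (phi_KK Kk2)) (tr_A _ _ Bd).
    rewrite -(tr_lin _ _ (AgQ 2) (phi_KK Kk1)) -(tr_lin _ _ (AgQ 1) (phi_KK Kk2)).
    by rewrite -(tr_lin _ _ (Ag 0) Bd) -raddfB E.
  by exists v; split=> //; exists a.
have [v vE] := fin_all_exists vP.
by exists v, y1, k1.
Qed.

(** If the obstruction vanishes, the part of [x] along [rho] becomes divisible by [h 0] after
    multiplication by [h 1], so a power of [hQ 1] times [x] is divisible by [h 0]; saturation
    removes that power. *)
Lemma obst_kernel x v : KK x -> obst x v ->
  (forall j, exists2 a, A a & v j = g 0 * a) -> exists2 w, KK w & x = h 0 * w.
Proof.
move=> Kx [y [k [Ky Kk E tE]]] vE.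
have aP j : exists a, A a /\ tr 1 j (phi k) = g 0 * a.
  have [Av [a Aa ->]] := tE j; have [a' Aa' ->] := vE j.
  exists (gQ 1 * a' - (0 - a)); split; last by ring.
  by apply: (AB (AM (AgQ _) Aa')); apply: AB.
have [a aE] := fin_all_exists aP.
have Bb : B (\sum_j xi 1 j * a j) by apply: B_sum => j; apply: xi_B; case: (aE j).
have bE : g 1 * phi k = g 0 * \sum_j xi 1 j * a j.
  rewrite -(trK 1 (phi_KK Kk)) mulr_sumr; apply: eq_bigr => j _; case: (aE j) => _ ->; ring.
have [x' Kx' rx'] := corr_KK Bb.
have E2 : rho * (h 1 * k) = h 0 * x'.
  apply/eqP; rewrite -subr_eq0; apply/eqP/corr_inj0.
  have := corrB (corr_rho (KKM (PQh 1) Kk)) (corrM (PQh 0) rx').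
  by rewrite rmorphM -[phi (h 1)]/(g 1) bE subrr.
(* The factor [h 1 ^+ Q.-1] completes [h 1 * hQ 1] to a power of [hQ 1], the form that [KK_sat]
   accepts. *)
pose Y := h 1 ^+ Q.-1 * (h 1 * y + x').
have KY : KK Y.
  apply: KKM; first exact: PQX.
  by apply: KKD => //; apply: KKM.
have E3 : hQ 1 ^+ 2 * x = h 0 * Y.
  rewrite /Y; have -> : hQ 1 ^+ 2 = h 1 ^+ Q.-1 * h 1 * hQ 1.
    by rewrite -exprSr prednK.
  rewrite -!mulrA E; have -> : h 1 * (h 0 * y + rho * k) = h 0 * (h 1 * y) + rho * (h 1 * k).
    by ring.
  by rewrite E2; ring.
(* Likewise [h 0] is completed to [hQ 0], and the added factor is cancelled at the end by
   regularity. *)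
have KKx : KK (h 0 ^+ Q.-1 * x) by apply: KKM => //; apply: PQX.
have [|w Kw wE] := KK_sat (e := 2) KKx KY.
  by rewrite mulrCA E3 mulrA -exprSr prednK.
exists w => //; apply/eqP; rewrite -subr_eq0; apply/eqP.
have : h 0 ^+ Q.-1 * (x - h 0 * w) = 0.
  by rewrite mulrBr mulrA -exprSr prednK // -wE subrr.
elim: Q.-1 => [|n IH]; first by rewrite expr0 mul1r.
by rewrite exprS -mulrA => /h_reg.
Qed.
End Extend.
End Lifting.

Notation indep := (indep_mod (fun x => x = 0)).

(** The dimension of a kernel stated without subspaces: |C| linear conditions cost at most |C| of
    the |I| independent vectors. *)
Lemma kernel_family (K : fieldType) (V : lmodType K) (I C : finType) (t : I -> V)
    (co : I -> C -> K) : indep t ->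
  exists n (x : 'I_n -> I -> K), [/\ (#|I| <= n + #|C|)%N,
    forall l z, \sum_i x l i * co i z = 0 &
    indep (fun l => \sum_i x l i *: t i)].
Proof.
move=> ind_t.
pose M : 'M[K]_(#|I|, #|C|) := \matrix_(i, z) co (enum_val i) (enum_val z).
pose B := row_base (kermx M).
have BM : B *m M = 0.
  by apply/eqP; rewrite -sub_kermx eq_row_base.
have sum_enum (F : I -> K) : \sum_i F i = \sum_(j < #|I|) F (enum_val j).
  rewrite (reindex (@enum_val I predT)) //=.
  by exists enum_rank => i _; rewrite ?enum_valK ?enum_rankK.
exists (\rank (kermx M)), (fun l i => B l (enum_rank i)); split.
- by rewrite mxrank_ker; have := rank_leq_col M; have := rank_leq_row M; lia.
- move=> l z; have /matrixP/(_ l (enum_rank z)) := BM; rewrite !mxE => E.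
  rewrite -[RHS]E sum_enum; apply: eq_bigr => j _.
  by rewrite enum_valK [M _ _]mxE enum_rankK.
move=> d; under eq_bigr => l _ do rewrite scaler_sumr.
rewrite exchange_big /=; under eq_bigr => i _ do (under eq_bigr => l _ do rewrite scalerA; rewrite -scaler_suml).
move/ind_t => E; have fB : row_free B by apply: row_base_free.
have dB0 : (\row_l d l) *m B = 0.
  apply/rowP => j; rewrite !mxE -[RHS](E (enum_val j)); apply: eq_bigr => l _.
  by rewrite mxE enum_valK.
have d0 : \row_l d l = 0 by apply: (row_free_inj fB); rewrite dB0 mul0mx.
by move=> l; have /rowP/(_ l) := d0; rewrite !mxE.
Qed.

(** * Dimension count for homogeneous compatible families *)

Section Counting.
Variables (K : fieldType) (R S : comAlgType K) (phi : {rmorphism R -> S}).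
Variables (c Q : nat) (r : 'I_c -> R) (h : 'I_3 -> R) (J : finType).
Variables (PQ KK : R -> Prop) (A B : S -> Prop).
Variables (al : 'I_3 -> J -> {additive R -> R}) (X : 'I_3 -> J -> R).
Variables (tr : 'I_3 -> J -> {additive S -> S}) (xi : 'I_3 -> J -> S).
Variables (cR : nat -> {additive R -> R}) (cS : nat -> {additive S -> S}).
Variables (e : 'I_c -> nat) (gam : nat) (tau : J -> nat).

Let hQ k := h k ^+ Q.
Let g k := phi (h k).
Let gQ k := g k ^+ Q.
Let rho := \prod_i r i ^+ Q.-1.

Hypothesis Q_gt0 : (0 < Q)%N.
Hypothesis PQ0 : PQ 0.
Hypothesis PQB : forall x y, PQ x -> PQ y -> PQ (x - y).
Hypothesis PQM : forall x y, PQ x -> PQ y -> PQ (x * y).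
Hypothesis PQr : forall i, PQ (r i).
Hypothesis PQh : forall k, PQ (h k).
Hypothesis PQ1 : PQ 1.
Hypothesis PQZ : forall a x, PQ x -> PQ (a *: x).
Hypothesis KK0 : KK 0.
Hypothesis KKB : forall x y, KK x -> KK y -> KK (x - y).
Hypothesis KKM : forall p x, PQ p -> KK x -> KK (p * x).
Hypothesis A0 : A 0.
Hypothesis AB : forall x y, A x -> A y -> A (x - y).
Hypothesis A1 : A 1.
Hypothesis AM : forall x y, A x -> A y -> A (x * y).
Hypothesis AZ : forall a x, A x -> A (a *: x).
Hypothesis B0 : B 0.
Hypothesis BB : forall x y, B x -> B y -> B (x - y).
Hypothesis BM : forall a x, A a -> B x -> B (a * x).
Hypothesis Ag : forall k, A (g k).
Hypothesis al_PQ : forall k j x, KK x -> PQ (al k j x).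
Hypothesis al_lin : forall k j p x, PQ p -> KK x -> al k j (p * x) = p * al k j x.
Hypothesis X_KK : forall k j p, PQ p -> KK (X k j * p).
Hypothesis alK : forall k x, KK x -> \sum_j X k j * al k j x = hQ k * x.
Hypothesis tr_A : forall k j x, B x -> A (tr k j x).
Hypothesis tr_lin : forall k j a x, A a -> B x -> tr k j (a * x) = a * tr k j x.
Hypothesis xi_B : forall k j a, A a -> B (xi k j * a).
Hypothesis trK : forall k x, B x -> \sum_j xi k j * tr k j x = g k * x.
Hypothesis phi_KK : forall x, KK x -> B (phi x).
Hypothesis phiZ : forall a x, phi (a *: x) = a *: phi x.
Hypothesis rho_phi : forall x, KK x -> (rho * x = 0) <-> (phi x = 0).
Hypothesis ann_PQ : forall p, PQ p -> (forall i, r i * p = 0) ->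
  exists2 q, PQ q & p = rho * q.
Hypothesis r_nil : forall i, r i ^+ Q = 0.
Hypothesis KK_sat : forall e x y, KK x -> KK y -> hQ 1 ^+ e * x = hQ 0 * y ->
  exists2 z, KK z & x = hQ 0 * z.
Hypothesis h_reg : forall k x, h k * x = 0 -> x = 0.
Hypothesis g_reg : forall k x, g k * x = 0 -> x = 0.
Hypothesis B_sat : forall x y, B x -> B y -> gQ 1 * x = gQ 0 * y ->
  exists2 z, B z & x = gQ 0 * z.
Hypothesis A_koszul : forall x y z, A x -> A y -> A z ->
  gQ 2 * x + gQ 0 * y + gQ 1 * z = 0 ->
  exists a : 'I_3 -> S, (forall k, A (a k)) /\
   [/\ x = gQ 1 * a 0 - gQ 0 * a 1, y = gQ 2 * a 1 - gQ 1 * a 2 &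
       z = gQ 0 * a 2 - gQ 2 * a 0].
Hypothesis A_reg : forall x y z, A x -> A y -> A z -> gQ 2 * x - gQ 1 * y = g 0 * z ->
  exists a a', [/\ A a, A a' & x = gQ 1 * a + g 0 * a'].
Hypothesis B_phi : forall k b, B b -> exists2 x, KK x & phi x = gQ k * b.

(* Gradings: [cR d] and [cS d] are the projections on the components of degree [d]. *)
Let hR d x := cR d x = x.
Let hS d x := cS d x = x.
Hypothesis cR_idem : forall d x, hR d (cR d x).
Hypothesis cR_scale : forall d a x, cR d (a *: x) = a *: cR d x.
Hypothesis cRM : forall d d' x y, hR d' x ->
  cR d (x * y) = if (d' <= d)%N then x * cR (d - d') y else 0.
Hypothesis cS_idem : forall d x, hS d (cS d x).
Hypothesis cSM : forall d d' x y, hS d' x ->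
  cS d (x * y) = if (d' <= d)%N then x * cS (d - d') y else 0.
Hypothesis cR_KK : forall d x, KK x -> KK (cR d x).
Hypothesis cS_A : forall d x, A x -> A (cS d x).
Hypothesis phi_c : forall d x, phi (cR d x) = cS d (phi x).
Hypothesis trZ : forall k j a x, tr k j (a *: x) = a *: tr k j x.
Hypothesis tr_c : forall j d x, B x -> tr 1 j (cS d x) = cS (d + tau j) (tr 1 j x).
Hypothesis hom1 : hR 0 1.
Hypothesis hom_r : forall i, hR (e i) (r i).
Hypothesis hom_h : forall k, hR gam (h k).

Local Notation T := {ffun 'I_c -> 'I_Q}.
Variables (d : nat).
Let be (b : T) := (\sum_i b i * e i)%N.
Let fe := (\sum_i Q.-1 * e i)%N.

Variables (Ub Zb : T -> finType) (bet : forall b, Ub b -> S) (mz : forall b, Zb b -> S).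
Hypothesis bet_B : forall b i, B (@bet b i).
Hypothesis bet_hom : forall b i, exists2 D, hS D (@bet b i) & (D + be b = d + gam)%N.
Hypothesis bet_ind : forall b, indep (@bet b).
Hypothesis mz_span : forall b j D v, A v -> hS D v ->
  (D + be b = d + gam + tau j)%N -> exists (co : Zb b -> K) a,
    A a /\ v = \sum_z co z *: mz z + g 0 * a.
Variables (Z : finType) (zet : Z -> R).
Hypothesis KK_span : forall x, KK x -> hR d x -> exists co : Z -> K, x = \sum_z co z *: zet z.

Local Notation shiftf := (@shiftf c Q R).
Local Notation decr := (@decr c Q).
Local Notation corr := (corr phi Q r h KK).
Local Notation obst := (obst phi Q r h KK A tr).

Let PQ_alg a : PQ (a%:A). Proof. exact: PQZ. Qed.
Let phi_alg a : phi (a%:A) = a%:A. Proof. by rewrite phiZ rmorph1. Qed.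
Let KKZ a x : KK x -> KK (a *: x).
Proof. by move=> Kx; rewrite -mulr_algl; apply: KKM. Qed.
Let KK_D x y : KK x -> KK y -> KK (x + y). Proof. exact: KKD. Qed.
Let KK_sumI (I : finType) (F : I -> R) : (forall i, KK (F i)) -> KK (\sum_i F i).
Proof. by move=> HF; elim/big_ind: _ => //; apply: KKD. Qed.
Let KK_lin (I : finType) (x : I -> K) (F : I -> R) : (forall i, KK (F i)) -> KK (\sum_i x i *: F i).
Proof. by move=> HF; apply: KK_sumI => i; apply: KKZ. Qed.

Lemma hR_lin (I : finType) (x : I -> K) (F : I -> R) D :
  (forall i, hR D (F i)) -> hR D (\sum_i x i *: F i).
Proof.
by move=> HF; rewrite /hR raddf_sum; apply: eq_bigr => i _; rewrite cR_scale HF.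
Qed.

Lemma hRM a b x y : hR a x -> hR b y -> hR (a + b) (x * y).
Proof. by move=> Hx Hy; rewrite /hR (cRM _ _ Hx) leq_addr addKn Hy. Qed.

Lemma hRX a x n : hR a x -> hR (n.+1 * a) (x ^+ n.+1).
Proof.
move=> Hx; elim: n => [|n IH]; first by rewrite mul1n expr1.
by rewrite exprS mulSn; apply: hRM.
Qed.

Lemma hRX0 a x n : hR a x -> hR (n * a) (x ^+ n).
Proof. by case: n => [|n]; [rewrite mul0n expr0|apply: hRX]. Qed.

Lemma hom_hQ k : hR (Q * gam) (hQ k). Proof. exact: hRX0. Qed.

Lemma hom_rho : hR fe rho.
Proof.
rewrite /rho /fe; elim/big_rec2: _ => [|i x y _ Hy]; first exact: hom1.
by apply: hRM => //; apply: hRX0.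
Qed.

Lemma hom_g k D x : cS D (g k * x) = if (gam <= D)%N then g k * cS (D - gam) x else 0.
Proof. by apply: cSM; rewrite /hS -phi_c hom_h. Qed.

Lemma hom_gQ k D x : cS D (gQ k * x) = if (Q * gam <= D)%N then gQ k * cS (D - Q * gam) x else 0.
Proof.
have E : gQ k = phi (hQ k) by rewrite rmorphXn.
by apply: cSM; rewrite E /hS -phi_c hom_hQ.
Qed.

Lemma cR_add a D x y : hR a x -> cR (a + D) (x * y) = x * cR D y.
Proof. by move=> Hx; rewrite (cRM _ _ Hx) leq_addr addKn. Qed.

Lemma corr_comp D x b : corr x b -> corr (cR (D + fe) x) (cS D b).
Proof.
move=> [k Kk [kE pk]]; exists (cR (Q * gam + D) k); first exact: cR_KK.
split; last first.
  by rewrite phi_c pk hom_gQ leq_addr addKn.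
have -> : hQ 0 * cR (D + fe) x = cR (Q * gam + (D + fe)) (hQ 0 * x).
  by rewrite (cR_add _ _ (hom_hQ 0)).
by rewrite -/(hQ 0) in kE; rewrite kE addnA addnC (cR_add _ _ hom_rho).
Qed.

(** The degree falls by [be a] so that multiplication by the [r i] respects it; at the top exponent,
    where [be] equals [fe], the entry has degree [d]. *)
Definition DL (Lam : {set T}) (x : {ffun T -> R}) :=
  (forall a, a \in Lam -> [/\ KK (x a), forall i, r i * x a = shiftf x i a
     & exists2 D, hR D (x a) & (D + be a = d + fe)%N]) /\
  (forall a, a \notin Lam -> x a = 0).

Lemma be_le (b : T) : (be b <= fe)%N.
Proof.
apply: leq_sum => i _; rewrite leq_mul2r -ltnS prednK ?ltn_ord ?orbT //.
Qed.

Lemma corr_D x y a b : corr x a -> corr y b -> corr (x + y) (a + b).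
Proof.
move=> Hx Hy; rewrite -[y]opprK -[b]opprK -[- y]sub0r -[- b]sub0r.
by apply: (corrB KKB) => //; apply: (corrB KKB) => //; exact: (corr0 phi Q r h KK0).
Qed.

Section Step.
Variables (Lam : {set T}) (b : T).
Hypothesis dLam : downset Lam.
Hypothesis bLam : b \notin Lam.
Hypothesis decb : forall i, (0 < b i)%N -> decr i b \in Lam.

Let Dx := (d + fe - be b)%N.
Let DxE : (Dx + be b = d + fe)%N.
Proof. by rewrite subnK // (leq_trans (be_le b)) ?leq_addl. Qed.

Let be_dec i : (0 < b i)%N -> be b = (e i + be (decr i b))%N.
Proof.
move=> bi; rewrite /be (bigD1 i) //= [in RHS](bigD1 i) //= ffunE eqxx /=.
rewrite -{1}(prednK bi) mulSn -!addnA; congr (_ + (_ + _))%N.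
by apply: eq_bigr => j /negPf ji; rewrite ffunE ji.
Qed.

Lemma step_lift (x : {ffun T -> R}) : DL Lam x ->
  exists y, [/\ KK y, forall i, r i * y = h 0 * shiftf x i b & hR (gam + Dx) y].
Proof.
move=> [Lx _].
have [y Ky yE] : exists2 y, KK y & forall i, r i * y = h 0 * shiftf x i b.
  apply: (lift_family Q_gt0 PQ0 PQB PQM PQr PQh PQ1 KK0 KKB KKM A1 AM B0 BB Ag
    al_PQ al_lin X_KK alK tr_A tr_lin xi_B trK phi_KK rho_phi ann_PQ r_nil KK_sat
    h_reg g_reg B_sat A_koszul B_phi dLam decb).
  by move=> a /Lx[].
exists (cR (gam + Dx) y); split; [exact: cR_KK| |exact: cR_idem].
move=> i; rewrite -(cR_add _ _ (hom_r i)) yE /shiftf.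
case: posnP => [|bi]; first by rewrite mulr0 raddf0.
rewrite addnCA (cR_add _ _ (hom_h 0)); congr (_ * _).
have [_ _ [D HD DE]] := Lx _ (decb bi).
suff -> : (e i + Dx = D)%N by [].
by have := be_dec bi; move: DxE DE; lia.
Qed.

Lemma step_theta (u : Ub b) : exists y, [/\ KK y, corr y (bet u) & hR (gam + Dx) y].
Proof.
have [D HD DE] := @bet_hom b u.
have [y Ky ry] : exists2 y, KK y & corr y (bet u).
  exact: (corr_KK PQM PQr PQh PQ1 KKB KKM rho_phi KK_sat B_phi).
exists (cR (gam + Dx) y); split; [exact: cR_KK| |exact: cR_idem].
have := corr_comp D ry; rewrite HD.
suff -> : (D + fe = gam + Dx)%N by [].
by move: DxE DE; lia.
Qed.

(** All data are cut down to the degree of [x]; there the obstruction is determined modulo [g 0] by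
    finitely many coordinates on [mz]. *)
Lemma obst_coord x v : KK x -> hR (gam + Dx) x -> obst x v ->
  exists (v' : J -> S) (co : J * Zb b -> K), obst x v' /\ forall j, exists2 a, A a &
    v' j = \sum_z co (j, z) *: mz z + g 0 * a.
Proof.
move=> Kx Hx [y [k [Ky Kk E tE]]].
have E' : hQ 1 * x = h 0 * cR (Q.-1 * gam + (gam + Dx)) y + cR (Q * gam + (gam + Dx)) (rho * k).
  have := congr1 (cR (Q * gam + (gam + Dx))) E.
  rewrite (cR_add _ _ (hom_hQ 1)) Hx raddfD /= => ->; congr (_ + _).
  rewrite -{1}(prednK Q_gt0) mulSn -addnA (cR_add _ _ (hom_h 0)).
  by [].
(* Below degree [fe] a multiple of [rho] has no component, and the obstruction can be taken to be
   0. *)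
have [lef|ltf] := leqP fe (Q * gam + (gam + Dx)); last first.
  exists (fun=> 0), (fun=> 0); split; last first.
    by move=> j; exists 0 => //; rewrite mulr0 big1 ?addr0 // => z _; rewrite scale0r.
  exists (cR (Q.-1 * gam + (gam + Dx)) y), 0; split=> //; first exact: cR_KK.
    by rewrite E' (cRM _ _ hom_rho) leqNgt ltf /= mulr0.
  by move=> j; split=> //; exists 0; rewrite // rmorph0 raddf0 !mulr0 addr0.
set D' := (Q * gam + (gam + Dx) - fe)%N.
have D'E : (D' + be b = Q * gam + (gam + d))%N by rewrite /D'; move: DxE lef; lia.
rewrite (cRM _ _ hom_rho) lef -/D' in E'.
have vP j : exists w : S * (Zb b -> K), [/\ A w.1, exists2 a, A a & tr 1 j (phi (cR D' k)) = gQ 1 * w.1 + g 0 * a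
   & exists2 a, A a & w.1 = \sum_z w.2 z *: mz z + g 0 * a].
  have [Av [a Aa aE]] := tE j.
  have trE : tr 1 j (phi (cR D' k)) = cS (D' + tau j) (gQ 1 * v j) + cS (D' + tau j) (g 0 * a).
    by rewrite phi_c (tr_c _ _ (phi_KK Kk)) aE raddfD.
  have [a' Aa' a'E] : exists2 a', A a' & cS (D' + tau j) (g 0 * a) = g 0 * a'.
    rewrite hom_g; case: leqP => _; first by exists (cS (D' + tau j - gam) a) => //; apply: cS_A.
    by exists 0; rewrite ?mulr0.
  rewrite a'E hom_gQ in trE.
  have [le1|lt1] := leqP (Q * gam) (D' + tau j); last first.
    rewrite leqNgt lt1 /= in trE.
    exists (0, fun=> 0); split=> //=; first by exists a'; rewrite // mulr0.
    by exists 0 => //; rewrite mulr0 big1 ?addr0 // => z _; rewrite scale0r.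
  have [|||co [a2 [Aa2 E2]]] := @mz_span b j (D' + tau j - Q * gam) (cS (D' + tau j - Q * gam) (v j)).
  - exact: cS_A.
  - exact: cS_idem.
  - by move: D'E le1; lia.
  exists (cS (D' + tau j - Q * gam) (v j), co); split=> /=; first exact: cS_A.
    by exists a' => //; rewrite trE le1.
  by exists a2.
have [w wE] := fin_all_exists vP.
exists (fun j => (w j).1), (fun jz => (w jz.1).2 jz.2); split; last first.
  by move=> j; case: (wE j) => _ _ [a Aa aE]; exists a.
exists (cR (Q.-1 * gam + (gam + Dx)) y), (cR D' k); split=> //; try exact: cR_KK.
by move=> j; case: (wE j).
Qed.

Lemma obst_lin (I : finType) (x : I -> K) (y : I -> R) (v : I -> J -> S) :
  (forall i, obst (y i) (v i)) -> obst (\sum_i x i *: y i) (fun j => \sum_i x i *: v i j).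
Proof.
move=> ob; have [w] := fin_all_exists ob.
move=> /fin_all_exists[k kE].
exists (\sum_i x i *: w i), (\sum_i x i *: k i); split.
- by apply: KK_lin => i; case: (kE i).
- by apply: KK_lin => i; case: (kE i).
- rewrite !mulr_sumr -big_split; apply: eq_bigr => i _ /=; case: (kE i) => _ _ E _.
  by rewrite -!scalerAr E scalerDr.
move=> j; have aP i : exists a, A a /\ tr 1 j (phi (k i)) = gQ 1 * v i j + g 0 * a.
  by case: (kE i) => _ _ _ /(_ j)[_ [a Aa aE]]; exists a.
have [a aE] := fin_all_exists aP.
have AD u1 u2 : A u1 -> A u2 -> A (u1 + u2).
  by move=> H1 H2; rewrite -[u2]opprK -[- u2]sub0r; apply: AB => //; apply: AB.
have A_lin (F : I -> S) : (forall i, A (F i)) -> A (\sum_i x i *: F i).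
  by move=> HF; elim/big_ind: _ => // i _; apply: AZ.
split; first by apply: A_lin => i; case: (kE i) => _ _ _ /(_ j)[].
exists (\sum_i x i *: a i); first by apply: A_lin => i; case: (aE i).
rewrite !raddf_sum /= !mulr_sumr -big_split; apply: eq_bigr => i _ /=.
by case: (aE i) => _; rewrite phiZ trZ => ->; rewrite scalerDr -!scalerAr.
Qed.

Let hL D (x : R) : hR (gam + D) (h 0 * x) -> hR D x.
Proof.
rewrite /hR (cR_add _ _ (hom_h 0)) => E; apply/eqP; rewrite -subr_eq0; apply/eqP/(@h_reg 0).
by rewrite mulrBr E subrr.
Qed.

(** Old families lift to [b] after multiplication by [h 0], and each [bet u] contributes a new
    family supported at [b]. Divisibility by [h 0] is then imposed through the |J| |Zb| coordinates
    of the obstruction, and the families that survive are divided by [h 0]. *)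
Lemma step n (v : 'I_n -> {ffun T -> R}) : indep v -> (forall i, DL Lam (v i)) ->
  exists n' (w : 'I_n' -> {ffun T -> R}), [/\ indep w, forall i, DL (b |: Lam) (w i) &
    (n + #|Ub b| <= n' + #|J| * #|Zb b|)%N].
Proof.
move=> ind_v Dv.
have [y yE] := fin_all_exists (fun i => step_lift (Dv i)).
have [th thE] := fin_all_exists step_theta.
pose x (i : 'I_n + Ub b) : R := match i with inl i => y i | inr u => th u end.
pose uu (i : 'I_n + Ub b) : {ffun T -> R} := match i with inl i => v i | inr u => 0 end.
have KKx i : KK (x i) by case: i => i; [case: (yE i)|case: (thE i)].
have hx i : hR (gam + Dx) (x i) by case: i => i; [case: (yE i)|case: (thE i)].
have rx i j : r j * x i = h 0 * shiftf (uu i) j b.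
  case: i => i; [by case: (yE i)|case: (thE i) => _ ri _ /=].
  rewrite (corr_ann Q_gt0 r_nil h_reg ri).
  by rewrite /shiftf; case: eqP; rewrite ?ffunE ?mulr0.
have Luu i a : a \in Lam -> KK (uu i a) /\ forall j, r j * uu i a = shiftf (uu i) j a.
  move=> aL; case: i => i /=; first by case: (Dv i) => /(_ _ aL)[].
  by split=> [|j]; rewrite /shiftf !ffunE ?mulr0 ?if_same.
have obP i : exists w : (J -> S) * (J * Zb b -> K), obst (x i) w.1 /\ forall j, exists2 a, A a &
    w.1 j = \sum_z w.2 (j, z) *: mz z + g 0 * a.
  have [w0 ow0] : exists w, obst (x i) w.
    exact: (obst_ex Q_gt0 PQ0 PQB PQM PQr PQh PQ1 KK0 KKB KKM A1 AM Ag al_PQ al_lin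
      X_KK alK tr_A tr_lin phi_KK rho_phi ann_PQ r_nil h_reg g_reg B_sat A_reg
      dLam decb (Luu i)).
  have [w [co [H1 H2]]] := obst_coord (KKx i) (hx i) ow0.
  by exists (w, co).
have [wc wcE] := fin_all_exists obP.
(* Entries away from [b] carry the factor [h 0] that the lift at [b] has cost; independence is
   proved before the division and passes to the kernel. *)
pose tt i : {ffun T -> R} := [ffun a => if a == b then x i else h 0 * uu i a].
have ind_t : indep tt.
  move=> cc E.
  have Ea a : \sum_i cc i *: tt i a = 0.
    by have := congr1 (fun F : {ffun T -> R} => F a) E; rewrite sum_ffunE ffunE => E1; rewrite -[RHS]E1; apply: eq_bigr => i _; rewrite [in RHS]ffunE.
  have c_l i : cc (inl i) = 0.
    apply: (ind_v (fun i => cc (inl i))); apply/ffunP => a; rewrite sum_ffunE ffunE.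
    have [->|ab] := eqVneq a b.
      rewrite big1 // => j _; rewrite !ffunE; case: (Dv j) => _ ->; rewrite ?scaler0 //.
    apply: (@h_reg 0); rewrite -[RHS](Ea a) big_sumType /= [X in _ + X]big1 ?addr0; last first.
      by move=> u _; rewrite /= !ffunE (negPf ab) /= ?ffunE mulr0 scaler0.
    rewrite mulr_sumr; apply: eq_bigr => j _; rewrite !ffunE (negPf ab) /=.
    by rewrite -scalerAr.
  case=> [i|u]; first exact: c_l.
  refine (@bet_ind b (fun u => cc (inr u)) _ u).
  have := Ea b; rewrite big_sumType /= [X in X + _]big1 ?add0r; last first.
    by move=> j _; rewrite c_l scale0r.
  under eq_bigr => w _ do rewrite ffunE eqxx /=.
  move=> th0; apply: (corr_fun0 rho_phi g_reg).
  rewrite -th0; elim/big_rec2: _ => [|w p q _ rpq]; first exact: (corr0 phi Q r h KK0).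
  have rw : corr (cc (inr w) *: th w) (cc (inr w) *: bet w).
    rewrite -(mulr_algl _ (th w)) -(mulr_algl _ (bet w)) -phi_alg.
    by apply: (corrM KKM) => //; case: (thE w).
  exact: corr_D.
have [n' [xx [le_n kerx ind_s]]] := kernel_family (fun i => (wc i).2) ind_t.
rewrite card_sum card_ord card_prod in le_n.
pose u' l : {ffun T -> R} := \sum_(i : 'I_n + Ub b) xx l i *: uu i.
have u'E l a : u' l a = \sum_i xx l i *: uu i a.
  by rewrite /u' sum_ffunE; apply: eq_bigr => i _; rewrite ffunE.
have wP l : exists wb, KK wb /\ \sum_i xx l i *: x i = h 0 * wb.
  have ob := obst_lin (xx l) (fun i => (wcE i).1).
  have [|wb Kwb wbE] := obst_kernel Q_gt0 PQM PQr PQh PQ1 KK0 KKB KKM A0 AB A1 AM B0 BB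
      Ag xi_B trK phi_KK rho_phi KK_sat h_reg B_phi (KK_lin (xx l) KKx) ob; last by exists wb.
  move=> j; have aP i : exists a, A a /\ (wc i).1 j = \sum_z (wc i).2 (j, z) *: mz z + g 0 * a.
    by case: (wcE i) => _ /(_ j)[a Aa aE]; exists a.
  have [a aE] := fin_all_exists aP.
  exists (\sum_i xx l i *: a i).
    elim/big_ind: _ => // [a1 a2 Aa1 Aa2|i _]; last by apply: AZ; case: (aE i).
    by rewrite -[a2]opprK -[- a2]sub0r; apply: AB => //; apply: AB.
  under eq_bigr => i _ do (case: (aE i) => _ ->; rewrite scalerDr scaler_sumr).
  rewrite big_split /= exchange_big /= big1 ?add0r.
    by rewrite mulr_sumr; apply: eq_bigr => i _; rewrite -scalerAr.
  move=> z _; under eq_bigr => i _ do rewrite scalerA.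
  by rewrite -scaler_suml kerx scale0r.
have [wb wbE] := fin_all_exists wP.
exists n', (fun l => [ffun a => if a == b then wb l else u' l a]); split.
- move=> cc E l; apply: (ind_s cc).
  apply/ffunP => a; rewrite sum_ffunE ffunE.
  have := congr1 (fun F : {ffun T -> R} => h 0 * F a) E; rewrite sum_ffunE ffunE mulr0 => E1; rewrite -[RHS]E1.
  rewrite mulr_sumr; apply: eq_bigr => l' _; rewrite !ffunE sum_ffunE -scalerAr; congr (_ *: _).
  case: (eqVneq a b) => [->|ab].
    case: (wbE l') => _ <-; apply: eq_bigr => i _; rewrite !ffunE eqxx //.
  by rewrite u'E mulr_sumr; apply: eq_bigr => i _; rewrite !ffunE (negPf ab) -scalerAr.
- move=> l; set w := finfun _.
  have wLam a : a \in Lam -> w a = u' l a.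
    by move=> aL; rewrite ffunE (negPf (_ : a != b)) //; apply: contraNneq bLam => <-.
  have sw j (a : T) : (0 < a j)%N -> decr j a \in Lam ->
      shiftf w j a = \sum_i xx l i *: shiftf (uu i) j a.
    move=> aj dL; by rewrite /shiftf -[_ == _]negbK -lt0n aj /= wLam // u'E.
  have sw0 j (a : T) : a j = 0%N :> nat -> shiftf w j a = 0.
    by move=> aj; rewrite /shiftf aj.
  split=> [a|a].
    rewrite in_setU1 => /orP[/eqP ->|aL].
      have -> : w b = wb l by rewrite ffunE eqxx.
      case: (wbE l) => Kw wE; split=> //.
        move=> i; apply/eqP; rewrite -subr_eq0; apply/eqP/(@h_reg 0).
        rewrite mulrBr mulrCA -wE mulr_sumr; apply/eqP; rewrite subr_eq0; apply/eqP.
        have [bi|bi] := posnP (b i).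
          rewrite sw0 // mulr0 big1 // => j _.
          by rewrite -scalerAr rx /shiftf bi mulr0 scaler0.
        rewrite sw ?decb // mulr_sumr; apply: eq_bigr => j _.
        by rewrite -!scalerAr rx.
      exists Dx; last exact: DxE.
      by apply: hL; rewrite -wE; apply: hR_lin.
    rewrite wLam // u'E; split.
    - by apply: KK_lin => i; case: (Luu i _ aL).
    - move=> j; rewrite mulr_sumr.
      have [aj|aj] := posnP (a j).
        rewrite sw0 // big1 // => i _; rewrite -scalerAr; case: (Luu i _ aL) => _ ->.
        by rewrite /shiftf aj scaler0.
      rewrite sw //; last exact: dLam.
      by apply: eq_bigr => i _; rewrite -scalerAr; case: (Luu i _ aL) => _ ->.
    exists (d + fe - be a)%N; last by rewrite subnK // (leq_trans (be_le a)) ?leq_addl.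
    apply: hR_lin; case=> i /=; last by rewrite /hR ffunE raddf0.
    case: (Dv i) => /(_ _ aL)[_ _ [D HD DE]] _.
    by rewrite -DE addnK.
  rewrite in_setU1 negb_or => /andP[ab aL]; rewrite ffunE (negPf ab) u'E big1 // => i _.
  case: i => i /=; last by rewrite ffunE scaler0.
  by case: (Dv i) => _ ->; rewrite ?scaler0.
by move: le_n; lia.
Qed.
End Step.

(** Removing an exponent of maximal weight leaves a downset that contains all its predecessors, so
    exponents can be added one at a time. *)
Lemma chain (Lam : {set T}) : downset Lam ->
  exists n (w : 'I_n -> {ffun T -> R}), [/\ indep w, forall i, DL Lam (w i) &
    (\sum_(b in Lam) #|Ub b| <= n + \sum_(b in Lam) #|J| * #|Zb b|)%N].
Proof.
have [m] := ubnP #|Lam|; elim: m Lam => // m IH Lam ltm dL.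
have [->|[b0 b0L]] := set_0Vmem Lam.
  exists 0%N, (fun=> 0); split=> [cc _ []//|[]//|]; by rewrite !big_set0.
pose wt (a : T) := (\sum_i (a i : nat))%N.
pose b := [arg max_(a > b0 | a \in Lam) wt a].
have [bL bmax] : b \in Lam /\ forall a, a \in Lam -> (wt a <= wt b)%N.
  by rewrite /b; case: arg_maxnP => // b1 ? ?; split.
have decr_lt i (a : T) : (0 < a i)%N -> (wt (decr i a) < wt a)%N.
  move=> a0; rewrite /wt (bigD1 i) //= [in X in (_ < X)%N](bigD1 i) //=.
  rewrite ffunE eqxx /= -(ltn_predK a0) -addSn leq_add // leq_sum // => j /negPf ji.
  by rewrite ffunE ji.
have decrE i (a : T) : a i = 0%N :> nat -> decr i a = a.
  move=> a0; apply/ffunP => j; rewrite ffunE; case: eqP => // ->.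
  by apply/val_inj; rewrite /= a0.
have dL' : downset (Lam :\ b).
  move=> a i /setD1P[ab aL]; apply/setD1P; split; last exact: dL.
  have [a0|a0] := posnP (a i); first by rewrite decrE.
  by apply: contraTneq (bmax _ aL) => <-; rewrite -ltnNge decr_lt.
have [||n [w [ind_w Dw le_n]]] := IH (Lam :\ b) => //.
  by move: ltm; rewrite (cardsD1 b Lam) bL.
have [||n' [w' [ind_w' Dw' le_n']]] := @step (Lam :\ b) b dL' _ _ n w ind_w Dw.
- by rewrite !inE eqxx.
- move=> i bi; apply/setD1P; split; last exact: dL.
  by apply/eqP => E; have := decr_lt _ _ bi; rewrite E ltnn.
exists n', w'; rewrite setD1K // in Dw'; split=> //.
rewrite (big_setD1 b) //= [X in (_ <= _ + X)%N](big_setD1 b) //=.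
have arith (s1 s2 s3 s4 : nat) : (s1 <= n + s2 -> n + s3 <= n' + s4 ->
  s3 + s1 <= n' + (s4 + s2))%N by lia.
exact: arith le_n le_n'.
Qed.

(** A family over the whole box is determined by its entry at the top exponent, since multiplication
    by the [r i] recovers all others; that entry lies in degree [d] of [KK], which [zet] spans. *)
Theorem section_count :
  (\sum_b #|Ub b| <= #|Z| + \sum_b #|J| * #|Zb b|)%N.
Proof.
have [|n [w [ind_w Dw le_n]]] := @chain setT; first by move=> a i _; rewrite inE.
have sT (F : T -> nat) : (\sum_(b in setT) F b = \sum_b F b)%N.
  by apply: eq_bigl => b; rewrite inE.
rewrite !sT in le_n.
apply: (leq_trans le_n); rewrite leq_add2r.
have ltQ : (Q.-1 < Q)%N by rewrite prednK.
pose top : T := [ffun=> Ordinal ltQ].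
have topE : be top = fe by apply: eq_bigr => i _; rewrite ffunE.
have inj_top (x : {ffun T -> R}) : DL setT x -> x top = 0 -> x = 0.
  move=> [Dx _] x0; apply/ffunP => a; rewrite ffunE.
  have [k] := ubnP (\sum_i (Q.-1 - a i))%N; elim: k a => // k IH a ltk.
  have [/existsP[i lti]|/existsPn ge] := boolP [exists i, (a i < Q.-1)%N]; last first.
    rewrite -[RHS]x0; congr (x _); apply/ffunP => i; rewrite ffunE; apply/val_inj/eqP => /=.
    by rewrite eqn_leq -ltnS prednK // ltn_ord leqNgt ge.
  have lti' : ((a i).+1 < Q)%N by lia.
  pose a' : T := [ffun j => if j == i then Ordinal lti' else a j].
  have aE : a = decr i a'.
    apply/ffunP => j; rewrite !ffunE; case: eqP => // ->.
    by apply/val_inj; rewrite /= ?ffunE ?eqxx.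
  have [_ /(_ i) ra _] := Dx a' (in_setT _).
  have E2 : shiftf x i a' = x (decr i a') by rewrite /shiftf ffunE eqxx.
  rewrite aE -E2 -ra IH ?mulr0 //.
  rewrite ltnS in ltk; apply: leq_trans ltk; rewrite (bigD1 i) //= [in X in (_ < X)%N](bigD1 i) //=.
  rewrite ffunE eqxx /= -addSn leq_add ?subnSK //.
  by apply: leq_sum => j /negPf ji; rewrite ffunE ji.
have lin_DL (cc : 'I_n -> K) : DL setT (\sum_i cc i *: w i).
  split=> a; last by rewrite inE.
  move=> _; have E a' : (\sum_i cc i *: w i) a' = \sum_i cc i *: w i a'.
    by rewrite sum_ffunE; apply: eq_bigr => i _; rewrite ffunE.
  rewrite E; split.
  - by apply: KK_lin => i; case: (Dw i) => /(_ a (in_setT _))[].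
  - move=> j; rewrite mulr_sumr /shiftf E; case: posnP => [aj|aj].
      rewrite big1 // => i _; rewrite -scalerAr; case: (Dw i) => /(_ a (in_setT _))[_ -> _ _].
      by rewrite /shiftf aj scaler0.
    apply: eq_bigr => i _; rewrite -scalerAr; case: (Dw i) => /(_ a (in_setT _))[_ -> _ _].
    by rewrite /shiftf -[_ == _]negbK -lt0n aj.
  exists (d + fe - be a)%N; last by rewrite subnK // (leq_trans (be_le a)) ?leq_addl.
  apply: hR_lin => i; case: (Dw i) => /(_ a (in_setT _))[_ _ [D HD DE]] _.
  by rewrite -DE addnK.
rewrite -[X in (X <= _)%N]card_ord.
apply: (exchange_leq (V := R) (W := fun x => x = 0) (u := fun i => w i top) (v := zet)).
- exact: subsp0.
- move=> cc E; apply: (ind_w cc); apply: inj_top => //.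
  by rewrite sum_ffunE -[RHS]E; apply: eq_bigr => i _; rewrite ffunE.
move=> i; have [Kt _ [D HD DE]] : [/\ KK (w i top), forall j, r j * w i top = shiftf (w i) j top
     & exists2 D, hR D (w i top) & (D + be top = d + fe)%N] by case: (Dw i) => /(_ top (in_setT _)).
have [|co coE] := KK_span Kt.
  by move: DE; rewrite topE => /addIn <-.
by exists co; rewrite -coE subrr.
Qed.
End Counting.

(** * Truncated Frobenius extensions *)

Section TruncatedAlgebra.
Variables (K : fieldType) (S : comAlgType K) (m Q : nat) (Q_gt0 : (0 < Q)%N) (F : 'I_m -> S).

(** The ring S[Y]/(Y_i^Q - F_i), stored as coordinates on box monomials. The type carries [Q_gt0]
    and [F] as phantom arguments because the multiplication depends on them. *)
Definition talg & (0 < Q)%N & ('I_m -> S) : Type := {ffun {ffun 'I_m -> 'I_Q} -> S}.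
Local Notation R := (talg Q_gt0 F).
Local Notation T := {ffun 'I_m -> 'I_Q}.

HB.instance Definition _ := GRing.Lmodule.on R.

Definition tmod (mu : 'X_{1..m}) : T := [ffun i => Ordinal (ltn_pmod (mu i) Q_gt0)].
Definition tcarry (mu : 'X_{1..m}) : S := \prod_i F i ^+ (mu i %/ Q).
Definition tred (u : {mpoly S[m]}) : R :=
  [ffun a => \sum_(mu <- msupp u | tmod mu == a) u@_mu * tcarry mu].
Definition tlift (x : R) : {mpoly S[m]} := \sum_a (x : {ffun T -> S}) a *: 'X_[mbox a].

Lemma tred_big (u : {mpoly S[m]}) (s : seq 'X_{1..m}) a : uniq s -> {subset msupp u <= s} ->
  (tred u : {ffun T -> S}) a = \sum_(mu <- s | tmod mu == a) u@_mu * tcarry mu.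
Proof.
move=> us sub; rewrite ffunE [RHS](bigID (mem (msupp u))) /= [X in _ + X]big1 ?addr0; last first.
  by move=> mu /andP[_ /memN_msupp_eq0->]; rewrite mul0r.
rewrite -[LHS]big_filter -[RHS]big_filter; apply: perm_big.
apply: uniq_perm; rewrite ?filter_uniq ?msupp_uniq // => mu; rewrite !mem_filter.
by case: (boolP (mu \in msupp u)) => [/[dup] muu /sub ->|]; rewrite ?andbF ?andbT.
Qed.

Lemma tredP c (u v : {mpoly S[m]}) : tred (c *: u + v) = [ffun a =>
  c * (tred u : {ffun T -> S}) a + (tred v : {ffun T -> S}) a].
Proof.
apply/ffunP => a; rewrite [RHS]ffunE.
pose s := undup (msupp (c *: u + v) ++ msupp u ++ msupp v).
have us : uniq s by apply: undup_uniq.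
have ins x : x \in s = (x \in msupp (c *: u + v)) || (x \in msupp u) || (x \in msupp v).
  by rewrite mem_undup !mem_cat orbA.
rewrite !(@tred_big _ s) // ?mulr_sumr; try by move=> x xs; rewrite ins xs ?orbT.
rewrite -big_split; apply: eq_bigr => mu _ /=.
by rewrite mcoeffD mcoeffZ mulrDl mulrA.
Qed.

Fact tred_additive : additive tred.
Proof.
move=> u v; have E := tredP (-1) v u; rewrite scaleN1r addrC in E.
rewrite E; apply/ffunP => a; rewrite !ffunE mulN1r addrC; congr (_ + _).
Qed.
HB.instance Definition _ := GRing.isAdditive.Build {mpoly S[m]} R tred tred_additive.

Definition tscale (c : S) (x : R) : R := [ffun a => c * (x : {ffun T -> S}) a].

Lemma tredZ c u : tred (c *: u) = tscale c (tred u).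
Proof.
have := tredP c u 0; rewrite addr0 (raddf0 tred) => ->; apply/ffunP => a.
by rewrite [LHS]ffunE [RHS]ffunE [X in _ + X]ffunE addr0.
Qed.

Lemma tredX mu : tred 'X_[mu] = [ffun a => if a == tmod mu then tcarry mu else 0].
Proof.
apply/ffunP => a; rewrite !ffunE msuppX big_mkcond big_seq1 mcoeffX eqxx mul1r eq_sym.
by [].
Qed.

Lemma tmod_mbox (a : T) : tmod (mbox a) = a.
Proof. by apply/ffunP => i; apply/val_inj; rewrite ffunE /= mnmE modn_small. Qed.

Lemma tcarry_mbox (a : T) : tcarry (mbox a) = 1.
Proof. by apply: big1 => i _; rewrite mnmE divn_small. Qed.

Lemma tredK (x : R) : tred (tlift x) = x.
Proof.
rewrite /tlift raddf_sum /=; apply/ffunP => b; rewrite sum_ffunE.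
rewrite (bigD1 b) //= tredZ tredX !ffunE tmod_mbox eqxx tcarry_mbox mulr1 big1 ?addr0 //.
by move=> a; rewrite eq_sym tredZ tredX !ffunE tmod_mbox => /negPf ->; rewrite mulr0.
Qed.

Lemma tlift_tredX mu : tlift (tred 'X_[mu]) = tcarry mu *: 'X_[mbox (tmod mu)].
Proof.
rewrite /tlift (bigD1 (tmod mu)) //= tredX ffunE eqxx big1 ?addr0 // => a /negPf aN.
by rewrite ffunE aN scale0r.
Qed.

Lemma tlift_lin c (x y : R) : tlift (tscale c x + y) = c *: tlift x + tlift y.
Proof.
rewrite /tlift scaler_sumr -big_split; apply: eq_bigr => a _ /=.
by rewrite !ffunE scalerDl scalerA.
Qed.

(** Reducing a factor beforehand does not change the reduced product; associativity and
    multiplicativity of [tred] follow from this. *)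
Lemma tredM_lift u v : tred (tlift (tred u) * v) = tred (u * v).
Proof.
elim/mpolyind: u v => [|c mu u _ _ IH] v.
  rewrite raddf0 mul0r /tlift big1 ?mul0r // => a _; by rewrite ffunE scale0r.
rewrite raddfD /= tredZ tlift_lin !mulrDl !raddfD /= IH; congr (_ + _).
rewrite tlift_tredX -!scalerAl !tredZ; congr tscale.
elim/mpolyind: v => [|d nu v _ _ IHv]; first by rewrite !mulr0 !raddf0 /tscale; apply/ffunP => a; rewrite !ffunE mulr0.
have scD (x y : R) : tscale (tcarry mu) (x + y) = tscale (tcarry mu) x + tscale (tcarry mu) y.
  by apply/ffunP => a; rewrite !ffunE mulrDr.
rewrite !mulrDr !raddfD /= scD IHv; congr (_ + _).
have scC (x : R) : tscale (tcarry mu) (tscale d x) = tscale d (tscale (tcarry mu) x).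
  by apply/ffunP => a; rewrite !ffunE mulrCA.
rewrite -!scalerAr !tredZ scC; congr tscale.
rewrite -!mpolyXD !tredX; apply/ffunP => a; rewrite !ffunE.
have -> : tmod (mbox (tmod mu) + nu) = tmod (mu + nu).
  by apply/ffunP => i; apply/val_inj; rewrite !ffunE /= !mnmDE mnmE ffunE /= modnDml.
case: eqP => _; last by rewrite mulr0.
rewrite /tcarry -big_split; apply: eq_bigr => i _ /=; rewrite -exprD; congr (_ ^+ _).
by rewrite !mnmDE mnmE ffunE /= [X in _ = ((X + _) %/ _)%N](divn_eq (mu i) Q) -addnA divnMDl.
Qed.

Definition tmul (x y : R) : R := tred (tlift x * tlift y).

Fact tmulC : commutative tmul.
Proof. by move=> x y; rewrite /tmul mulrC. Qed.
Fact tmulA : associative tmul.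
Proof.
move=> x y z; rewrite /tmul tredM_lift mulrC tredM_lift.
by rewrite mulrC mulrA.
Qed.
Fact tmul1 : left_id (tred 1) tmul.
Proof. by move=> x; rewrite /tmul tredM_lift mul1r tredK. Qed.
Fact tliftD (x y : R) : tlift (x + y) = tlift x + tlift y.
Proof.
by rewrite /tlift -big_split; apply: eq_bigr => a _ /=; rewrite ffunE scalerDl.
Qed.
Fact tmulDl : left_distributive tmul +%R.
Proof. by move=> x y z; rewrite /tmul tliftD mulrDl raddfD. Qed.
Fact tone_neq0 : tred 1 != 0.
Proof.
apply/eqP => /(congr1 (fun x : R => (x : {ffun T -> S}) (tmod 0%MM))).
rewrite -mpolyX0 tredX !ffunE eqxx /tcarry big1 => [|i _]; last by rewrite mnm0E div0n.
by move/eqP; rewrite oner_eq0.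
Qed.

HB.instance Definition _ := GRing.Zmodule_isComNzRing.Build R tmulA tmulC tmul1 tmulDl tone_neq0.

Fact tscaleAl (a : K) (x y : R) : a *: (x * y) = (a *: x) * y.
Proof.
have scE (z : R) : a *: z = tscale a%:A z by apply/ffunP => b; rewrite !ffunE mulr_algl.
rewrite !scE {2}/tscale -[LHS]/(tscale a%:A (tred (tlift x * tlift y))) -tredZ.
rewrite -[RHS]/(tred (tlift (tscale a%:A x) * tlift y)); congr tred.
have t0 : tlift 0 = 0 by rewrite /tlift big1 // => b _; rewrite ffunE scale0r.
by have := tlift_lin a%:A x 0; rewrite addr0 t0 addr0 => ->; rewrite -scalerAl.
Qed.
HB.instance Definition _ := GRing.Lmodule_isLalgebra.Build K R tscaleAl.
HB.instance Definition _ := GRing.Lalgebra_isComAlgebra.Build K R.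

Fact tred_multiplicative : monoid_morphism tred.
Proof.
split=> // u v; rewrite -[RHS]/(tred (tlift (tred u) * tlift (tred v))) tredM_lift.
by rewrite [in RHS]mulrC tredM_lift mulrC.
Qed.
HB.instance Definition _ := GRing.isMonoidMorphism.Build {mpoly S[m]} R tred tred_multiplicative.

End TruncatedAlgebra.

(** * Weighted gradings *)

Section Grading.
Variables (K : fieldType) (n : nat) (w : 'I_n -> nat).
Implicit Types (mu nu : 'X_{1..n}) (p q : {mpoly K[n]}).

Definition wdeg mu := (\sum_i w i * mu i)%N.

Lemma wdegD mu nu : wdeg (mu + nu) = (wdeg mu + wdeg nu)%N.
Proof. by rewrite /wdeg -big_split; apply: eq_bigr => i _; rewrite mnmDE mulnDr. Qed.

Lemma wdeg0 : wdeg 0%MM = 0%N.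
Proof. by apply: big1 => i _; rewrite mnm0E muln0. Qed.

Lemma wdegU i : wdeg U_(i)%MM = w i.
Proof.
rewrite /wdeg (bigD1 i) //= mnm1E eqxx muln1 big1 ?addn0 // => j.
by rewrite mnm1E eq_sym => /negPf ->; rewrite muln0.
Qed.

Definition wcomp d p := \sum_(mu <- msupp p | wdeg mu == d) p@_mu *: 'X_[mu].

Lemma mcoeff_wcomp d p mu : (wcomp d p)@_mu = if wdeg mu == d then p@_mu else 0.
Proof.
rewrite /wcomp raddf_sum /=.
under eq_bigr => nu _ do rewrite mcoeffZ mcoeffX.
have [mu_p|mu_p] := boolP (mu \in msupp p).
  rewrite big_mkcond (bigD1_seq mu) ?msupp_uniq //= eqxx mulr1 big1 ?addr0 // => nu.
  by move/negPf=> ->; rewrite mulr0; case: ifP.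
rewrite (memN_msupp_eq0 mu_p) if_same big1_seq // => nu /andP[_ nu_p].
by case: eqP => [E|_]; [rewrite -E nu_p in mu_p|rewrite mulr0].
Qed.

Fact wcomp_linear d : linear (wcomp d).
Proof.
move=> c p q; apply/mpolyP => mu; rewrite mcoeffD mcoeffZ !mcoeff_wcomp mcoeffD mcoeffZ.
by case: ifP; rewrite ?mulr0 ?addr0.
Qed.
HB.instance Definition _ d :=
  GRing.isLinear.Build K {mpoly K[n]} {mpoly K[n]} _ (wcomp d) (@wcomp_linear d).

Definition whom d p := wcomp d p = p.

Lemma whomP d p : whom d p <-> forall mu, p@_mu != 0 -> wdeg mu = d.
Proof.
split=> [<- mu|H]; first by rewrite mcoeff_wcomp; case: (wdeg mu =P d) => // _; rewrite eqxx.
apply/mpolyP => mu; rewrite mcoeff_wcomp; case: (wdeg mu =P d) => // ne.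
by apply/esym/eqP; apply/contraT => /H.
Qed.

Lemma wcomp_whom d e p : whom e p -> wcomp d p = if d == e then p else 0.
Proof.
move=> /whomP Hp; apply/mpolyP => mu; rewrite mcoeff_wcomp.
have [E|/Hp ->] := eqVneq p@_mu 0; last by rewrite eq_sym; case: ifP; rewrite ?mcoeff0.
by rewrite E if_same; case: ifP; rewrite ?mcoeff0 ?E.
Qed.

Lemma wcomp_idem d p : whom d (wcomp d p).
Proof. by apply/mpolyP => mu; rewrite !mcoeff_wcomp; case: (wdeg mu == d). Qed.

Lemma whomX mu : whom (wdeg mu) 'X_[mu].
Proof.
apply/whomP => nu; rewrite mcoeffX; case: (mu =P nu) => [<-//|_]; by rewrite mulr0n eqxx.
Qed.

Lemma whomZ d c p : whom d p -> whom d (c *: p).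
Proof. by rewrite /whom linearZ /= => ->. Qed.
Lemma whom0 d : whom d 0. Proof. exact: raddf0. Qed.
Lemma whomD d p q : whom d p -> whom d q -> whom d (p + q).
Proof. by rewrite /whom raddfD /= => -> ->. Qed.
Lemma whomB d p q : whom d p -> whom d q -> whom d (p - q).
Proof. by rewrite /whom raddfB /= => -> ->. Qed.
Lemma whom_sum d I (r : seq I) (P : pred I) F : (forall i, P i -> whom d (F i)) ->
  whom d (\sum_(i <- r | P i) F i).
Proof. by move=> HF; elim/big_ind: _ => //; [exact: whom0|exact: whomD]. Qed.
Lemma whomC c : whom 0 c%:MP.
Proof.
by rewrite -alg_mpolyC; apply: whomZ; have := whomX 0%MM; rewrite wdeg0 mpolyX0.
Qed.
Lemma whom1 : whom 0 1. Proof. exact: (whomC 1). Qed.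

Lemma wcompX d mu : wcomp d 'X_[mu] = if d == wdeg mu then 'X_[mu] else 0.
Proof. exact: wcomp_whom (whomX mu). Qed.

Lemma wcompM d d' p q : whom d' p ->
  wcomp d (p * q) = if (d' <= d)%N then p * wcomp (d - d')%N q else 0.
Proof.
move=> /whomP Hp; rewrite (mpolyE p) mulr_suml raddf_sum /= mulr_suml.
rewrite [RHS](_ : _ = \sum_(mu <- msupp p) (if (d' <= d)%N then
   (p@_mu *: 'X_[mu]) * wcomp (d - d')%N q else 0)); last first.
  by case: ifP => //; rewrite big1.
apply: eq_big_seq => mu; rewrite mcoeff_msupp => /Hp E.
elim/mpolyind: q => [|c nu q _ _ IH].
  by rewrite mulr0 !raddf0 mulr0 if_same.
rewrite mulrDr !raddfD /= IH mulrDr.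
have -> : wcomp d (p@_mu *: 'X_[mu] * (c *: 'X_[nu])) = if (d' <= d)%N then
    p@_mu *: 'X_[mu] * wcomp (d - d')%N (c *: 'X_[nu]) else 0.
  rewrite -scalerAr -scalerAl -mpolyXD !linearZ /= !wcompX wdegD E.
  have [led|] := leqP d' d; last first.
    by move=> ltd; rewrite (ltn_eqF (leq_trans ltd (leq_addr _ _))) !scaler0.
  rewrite -{1}(subnKC led) eqn_add2l; case: eqP => _; last by rewrite !scaler0 mulr0.
  by rewrite -scalerAr -scalerAl -mpolyXD.
by case: ifP; rewrite ?addr0.
Qed.

Lemma whomM d e p q : whom d p -> whom e q -> whom (d + e)%N (p * q).
Proof. by move=> Hp Hq; rewrite /whom (wcompM _ _ Hp) leq_addr addKn Hq. Qed.

Lemma whomXn d p k : whom d p -> whom (d * k)%N (p ^+ k).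
Proof.
move=> Hp; elim: k => [|k IH]; first by rewrite muln0 expr0; apply: whom1.
by rewrite mulnS exprS; apply: whomM.
Qed.

Lemma whom_prod I (r : seq I) (P : pred I) (D : I -> nat) F :
  (forall i, P i -> whom (D i) (F i)) ->
  whom (\sum_(i <- r | P i) D i)%N (\prod_(i <- r | P i) F i).
Proof.
by move=> HF; elim/big_rec2: _ => [|i x y Pi H]; [exact: whom1|apply: whomM => //; exact: HF].
Qed.

Lemma wcomp_decomp p : exists B, p = \sum_(d < B) wcomp d p.
Proof.
exists (\max_(mu <- msupp p) wdeg mu).+1; apply/mpolyP => mu.
rewrite raddf_sum /=; under eq_bigr => d _ do rewrite mcoeff_wcomp.
have [mup|/memN_msupp_eq0 ->] := boolP (mu \in msupp p); last first.
  by rewrite big1 // => d _; rewrite if_same.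
have lt : (wdeg mu < (\max_(mu <- msupp p) wdeg mu).+1)%N.
  by rewrite ltnS (big_rem mu) //= leq_maxl.
rewrite (bigD1 (Ordinal lt)) //= eqxx big1 ?addr0 // => d.
by rewrite -val_eqE /= eq_sym => /negPf ->.
Qed.
End Grading.

Lemma wcomp_subst (K : fieldType) n m (u : 'I_n -> nat) (w : 'I_m -> nat)
    (f : 'I_m -> {mpoly K[n]}) d p : (forall i, whom u (w i) (f i)) ->
  (wcomp w d p)^$ f = wcomp u d (p^$ f).
Proof.
move=> Hf; elim/mpolyind: p => [|c mu p _ _ IH]; first by rewrite !raddf0.
rewrite !raddfD /= IH; congr (_ + _).
rewrite !linearZ /= wcompX.
have H : whom u (wdeg w mu) ('X_[mu]^$ f).
  by rewrite substX; apply: whom_prod => i _; apply: whomXn.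
by rewrite (wcomp_whom _ H); case: ifP => _ //; rewrite ?comp_mpoly0 ?raddf0.
Qed.

Section IndependentSubset.
Variables (K : fieldType) (V : lmodType K) (W : V -> Prop) (hW : subsp W).

Lemma indep_subset (J : finType) (v : J -> V) : exists B : {set J},
  indep_mod W (fun i : {j | j \in B} => v (val i)) /\
  forall j, exists c : {j | j \in B} -> K, W (v j - \sum_i c i *: v (val i)).
Proof.
pose ind (B : {set J}) := forall c : J -> K, (forall j, j \notin B -> c j = 0) ->
  W (\sum_j c j *: v j) -> forall j, c j = 0.
have ex0 : ind set0 by move=> c c0 _ j; apply: c0; rewrite inE.
(* Excluded middle turns independence into a boolean, so that an independent subset of maximal size
   can be chosen. *)
pose indb B : bool := if excluded_middle_informative (ind B) then true else false.
have indP B : reflect (ind B) (indb B).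
  by rewrite /indb; case: excluded_middle_informative => H; constructor.
have [B [/indP iB maxB]] : exists B, indb B /\ forall B', indb B' -> (#|B'| <= #|B|)%N.
  pose B := [arg max_(B > set0 | indb B) #|B|].
  by exists B; rewrite /B; case: arg_maxnP => [|B' ? ?]; [apply/indP|split].
have sumB (c : {j | j \in B} -> K) :
    exists2 c' : J -> K, (forall j, j \notin B -> c' j = 0) &
    \sum_i c i *: v (val i) = \sum_j c' j *: v j /\ forall i, c' (val i) = c i.
  pose c' j := if insub j is Some i then c i else 0.
  have c'E i : c' (val i) = c i by rewrite /c' valK.
  exists c'; first by move=> j jB; rewrite /c' insubN.
  split=> //; rewrite (bigID (mem B)) /= [X in _ = _ + X]big1 ?addr0; last first.
    by move=> j jB; rewrite /c' insubN ?scale0r.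
  rewrite [RHS](reindex_omap (@sval _ (fun j => j \in B)) insub); last first.
    by move=> j jB; rewrite insubT.
  by apply: eq_big => [i|i _]; rewrite ?c'E // valK eqxx (valP i).
exists B; split=> [c Wc i|j].
  have [c' c'0 [E c'E]] := sumB c; rewrite E in Wc.
  by rewrite -c'E (iB c').
have [jB|jB] := boolP (j \in B).
  exists (fun i => (val i == j)%:R); rewrite (bigD1 (exist _ j jB)) //= eqxx scale1r big1.
    by rewrite addr0 subrr; case: hW.
  by move=> i; rewrite -val_eqE /= => /negPf ->; rewrite scale0r.
have /indP nI : ~~ indb (j |: B).
  apply/negP => /maxB; by rewrite cardsU1 jB add1n ltnn.
have [c [c0 Wc [k ck]]] : exists c : J -> K, [/\ forall i, i \notin j |: B -> c i = 0,
    W (\sum_i c i *: v i) & exists i, c i <> 0].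
  apply: NNPP => H; apply: nI => c c0 Wc i; apply: NNPP => ci.
  by apply: H; exists c; split=> //; exists i.
have cj : c j != 0.
  apply/eqP => cj; apply: ck; apply: (iB c) => // i iB'.
  have [->|ij] := eqVneq i j; first exact: cj.
  by apply: c0; rewrite !inE negb_or ij.
exists (fun i => - (c (val i) / c j)).
have -> : v j - \sum_(i : {j | j \in B}) - (c (val i) / c j) *: v (val i) = (c j)^-1 *: \sum_i c i *: v i.
  have [c' c'0 [-> c'E]] := sumB (fun i => - (c (val i) / c j)).
  rewrite [in RHS](bigD1 j) //= scalerDr scalerA mulVf // scale1r; congr (_ + _).
  rewrite (bigD1 j) //= c'0 // scale0r add0r -sumrN scaler_sumr.
  apply: eq_bigr => i ij; rewrite scalerA -scaleNr; congr (_ *: _).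
  have [iB'|iB'] := boolP (i \in B).
    by have := c'E (exist _ i iB') => /= ->; rewrite opprK mulrC.
  have cz : c i = 0 by apply: c0; rewrite !inE negb_or ij.
  by rewrite c'0 // cz mulr0 oppr0.
by case: hW => _ _; apply.
Qed.
End IndependentSubset.

(** * Homogeneous bases modulo parameters *)

Section GradedBasis.
Variables (K : fieldType) (m l : nat) (w : 'I_m -> nat).
Variables (t : 'I_l -> {mpoly K[m]}) (e : 'I_l -> nat).
Hypothesis w_gt0 : forall i, (0 < w i)%N.
Hypothesis e_gt0 : forall j, (0 < e j)%N.
Hypothesis hom_t : forall j, whom w (e j) (t j).

Lemma mdeg_wdeg mu : (mdeg mu <= wdeg w mu)%N.
Proof. by rewrite mdegE; apply: leq_sum => i _; rewrite leq_pmull. Qed.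

(** Graded Nakayama lemma: finitely many monomials contain a basis modulo the ideal, and since the
    [t j] have positive degree, induction on the degree expresses every polynomial over the subring
    that they generate. *)
Lemma graded_basis D : (forall mu, (D <= wdeg w mu)%N -> in_ideal t 'X_[mu]) ->
  exists (I : finType) (b : I -> {mpoly K[m]}) (bd : I -> nat),
  [/\ forall i, whom w (bd i) (b i), indep_mod (in_ideal t) b &
      forall x, exists F : I -> {mpoly K[l]}, x = \sum_i b i * (F i)^$ t].
Proof.
move=> HD; have hW : subsp (in_ideal t) by apply: in_ideal_subsp.
have [B [ind_B span_B]] := indep_subset hW (fun mu : 'X_{1..m < D} => 'X_[mu] : {mpoly K[m]}).
pose I := {j | j \in B}; pose b (i : I) : {mpoly K[m]} := 'X_[val i].
pose bd (i : I) := wdeg w (val i).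
exists I, b, bd; split=> [i||]; [exact: whomX|exact: ind_B|].
pose sp x := exists F : I -> {mpoly K[l]}, x = \sum_i b i * (F i)^$ t.
have spD x y : sp x -> sp y -> sp (x + y).
  move=> [F ->] [G ->]; exists (fun i => F i + G i).
  by rewrite -big_split; apply: eq_bigr => i _; rewrite comp_mpolyD mulrDr.
have sp0 : sp 0 by exists (fun=> 0); rewrite big1 // => i _; rewrite comp_mpoly0 mulr0.
have spt x j : sp x -> sp (t j * x).
  move=> [F ->]; exists (fun i => 'X_j * F i); rewrite mulr_sumr.
  by apply: eq_bigr => i _; rewrite rmorphM /= substXU mulrCA.
have spZ c x : sp x -> sp (c *: x).
  move=> [F ->]; exists (fun i => c *: F i); rewrite scaler_sumr.
  by apply: eq_bigr => i _; rewrite comp_mpolyZ scalerAr.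
have sp_sum (J : finType) (F : J -> {mpoly K[m]}) : (forall j, sp (F j)) -> sp (\sum_j F j).
  by move=> HF; elim/big_ind: _.
have spb i : sp (b i).
  exists (fun j => (i == j)%:R); rewrite (bigD1 i) //= eqxx comp_mpoly1 mulr1 big1 ?addr0 //.
  by move=> j; rewrite eq_sym => /negPf ->; rewrite mulr0n comp_mpoly0 mulr0.
suff H d : forall x, whom w d x -> sp x.
  move=> x; have [N ->] := wcomp_decomp w x.
  by elim/big_ind: _ => // i _; apply: (H i); apply: wcomp_idem.
have [k] := ubnP d; elim: k d => // k IH d ltd x Hx.
have spX mu : wdeg w mu = d -> sp 'X_[mu].
  move=> mud.
  have spI q : in_ideal t q -> whom w d q -> sp q.
    move=> [r E] Hq; rewrite -Hq E raddf_sum /=; apply: sp_sum => j.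
    rewrite (wcompM _ _ (hom_t j)); case: leqP => // lej; apply: spt.
    apply: (IH (d - e j)%N); last exact: wcomp_idem.
    by have := e_gt0 j; lia.
  have [/HD/spI|ltD] := leqP D (wdeg w mu); first by apply; rewrite -mud; apply: whomX.
  have mudeg : (mdeg mu < D)%N by apply: leq_ltn_trans (mdeg_wdeg mu) ltD.
  have [c] := span_B (BMultinom mudeg); move=> /= [r E].
  have E2 : wcomp w d ('X_[mu] - \sum_i c i *: b i) = wcomp w d (\sum_j t j * r j).
    by rewrite -E.
  rewrite raddfB /= wcompX mud eqxx in E2.
  rewrite -[X in sp X](subrK (wcomp w d (\sum_i c i *: b i))) E2; apply: spD.
    apply: spI; last exact: wcomp_idem.
    rewrite raddf_sum /=; elim/big_ind: _; [exact: in_ideal0|exact: in_idealD|].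
    move=> j _; rewrite (wcompM _ _ (hom_t j)); case: ifP => _; last exact: in_ideal0.
    by apply: in_idealMr; apply: in_ideal_gen.
  rewrite raddf_sum /=; apply: sp_sum => i; rewrite linearZ /= wcompX.
  by apply: spZ; case: ifP => _; [apply: spb|].
rewrite (mpolyE x) big_seq; elim/big_ind: _ => // mu.
rewrite mcoeff_msupp => xmu; apply/spZ/spX.
by move/whomP: Hx; apply.
Qed.
End GradedBasis.

(** * Monomial ideals in a free presentation *)

Definition mideal (R : pzSemiRingType) (l : nat) (t : 'I_l -> R) (Z : pred 'I_l)
    (s : 'I_l -> nat) (x : R) := exists q : 'I_l -> R, x = \sum_(i | Z i) t i ^+ s i * q i.

Lemma mideal_supp (K : fieldType) l (Z : pred 'I_l) s (F : {mpoly K[l]}) :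
  mideal (fun i => 'X_i) Z s F <->
  forall mu, mu \in msupp F -> exists2 i, Z i & (s i <= mu i)%N.
Proof.
split=> [[q ->] mu|].
  rewrite mcoeff_msupp raddf_sum /= => nz.
  have [i Zi] : exists2 i, Z i & ('X_i ^+ s i * q i)@_mu != 0.
    apply: NNPP => H; case/eqP: nz; apply: big1 => i Zi; apply/eqP.
    by apply/negP => /negP Hi; apply: H; exists i.
  rewrite mpolyXn -mcoeff_msupp mulrC (perm_mem (msuppMX _ _)) => /mapP[nu _ ->].
  by exists i => //; rewrite mnmDE mulmnE mnm1E eqxx mul1n leq_addr.
move=> H; rewrite (mpolyE F) big_seq.
elim/big_ind: _ => [|x y [q ->] [r ->]|mu /H[i Zi le]].
- by exists (fun=> 0); rewrite big1 // => i _; rewrite mulr0.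
- by exists (fun i => q i + r i); rewrite -big_split; apply: eq_bigr => i _; rewrite mulrDr.
exists (fun j => if j == i then F@_mu *: 'X_[mu - U_(i) *+ s i] else 0).
rewrite (bigD1 i) //= eqxx big1 ?addr0 => [|j /andP[_ /negPf->]]; last by rewrite mulr0.
rewrite -scalerAr mpolyXn -mpolyXD addmC submK //.
apply/mnm_lepP => j; rewrite mulmnE mnm1E.
by have [<-|_] := eqVneq i j; rewrite ?mul1n ?mul0n.
Qed.

Section FreeModule.
Variables (K : fieldType) (m l : nat) (t : 'I_l -> {mpoly K[m]}) (I : finType).
Variable b : I -> {mpoly K[m]}.
Hypothesis span_b : forall x, exists F : I -> {mpoly K[l]}, x = \sum_i b i * (F i)^$ t.
Hypothesis free_b : forall F : I -> {mpoly K[l]}, \sum_i b i * (F i)^$ t = 0 -> forall i, F i = 0.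

Lemma free_inj (F G : I -> {mpoly K[l]}) :
  \sum_i b i * (F i)^$ t = \sum_i b i * (G i)^$ t -> forall i, F i = G i.
Proof.
move=> E i; apply/eqP; rewrite -subr_eq0; apply/eqP; move: i; apply: free_b.
under eq_bigr => i _ do rewrite comp_mpolyB mulrBr.
by rewrite sumrB E subrr.
Qed.

(** Freeness over the [t j] turns ideals generated by powers of the [t j] into monomial ideals of
    the coordinates, so that colon ideals and socles are read off exponents; this stands in for the
    theory of regular sequences. *)
Lemma mideal_coord (Z : pred 'I_l) s (F : I -> {mpoly K[l]}) :
  mideal t Z s (\sum_i b i * (F i)^$ t) <->
  forall i, mideal (fun i => 'X_i) Z s (F i).
Proof.
split=> [[q E] i|/fin_all_exists[q qE]].
  have [G GE] := fin_all_exists (fun j => span_b (q j)).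
  exists (fun j => G j i); move: i.
  apply: (free_inj (G := fun i => \sum_(j | Z j) 'X_j ^+ s j * G j i)).
  rewrite E; under eq_bigr => j _ do rewrite GE mulr_sumr.
  rewrite exchange_big /=; apply: eq_bigr => i _.
  rewrite raddf_sum /= mulr_sumr; apply: eq_bigr => j _.
  by rewrite rmorphM /= rmorphXn /= substXU mulrCA.
exists (fun j => \sum_i b i * (q i j)^$ t).
under [RHS]eq_bigr => j _ do rewrite mulr_sumr.
rewrite exchange_big /=; apply: eq_bigr => i _.
rewrite qE raddf_sum /= mulr_sumr; apply: eq_bigr => j _.
by rewrite rmorphM /= rmorphXn /= substXU mulrCA.
Qed.

Lemma coordM (mu : 'X_{1..l}) (F : I -> {mpoly K[l]}) :
  (\prod_j t j ^+ mu j) * (\sum_i b i * (F i)^$ t) = \sum_i b i * ('X_[mu] * F i)^$ t.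
Proof.
rewrite mulr_sumr; apply: eq_bigr => i _.
by rewrite rmorphM /= substX mulrCA.
Qed.

Lemma mideal_colon (Z : pred 'I_l) s (mu : 'X_{1..l}) x :
  mideal t Z s ((\prod_j t j ^+ mu j) * x) -> mideal t Z (fun i => s i - mu i)%N x.
Proof.
have [F ->] := span_b x; rewrite coordM => /mideal_coord H; apply/mideal_coord => i.
apply/mideal_supp => nu nu_F.
have /mideal_supp/(_ (mu + nu)%MM)[] := H i.
  by rewrite mulrC (perm_mem (msuppMX _ _)) map_f.
by move=> j Zj le; exists j; rewrite // leq_subLR -mnmDE.
Qed.

(** In coordinates: a monomial outside the ideal that each variable of [Z] carries into it has all
    its exponents on [Z] equal to Q - 1. *)
Lemma mideal_socle (Z : pred 'I_l) Q x : (0 < Q)%N ->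
  (forall j, Z j -> mideal t Z (fun=> Q) (t j * x)) ->
  exists y, mideal t Z (fun=> Q) (x - (\prod_(j | Z j) t j ^+ Q.-1) * y).
Proof.
move=> Q0; have [F ->] := span_b x => H.
pose mu0 : 'X_{1..l} := [multinom (if Z j then Q.-1 else 0)%N | j < l].
have prodE : \prod_(j | Z j) t j ^+ Q.-1 = \prod_j t j ^+ mu0 j.
  by rewrite big_mkcond; apply: eq_bigr => j _; rewrite mnmE; case: (Z j).
pose good (mu : 'X_{1..l}) := [forall j, Z j ==> (Q.-1 == mu j)].
pose G i := \sum_(mu <- msupp (F i) | good mu) (F i)@_mu *: 'X_[mu - mu0].
have GE i : 'X_[mu0] * G i = \sum_(mu <- msupp (F i) | good mu) (F i)@_mu *: 'X_[mu].
  rewrite mulr_sumr; apply: eq_bigr => mu /forall_inP gmu.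
  rewrite -scalerAr -mpolyXD addmC submK //; apply/mnm_lepP => j; rewrite mnmE.
  by case: ifP => // /gmu /eqP ->.
exists (\sum_i b i * (G i)^$ t); rewrite prodE coordM -sumrB.
rewrite (eq_bigr (fun i => b i * (F i - 'X_[mu0] * G i)^$ t)); last first.
  by move=> i _; rewrite comp_mpolyB mulrBr.
apply/mideal_coord => i; apply/mideal_supp => nu; rewrite GE mcoeff_msupp.
have -> : F i - \sum_(mu <- msupp (F i) | good mu) (F i)@_mu *: 'X_[mu] =
    \sum_(mu <- msupp (F i) | ~~ good mu) (F i)@_mu *: 'X_[mu].
  apply/eqP; rewrite subr_eq addrC; apply/eqP.
  by rewrite [LHS](mpolyE (F i)) (bigID good).
rewrite raddf_sum /= => nz.
have /andP[nu_F bad] : (nu \in msupp (F i)) && ~~ good nu.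
  apply: contraNT nz => nn; apply/eqP; rewrite big_seq_cond big1 // => mu mu_F.
  rewrite mcoeffZ mcoeffX; case: (mu =P nu) => [E|_]; last by rewrite mulr0.
  by rewrite -E mu_F in nn.
have /forall_inPn[j Zj ne] := bad.
have := H j Zj; rewrite mulr_sumr.
rewrite (eq_bigr (fun i => b i * ('X_j * F i)^$ t)) => [/mideal_coord/(_ i)/mideal_supp|k _]; last first.
  by rewrite rmorphM /= substXU mulrCA.
move/(_ (U_(j) + nu)%MM); rewrite mulrC (perm_mem (msuppMX _ _)) map_f // => /(_ isT)[k Zk le].
exists k => //; move: le; rewrite mnmDE mnm1E; case: eqP => [<-|//].
rewrite add1n leq_eqVlt => /orP[/eqP E|]; last by rewrite ltnS.
by case/eqP: ne; rewrite E.
Qed.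
End FreeModule.

Section Concat.
Variables (T : Type) (a b : nat) (r : 'I_a -> T) (h : 'I_b -> T).
Definition catf (i : 'I_(a + b)) := match split i with inl j => r j | inr k => h k end.
Lemma catfL i : catf (lshift b i) = r i.
Proof. by rewrite /catf (unsplitK (inl i)). Qed.
Lemma catfR i : catf (rshift a i) = h i.
Proof. by rewrite /catf (unsplitK (inr i)). Qed.
End Concat.

Lemma mideal_cat (R : pzSemiRingType) a b (r : 'I_a -> R) (h : 'I_b -> R) Z1 Z2 s1 s2 x :
  mideal (catf r h) (catf Z1 Z2) (catf s1 s2) x <-> exists q1 q2,
    x = \sum_(i | Z1 i) r i ^+ s1 i * q1 i + \sum_(i | Z2 i) h i ^+ s2 i * q2 i.
Proof.
have E q : \sum_(i | catf Z1 Z2 i) catf r h i ^+ catf s1 s2 i * q i =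
    \sum_(i | Z1 i) r i ^+ s1 i * q (lshift b i) + \sum_(i | Z2 i) h i ^+ s2 i * q (rshift a i).
  rewrite big_mkcond big_split_ord /= -!big_mkcond /=.
  by congr (_ + _); [apply: eq_big => i|apply: eq_big => i]; rewrite ?catfL ?catfR.
split=> [[q ->]|[q1 [q2 ->]]]; first by eexists; eexists; exact: E.
exists (catf q1 q2); rewrite E; congr (_ + _); apply: eq_bigr => i _; by rewrite ?catfL ?catfR.
Qed.

(** Taking the colon by a power of a parameter outside [Z] lowers no exponent of the ideal, so such
    a parameter is a nonzerodivisor modulo it. *)
Lemma mideal_colon1 (K : fieldType) (m l : nat) (t : 'I_l -> {mpoly K[m]}) (I : finType)
    (b : I -> {mpoly K[m]}) :
  (forall x, exists F : I -> {mpoly K[l]}, x = \sum_i b i * (F i)^$ t) ->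
  (forall F : I -> {mpoly K[l]}, \sum_i b i * (F i)^$ t = 0 -> forall i, F i = 0) ->
  forall Z s j k x, ~~ Z j -> mideal t Z s (t j ^+ k * x) -> mideal t Z s x.
Proof.
move=> sp fr Z s j k x Zj H.
have [|q ->] := @mideal_colon _ _ _ _ _ b sp fr Z s (U_(j) *+ k)%MM x.
  rewrite (bigD1 j) //= big1 ?mulr1 => [|i /negPf ij]; rewrite mulmnE mnm1E ?eqxx ?mul1n //.
  by rewrite eq_sym ij mul0n expr0.
exists q; apply: eq_bigr => i Zi; congr (_ ^+ _ * _).
by rewrite mulmnE mnm1E; case: eqP => [E|_]; rewrite ?mul0n ?subn0 //; rewrite E Zi in Zj.
Qed.

(** * The presentation of a subalgebra and its truncated extension *)

Section Pullback.
Variables (K : closedFieldType) (p : nat) (charK : p \in [pchar K]) (n m : nat).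
Variables (f : 'I_m -> {mpoly K[n]}) (ee : nat) (Q_gt0 : (0 < p ^ ee)%N).
Local Notation Q := (p ^ ee)%N.
Local Notation S := {mpoly K[n]}.
Local Notation P := {mpoly K[m]}.
Local Notation F := (fun i => f i ^+ Q).
Local Notation R := (talg Q_gt0 F).
Local Notation T := {ffun 'I_m -> 'I_Q}.

Let charS : p \in [pchar S]. Proof. exact: pchar_mpoly. Qed.

Definition tco (x : R) (a : T) : S := (x : {ffun T -> S}) a.
Definition tmon (s : S) (mu : 'X_{1..m}) : R := tscale s (tred Q_gt0 F 'X_[mu]).

Lemma tcoP (x y : R) : (forall a, tco x a = tco y a) -> x = y.
Proof. by move=> E; apply/ffunP. Qed.

Lemma tcoD x y a : tco (x + y) a = tco x a + tco y a. Proof. by rewrite /tco ffunE. Qed.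
Lemma tcoB x y a : tco (x - y) a = tco x a - tco y a. Proof. by rewrite /tco !ffunE. Qed.
Lemma tco0 a : tco 0 a = 0. Proof. by rewrite /tco ffunE. Qed.
Lemma tcoZ c x a : tco (c *: x) a = c *: tco x a. Proof. by rewrite /tco ffunE. Qed.
Lemma tco_sum (I : finType) (G : I -> R) a : tco (\sum_i G i) a = \sum_i tco (G i) a.
Proof. by rewrite /tco sum_ffunE. Qed.

Lemma tmonE s mu : tmon s mu = tred Q_gt0 F (s *: 'X_[mu]).
Proof. by rewrite tredZ. Qed.

Lemma tco_mon s mu a :
  tco (tmon s mu) a = if a == tmod Q_gt0 mu then s * tcarry Q F mu else 0.
Proof. by rewrite /tco /tmon tredX !ffunE; case: ifP; rewrite ?mulr0. Qed.

Lemma tco_box s a b : tco (tmon s (mbox b)) a = if a == b then s else 0.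
Proof. by rewrite tco_mon tmod_mbox tcarry_mbox mulr1. Qed.


Lemma tmonM s t mu nu : tmon s mu * tmon t nu = tmon (s * t) (mu + nu)%MM.
Proof.
rewrite !tmonE -(rmorphM (tred Q_gt0 F)).
congr (tred _ _ _).
rewrite -!mul_mpolyC rmorphM /=.
by rewrite mulrACA mpolyXD.
Qed.

Lemma tmon0M s x a : tco (tmon s 0%MM * x) a = s * tco x a.
Proof.
rewrite tmonE mpolyX0 -[x](tredK x) -(rmorphM (tred Q_gt0 F)) /= tredK -scalerAl mul1r tredZ tredK.
by rewrite /tco ffunE.
Qed.

Lemma tmonD s t mu : tmon (s + t) mu = tmon s mu + tmon t mu.
Proof. by rewrite !tmonE scalerDl raddfD. Qed.

Lemma talg_ind (Pr : R -> Prop) : Pr 0 ->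
  (forall s (a : T) x, Pr x -> Pr (tmon s (mbox a) + x)) -> forall x, Pr x.
Proof.
move=> P0 PS x; rewrite -[x]tredK /tlift raddf_sum /=.
elim/big_rec: _ => // a y _; rewrite -tmonE; exact: PS.
Qed.

Lemma talgE (x : R) : x = \sum_a tmon (tco x a) (mbox a).
Proof.
rewrite -[LHS]tredK /tlift raddf_sum /=; apply: eq_bigr => a _; exact/esym/tmonE.
Qed.

Lemma tco_sum_box (z : T -> S) a : tco (\sum_b tmon (z b) (mbox b)) a = z a.
Proof.
rewrite tco_sum (bigD1 a) //= big1 ?addr0 => [|b ba]; first by rewrite tco_box eqxx.
by rewrite tco_box eq_sym (negPf ba).
Qed.

(** The evaluation of Y_i at f_i. It respects products in the truncated ring because there Y_i^Q
    equals f_i^Q. *)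
Definition tphi (x : R) : S := (tlift x).@[f].

Lemma tphiE x : tphi x = \sum_a tco x a * \prod_i f i ^+ a i.
Proof.
rewrite /tphi /tlift raddf_sum /=; apply: eq_bigr => a _; rewrite mevalZ mevalX.
by congr (_ * _); apply: eq_bigr => i _; rewrite mnmE.
Qed.

Lemma tphi_red u : tphi (tred Q_gt0 F u) = u.@[f].
Proof.
elim/mpolyind: u => [|s mu u _ _ IH].
  by rewrite !raddf0 tphiE big1 // => a _; rewrite tco0 mul0r.
rewrite !raddfD /= -IH !tphiE -tmonE.
under eq_bigr => a _ do rewrite tcoD mulrDl.
rewrite big_split; congr (_ + _); rewrite /= (bigD1 (tmod Q_gt0 mu)) //= [X in _ + X]big1 ?addr0; last first.
  by move=> a /negPf aN; rewrite [X in X * _]tco_mon aN mul0r.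
rewrite [X in X * _]tco_mon eqxx mevalZ mevalX -mulrA; congr (_ * _).
rewrite -big_split; apply: eq_bigr => i _ /=; rewrite ffunE /= -exprM -exprD.
by congr (_ ^+ _); rewrite [RHS](divn_eq _ Q) mulnC.
Qed.

Fact tphi_additive : additive tphi.
Proof.
move=> x y; rewrite !tphiE -sumrB; apply: eq_bigr => a _; by rewrite tcoB mulrBl.
Qed.
Fact tphi_mult : monoid_morphism tphi.
Proof.
split; first by rewrite -[1]/(tred Q_gt0 F 1) tphi_red rmorph1.
by move=> x y; rewrite -[x]tredK -[y]tredK -(rmorphM (tred Q_gt0 F)) !tphi_red rmorphM.
Qed.
HB.instance Definition _ := GRing.isAdditive.Build R S tphi tphi_additive.
HB.instance Definition _ := GRing.isMonoidMorphism.Build R S tphi tphi_mult.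

Lemma tphiD x y : tphi (x + y) = tphi x + tphi y. Proof. exact: raddfD. Qed.
Lemma tphiZ c x : tphi (c *: x) = c *: tphi x.
Proof. by rewrite !tphiE scaler_sumr; apply: eq_bigr => a _; rewrite tcoZ scalerAl. Qed.

Lemma tphi_mon s mu : tphi (tmon s mu) = s * \prod_i f i ^+ mu i.
Proof. by rewrite tmonE tphi_red mevalZ mevalX. Qed.

Definition tiota (x : P) : R := tred Q_gt0 F (map_mpoly (mpolyC n (R := K)) x).
Fact tiota_additive : additive tiota.
Proof. by move=> x y; rewrite /tiota !raddfB. Qed.
Fact tiota_mult : monoid_morphism tiota.
Proof. by split=> [|x y]; rewrite /tiota ?rmorph1 ?rmorphM. Qed.
HB.instance Definition _ := GRing.isAdditive.Build P R tiota tiota_additive.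
HB.instance Definition _ := GRing.isMonoidMorphism.Build P R tiota tiota_mult.

Lemma tiotaD x y : tiota (x + y) = tiota x + tiota y. Proof. exact: raddfD. Qed.
Lemma tiotaM x y : tiota (x * y) = tiota x * tiota y. Proof. exact: rmorphM. Qed.
Lemma tiotaXn x k : tiota (x ^+ k) = tiota x ^+ k. Proof. exact: rmorphXn. Qed.
Lemma tiota_mon c mu : tiota (c *: 'X_[mu]) = tmon c%:MP mu.
Proof. by rewrite /tiota map_mpolyZ map_mpolyX tmonE. Qed.

Lemma tiotaZ c x : tiota (c *: x) = c *: tiota x.
Proof.
rewrite /tiota map_mpolyZ tredZ; apply: tcoP => a; rewrite tcoZ /tco ffunE.
by rewrite mul_mpolyC.
Qed.

Local Opaque tphi tiota tmon tred.

Lemma tphi_iota x : tphi (tiota x) = x^$ f.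
Proof.
elim/mpolyind: x => [|c mu x _ _ IH]; first by rewrite !raddf0.
rewrite tiotaD tphiD [RHS]comp_mpolyD; congr (_ + _); last exact: IH.
rewrite tiota_mon tphi_mon [RHS]comp_mpolyZ substX.
exact: mul_mpolyC.
Qed.

(** Frobenius is additive and Y_i^Q equals f_i^Q in the truncated ring, so the Q-th power of a
    polynomial in Y is a scalar. *)
Lemma tiota_expQ x : tiota x ^+ Q = tmon ((x^$ f) ^+ Q) 0%MM.
Proof.
rewrite -tiotaXn; elim/mpolyind: x => [|c mu x _ _ IH].
  rewrite !raddf0 expr0n expr0n gtn_eqF //= raddf0.
  by apply: tcoP => a; rewrite tco0 tco_mon mul0r if_same.
rewrite pchar_expD; last exact: pchar_mpoly.
rewrite tiotaD comp_mpolyD [in RHS]pchar_expD // tmonD; congr (_ + _); last exact: IH.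
rewrite exprZn mpolyXn tiota_mon comp_mpolyZ substX exprZn -mul_mpolyC -prodrXl; apply: tcoP => a; rewrite !tco_mon.
have -> : tmod Q_gt0 (mu *+ Q) = tmod Q_gt0 (0%MM : 'X_{1..m}).
  by apply/ffunP => i; apply/val_inj; rewrite !ffunE /= mulmnE mnm0E modnMl mod0n.
case: ifP => // _; rewrite /tcarry [X in _ = _ * X]big1 ?mulr1 => [|i _]; last by rewrite mnm0E div0n.
congr (_ * _); apply: eq_bigr => i _; rewrite mulmnE mulnK // -!exprM; congr (_ ^+ _).
exact: mulnC.
Qed.

Lemma tco_iota (u : T -> P) a :
  tco (tiota (\sum_a 'X_[mbox a] * u a ^+ Q)) a = ((u a)^$ f) ^+ Q.
Proof.
rewrite raddf_sum /= tco_sum (bigD1 a) //= big1 ?addr0; last first.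
  move=> b ba; rewrite tiotaM tiotaXn tiota_expQ mulrC tmon0M -[X in tiota X]scale1r.
  by rewrite tiota_mon tco_box eq_sym (negPf ba) mulr0.
rewrite tiotaM tiotaXn tiota_expQ mulrC tmon0M -[X in tiota X]scale1r.
by rewrite tiota_mon tco_box eqxx mulr1.
Qed.

Definition imf (s : S) := exists x : P, s = x^$ f.
Definition PQ (x : R) := exists y, x = tiota y.

(** [frob_split_ex] writes a polynomial through box monomials and Q-th powers, and [tiota_expQ]
    evaluates the latter; the image of P is thus the Frobenius twist of [A]. *)
Lemma PQE x : PQ x <-> forall a, exists2 s, imf s & tco x a = s ^+ Q.
Proof.
split=> [[y ->] a|].
  have [u ->] := frob_split_ex charK ee y.
  by rewrite tco_iota; exists ((u a)^$ f) => //; exists (u a).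
move=> H; have uP a : exists u : P, tco x a = (u^$ f) ^+ Q.
  by have [s [u ->] E] := H a; exists u.
have [u uE] := fin_all_exists uP.
by exists (\sum_a 'X_[mbox a] * u a ^+ Q); apply: tcoP => a; rewrite tco_iota.
Qed.

Lemma PQ_mon x y : PQ x -> exists u : T -> P,
  x * y = \sum_a tmon (((u a)^$ f) ^+ Q) (mbox a) * y.
Proof.
move=> /PQE H; have uP a : exists u : P, tco x a = (u^$ f) ^+ Q.
  by have [s [u ->] E] := H a; exists u.
have [u uE] := fin_all_exists uP.
by exists u; rewrite {1}(talgE x) mulr_suml; apply: eq_bigr => a _; rewrite uE.
Qed.

Section Coordinatewise.
Variable t : {additive S -> S}.
Definition tmap (x : R) : R := [ffun a => t (tco x a)].
Lemma tco_map x a : tco (tmap x) a = t (tco x a). Proof. by rewrite /tco ffunE. Qed.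
Fact tmap_additive : additive tmap.
Proof. by move=> x y; apply: tcoP => a; rewrite tcoB !tco_map tcoB raddfB. Qed.
HB.instance Definition _ := GRing.isAdditive.Build R R tmap tmap_additive.
Lemma tmapD x y : tmap (x + y) = tmap x + tmap y. Proof. exact: raddfD. Qed.

Lemma tmap_mon s mu : (forall x, t (tcarry Q F mu * x) = tcarry Q F mu * t x) ->
  tmap (tmon s mu) = tmon (t s) mu.
Proof.
move=> H; apply: tcoP => a; rewrite tco_map !tco_mon; case: ifP => _; last exact: raddf0.
by rewrite mulrC H mulrC.
Qed.

Hypothesis t_lin : forall s x, imf s -> t (s * x) = s * t x.

Lemma imf_carry mu : imf (tcarry Q F mu).
Proof.
exists 'X_[[multinom (Q * (mu i %/ Q))%N | i < m]]; rewrite substX.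
by apply: eq_bigr => i _; rewrite mnmE exprM.
Qed.

(** Multiplication by a monomial permutes the box coordinates up to carries, which lie in [A];
    linearity of [t] over [A] therefore suffices. *)
Lemma tmap_lin x y : PQ x -> tmap (x * y) = x * tmap y.
Proof.
elim/talg_ind: y => [|s b y IH] Px; first by rewrite raddf0 !mulr0 raddf0.
rewrite mulrDr !tmapD [RHS]mulrDr; congr (_ + _); last exact: IH.
have [y0 ->] := Px; elim/mpolyind: y0 => [|c mu y0 _ _ IHy]; first by rewrite raddf0 !mul0r raddf0.
rewrite tiotaD !mulrDl tmapD; congr (_ + _); last exact: IHy.
rewrite tiota_mon tmonM !tmap_mon; try by move=> z; apply/t_lin/imf_carry.
by rewrite tmonM t_lin //; exists c%:MP; rewrite comp_mpolyC.
Qed.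
End Coordinatewise.

Section Graded.
Variables (w : 'I_m -> nat).
Hypothesis hom_f : forall i, whom (fun=> 1%N) (w i) (f i).
Local Notation wc := (wcomp (fun=> 1%N)).
Local Notation sh := (whom (fun=> 1%N)).

(** The variable Y_i has weight [w i], the degree of f_i, so that the relations Y_i^Q = f_i^Q are
    homogeneous. *)
Definition tcomp (d : nat) (x : R) : R :=
  [ffun a : T => if (wdeg w (mbox a) <= d)%N then wc (d - wdeg w (mbox a))%N (tco x a) else 0].
Lemma tco_comp d x (a : T) : tco (tcomp d x) a =
  if (wdeg w (mbox a) <= d)%N then wc (d - wdeg w (mbox a))%N (tco x a) else 0.
Proof. by rewrite /tco ffunE. Qed.
Fact tcomp_additive d : additive (tcomp d).
Proof.
move=> x y; apply: tcoP => a; rewrite tcoB !tco_comp tcoB; case: ifP; rewrite ?subrr //.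
by rewrite raddfB.
Qed.
HB.instance Definition _ d := GRing.isAdditive.Build R R (tcomp d) (@tcomp_additive d).
Lemma tcompD d x y : tcomp d (x + y) = tcomp d x + tcomp d y. Proof. exact: raddfD. Qed.

Lemma tcomp_idem d x : tcomp d (tcomp d x) = tcomp d x.
Proof.
by apply: tcoP => a; rewrite !tco_comp; case: (_ <= _)%N; rewrite // wcomp_idem.
Qed.

Lemma tcompZ d c x : tcomp d (c *: x) = c *: tcomp d x.
Proof.
apply: tcoP => a; rewrite tcoZ !tco_comp tcoZ; case: ifP; rewrite ?scaler0 //.
by rewrite linearZ.
Qed.

Lemma hom_carry mu : exists2 D, sh D (tcarry Q F mu) & wdeg w mu = (D + wdeg w (mbox (tmod Q_gt0 mu)))%N.
Proof.
exists (\sum_i w i * Q * (mu i %/ Q))%N.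
  by apply: whom_prod => i _; apply: whomXn; apply: whomXn.
rewrite /wdeg -big_split; apply: eq_bigr => i _ /=; rewrite mnmE ffunE /=.
by rewrite {1}(divn_eq (mu i) Q) mulnDr; congr (_ + _)%N; rewrite mulnAC mulnA.
Qed.

Lemma tcomp_mon d s mu : tcomp d (tmon s mu) =
  if (wdeg w mu <= d)%N then tmon (wc (d - wdeg w mu)%N s) mu else 0.
Proof.
have [D hD ->] := hom_carry mu.
apply: tcoP => a; rewrite (fun_if (fun x => tco x a)) tco0 tco_comp !tco_mon.
case: (a =P _) => [->|_]; last by rewrite raddf0 !if_same.
rewrite mulrC (wcompM _ _ hD) -subnDA addnC.
case: (leqP _ d) => le1; last by case: leqP => // le2; move: le1 le2; lia.
by case: (leqP (_ + _)) => le2; case: (leqP D) => le3; rewrite // 1?mulrC //; move: le1 le2 le3; lia.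
Qed.

Lemma tcompM d d' x y : tcomp d' x = x ->
  tcomp d (x * y) = if (d' <= d)%N then x * tcomp (d - d') y else 0.
Proof.
move=> hx; have E a : tco x a = if (wdeg w (mbox a) <= d')%N
    then wc (d' - wdeg w (mbox a))%N (tco x a) else 0.
  by rewrite -tco_comp hx.
rewrite (talgE x) !mulr_suml raddf_sum /=.
rewrite [RHS](_ : _ = \sum_a if (d' <= d)%N then tmon (tco x a) (mbox a) * tcomp (d - d') y else 0);
  last by case: leqP => // _; rewrite big1.
apply: eq_bigr => a _; have := E a; have t0 mu : tmon 0 mu = 0.
  by apply: tcoP => b; rewrite tco_mon mul0r if_same tco0.
case: leqP => [le hE|_ ->]; last by rewrite t0 !mul0r raddf0 if_same.
have {}hE : sh (d' - wdeg w (mbox a))%N (tco x a) by rewrite /whom -hE.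
elim/talg_ind: y => [|s b y IH]; first by rewrite !mulr0 !raddf0 !mulr0 if_same.
rewrite mulrDr !tcompD.
rewrite [RHS](_ : _ = (if (d' <= d)%N then tmon (tco x a) (mbox a) * tcomp (d - d') (tmon s (mbox b)) else 0)
  + (if (d' <= d)%N then tmon (tco x a) (mbox a) * tcomp (d - d') y else 0)); last first.
  by case: (d' <= d)%N; [exact: mulrDr|exact/esym/addr0].
congr (_ + _); last exact: IH.
clear E IH; set wa := wdeg w (mbox a) in le hE *; rewrite tmonM !tcomp_mon wdegD -/wa (wcompM _ _ hE).
set wb := wdeg w (mbox b).
case: (leqP d' d) => ld; last by case: leqP => // l1; case: leqP => l2; [move: le ld l1 l2; clear; lia|];
  apply: tcoP => c; rewrite tco_mon mul0r if_same tco0.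
rewrite (fun_if (fun z => tmon (tco x a) (mbox a) * z)) tmonM mulr0.
case: (leqP _ d) => l1; last by case: leqP => // l2; move: le ld l1 l2; clear; lia.
case: (leqP wb (d - d')) => l2; case: leqP => l3;
  try by move: le ld l1 l2 l3; clear; lia.
- by congr (tmon (_ * wc _ _) _); move: le ld l1 l2 l3; clear; lia.
- by apply: tcoP => c; rewrite tco_mon mul0r if_same tco0.
Qed.

Lemma tphi_comp d x : tphi (tcomp d x) = wc d (tphi x).
Proof.
elim/talg_ind: x => [|s a x IH]; first by rewrite !raddf0.
rewrite tcompD !tphiD raddfD /=; congr (_ + _); last exact: IH.
rewrite tcomp_mon.
rewrite (fun_if tphi) raddf0 !tphi_mon [in RHS]mulrC.
have hP : sh (wdeg w (mbox a)) (\prod_i f i ^+ mbox a i).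
  by apply: whom_prod => i _; apply: whomXn.
rewrite (wcompM _ _ hP).
by case: ifP; rewrite // mulrC.
Qed.

Lemma tiota_hom d x : whom w d x -> tcomp d (tiota x) = tiota x.
Proof.
move/whomP => Hx; rewrite (mpolyE x) !raddf_sum /= big_seq [RHS]big_seq.
apply: eq_bigr => mu; rewrite mcoeff_msupp => /Hx E; rewrite tiota_mon tcomp_mon E leqnn subnn.
by rewrite whomC.
Qed.
End Graded.
End Pullback.

Section ImageAlgebra.
Variables (K : closedFieldType) (n m : nat) (f : 'I_m -> {mpoly K[n]}).
Local Notation S := {mpoly K[n]}.
Local Notation P := {mpoly K[m]}.
Local Notation A := (imf f).

Lemma imf0 : A 0. Proof. by exists 0; rewrite raddf0. Qed.
Lemma imf1 : A 1. Proof. by exists 1; rewrite rmorph1. Qed.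
Lemma imfB x y : A x -> A y -> A (x - y).
Proof. by move=> [u ->] [v ->]; exists (u - v); rewrite raddfB. Qed.
Lemma imfM x y : A x -> A y -> A (x * y).
Proof. by move=> [u ->] [v ->]; exists (u * v); rewrite rmorphM. Qed.
Lemma imfZ a x : A x -> A (a *: x).
Proof. by move=> [u ->]; exists (a *: u); rewrite comp_mpolyZ. Qed.
Lemma imf_subst (x : P) : A (x^$ f). Proof. by exists x. Qed.
Lemma imfD x y : A x -> A y -> A (x + y).
Proof. by move=> [u ->] [v ->]; exists (u + v); rewrite raddfD. Qed.
Lemma imf_sum (J : finType) (Z : pred J) (F : J -> S) : (forall i, A (F i)) -> A (\sum_(i | Z i) F i).
Proof.
by move=> HF; elim/big_ind: _ => //; [exact: imf0|exact: imfD].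
Qed.

End ImageAlgebra.

(** * Regularity of parameters in the image algebra *)

Section Presentation.
Variables (K : closedFieldType) (p : nat) (charK : p \in [pchar K]) (n m c : nat).
Local Notation N := (3 + n)%N.
Local Notation S := {mpoly K[N]}.
Local Notation P := {mpoly K[m]}.
Variables (f : 'I_m -> S) (r : 'I_c -> P) (h : 'I_N -> P).
Let g k := (h k)^$ f.
Let t := catf r h.
Local Notation A := (imf f).
Variables (I : finType) (b : I -> P).
Hypothesis span_b : forall x, exists F : I -> {mpoly K[c + N]}, x = \sum_i b i * (F i)^$ t.
Hypothesis free_b : forall F : I -> {mpoly K[c + N]}, \sum_i b i * (F i)^$ t = 0 -> forall i, F i = 0.
Variables (I' : finType) (b' : I' -> S).
Hypothesis span_b' : forall x, exists F : I' -> {mpoly K[N]}, x = \sum_i b' i * (F i)^$ g.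
Hypothesis free_b' : forall F : I' -> {mpoly K[N]}, \sum_i b' i * (F i)^$ g = 0 -> forall i, F i = 0.
Hypothesis ker_f : forall x : P, x^$ f = 0 <-> in_ideal r x.

(** Identifies A/(g^s) with P/(r, h^s), which moves questions about parameters of [A] to the free
    module P. *)
Lemma imf_mideal Z s (x : P) :
  (exists q, (forall k, A (q k)) /\ x^$ f = \sum_(k | Z k) g k ^+ s k * q k) <->
  mideal t (catf xpredT Z) (catf (fun=> 1%N) s) x.
Proof.
rewrite mideal_cat; split=> [[q [Aq E]]|[q1 [q2 ->]]].
  have [q2 q2E] := fin_all_exists Aq.
  have /ker_f[q1 q1E] : (x - \sum_(k | Z k) h k ^+ s k * q2 k)^$ f = 0.
    rewrite comp_mpolyB E [X in _ - X](_ : _ = \sum_(k | Z k) g k ^+ s k * q k) ?subrr //.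
    by rewrite raddf_sum; apply: eq_bigr => k _; rewrite /= rmorphM /= rmorphXn /= q2E.
  exists q1, q2; apply/eqP; rewrite -subr_eq q1E; apply/eqP.
  by apply: eq_bigr => i _; rewrite expr1.
exists (fun k => (q2 k)^$ f); split=> [k|]; first exact: imf_subst.
rewrite comp_mpolyD [X in X + _](_ : _ = 0) ?add0r; last first.
  by apply/ker_f; exists q1; apply: eq_bigr => i _; rewrite expr1.
rewrite raddf_sum; apply: eq_bigr => k _.
by rewrite /= rmorphM /= rmorphXn.
Qed.

Lemma imf_colon Z s j k x : A x -> ~~ Z j ->
  (exists q, (forall k, A (q k)) /\ g j ^+ k * x = \sum_(i | Z i) g i ^+ s i * q i) ->
  exists q, (forall k, A (q k)) /\ x = \sum_(i | Z i) g i ^+ s i * q i.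
Proof.
move=> [y ->] Zj [q [Aq E]]; apply/imf_mideal.
have Zj' : ~~ catf xpredT Z (rshift c j) by rewrite catfR.
apply: (mideal_colon1 span_b free_b (j := rshift c j) (k := k) Zj').
rewrite /t catfR -/t; apply/imf_mideal; exists q; split=> //.
by rewrite -E rmorphM rmorphXn.
Qed.

Lemma imf_colon1 j a k s x y : j != a -> A x -> A y -> g j ^+ k * x = g a ^+ s * y ->
  exists2 z, A z & x = g a ^+ s * z.
Proof.
move=> ja Ax Ay E.
have [|q [Aq]] := @imf_colon (pred1 a) (fun=> s) j k x Ax ja.
  by exists (fun=> y); split=> //; rewrite big_pred1_eq.
by rewrite big_pred1_eq; exists (q a).
Qed.

Lemma imf_colon2 j a a' k s s' x y z : j != a -> j != a' -> a != a' -> A x -> A y -> A z ->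
  g j ^+ k * x = g a ^+ s * y + g a' ^+ s' * z ->
  exists y' z', [/\ A y', A z' & x = g a ^+ s * y' + g a' ^+ s' * z'].
Proof.
move=> ja ja' aa' Ax Ay Az E.
have sumE (F : 'I_N -> S) : \sum_(i | pred2 a a' i) F i = F a + F a'.
  rewrite (bigD1 a) /= ?eqxx //=; congr (_ + _); rewrite (big_pred1 a') // => i /=.
  by case: (eqVneq i a) => [->|]; rewrite ?(negPf aa') ?andbF ?andbT.
pose ss i := if i == a then s else s'.
have [||q [Aq]] := @imf_colon (pred2 a a') ss j k x Ax.
- by rewrite /= negb_or ja ja'.
- exists (fun i => if i == a then y else z); split=> [i|]; first by case: eqP.
  by rewrite sumE /ss eqxx [a' == a]eq_sym (negPf aa').
rewrite sumE /ss eqxx [a' == a]eq_sym (negPf aa') => ->.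
by exists (q a), (q a').
Qed.

Lemma par_colon1 j a k s x y : j != a -> g j ^+ k * x = g a ^+ s * y ->
  exists z, x = g a ^+ s * z.
Proof.
move=> ja E.
have [|q] := mideal_colon1 span_b' free_b' (Z := pred1 a) (s := fun=> s) (j := j) (k := k) (x := x) ja.
  by exists (fun=> y); rewrite big_pred1_eq.
by rewrite big_pred1_eq; exists (q a).
Qed.

Lemma par_reg k x : g k * x = 0 -> x = 0.
Proof.
move=> E.
have [|q] := mideal_colon1 span_b' free_b' (Z := pred0) (s := fun=> 0%N) (j := k) (k := 1%N) (x := x) isT.
  by exists (fun=> 0); rewrite big_pred0_eq expr1 E.
by rewrite big_pred0_eq.
Qed.

(** Both products with g_j^k and g_a^s lie in [A] and satisfy the obvious relation, so regularity
    divides by g_a^s inside [A]. This is depth two of [A]. *)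
Lemma imf_sat j a k s z : j != a -> A (g j ^+ k * z) -> A (g a ^+ s * z) -> A z.
Proof.
move=> ja H1 H2; have [|y Ay] := imf_colon1 (k := k) (s := s) ja H2 H1.
  by rewrite mulrCA.
have ga0 : g a != 0.
  apply/eqP => E; have := @par_reg a 1; rewrite E mul0r => /(_ erefl)/eqP.
  by rewrite oner_eq0.
by move/(mulfI (expf_neq0 s ga0)) => ->.
Qed.

(** Exactness of the Koszul complex of three regular elements, by two successive divisions in [A]
    and a cancellation of [G 1 ^+ Q] in the ambient ring. *)
Lemma imf_koszul (G : 'I_3 -> S) Q x y z : (forall k, G k = g (lshift n k)) ->
  A x -> A y -> A z ->
  G 2 ^+ Q * x + G 0 ^+ Q * y + G 1 ^+ Q * z = 0 ->
  exists a : 'I_3 -> S, (forall k, A (a k)) /\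
   [/\ x = G 1 ^+ Q * a 0 - G 0 ^+ Q * a 1, y = G 2 ^+ Q * a 1 - G 1 ^+ Q * a 2 &
       z = G 0 ^+ Q * a 2 - G 2 ^+ Q * a 0].
Proof.
move=> GE; rewrite !GE; set G0 := g (lshift n 0); set G1 := g (lshift n 1); set G2 := g (lshift n 2).
move=> Ax Ay Az E.
have AN u : A u -> A (- u) by move=> Au; rewrite -[- u]sub0r; apply: imfB => //; exact: imf0.
have AG k : A (g k) by apply: imf_subst.
have AGX k s : A (g k ^+ s) by rewrite /g -rmorphXn; apply: imf_subst.
have reg k s u : g k ^+ s * u = 0 -> u = 0.
  elim: s => [|s IH]; rewrite ?expr0 ?mul1r // exprS -mulrA.
  by move/par_reg; exact: IH.
have [|||||||a0 [a1 [A0 A1 xE]]] := @imf_colon2 (lshift n 2) (lshift n 1) (lshift n 0) Q Q Q x (- z) (- y).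
- by rewrite eq_lshift. - by rewrite eq_lshift. - by rewrite eq_lshift. - by []. - exact: AN. - exact: AN.
- by apply/eqP; rewrite -subr_eq0 -E; apply/eqP; rewrite -/G0 -/G1 -/G2; move: (G0 ^+ Q) (G1 ^+ Q) (G2 ^+ Q) => u0 u1 u2; ring.
rewrite -/G1 -/G0 in xE.
have E2 : G0 ^+ Q * (y + G2 ^+ Q * a1) = G1 ^+ Q * (- (z + G2 ^+ Q * a0)).
  by apply/eqP; rewrite -subr_eq0 -E xE; apply/eqP; move: (G0 ^+ Q) (G1 ^+ Q) (G2 ^+ Q) => u0 u1 u2; ring.
have [||||a2 A2 yE] := @imf_colon1 (lshift n 0) (lshift n 1) Q Q (y + G2 ^+ Q * a1) (- (z + G2 ^+ Q * a0)).
- by rewrite eq_lshift.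
- by rewrite -[_ * _]opprK; apply: imfB => //; apply/AN/imfM => //; exact: AGX.
- by apply: (AN); rewrite -[_ * a0]opprK; apply: imfB => //; apply/AN/imfM => //; exact: AGX.
- exact: E2.
exists (fun k => if k == 0 then a0 else if k == 1 then - a1 else - a2); split.
  by move=> k; case: ifP => // _; case: ifP => _; apply: AN.
rewrite /=; split; first by rewrite xE; ring.
  by rewrite -[y](addrK (G2 ^+ Q * a1)) yE -/G1; ring.
suff E3 : z + G2 ^+ Q * a0 + G0 ^+ Q * a2 = 0.
  by apply/eqP; rewrite -subr_eq0 -[X in _ == X]E3; apply/eqP; ring.
apply: (reg (lshift n 1) Q); rewrite -/G1.
have -> : G1 ^+ Q * (z + G2 ^+ Q * a0 + G0 ^+ Q * a2) =
  G0 ^+ Q * (G1 ^+ Q * a2) - G1 ^+ Q * (- (z + G2 ^+ Q * a0)).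
  by move: (G0 ^+ Q) (G1 ^+ Q) (G2 ^+ Q) => u0 u1 u2; ring.
by rewrite -E2 yE subrr.
Qed.

Lemma imf_reg3 (G : 'I_3 -> S) Q x y z : (forall k, G k = g (lshift n k)) ->
  A x -> A y -> A z ->
  G 2 ^+ Q * x - G 1 ^+ Q * y = G 0 * z ->
  exists a a', [/\ A a, A a' & x = G 1 ^+ Q * a + G 0 * a'].
Proof.
move=> GE; rewrite !GE; set G0 := g (lshift n 0); set G1 := g (lshift n 1); set G2 := g (lshift n 2).
move=> Ax Ay Az E.
have [|||||||a0 [a1 [A0 A1]]] := @imf_colon2 (lshift n 2) (lshift n 1) (lshift n 0) Q Q 1 x y z; rewrite ?expr1; try by rewrite eq_lshift.
- by [].
- by [].
- by [].
- by rewrite -/G0 -E addrC subrK.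
by exists a0, a1.
Qed.

End Presentation.

(** * Counting in the pullback *)

Section PullbackCount.
Variables (K : closedFieldType) (p : nat) (charK : p \in [pchar K]) (n m c : nat).
Local Notation N := (3 + n)%N.
Local Notation S := {mpoly K[N]}.
Local Notation P := {mpoly K[m]}.
Variables (f : 'I_m -> S) (r : 'I_c -> P) (h : 'I_N -> P).
Let g k := (h k)^$ f.
Let t := catf r h.
Local Notation A := (imf f).
Variables (I : finType) (b : I -> P).
Hypothesis span_b : forall x, exists F : I -> {mpoly K[c + N]}, x = \sum_i b i * (F i)^$ t.
Hypothesis free_b : forall F : I -> {mpoly K[c + N]}, \sum_i b i * (F i)^$ t = 0 -> forall i, F i = 0.
Variables (I' : finType) (b' : I' -> S).
Hypothesis span_b' : forall x, exists F : I' -> {mpoly K[N]}, x = \sum_i b' i * (F i)^$ g.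
Hypothesis free_b' : forall F : I' -> {mpoly K[N]}, \sum_i b' i * (F i)^$ g = 0 -> forall i, F i = 0.
Hypothesis ker_f : forall x : P, x^$ f = 0 <-> in_ideal r x.
Variables (w : 'I_m -> nat) (e : 'I_c -> nat) (gam : nat).
Local Notation wc := (wcomp (fun=> 1%N)).
Local Notation sh := (whom (fun=> 1%N)).
Hypothesis hom_f : forall i, sh (w i) (f i).
Hypothesis hom_r : forall i, whom w (e i) (r i).
Hypothesis hom_h : forall k, whom w gam (h k).

Variable B : S -> Prop.
Hypothesis BB : forall x y, B x -> B y -> B (x - y).
Hypothesis BM : forall x y, B x -> B y -> B (x * y).
Hypothesis AB : forall x, A x -> B x.
Hypothesis Bwc : forall d x, B x -> B (wc d x).
Hypothesis Bsat : forall i j z, B (g (lshift n 1) ^+ i * z) -> B (g (lshift n 0) ^+ j * z) -> B z.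

Variables (TR : {additive S -> S}) (J : finType) (xx yy : 'I_3 -> J -> S) (tau : J -> nat).
Hypothesis TRZ : forall a x, TR (a *: x) = a *: TR x.
Hypothesis TRA : forall a x, A a -> TR (a * x) = a * TR x.
Hypothesis TRX : forall q x, TR (x ^+ (p ^ q)) = TR x ^+ (p ^ q).
Hypothesis TRwc : forall d x, TR (wc d x) = wc d (TR x).
Hypothesis TR_A : forall q k j x, B x -> A (TR (yy k j ^+ (p ^ q) * x)).
Hypothesis TR_K : forall q k x, B x ->
  \sum_j xx k j ^+ (p ^ q) * TR (yy k j ^+ (p ^ q) * x) = g (lshift n k) ^+ (p ^ q) * x.
Hypothesis xx_B : forall k j, B (xx k j).
Hypothesis yy_hom : forall j, sh (tau j) (yy 1 j).

Local Opaque expn expn_rec GRing.exp comp_mpoly tmon tiota tphi tmap.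
Variable ee : nat.
Local Notation Q := (p ^ ee)%N.
Let Q_gt0 : (0 < Q)%N.
Proof. by rewrite expn_gt0 prime_gt0 ?(pcharf_prime charK). Qed.
Local Notation F := (fun i => f i ^+ Q).
Local Notation R := (talg Q_gt0 F).
Local Notation T := {ffun 'I_m -> 'I_Q}.
Let iota : {rmorphism P -> R} := @tiota K p _ m f ee Q_gt0.
Let phi : {rmorphism R -> S} := @tphi K p _ m f ee Q_gt0.
Local Notation tmon := (@tmon K p N m f ee Q_gt0).
Let charS : p \in [pchar S]. Proof. exact: pchar_mpoly. Qed.
Let charP : p \in [pchar P]. Proof. exact: pchar_mpoly. Qed.

Definition trmul (y x : S) : S := TR (y * x).
Fact trmul_additive y : additive (trmul y).
Proof. by move=> u v; rewrite /trmul mulrBr raddfB. Qed.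
HB.instance Definition _ y := GRing.isAdditive.Build S S (trmul y) (trmul_additive y).

Let rR i := iota (r i).
Let hR (k : 'I_3) := iota (h (lshift n k)).
Let PQ' : R -> Prop := @PQ K p N m f ee Q_gt0.
(** The Frobenius twist of [B], in the form that [PQE] gives to the twist of [A]. *)
Let KK (x : R) := forall a, exists2 s, B s & tco x a = s ^+ Q.
Let al k j : {additive R -> R} := tmap (trmul (yy k j ^+ Q)).
Let X k j : R := tmon (xx k j ^+ Q) 0%MM.
Let tr k j : {additive S -> S} := trmul (yy k j).
Let cR d : {additive R -> R} := tcomp w d.
Let cS d : {additive S -> S} := wc d.
Let rho := \prod_i rR i ^+ Q.-1.

Let preg k x : g k * x = 0 -> x = 0.
Proof. exact: (par_reg span_b' free_b'). Qed.
Let g_neq0 k : g k != 0.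
Proof. by apply/eqP => E; have := @preg k 1; rewrite E mul0r => /(_ erefl)/eqP; rewrite oner_eq0. Qed.

Let B0 : B 0. Proof. exact/AB/imf0. Qed.
Let BD x y : B x -> B y -> B (x + y).
Proof. by move=> Hx Hy; rewrite -[y]opprK -[- y]sub0r; apply: BB => //; apply: BB. Qed.
Let B_sum (J' : finType) (G : J' -> S) : (forall i, B (G i)) -> B (\sum_i G i).
Proof. by move=> HG; elim/big_ind: _ => // *; apply: BD. Qed.
Let BX x k : B x -> B (x ^+ k).
Proof. by move=> Hx; elim: k => [|k IH]; rewrite ?expr0 ?exprS; [exact/AB/imf1|exact: BM]. Qed.

Let iotaM x y : iota (x * y) = iota x * iota y. Proof. exact: tiotaM. Qed.
Let iotaXn x k : iota (x ^+ k) = iota x ^+ k. Proof. exact: tiotaXn. Qed.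
Let iota_expQ x : iota x ^+ Q = tmon ((x^$ f) ^+ Q) 0%MM. Proof. exact: (tiota_expQ charK). Qed.

Let KK0 : KK 0.
Proof. by move=> a; exists 0 => //; rewrite tco0 expr0n gtn_eqF. Qed.

Let KKB x y : KK x -> KK y -> KK (x - y).
Proof.
move=> Hx Hy a; have [s Bs E] := Hx a; have [s' Bs' E'] := Hy a.
by exists (s - s'); [exact: BB|rewrite tcoB E E' pchar_expB].
Qed.

Let KK_D x y : KK x -> KK y -> KK (x + y).
Proof.
move=> Hx Hy a; have [s Bs E] := Hx a; have [s' Bs' E'] := Hy a.
by exists (s + s'); [exact: BD|rewrite tcoD E E' pchar_expD].
Qed.

Let KK_mon s mu : B s -> KK (tmon (s ^+ Q) mu).
Proof.
move=> Bs a; rewrite tco_mon; case: eqP => _; last by exists 0; rewrite // expr0n gtn_eqF.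
exists (s * \prod_i f i ^+ (mu i %/ Q)).
  apply: BM => //; apply: AB; exists 'X_[[multinom (mu i %/ Q)%N | i < m]]; rewrite substX.
  by apply: eq_bigr => i _; rewrite mnmE.
rewrite exprMn -prodrXl; congr (_ * _); apply: eq_bigr => i _.
by rewrite -!exprM mulnC.
Qed.

Let KKM x y : PQ' x -> KK y -> KK (x * y).
Proof.
move=> Px Ky; have [u ->] := PQ_mon charK y Px.
elim/big_ind: _ => // a _; rewrite {}(talgE y) mulr_sumr.
elim/big_ind: _ => // a' _; rewrite tmonM; have [s Bs ->] := Ky a'.
rewrite -exprMn; apply: KK_mon; apply: BM => //; exact/AB/imf_subst.
Qed.

Let PQ0 : PQ' 0. Proof. by exists 0; rewrite raddf0. Qed.
Let PQB x y : PQ' x -> PQ' y -> PQ' (x - y).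
Proof. by move=> [u ->] [v ->]; exists (u - v); rewrite raddfB. Qed.
Let PQM x y : PQ' x -> PQ' y -> PQ' (x * y).
Proof. by move=> [u ->] [v ->]; exists (u * v); rewrite tiotaM. Qed.
Let PQ_iota u : PQ' (iota u). Proof. by exists u. Qed.
Let PQr i : PQ' (rR i). Proof. by exists (r i). Qed.
Let PQh k : PQ' (hR k). Proof. by exists (h (lshift n k)). Qed.
Let PQ1 : PQ' 1. Proof. by exists 1; rewrite rmorph1. Qed.
Let PQZ a x : PQ' x -> PQ' (a *: x).
Proof. by move=> [u ->]; exists (a *: u); rewrite tiotaZ. Qed.

Let al_PQ k j x : KK x -> PQ' (al k j x).
Proof.
move=> Kx; apply/(PQE charK) => a; have [s Bs E] := Kx a.
exists (TR (yy k j * s)); first by have := TR_A 0 k j Bs; rewrite expn0 expr1.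
by rewrite tco_map E /= /trmul -exprMn TRX.
Qed.

Let al_lin k j x y : PQ' x -> KK y -> al k j (x * y) = x * al k j y.
Proof.
by move=> Px _; apply: tmap_lin => // s z As; rewrite /= /trmul mulrCA; exact: TRA.
Qed.

Let X_KK k j x : PQ' x -> KK (X k j * x).
Proof.
move=> /(PQE charK) Px a; have [s As E] := Px a.
by exists (xx k j * s); [apply: BM => //; exact: AB|rewrite tmon0M E exprMn].
Qed.

Let alK k x : KK x -> \sum_j X k j * al k j x = hR k ^+ Q * x.
Proof.
move=> Kx; apply: tcoP => a; have [s Bs E] := Kx a.
rewrite iota_expQ tmon0M E tco_sum; have := TR_K 0 k Bs; rewrite expn0.
move/(congr1 (fun z => z ^+ Q)); rewrite expr1 exprMn => <-; rewrite pchar_exp_sum //.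
apply: eq_bigr => j _; rewrite tmon0M tco_map E /= /trmul !expr1 -exprMn TRX.
by rewrite exprMn.
Qed.

(** So [iota] embeds P/(r^Q): each Frobenius component of an element of the kernel lies in the ideal
    (r). *)
Let ioI x : iota x = 0 <-> exists q, x = \sum_i r i ^+ Q * q i.
Proof.
split=> [|[q ->]]; last first.
  rewrite raddf_sum big1 // => i _; rewrite [LHS]iotaM iotaXn iota_expQ.
  have -> : (r i)^$ f = 0.
    apply/ker_f; exists (fun j => if j == i then 1 else 0).
    rewrite (bigD1 i) //= eqxx mulr1 big1 ?addr0 // => j /negPf ->; by rewrite mulr0.
  by apply: tcoP => a; rewrite tmon0M expr0n gtn_eqF // mul0r tco0.
have [u ->] := frob_split_ex charK ee x => E.
have uP a : exists q, u a = \sum_j r j * q j.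
  apply/ker_f; have := congr1 (fun z => tco z a) E; rewrite tco_iota // tco0 => /eqP.
  by rewrite expf_eq0 => /andP[_ /eqP].
have [q qE] := fin_all_exists uP.
exists (fun j => \sum_a 'X_[mbox a] * q a j ^+ Q).
under [RHS]eq_bigr => j _ do rewrite mulr_sumr.
rewrite exchange_big /=; apply: eq_bigr => a _; rewrite qE pchar_exp_sum // mulr_sumr.
by apply: eq_bigr => j _; rewrite exprMn mulrCA.
Qed.

Let cat_r s x : mideal t (catf xpredT xpred0) (catf (fun=> s) (fun=> 0%N)) x <->
  exists q, x = \sum_i r i ^+ s * q i.
Proof.
rewrite mideal_cat; split=> [[q [q' ->]]|[q ->]].
  by exists q; rewrite [X in _ + X]big_pred0_eq addr0.
by exists q, (fun=> 0); rewrite [X in _ = _ + X]big_pred0_eq addr0.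
Qed.

Let rhoE : rho = iota (\prod_i r i ^+ Q.-1).
Proof. by rewrite /rho rmorph_prod; apply: eq_bigr => i _; rewrite -iotaXn. Qed.

Let prod_t s : \prod_i t i ^+ catf (fun=> s) (fun=> 0%N) i = \prod_i r i ^+ s.
Proof.
rewrite big_split_ord /= [X in _ * X]big1 ?mulr1 => [|i _]; last by rewrite catfR expr0.
by apply: eq_bigr => i _; rewrite /t !catfL.
Qed.

(** The colon of (r^Q) by the product of the r_i^(Q-1) is (r), read off exponents through
    freeness. *)
Let rho_iota x : rho * iota x = 0 <-> x^$ f = 0.
Proof.
rewrite rhoE -iotaM ioI ker_f; split=> [[q E]|[q ->]]; last first.
  exists (fun i => q i * \prod_(j | j != i) r j ^+ Q.-1).
  rewrite mulr_sumr; apply: eq_bigr => i _; rewrite (bigD1 i) //=.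
  have -> : r i ^+ Q = r i * r i ^+ Q.-1 by rewrite -exprS prednK.
  by ring.
have /cat_r H : exists q, (\prod_i r i ^+ Q.-1) * x = \sum_i r i ^+ Q * q i by exists q.
pose mu : 'X_{1..c + N} := [multinom catf (fun=> Q.-1) (fun=> 0%N) i | i < c + N].
have prodE : \prod_i t i ^+ mu i = \prod_i r i ^+ Q.-1.
  by rewrite -prod_t; apply: eq_bigr => i _; rewrite mnmE.
rewrite -prodE in H; have {H} := mideal_colon span_b free_b H.
move=> [q1 E1]; have /cat_r[q2 ->] : mideal t (catf xpredT xpred0) (catf (fun=> 1%N) (fun=> 0%N)) x.
  exists q1; rewrite E1; apply: eq_bigr => i; case: (split_ordP i) => j -> Zj.
    by rewrite mnmE !catfL -{1}(prednK Q_gt0) subSnn.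
  by rewrite catfR in Zj.
by exists q2; apply: eq_bigr => i _; rewrite expr1.
Qed.

Let phi_iota x : phi (iota x) = x^$ f. Proof. exact: tphi_iota. Qed.

Let phi_hR k : phi (hR k) = g (lshift n k). Proof. exact: phi_iota. Qed.

Let h_reg k x : hR k * x = 0 -> x = 0.
Proof.
move=> E; apply: tcoP => a; rewrite tco0; apply/eqP.
have hE : hR k ^+ Q = hR k ^+ Q.-1 * hR k by rewrite -exprSr prednK.
have : hR k ^+ Q * x = 0 by rewrite hE -mulrA E mulr0.
rewrite iota_expQ => /(congr1 (fun z => tco z a)); rewrite tmon0M tco0 => /eqP.
by rewrite mulf_eq0 expf_eq0 (negPf (g_neq0 _)) andbF.
Qed.

Let hX_reg k i x : hR k ^+ i * x = 0 -> x = 0.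
Proof.
elim: i => [|i IH]; first by rewrite expr0 mul1r.
rewrite exprS -mulrA => E; exact/IH/(h_reg E).
Qed.

Let phi_al k j x : phi (al k j x) = TR (yy k j ^+ Q * phi x).
Proof.
rewrite [phi _]tphiE [phi x]tphiE mulr_sumr raddf_sum /=; apply: eq_bigr => a _.
rewrite tco_map /= /trmul [in LHS]mulrC -TRA ?mulrA; last first.
  by exists 'X_[mbox a]; rewrite substX; apply: eq_bigr => i _; rewrite mnmE.
by congr (TR _); ring.
Qed.

Let phi_KK x : KK x -> B (phi x).
Proof.
move=> Kx; rewrite [phi x]tphiE; apply: B_sum => a; have [s Bs ->] := Kx a.
apply: BM; first exact: BX.
by apply: AB; exists 'X_[mbox a]; rewrite substX; apply: eq_bigr => i _; rewrite mnmE.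
Qed.

(** Known on [PQ] by [rho_iota]; the maps [al], which are linear over [PQ] and recover an element up
    to a regular factor, extend it to [KK]. *)
Let rho_phi x : KK x -> (rho * x = 0) <-> (phi x = 0).
Proof.
move=> Kx; have alx j : exists u, al 0 j x = iota u by apply: al_PQ.
split=> E.
  have E' : phi (hR 0 ^+ Q * x) = 0.
    rewrite -alK // raddf_sum big1 //= => j _; rewrite rmorphM /=.
    have [u uE] := alx j; rewrite uE phi_iota.
    suff -> : u^$ f = 0 by rewrite mulr0.
    apply/rho_iota; rewrite -uE -al_lin //; first by rewrite E raddf0.
    by rewrite rhoE; apply: PQ_iota.
  move: E'; rewrite rmorphM rmorphXn /= phi_iota => /eqP.
  by rewrite mulf_eq0 expf_eq0 (negPf (g_neq0 _)) andbF => /eqP.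
have E' : hR 0 ^+ Q * (rho * x) = 0.
  rewrite mulrCA -alK // mulr_sumr big1 // => j _; have [u uE] := alx j.
  rewrite uE mulrCA; suff -> : rho * iota u = 0 by rewrite mulr0.
  by apply/rho_iota; rewrite -phi_iota -uE phi_al E mulr0 raddf0.
exact: hX_reg E'.
Qed.

(** The socle computation [mideal_socle] for the r_i alone, pushed through [iota]. *)
Let ann_PQ x : PQ' x -> (forall i, rR i * x = 0) -> exists2 q, PQ' q & x = rho * q.
Proof.
move=> [y ->] H.
have [j|z] := mideal_socle (Z := catf xpredT xpred0) (x := y) span_b free_b Q_gt0.
  case: (split_ordP j) => i ->; rewrite ?catfR // => _.
  have /ioI[q E] : iota (r i * y) = 0 by rewrite iotaM; apply: H.
  have /cat_r[q' qE] : exists q, r i * y = \sum_i r i ^+ Q * q i by exists q.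
  have -> : t (lshift N i) = r i by rewrite /t catfL.
  rewrite qE.
  by exists q'; apply: eq_bigr => k; case: (split_ordP k) => l ->; rewrite ?catfL ?catfR.
move=> [q' E]; exists (iota z); first exact: PQ_iota.
rewrite rhoE -iotaM; apply/eqP; rewrite -subr_eq0 -[X in X == 0]raddfB; apply/eqP/ioI.
have prodE : \prod_(j | catf xpredT xpred0 j) t j ^+ Q.-1 = \prod_i r i ^+ Q.-1.
  rewrite big_mkcond big_split_ord /= [X in _ * X]big1 ?mulr1 => [|i _]; last by rewrite catfR.
  by apply: eq_bigr => i _; rewrite /t !catfL.
rewrite -prodE E; apply/cat_r; exists q'.
by apply: eq_bigr => k; case: (split_ordP k) => l ->; rewrite ?catfL ?catfR.
Qed.

Let r_nil i : rR i ^+ Q = 0.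
Proof.
rewrite -iotaXn; apply/ioI; exists (fun j => if j == i then 1 else 0).
rewrite (bigD1 i) //= eqxx mulr1 big1 ?addr0 // => j /negPf ->; by rewrite mulr0.
Qed.

Let neq_ls (i j : 'I_3) : i != j -> lshift n i != lshift n j.
Proof. by rewrite eq_lshift. Qed.

Let B_colon i j s s' : B s -> B s' -> g (lshift n 1) ^+ i * s = g (lshift n 0) ^+ j * s' ->
  exists2 z, B z & s = g (lshift n 0) ^+ j * z.
Proof.
move=> Bs Bs' E.
have [z zE] := par_colon1 span_b' free_b' (neq_ls (i := 1) (j := 0) isT) E.
exists z => //; apply: (Bsat (i := i) (j := j)); last by rewrite -zE.
suff -> : g (lshift n 1) ^+ i * z = s' by [].
have g0 : g (lshift n 0) ^+ j != 0 by apply: expf_neq0; apply: g_neq0.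
by apply: (mulfI g0); rewrite -E zE mulrCA.
Qed.

Let KK_sat k x y : KK x -> KK y -> hR 1 ^+ Q ^+ k * x = hR 0 ^+ Q * y ->
  exists2 z, KK z & x = hR 0 ^+ Q * z.
Proof.
move=> Kx Ky E.
have hX1 : hR 1 ^+ Q ^+ k = tmon ((g (lshift n 1) ^+ k) ^+ Q) 0%MM.
  rewrite -exprM mulnC exprM -[hR 1 ^+ k](iotaXn (h (lshift n 1)) k) iota_expQ.
  by rewrite rmorphXn.
have zP a : exists z, B z /\ tco x a = (g (lshift n 0) * z) ^+ Q.
  have [s Bs Es] := Kx a; have [s' Bs' Es'] := Ky a.
  have E0 : tco (hR 1 ^+ Q ^+ k * x) a = tco (hR 0 ^+ Q * y) a by rewrite E.
  rewrite hX1 (iota_expQ (h (lshift n 0))) in E0.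
  have E1 := etrans (esym (tmon0M _ x a)) (etrans E0 (tmon0M _ y a)).
  rewrite Es Es' -(exprMn Q _ s) -(exprMn Q _ s') in E1.
  have {}E1 := pchar_exp_inj charS E1.
  have [|z Bz zE] := @B_colon k 1 s s' Bs Bs'; first by rewrite expr1.
  rewrite expr1 in zE.
  by exists z; exact: (conj Bz (etrans Es (congr1 (fun u => u ^+ Q) zE))).
have [z zE] := fin_all_exists zP.
exists (\sum_a tmon (z a ^+ Q) (mbox a)).
  elim/big_ind: _ => [|u v|a _]; [exact: KK0|exact: KK_D|].
  by apply: KK_mon; exact: (proj1 (zE a)).
apply: tcoP => a; rewrite (iota_expQ (h (lshift n 0))).
apply: etrans (esym (tmon0M _ _ a)); rewrite tco_sum_box -(exprMn Q _ (z a)).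
exact: (proj2 (zE a)).
Qed.

Let B_phi k s : B s -> exists2 x, KK x & phi x = (phi (hR k)) ^+ Q * s.
Proof.
move=> Bs; have uP j : exists u, TR (yy k j ^+ Q * s) = u^$ f.
  by have [u uE] := TR_A ee k j Bs; exists u.
have [u uE] := fin_all_exists uP.
exists (\sum_j X k j * iota (u j)).
  elim/big_ind: _ => [|u1 u2|j _]; [exact: KK0|exact: KK_D|].
  by apply: X_KK; exact: PQ_iota.
rewrite phi_hR -TR_K // raddf_sum; apply: eq_bigr => j _ /=.
rewrite rmorphM [X in X * _]tphi_mon [phi (iota _)]phi_iota uE big1 ?mulr1 // => i _.
by rewrite mnm0E.
Qed.

Let A_koszul x y z : A x -> A y -> A z ->
  phi (hR 2) ^+ Q * x + phi (hR 0) ^+ Q * y + phi (hR 1) ^+ Q * z = 0 ->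
  exists a : 'I_3 -> S, (forall k, A (a k)) /\
   [/\ x = phi (hR 1) ^+ Q * a 0 - phi (hR 0) ^+ Q * a 1, y = phi (hR 2) ^+ Q * a 1 - phi (hR 1) ^+ Q * a 2 &
       z = phi (hR 0) ^+ Q * a 2 - phi (hR 2) ^+ Q * a 0].
Proof.
exact: (imf_koszul (G := fun k => phi (hR k)) span_b free_b span_b' free_b' ker_f phi_hR).
Qed.

Let A_reg x y z : A x -> A y -> A z ->
  phi (hR 2) ^+ Q * x - phi (hR 1) ^+ Q * y = phi (hR 0) * z ->
  exists a a', [/\ A a, A a' & x = phi (hR 1) ^+ Q * a + phi (hR 0) * a'].
Proof. exact: (imf_reg3 (G := fun k => phi (hR k)) span_b free_b ker_f phi_hR). Qed.

Local Notation TT := {ffun 'I_c -> 'I_Q}.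
Variable d : nat.
Hypothesis ltdQ : (d < Q)%N.
Let be (b : TT) := (\sum_i b i * e i)%N.
Variables (Ub Zb : TT -> finType) (bet : forall b, Ub b -> S) (mz : forall b, Zb b -> S).
Hypothesis bet_B : forall b i, B (@bet b i).
Hypothesis bet_hom : forall b i, exists2 D, sh D (@bet b i) & (D + be b = d + gam)%N.
Hypothesis bet_ind : forall b, indep_mod (fun x => x = 0) (@bet b).
Hypothesis mz_span : forall b j D v, A v -> sh D v ->
  (D + be b = d + gam + tau j)%N -> exists (co : Zb b -> K) a,
    A a /\ v = \sum_z co z *: mz z + g (lshift n 0) * a.

(** Below degree [Q] the twist of [B] has no more room than P: a Q-th power of positive degree has
    degree at least [Q], so in degree [d] the coordinates are constants, and the box monomials of
    weight [d] span. *)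
Lemma pullback_count :
  (\sum_b #|Ub b| <= #|[set a : T | wdeg w (mbox a) == d]| + \sum_b #|J| * #|Zb b|)%N.
Proof.
pose Zt : finType := {a : T | a \in [set a : T | wdeg w (mbox a) == d]}.
have -> : #|[set a : T | wdeg w (mbox a) == d]| = #|Zt| by rewrite card_sig; apply: eq_card => a; rewrite inE.
(* A component of a Q-th power vanishes unless [Q] divides the degree, and then it is the Q-th power
   of a component. *)
have cK D x : KK x -> KK (cR D x).
  move=> Kx a; rewrite tco_comp; have [s Bs ->] := Kx a.
  case: ifP => _; last by exists 0; rewrite // expr0n gtn_eqF.
  set D' := (D - _)%N.
  exists (if (Q %| D')%N then wc (D' %/ Q)%N s else 0); first by case: ifP => _ //; apply: Bwc.
  have [B' sE] := wcomp_decomp (fun=> 1%N) s.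
  rewrite {1}sE pchar_exp_sum // raddf_sum /=.
  have wE (i : nat) : wc D' (wc i s ^+ Q) = if D' == (i * Q)%N then wc i s ^+ Q else 0.
    by rewrite (wcomp_whom _ (whomXn _ (wcomp_idem _ _ _))).
  under eq_bigr => i _ do rewrite wE.
  case: ifP => [dv|ndv]; last first.
    rewrite expr0n gtn_eqF //= big1 // => i _; case: eqP => // E.
    by rewrite E dvdn_mull in ndv.
  rewrite [in RHS]sE raddf_sum /= pchar_exp_sum //; apply: eq_bigr => i _.
  rewrite (wcomp_whom _ (wcomp_idem _ _ _)) -{1}(divnK dv) eqn_pmul2r //.
  by case: (_ == _); rewrite // expr0n gtn_eqF.
have Ag k : A (phi (hR k)) by rewrite phi_hR; apply: imf_subst.
have tr_A k j x : B x -> A (tr k j x).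
  by move=> Bx; have := TR_A 0 k j Bx; rewrite expn0 expr1.
have tr_lin k j a x : A a -> B x -> tr k j (a * x) = a * tr k j x.
  by move=> Aa _; rewrite /= /trmul mulrCA; exact: TRA.
have xi_B k j a : A a -> B (xx k j * a) by move=> Aa; apply: BM => //; exact: AB.
have trK k x : B x -> \sum_j xx k j * tr k j x = phi (hR k) * x.
  by move=> Bx; have := TR_K 0 k Bx; rewrite expn0 expr1 -phi_hR => <-; apply: eq_bigr => j _; rewrite !expr1.
have phiZ a x : phi (a *: x) = a *: phi x by apply: tphiZ.
have g_reg k x : phi (hR k) * x = 0 -> x = 0 by rewrite phi_hR; apply: preg.
have B_sat x y : B x -> B y -> phi (hR 1) ^+ Q * x = phi (hR 0) ^+ Q * y ->
    exists2 z, B z & x = phi (hR 0) ^+ Q * z.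
  by move=> Bx By E; rewrite phi_hR; apply: (B_colon Bx By); rewrite -!phi_hR; exact: E.
refine (@section_count K _ _ phi c Q rR hR J PQ' KK A B al X tr xx cR cS e gam tau Q_gt0 PQ0 PQB PQM PQr PQh PQ1 PQZ KK0 KKB KKM (@imf0 _ _ _ f) (@imfB _ _ _ f) (@imf1 _ _ _ f) (@imfM _ _ _ f) (@imfZ _ _ _ f) B0 BB Ag al_PQ al_lin X_KK alK tr_A tr_lin xi_B trK phi_KK phiZ rho_phi ann_PQ r_nil KK_sat h_reg g_reg B_sat A_koszul A_reg B_phi
  _ _ _ _ _ cK _ _ _ _ _ _ _ d Ub Zb bet mz bet_B bet_hom bet_ind _ Zt (fun z : Zt => tmon 1 (mbox (val z))) _).
- by move=> D x; apply: tcomp_idem.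
- by move=> D a x; apply: tcompZ.
- by move=> D D' x y; apply: tcompM.
- by move=> D x; apply: wcomp_idem.
- by move=> D D' x y; apply: wcompM.
- by move=> D x [u ->]; exists (wcomp w D u); rewrite (wcomp_subst _ _ hom_f).
- by move=> D x; apply: tphi_comp.
- by move=> k j a x; rewrite /= /trmul -scalerAr TRZ.
- move=> j D x Bx; rewrite /= /trmul -TRwc (wcompM _ _ (yy_hom j)) leq_addl addnK.
  by [].
- by rewrite -(rmorph1 iota); apply: (tiota_hom charK _ hom_f); exact: whom1.
- by move=> i; apply: (tiota_hom charK _ hom_f); exact: hom_r.
- by move=> k; apply: (tiota_hom charK _ hom_f); exact: hom_h.
- move=> b0 j D v Av hv DE; have [co [a [Aa vE]]] := mz_span Av hv DE.
  by exists co, a; rewrite phi_hR; exact: (conj Aa vE).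
move=> x Kx hx.
have co_a (a : T) : exists co : K, tco x a = if wdeg w (mbox a) == d then co%:MP else 0.
  have [s Bs sE] := Kx a; have := congr1 (fun z : R => tco z a) hx; rewrite tco_comp.
  case: (ltngtP (wdeg w (mbox a)) d) => [lt|gt|E]; last first.
  - rewrite E subnn => Ex; exists (s ^+ Q)@_0; rewrite -Ex sE.
    apply/mpolyP => mu; rewrite mcoeff_wcomp mcoeffC.
    have -> : (wdeg (fun=> 1%N) mu == 0%N) = (mu == 0%MM).
      apply/eqP/eqP => [E0|->]; last exact: wdeg0.
      by apply/mnmP => i; rewrite mnm0E; move/eqP: E0; rewrite sum_nat_eq0 => /forallP/(_ i); rewrite mul1n => /eqP.
    by rewrite eq_sym; case: eqP => [<-|_]; rewrite ?mulr1 ?mulr0.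
  - by move=> <-; exists 0.
  (* Here the box monomial has weight less than [d], and a nonzero Q-th power would have a degree
     strictly between 0 and [Q]. *)
  rewrite sE => /whomP hs; exists 0.
  apply/eqP; rewrite expf_eq0 Q_gt0 /=; apply/eqP/mpolyP => mu; rewrite mcoeff0.
  apply/eqP/contraT => nz; have := hs (mu *+ Q)%MM.
  rewrite (mpoly_expq charK) raddf_sum /= (bigD1_seq mu) ?msupp_uniq ?mcoeff_msupp //=.
  rewrite mcoeffZ mcoeffX eqxx mulr1 big1 ?addr0 ?expf_neq0 // => [|nu nmu].
    move=> /(_ isT); rewrite /wdeg; under eq_bigr => i _ do rewrite mulmnE mul1n.
    rewrite -big_distrl /= => E0; have : (Q <= d - wdeg w (mbox a))%N.
      by rewrite -E0 leq_pmull // lt0n; apply/eqP => z0; move: E0; rewrite z0 mul0n => /esym/eqP; rewrite subn_eq0 leqNgt lt.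
    by move: ltdQ; clear; lia.
  rewrite mcoeffZ mcoeffX; case: eqP => [/mnmP E0|_]; last by rewrite mulr0.
  case/eqP: nmu; apply/mnmP => i; have := E0 i; rewrite !mulmnE => /eqP.
  by rewrite eqn_pmul2r // => /eqP.
have [co coE] := fin_all_exists co_a.
exists (fun z => co (val z)); apply: tcoP => a; rewrite tco_sum coE.
under eq_bigr => z _ do rewrite tcoZ tco_box.
have [E|ne] := eqVneq (wdeg w (mbox a)) d; last first.
  rewrite big1 // => z _; case: eqP => [E|_]; last by rewrite scaler0.
  by have := valP z; rewrite inE -E (negPf ne).
have aS : a \in [set a : T | wdeg w (mbox a) == d] by rewrite inE E.
rewrite (bigD1 (Sub a aS : Zt)) //= eqxx big1 ?addr0 => [|z za].
  by rewrite -alg_mpolyC.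
case: eqP => [E1|_]; last by rewrite scaler0.
by case/eqP: za; apply/val_inj.
Qed.
End PullbackCount.

(** * Growth *)

Lemma pow2_gt s : (s < 2 ^ s)%N. Proof. exact: ltn_expl. Qed.

Lemma exp_beats_poly c0 k a b : exists i, (c0 * (a + b * i) ^ k < 2 ^ i)%N.
Proof.
(* [s] is twice [t], so 2 ^ s is the square of 2 ^ t and beats the linear expression [u + k * s]. *)
pose u := (c0 + k * (a + b))%N; pose t := (u + 2 * k)%N; pose s := (2 * t)%N.
have s_big : (u + k * s < 2 ^ s)%N.
  apply: (@leq_trans (t.+1 * t.+1)%N); last by rewrite /s mul2n -addnn expnD leq_mul // pow2_gt.
  by rewrite /s /t; nia.
exists (2 ^ s)%N.
have le1 : (a + b * 2 ^ s <= 2 ^ (a + b + s))%N.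
  rewrite expnD; apply: (@leq_trans ((a + b) * 2 ^ s)%N); last by rewrite leq_mul2r ltnW ?orbT ?pow2_gt.
  by rewrite mulnDl leq_add2r leq_pmulr // expn_gt0.
apply: (@leq_ltn_trans (2 ^ (u + k * s))%N); last by rewrite ltn_exp2l.
have -> : (u + k * s = c0 + (a + b + s) * k)%N by rewrite /u; ring.
rewrite expnD expnM; apply: leq_mul; first exact/ltnW/pow2_gt.
by case: (k) => // k'; rewrite leq_exp2r.
Qed.

Lemma bernoulli C : (0 < C)%N -> (2 * C ^ C <= C.+1 ^ C)%N.
Proof.
case: C => // C _; suff H j : (C.+1 ^ j + j * C.+1 ^ j.-1 <= C.+2 ^ j)%N.
  by have := H C.+1; rewrite /= -expnS mul2n -addnn.
elim: j => [|j IH] //; rewrite [in X in (_ <= X)%N]expnS /=.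
apply: (@leq_trans (C.+2 * (C.+1 ^ j + j * C.+1 ^ j.-1))%N); last by rewrite leq_mul2l IH orbT.
case: j {IH} => [|j] //=; rewrite !expnS; nia.
Qed.

(** The number [j] of steps is fixed before [G]: the counting function depends on the power [Q],
    which is chosen later and must exceed the degrees reached in [j] steps. *)
Lemma growth_contradiction c0 k C sg D0 : (0 < C)%N -> exists j, forall G : nat -> nat,
  (0 < G D0)%N -> (forall D, G D <= c0 * D.+1 ^ k)%N ->
  ~ (forall i, (i < j)%N -> (C.+1 * G (D0 + i * sg) <= C * G (D0 + i.+1 * sg))%N).
Proof.
move=> C0; have [i ilt] := exp_beats_poly c0 k D0.+1 (C * sg).
exists (i * C)%N => G G0 Gpol H.
have {H}H j : (j <= i * C)%N -> (C.+1 ^ j <= C ^ j * G (D0 + j * sg))%N.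
  elim: j => [|j IH] le; first by rewrite mul0n addn0 !expn0 mul1n.
  rewrite !expnS; apply: (@leq_trans (C.+1 * (C ^ j * G (D0 + j * sg)))%N).
    by rewrite leq_mul2l IH ?orbT // ltnW.
  by have := H j le; set x := G _; set y := G _; set z := (C ^ j)%N; nia.
have := H (i * C)%N (leqnn _); apply/negP; rewrite -ltnNge.
apply: (@leq_ltn_trans (C ^ (i * C) * (c0 * (D0 + i * C * sg).+1 ^ k))%N).
  by rewrite leq_mul2l Gpol orbT.
apply: (@leq_trans (C ^ (i * C) * 2 ^ i)%N).
  rewrite ltn_pmul2l ?expn_gt0 ?C0 //; apply: leq_ltn_trans ilt.
  by rewrite addSn; have -> : (i * C * sg = C * sg * i)%N by ring.
have -> : (C ^ (i * C) * 2 ^ i = (2 * C ^ C) ^ i)%N by rewrite expnMn mulnC [(i * C)%N]mulnC expnM.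
rewrite [(i * C)%N]mulnC expnM; case: (i) => // i'; rewrite leq_exp2r //; exact: bernoulli.
Qed.

Section GrowthStep.
Variables (K : closedFieldType) (p : nat) (charK : p \in [pchar K]) (n m c : nat).
Local Notation N := (3 + n)%N.
Local Notation S := {mpoly K[N]}.
Local Notation P := {mpoly K[m]}.
Variables (f : 'I_m -> S) (r : 'I_c -> P) (h : 'I_N -> P).
Let g k := (h k)^$ f.
Let t := catf r h.
Local Notation A := (imf f).
Variables (I : finType) (b : I -> P).
Hypothesis span_b : forall x, exists F : I -> {mpoly K[c + N]}, x = \sum_i b i * (F i)^$ t.
Hypothesis free_b : forall F : I -> {mpoly K[c + N]}, \sum_i b i * (F i)^$ t = 0 -> forall i, F i = 0.
Variables (I' : finType) (b' : I' -> S).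
Hypothesis span_b' : forall x, exists F : I' -> {mpoly K[N]}, x = \sum_i b' i * (F i)^$ g.
Hypothesis free_b' : forall F : I' -> {mpoly K[N]}, \sum_i b' i * (F i)^$ g = 0 -> forall i, F i = 0.
Hypothesis ker_f : forall x : P, x^$ f = 0 <-> in_ideal r x.
Variables (w : 'I_m -> nat) (e : 'I_c -> nat) (gam : nat) (bd : I -> nat).
Local Notation wc := (wcomp (fun=> 1%N)).
Local Notation sh := (whom (fun=> 1%N)).
Hypothesis e_gt0 : forall i, (0 < e i)%N.
Hypothesis gam_gt0 : (0 < gam)%N.
Hypothesis hom_f : forall i, sh (w i) (f i).
Hypothesis hom_r : forall i, whom w (e i) (r i).
Hypothesis hom_h : forall k, whom w gam (h k).
Hypothesis hom_b : forall i, whom w (bd i) (b i).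

Variable B : S -> Prop.
Hypothesis BB : forall x y, B x -> B y -> B (x - y).
Hypothesis BM : forall x y, B x -> B y -> B (x * y).
Hypothesis AB : forall x, A x -> B x.
Hypothesis Bwc : forall d x, B x -> B (wc d x).
Hypothesis Bsat : forall i j z, B (g (lshift n 1) ^+ i * z) -> B (g (lshift n 0) ^+ j * z) -> B z.

Variables (TR : {additive S -> S}) (J : finType) (xx yy : 'I_3 -> J -> S) (tau : J -> nat).
Hypothesis TRZ : forall a x, TR (a *: x) = a *: TR x.
Hypothesis TRA : forall a x, A a -> TR (a * x) = a * TR x.
Hypothesis TRX : forall q x, TR (x ^+ (p ^ q)) = TR x ^+ (p ^ q).
Hypothesis TRwc : forall d x, TR (wc d x) = wc d (TR x).
Hypothesis TR_A : forall q k j x, B x -> A (TR (yy k j ^+ (p ^ q) * x)).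
Hypothesis TR_K : forall q k x, B x ->
  \sum_j xx k j ^+ (p ^ q) * TR (yy k j ^+ (p ^ q) * x) = g (lshift n k) ^+ (p ^ q) * x.
Hypothesis xx_B : forall k j, B (xx k j).
Hypothesis yy_hom : forall j, sh (tau j) (yy 1 j).

Variables (s : S) (del : nat).
Hypothesis s_B : B s.
Hypothesis s_hom : sh del s.
Hypothesis s_ind : forall x y, A x -> A y -> x + s * y = 0 -> y = 0.

Variable ee : nat.
Local Notation Q := (p ^ ee)%N.
Local Notation T := {ffun 'I_c -> 'I_Q}.
Local Notation V := {ffun 'I_N -> 'I_Q}.
Let th := catf e (fun _ : 'I_N => gam).
Let be (a : T) := (\sum_i a i * e i)%N.
Let dg (x : I * V) := (bd x.1 + gam * \sum_k x.2 k)%N.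
Let mk (v : V) (a : T) : 'X_{1..c + N} :=
  [multinom catf (fun i => a i : nat) (fun k => v k : nat) j | j < c + N].
Let hp (v : V) := \prod_k h k ^+ v k.
Let rp (a : T) := \prod_i r i ^+ a i.
Let k0 : 'I_N := lshift n 0.

Let wdeg_mk v a : wdeg th (mk v a) = (be a + gam * \sum_k v k)%N.
Proof.
rewrite /wdeg big_split_ord /= big_distrr /=; congr (_ + _)%N; apply: eq_bigr => i _.
  by rewrite mnmE /th !catfL mulnC.
by rewrite mnmE /th !catfR.
Qed.

Let subst_mk v a : ('X_[mk v a])^$ t = rp a * hp v.
Proof.
rewrite substX big_split_ord /=; congr (_ * _); apply: eq_bigr => i _.
  by rewrite mnmE /t !catfL.
by rewrite mnmE /t !catfR.
Qed.

Let mk_inj v a v' a' : mk v a = mk v' a' -> v = v' /\ a = a'.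
Proof.
move=> /mnmP E; split; apply/ffunP => i; apply/val_inj.
  by have := E (rshift c i); rewrite !mnmE !catfR.
by have := E (lshift N i); rewrite !mnmE !catfL.
Qed.


Let th_gt0 j : (0 < th j)%N.
Proof. by rewrite /th; case: (split_ordP j) => i ->; rewrite ?catfL ?catfR. Qed.

Let hom_t j : whom w (th j) (t j).
Proof. by rewrite /th /t; case: (split_ordP j) => i ->; rewrite ?catfL ?catfR. Qed.

Let mk_surj mu : (wdeg th mu < Q)%N -> exists v a, mu = mk v a.
Proof.
move=> lt; have ltj j : (mu j < Q)%N.
  apply: leq_ltn_trans lt; rewrite /wdeg (bigD1 j) //=.
  by apply: leq_trans (leq_addr _ _); rewrite leq_pmull.
exists [ffun k => Ordinal (ltj (rshift c k))], [ffun i => Ordinal (ltj (lshift N i))].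
apply/mnmP => j; rewrite mnmE; case: (split_ordP j) => i ->; by rewrite ?catfL ?catfR ffunE.
Qed.

(** P is free over the parameters, and below degree [Q] all exponents of parameters are below [Q],
    so restricting them to boxes loses nothing. *)
Lemma hom_span D x : (D < Q)%N -> whom w D x -> exists co : I * V * T -> K,
  x = \sum_(z | (dg z.1 + be z.2 == D)%N) co z *: (b z.1.1 * (rp z.2 * hp z.1.2)).
Proof.
move=> ltD hx; have [F FE] := span_b x.
exists (fun z => (F z.1.1)@_(mk z.1.2 z.2)).
rewrite -hx [in LHS]FE raddf_sum /=.
rewrite (eq_bigl (fun z : I * V * T => true && (dg z.1 + be z.2 == D)%N)) //.
rewrite -(pair_big_dep (fun _ : I * V => true) (fun (iv : I * V) a => dg iv + be a == D)%N
  (fun iv a => (F iv.1)@_(mk iv.2 a) *: (b iv.1 * (rp a * hp iv.2)))) /=.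
rewrite (eq_bigl (fun z : I * V => true && true)) //.
rewrite -(pair_big_dep (fun _ : I => true) (fun (i : I) (v : V) => true)
  (fun i v => \sum_(a : T | (dg (i, v) + be a == D)%N) (F i)@_(mk v a) *: (b i * (rp a * hp v)))) /=.
apply: eq_bigr => i _.
rewrite (wcompM _ _ (hom_b i)); case: leqP => [le|lt]; last first.
  rewrite big1 // => v _; rewrite big_pred0 // => a; apply/eqP => E.
  by move: lt; rewrite -E /dg /= -addnA ltnNge leq_addr.
rewrite -(wcomp_subst _ _ hom_t).
have -> : wcomp th (D - bd i)%N (F i) = \sum_v \sum_(a | (dg (i, v) + be a == D)%N) (F i)@_(mk v a) *: 'X_[mk v a].
  apply/mpolyP => mu; rewrite mcoeff_wcomp raddf_sum /=.
  under eq_bigr => v _ do rewrite raddf_sum /=.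
  have cE v a : ((F i)@_(mk v a) *: 'X_[mk v a])@_mu = (F i)@_(mk v a) * (mk v a == mu)%:R.
    by rewrite mcoeffZ mcoeffX.
  under eq_bigr => v _ do under eq_bigr => a _ do rewrite cE.
  have eqD v a : (dg (i, v) + be a == D)%N = (wdeg th (mk v a) == (D - bd i)%N).
    by rewrite wdeg_mk /dg /= -[RHS](eqn_add2l (bd i)) subnKC // addnAC addnA.
  case: eqP => [E|ne]; last first.
    rewrite big1 // => v _; rewrite big1 // => a; rewrite eqD => /eqP E.
    by case: eqP => [E'|_]; rewrite ?mulr0 //; rewrite -E' in ne.
  have [|v [a muE]] := @mk_surj mu; first by rewrite E (leq_ltn_trans (leq_subr _ _)).
  rewrite (bigD1 v) //= (bigD1 a) /=; last by rewrite eqD -muE E.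
  rewrite -muE eqxx mulr1 !big1 ?addr0 // => [v'|a'] /=.
    move=> ne; rewrite big1 // => a' _; case: eqP => [|_]; last by rewrite mulr0.
    by rewrite muE => /mk_inj[E' _]; rewrite E' eqxx in ne.
  case/andP=> _ ne; case: eqP => [|_]; last by rewrite mulr0.
  by rewrite muE => /mk_inj[_ E']; rewrite E' eqxx in ne.
rewrite raddf_sum /= mulr_sumr; apply: eq_bigr => v _.
rewrite raddf_sum /= mulr_sumr; apply: eq_bigr => a _.
by rewrite comp_mpolyZ subst_mk -scalerAr.
Qed.

Let vz (x : I * V) : S := (b x.1 * hp x.2)^$ f.

(** In free coordinates a monomial with exponent 0 in every r lies outside the ideal (r), so the
    products of the [b i] with monomials in the h survive in [A]. *)
Lemma vz_ind : indep_mod (fun x => x = 0) vz.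
Proof.
move=> cc E [i0 v0].
pose a0 : T := [ffun=> Ordinal (leq_ltn_trans (leq0n _) (ltn_ord (v0 k0)))].
pose F i := \sum_v cc (i, v) *: 'X_[mk v a0].
have rp0 : rp a0 = 1 by apply: big1 => i _; rewrite ffunE expr0.
have FE : \sum_i b i * (F i)^$ t = \sum_x cc x *: (b x.1 * hp x.2).
  rewrite sum_pair /=.
  apply: eq_bigr => i _; rewrite raddf_sum /= mulr_sumr; apply: eq_bigr => v _.
  by rewrite comp_mpolyZ subst_mk rp0 mul1r -scalerAr.
have /ker_f[q qE] : (\sum_i b i * (F i)^$ t)^$ f = 0.
  rewrite FE -[RHS]E raddf_sum /=; apply: eq_bigr => x _; exact: comp_mpolyZ.
have mF : mideal t (catf xpredT xpred0) (catf (fun=> 1%N) (fun=> 0%N)) (\sum_i b i * (F i)^$ t).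
  apply/mideal_cat; exists q, (fun=> 0); rewrite [X in _ + X]big_pred0_eq addr0 qE.
  by apply: eq_bigr => i _; rewrite expr1.
have /mideal_supp H := (mideal_coord span_b free_b _ _ _).1 mF i0.
have co0 : (F i0)@_(mk v0 a0) = cc (i0, v0).
  rewrite raddf_sum (bigD1 v0) //= mcoeffZ mcoeffX eqxx mulr1 big1 ?addr0 // => v ne.
  rewrite mcoeffZ mcoeffX; case: eqP => [/mk_inj[E' _]|_]; last by rewrite mulr0.
  by rewrite E' eqxx in ne.
rewrite -co0; apply/eqP; rewrite mcoeff_eq0; apply/negP => /H[j].
case: (split_ordP j) => k ->; rewrite ?catfL ?catfR // => _.
by rewrite mnmE catfL ffunE.
Qed.

(** For D below [Q] these two numbers are the dimensions in degree D of P and of its quotient by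
    [h k0]. *)
Let Pd D := #|[set z : I * V * T | dg z.1 + be z.2 == D]%N|.
Let Z0 D := #|[set z : I * V * T | (dg z.1 + be z.2 == D)%N && (z.1.2 k0 == 0 :> nat)]|.


(** Raising the exponent of the parameter [k0] by one is injective, and its image misses the triples
    counted by [Z0]. *)
Lemma Pd_shift D : (D + gam < Q)%N -> (Pd D + Z0 (D + gam) <= Pd (D + gam))%N.
Proof.
move=> ltD; set AD := [set z : I * V * T | dg z.1 + be z.2 == D]%N.
pose up (z : I * V * T) : I * V * T :=
  (z.1.1, [ffun k => if k == k0 then insubd (z.1.2 k0) (z.1.2 k0).+1 else z.1.2 k], z.2).
have lt1 z : z \in AD -> ((z.1.2 k0).+1 < Q)%N.
  rewrite inE /dg => /eqP E; apply: leq_ltn_trans ltD; rewrite -E.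
  have : (z.1.2 k0 <= gam * \sum_k z.1.2 k)%N.
    by rewrite (leq_trans _ (leq_pmull _ gam_gt0)) // (bigD1 k0) //= leq_addr.
  move: gam_gt0; set u := (gam * _)%N; set u' := nat_of_ord _; set u'' := be _; set u3 := bd _.
  by clear; lia.
have up0 z : z \in AD -> (up z).1.2 k0 = (z.1.2 k0).+1 :> nat.
  by move=> /lt1 lt; rewrite /= ffunE eqxx val_insubd lt.
have upk z k : k != k0 -> (up z).1.2 k = z.1.2 k by move=> /negPf ne; rewrite /= ffunE ne.
have up_inj : {in AD &, injective up}.
  move=> z z' Hz Hz' E; have E1 : z.1.1 = z'.1.1 by move: E => /(congr1 (fun z => z.1.1)).
  have E2 : z.2 = z'.2 by move: E => /(congr1 snd).
  have E3 : z.1.2 = z'.1.2.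
    apply/ffunP => k; have [->|ne] := eqVneq k k0.
      by apply/val_inj/eqP; rewrite /= -eqSS -!up0 // E.
    by rewrite -(upk z) // -(upk z') // E.
  by case: z z' {Hz Hz' E} E1 E2 E3 => [[? ?] ?] [[? ?] ?] /= -> -> ->.
rewrite /Pd -/AD -(card_in_imset up_inj) /Z0 -cardsUI.
rewrite [X in (_ + X)%N](_ : _ = 0%N) ?addn0; last first.
  apply/eqP; rewrite cards_eq0; apply/eqP/setP => z; rewrite !inE.
  apply/negP => /andP[/imsetP[y Hy ->] /andP[_]]; by rewrite up0.
apply/subset_leq_card/subsetP => z; rewrite in_setU; case/orP=> [/imsetP[y Hy ->]|]; last by rewrite !inE => /andP[].
move: (Hy); rewrite !inE /dg => /eqP <-; apply/eqP.
rewrite /= (bigD1 k0) //= [in RHS](bigD1 k0) //= up0 //.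
rewrite (eq_bigr (fun k => nat_of_ord (y.1.2 k))) => [|k ne]; last by rewrite upk.
move: (nat_of_ord (y.1.2 k0)) (\sum_(i | i != k0) _)%N (be _) (bd _) (gam) => u1 u2 u3 u4 u5.
by clear; ring.
Qed.

Lemma monomials_le D : (D < Q)%N ->
  (#|[set a : {ffun 'I_m -> 'I_Q} | wdeg w (mbox a) == D]| <= Pd D)%N.
Proof.
move=> ltD; rewrite /Pd; set A1 := [set a : {ffun 'I_m -> 'I_Q} | _]; set A2 := [set z : I * V * T | _].
rewrite -[X in (X <= _)%N]card_ord -[X in (_ <= X)%N]card_ord.
apply: (exchange_leq (V := P) (W := fun x => x = 0) (u := fun i : 'I_#|A1| => 'X_[mbox (enum_val i)])
  (v := fun i : 'I_#|A2| => b (enum_val i).1.1 * (rp (enum_val i).2 * hp (enum_val i).1.2))).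
- exact: subsp0.
- move=> co E i; have := congr1 (fun u : P => u@_(mbox (enum_val i))) E.
  rewrite raddf_sum /= mcoeff0 (bigD1 i) //= mcoeffZ mcoeffX eqxx mulr1 big1 ?addr0 // => j ji.
  rewrite mcoeffZ mcoeffX; case: eqP => [/mnmP E'|_]; last by rewrite mulr0.
  case/eqP: ji; apply: enum_val_inj; apply/ffunP => k; apply/val_inj.
  by have := E' k; rewrite !mnmE.
move=> i; have := enum_valP i; rewrite inE => /eqP E.
have [|co coE] := @hom_span D ('X_[mbox (enum_val i)]) ltD; first by rewrite -E; apply: whomX.
exists (fun j => co (enum_val j)); apply/eqP; rewrite subr_eq0 {1}coE; apply/eqP.
rewrite -(big_enum_val (fun z : I * V * T => co z *: (b z.1.1 * (rp z.2 * hp z.1.2)))) /=.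
by apply: eq_bigl => z; rewrite inE.
Qed.

Let fr i : (r i)^$ f = 0.
Proof.
apply/ker_f; exists (fun j => (j == i)%:R); rewrite (bigD1 i) //= eqxx mulr1 big1 ?addr0 // => j /negPf ->.
by rewrite mulr0.
Qed.

Lemma imf_span D v : (D < Q)%N -> A v -> sh D v -> exists (co : I * V -> K) a,
  A a /\ v = \sum_(x | (dg x == D) && (x.2 k0 == 0 :> nat)) co x *: vz x + g k0 * a.
Proof.
move=> ltD [y0 vE] hv; pose y := wcomp w D y0.
have yE : v = y^$ f by rewrite (wcomp_subst _ _ hom_f) -vE hv.
have [co coE] := hom_span ltD (wcomp_idem w D y0).
have Q0 : (0 < Q)%N by apply: leq_ltn_trans ltD.
pose a0 : T := [ffun=> Ordinal Q0].
have rp0 : rp a0 = 1 by apply: big1 => i _; rewrite ffunE expr0.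
have be0 : be a0 = 0%N by apply: big1 => i _; rewrite ffunE.
have rpf a : a != a0 -> (rp a)^$ f = 0.
  move=> ne; have [i ai] : exists i, (0 < a i)%N.
    apply: NNPP => H; case/eqP: ne; apply/ffunP => i; rewrite ffunE; apply/val_inj => /=.
    by case: (posnP (a i)) => // Hi; case: H; exists i.
  rewrite rmorph_prod (bigD1 i) //= rmorphXn /= fr expr0n.
  by rewrite (gtn_eqF ai) mul0r.
have vE2 : v = \sum_(x | dg x == D) co (x, a0) *: vz x.
  rewrite yE -/y in coE *; rewrite coE raddf_sum /=.
  rewrite big_mkcond sum_pair /= [RHS]big_mkcond; apply: eq_bigr => x _.
  rewrite -big_mkcond /=.
  case: eqP => [E|ne].
    rewrite (bigD1 a0) /= ?be0 ?addn0 ?E // big1 ?addr0 => [|a /andP[_ /rpf a0']].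
      by rewrite rp0 mul1r comp_mpolyZ.
    by rewrite comp_mpolyZ !rmorphM /= a0' mul0r mulr0 scaler0.
  rewrite big1 // => a /eqP E; have [aE|/rpf a0'] := eqVneq a a0.
    by case: ne; rewrite -E aE be0 addn0.
  by rewrite comp_mpolyZ !rmorphM /= a0' mul0r mulr0 scaler0.
rewrite vE2 (bigID (fun x : I * V => x.2 k0 == 0 :> nat)) /=.
pose hp' (v : V) := h k0 ^+ (v k0).-1 * \prod_(k | k != k0) h k ^+ v k.
exists (fun x => co (x, a0)), (\sum_(x | (dg x == D) && (x.2 k0 != 0 :> nat)) co (x, a0) *: (b x.1 * hp' x.2)^$ f).
split.
  elim/big_ind: _ => [|u u' Hu Hu'|x _]; first exact: imf0.
    by rewrite -[u']opprK -[- u']sub0r; apply: imfB => //; apply: imfB => //; exact: imf0.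
  exact/imfZ/imf_subst.
congr (_ + _); rewrite mulr_sumr; apply: eq_bigr => x /andP[_ nz].
rewrite -scalerAr; congr (_ *: _); rewrite /vz /g -rmorphM; congr (_ ^$ f).
have -> : hp x.2 = h k0 * hp' x.2.
  by rewrite /hp (bigD1 k0) //= /hp' mulrA -exprS prednK // lt0n.
exact: mulrCA.
Qed.

Lemma card_set_sum (X : finType) (R : pred X) : #|[set x | R x]| = (\sum_x R x)%N.
Proof. by rewrite -sum1_card big_mkcond; apply: eq_bigr => x _; rewrite inE; case: (R x). Qed.

(** The part of [B] that is counted is [A] plus [s * A], a direct sum by [s_ind]. Summed over the
    exponents of r, Hilbert functions of [A] become those of P, since as a graded space P is [A]
    with monomials in r adjoined. *)
Lemma growth_step d : (d + gam < Q)%N -> (forall j, d + gam + tau j < Q)%N -> (del <= d + gam)%N ->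
  (Pd (d + gam) + Pd (d + gam - del) <= Pd d + #|J| * \sum_j Z0 (d + gam + tau j))%N.
Proof.
move=> ltd ltt led.
pose A1 a := [set x : I * V | dg x + be a == d + gam]%N.
pose A2 a := [set x : I * V | dg x + be a == d + gam - del]%N.
pose A3 a := [set jx : J * (I * V) | (dg jx.2 + be a == d + gam + tau jx.1)%N && (jx.2.2 k0 == 0 :> nat)].
pose Ub a : finType := ('I_#|A1 a| + 'I_#|A2 a|)%type.
pose bet a (u : Ub a) : S := match u with inl i => vz (enum_val i) | inr i => s * vz (enum_val i) end.
pose Zb a : finType := 'I_#|A3 a|.
pose mz a (i : Zb a) : S := vz (enum_val i).2.
have vz_A x : A (vz x) by apply: imf_subst.
have vz_hom x : sh (dg x) (vz x).
  rewrite /vz /whom -(wcomp_subst _ _ hom_f); congr (_ ^$ f).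
  apply: (whomM (hom_b _)); rewrite /hp big_distrr /=; apply: whom_prod => k _; exact: whomXn.
have le : (\sum_a #|Ub a| <= #|[set a : {ffun 'I_m -> 'I_Q} | wdeg w (mbox a) == d]| + \sum_a #|J| * #|Zb a|)%N.
apply: (@pullback_count K p charK n m c f r h I b span_b free_b I' b' span_b' free_b' ker_f w e gam
  hom_f hom_r hom_h B BB BM AB Bwc Bsat TR J xx yy tau TRZ TRA TRX TRwc TR_A TR_K xx_B yy_hom ee d _ Ub Zb bet mz).
- by apply: leq_ltn_trans ltd; rewrite leq_addr.
- by move=> a [i|i]; [apply: AB; exact: vz_A|apply: BM => //; apply: AB; exact: vz_A].
- move=> a [i|i]; have := enum_valP i; rewrite inE => /eqP E.
    by exists (dg (enum_val i)).
  exists (del + dg (enum_val i))%N; first exact: whomM.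
  by rewrite -addnA E subnKC.
- move=> a cc; rewrite big_sumType /= => E.
  have A_sum k (X : {set I * V}) (co : 'I_k -> K) (F : 'I_k -> S) : (forall i, A (F i)) -> A (\sum_i co i *: F i).
    move=> HF; elim/big_ind: _ => [|u u' Hu Hu'|x _]; first exact: imf0.
      by rewrite -[u']opprK -[- u']sub0r; apply: imfB => //; apply: imfB => //; exact: imf0.
    exact/imfZ.
  have ind0 (X : {set I * V}) (co : 'I_#|X| -> K) : \sum_i co i *: vz (enum_val i) = 0 -> forall i, co i = 0.
    move=> E0 i; pose co' x := if [pick i | enum_val i == x] is Some i then co i else 0.
    have co'E j : co' (enum_val j) = co j.
      rewrite /co'; case: pickP => [j' /eqP /enum_val_inj -> //|/(_ j)]; by rewrite eqxx.
    rewrite -co'E; apply: vz_ind; rewrite -[RHS]E0.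
    rewrite -(eq_bigr _ (fun j _ => congr1 (fun z => z *: _) (co'E j))).
    rewrite -(big_enum_val (fun x => co' x *: vz x)) /= [RHS]big_mkcond /=; apply: eq_bigr => x _.
    case: ifP => // xX; rewrite /co'; case: pickP => [j /eqP Ej|_]; last exact: scale0r.
    by rewrite -Ej enum_valP in xX.
  have E2 : \sum_i cc (inr i) *: vz (enum_val i) = 0.
    apply: (s_ind (x := \sum_i cc (inl i) *: vz (enum_val i))).
    - by apply: (A_sum _ set0) => i; exact: vz_A.
    - by apply: (A_sum _ set0) => i; exact: vz_A.
    rewrite -[RHS]E mulr_sumr; congr (_ + _); apply: eq_bigr => i _; by rewrite scalerAr.
  have E1 : \sum_i cc (inl i) *: vz (enum_val i) = 0.
    rewrite -[RHS]E [X in _ = _ + X](_ : _ = s * \sum_i cc (inr i) *: vz (enum_val i)).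
      by rewrite E2 mulr0 addr0.
    by rewrite mulr_sumr; apply: eq_bigr => i _; rewrite scalerAr.
  by case=> i; [exact: (ind0 _ _ E1)|exact: (ind0 _ _ E2)].
- move=> a j D v Av hv DE.
  have ltD : (D < Q)%N by apply: leq_ltn_trans (ltt j); rewrite -DE leq_addr.
  have [co [y [Ay vE]]] := imf_span ltD Av hv.
  exists (fun i : Zb a => if (enum_val i).1 == j then co (enum_val i).2 else 0), y; split=> //.
  rewrite {1}vE; congr (_ + _).
  rewrite -(big_enum_val (fun jx : J * (I * V) => (if jx.1 == j then co jx.2 else 0) *: vz jx.2)) /=.
  rewrite [RHS]big_mkcond [RHS]sum_pair /=.
  under [RHS]eq_bigr => j' _ do (under eq_bigr => x _ do rewrite inE /=; rewrite -big_mkcond /=).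
  rewrite [RHS](bigD1 j) //= [X in _ = _ + X]big1 ?addr0 => [|j' /negPf ne]; last first.
    by rewrite big1 // => x _; rewrite ne scale0r.
  by apply: eq_big => [x|x _]; rewrite ?eqxx // -DE eqn_add2r.
rewrite (eq_bigr (fun a => #|A1 a| + #|A2 a|)%N) in le => [|a _]; last by rewrite card_sum !card_ord.
rewrite big_split /= -big_distrr /= in le.
have sum_set (R : I * V -> T -> bool) : (\sum_a #|[set x | R x a]| = #|[set z : I * V * T | R z.1 z.2]|)%N.
  rewrite card_set_sum -(pair_bigA _ (fun x a => R x a : nat)) /= exchange_big /=.
  by apply: eq_bigr => a _; rewrite card_set_sum.
rewrite !sum_set in le; apply: leq_trans le _; apply: leq_add.
  by apply: monomials_le; apply: leq_ltn_trans ltd; rewrite leq_addr.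
rewrite leq_mul2l; apply/orP; right; apply: eq_leq.
rewrite /Z0; under [RHS]eq_bigr => j _ do rewrite card_set_sum -(pair_bigA _ (fun x a => ((dg x + be a == d + gam + tau j)%N && (x.2 k0 == 0 :> nat)) : nat)) /= exchange_big /=.
rewrite [RHS]exchange_big /=; apply: eq_bigr => a _; rewrite card_ord card_set_sum.
by rewrite -(pair_bigA _ (fun j x => ((dg x + be a == d + gam + tau j)%N && (x.2 k0 == 0 :> nat)) : nat)).
Qed.
End GrowthStep.

(** Summed over degrees, the losses telescope to |J|^2 times the increment of [G] over a step [sg],
    while the gain is [G] itself: each step multiplies [G] by a factor bounded away from 1. *)
Lemma growth_inequality (J : finType) (tau : J -> nat) (P Z : nat -> nat) gam del taum M D :
  let G D := (\sum_(d < D.+1) P d)%N in let sg := (del - gam + gam + taum)%N in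
  (forall D, D + gam < M -> P D + Z (D + gam) <= P (D + gam))%N ->
  (forall d, d + gam < M -> (forall j, d + gam + tau j < M) -> del <= d + gam ->
     P (d + gam) + P (d + gam - del) <= P d + #|J| * \sum_j Z (d + gam + tau j))%N ->
  (gam <= del)%N -> (forall j, tau j <= taum)%N -> (D + sg < M)%N ->
  (G D + #|J| * #|J| * G D <= #|J| * #|J| * G (D + sg))%N.
Proof.
move=> G sg H1 H2 gd tm DM.
pose H x := (\sum_(d < x) P d)%N.
have H_add u x : (H (u + x) = H u + \sum_(d < x) P (u + d))%N by rewrite /H big_split_ord.
have H_mono u x : (u <= x)%N -> (H u <= H x)%N by move=> le; rewrite -(subnKC le) H_add leq_addr.
(* With [s + d] in place of [d], the degree [d + gam - del] of the gain runs through 0 .. D. *)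
pose s := (del - gam)%N.
pose A j := (\sum_(d < D.+1) P (s + tau j + d))%N.
pose B j := (\sum_(d < D.+1) P (s + tau j + gam + d))%N.
have step d : (d <= D)%N -> (P d + #|J| * \sum_j P (s + tau j + d) <= #|J| * \sum_j P (s + tau j + gam + d))%N.
  move=> dD; have ltM j : (s + d + gam + tau j < M)%N.
    by have := tm j; move: DM dD; rewrite /sg -/s; clear; lia.
  have ltM' : (s + d + gam < M)%N by move: DM dD; rewrite /sg -/s; clear; lia.
  have := H2 (s + d)%N ltM' ltM; have -> : (s + d + gam - del = d)%N by rewrite /s; move: gd; clear; lia.
  have dl : (del <= s + d + gam)%N by rewrite /s; move: gd; clear; lia.
  move=> /(_ dl) le2.
  have le1 := H1 _ ltM'.
  have le3 : (P d <= #|J| * \sum_j Z (s + d + gam + tau j))%N by move: le1 le2; clear; lia.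
  apply: leq_trans (_ : (#|J| * \sum_j (Z (s + d + gam + tau j) + P (s + tau j + d)) <= _)%N).
    by rewrite big_split /= mulnDr leq_add2r.
  rewrite leq_mul2l; apply/orP; right; apply: leq_sum => j _.
  have := H1 (s + tau j + d)%N.
  have -> : (s + tau j + d + gam = s + d + gam + tau j)%N by clear; lia.
  by move/(_ (ltM j)); rewrite addnC; have -> : (s + tau j + gam + d = s + d + gam + tau j)%N by clear; lia.
have sum1 : (G D + #|J| * \sum_j A j <= #|J| * \sum_j B j)%N.
  rewrite /A /B exchange_big [X in (_ <= _ * X)%N]exchange_big /= !big_distrr /= -big_split.
  by apply: leq_sum => d _; apply: step; rewrite -ltnS.
(* Two windows of length D + 1, [gam] apart: the difference of their sums is at most the increment
   of [G]. *)
have pure j : (B j + G D <= G (D + sg) + A j)%N.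
  have e1 := H_add (s + tau j + gam)%N D.+1; have e2 := H_add (s + tau j)%N D.+1.
  have l1 : (H (s + tau j + gam + D.+1) <= H (D + sg).+1)%N.
    by apply: H_mono; have := tm j; rewrite /sg -/s; clear; lia.
  have l2 : (H D.+1 <= H (s + tau j + D.+1))%N by apply: H_mono; rewrite leq_addl.
  have l3 : (H (s + tau j) <= H (s + tau j + gam))%N by apply: H_mono; rewrite leq_addr.
  rewrite -/(A j) in e2; rewrite -/(B j) in e1; rewrite -[G D]/(H D.+1) -[G _]/(H (D + sg).+1).
  by move: e1 e2 l1 l2 l3; clear; lia.
have sum2 : (\sum_j B j + #|J| * G D <= #|J| * G (D + sg) + \sum_j A j)%N.
  by rewrite -!sum_nat_const -!big_split /=; apply: leq_sum => j _; apply: pure.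
move: sum1 sum2; set a := (\sum_j A j)%N; set b := (\sum_j B j)%N; set x := G D; set y := G _; set z := #|J|.
by clear; nia.
Qed.

Section GrowthAbsurd.
Variables (K : closedFieldType) (p : nat) (charK : p \in [pchar K]) (n m c : nat).
Local Notation N := (3 + n)%N.
Local Notation S := {mpoly K[N]}.
Local Notation P := {mpoly K[m]}.
Variables (f : 'I_m -> S) (r : 'I_c -> P) (h : 'I_N -> P).
Let g k := (h k)^$ f.
Local Notation A := (imf f).
Hypothesis ker_f : forall x : P, x^$ f = 0 <-> in_ideal r x.
Hypothesis le_cNm : (c + N <= m)%N.
Variables (w : 'I_m -> nat) (e : 'I_c -> nat) (gam : nat).
Local Notation wc := (wcomp (fun=> 1%N)).
Local Notation sh := (whom (fun=> 1%N)).
Hypothesis w_gt0 : forall i, (0 < w i)%N.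
Hypothesis e_gt0 : forall i, (0 < e i)%N.
Hypothesis gam_gt0 : (0 < gam)%N.
Hypothesis hom_f : forall i, sh (w i) (f i).
Hypothesis hom_r : forall i, whom w (e i) (r i).
Hypothesis hom_h : forall k, whom w gam (h k).
Variables (DP DS : nat).
Hypothesis DP_t : forall mu, (DP <= wdeg w mu)%N -> in_ideal (catf r h) 'X_[mu].
Hypothesis DS_g : forall mu, (DS <= wdeg (fun=> 1%N) mu)%N -> in_ideal g 'X_[mu].

(** High monomials lie in the ideal of the parameters, so a finite homogeneous basis exists, and
    [le_cNm] makes the module free. *)
Lemma parameters_free : exists (I : finType) (b : I -> P) (bd : I -> nat),
  [/\ forall i, whom w (bd i) (b i),
      forall x, exists F : I -> {mpoly K[c + N]}, x = \sum_i b i * (F i)^$ (catf r h) &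
      forall F : I -> {mpoly K[c + N]}, \sum_i b i * (F i)^$ (catf r h) = 0 -> forall i, F i = 0].
Proof.
have hom_t j : whom w (catf e (fun=> gam) j) (catf r h j).
  by case: (split_ordP j) => i ->; rewrite ?catfL ?catfR.
have t_gt0 j : (0 < catf e (fun _ : 'I_N => gam) j)%N by case: (split_ordP j) => i ->; rewrite ?catfL ?catfR.
have [I [b [bd [hb ib sb]]]] := graded_basis w_gt0 t_gt0 hom_t DP_t.
by exists I, b, bd; split=> // F; apply: (free_over_parameters charK sb ib le_cNm).
Qed.

Lemma parameters_free' : exists (I : finType) (b : I -> S),
  (forall x, exists F : I -> {mpoly K[N]}, x = \sum_i b i * (F i)^$ g) /\
  (forall F : I -> {mpoly K[N]}, \sum_i b i * (F i)^$ g = 0 -> forall i, F i = 0).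
Proof.
have hom_g j : sh gam (g j) by rewrite /whom /g -(wcomp_subst _ _ hom_f) hom_h.
have one_gt0 (i : 'I_N) : (0 < (fun=> 1) i)%N by [].
have [I [b [bd [hb ib sb]]]] := graded_basis one_gt0 (fun=> gam_gt0) hom_g DS_g.
by exists I, b; split=> // F; apply: (free_over_parameters charK sb ib (leqnn _)).
Qed.

Lemma imf_saturated i j z : A (g (lshift n 1) ^+ i * z) -> A (g (lshift n 0) ^+ j * z) -> A z.
Proof.
have [I [b [bd [hb sb fb]]]] := parameters_free.
have [I' [b' [sb' fb']]] := parameters_free'.
by apply: (imf_sat sb fb sb' fb' ker_f); rewrite eq_lshift.
Qed.

Variable B : S -> Prop.
Hypothesis BB : forall x y, B x -> B y -> B (x - y).
Hypothesis BM : forall x y, B x -> B y -> B (x * y).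
Hypothesis AB : forall x, A x -> B x.
Hypothesis Bwc : forall d x, B x -> B (wc d x).
Hypothesis Bsat : forall i j z, B (g (lshift n 1) ^+ i * z) -> B (g (lshift n 0) ^+ j * z) -> B z.

Variables (TR : {additive S -> S}) (J : finType) (xx yy : 'I_3 -> J -> S) (tau : J -> nat).
Hypothesis TRZ : forall a x, TR (a *: x) = a *: TR x.
Hypothesis TRA : forall a x, A a -> TR (a * x) = a * TR x.
Hypothesis TRX : forall q x, TR (x ^+ (p ^ q)) = TR x ^+ (p ^ q).
Hypothesis TRwc : forall d x, TR (wc d x) = wc d (TR x).
Hypothesis TR_A : forall q k j x, B x -> A (TR (yy k j ^+ (p ^ q) * x)).
Hypothesis TR_K : forall q k x, B x ->
  \sum_j xx k j ^+ (p ^ q) * TR (yy k j ^+ (p ^ q) * x) = g (lshift n k) ^+ (p ^ q) * x.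
Hypothesis xx_B : forall k j, B (xx k j).
Hypothesis yy_hom : forall j, sh (tau j) (yy 1 j).

Variables (s : S) (del : nat).
Hypothesis s_B : B s.
Hypothesis s_hom : sh del s.
Hypothesis s_ind : forall x y, A x -> A y -> x + s * y = 0 -> y = 0.
Hypothesis le_gam_del : (gam <= del)%N.

Theorem pullback_absurd : False.
Proof.
have [I [b [bd [hb sb fb]]]] := parameters_free.
have [I' [b' [sb' fb']]] := parameters_free'.
have [i0] : inhabited I.
  apply: NNPP => nI; have [F] := sb 1; rewrite big1 => [/eqP|i _]; first by rewrite oner_eq0.
  by case: nI.
pose taum := (\max_j tau j)%N; pose sg := (del - gam + gam + taum)%N.
(* The successor keeps [C] positive when [J] is empty; monotonicity of [G] pays for it. *)
pose C := (#|J| * #|J|).+1.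
have [j jP] := @growth_contradiction #|I| (N + c) C sg (bd i0) isT.
(* [ee] is chosen after the number [j] of steps, so that [p ^ ee] exceeds every degree reached. *)
pose ee := (bd i0 + j * sg + sg + gam + taum).+1.
have pp : prime p := pcharf_prime charK.
have ltQ : (ee < p ^ ee)%N := ltn_expl _ (prime_gt1 pp).
pose Pd := (fun D => #|[set z : I * {ffun 'I_N -> 'I_(p ^ ee)} * {ffun 'I_c -> 'I_(p ^ ee)} |
   (bd z.1.1 + gam * \sum_k z.1.2 k + \sum_i z.2 i * e i == D)%N]|).
pose Z0 := (fun D => #|[set z : I * {ffun 'I_N -> 'I_(p ^ ee)} * {ffun 'I_c -> 'I_(p ^ ee)} |
   (bd z.1.1 + gam * \sum_k z.1.2 k + \sum_i z.2 i * e i == D)%N && (z.1.2 (lshift n 0) == 0 :> nat)]|).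
pose G := (fun D => \sum_(d < D.+1) Pd d)%N.
have Q0 : (0 < p ^ ee)%N by apply: leq_ltn_trans ltQ.
apply: (jP G).
- pose z0 : I * {ffun 'I_N -> 'I_(p ^ ee)} * {ffun 'I_c -> 'I_(p ^ ee)} :=
    (i0, [ffun=> Ordinal Q0], [ffun=> Ordinal Q0]).
  rewrite /G (bigD1 ord_max) //= addn_gt0; apply/orP; left; apply/card_gt0P; exists z0.
  rewrite inE /= !big1 ?muln0 ?addn0 //; by move=> k _; rewrite ffunE.
(* All exponents are at most the degree, which gives a polynomial bound that does not involve
   [Q]. *)
- move=> D; have -> : G D = #|[set z : I * {ffun 'I_N -> 'I_(p ^ ee)} * {ffun 'I_c -> 'I_(p ^ ee)} |
   (bd z.1.1 + gam * \sum_k z.1.2 k + \sum_i z.2 i * e i < D.+1)%N]|.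
    rewrite /G /Pd; under eq_bigr => d _ do rewrite card_set_sum.
    rewrite card_set_sum exchange_big /=; apply: eq_bigr => z _.
    set u := (_ + _ + _)%N; case: ltnP => [lt|ge].
      rewrite (bigD1 (Ordinal lt)) //= eqxx big1 ?addn0 // => k /eqP ne.
      by case: eqP => // E; case: ne; apply/val_inj.
    by rewrite big1 // => k _; case: eqP => // E; move: (ltn_ord k); rewrite -E ltnNge ge.
  have -> : (#|I| * D.+1 ^ (N + c) = #|{: I * {ffun 'I_N -> 'I_D.+1} * {ffun 'I_c -> 'I_D.+1}}|)%N.
    by rewrite !card_prod !card_ffun !card_ord expnD mulnA.
  pose cut (z : I * {ffun 'I_N -> 'I_(p ^ ee)} * {ffun 'I_c -> 'I_(p ^ ee)}) :
    I * {ffun 'I_N -> 'I_D.+1} * {ffun 'I_c -> 'I_D.+1} :=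
    (z.1.1, [ffun k => inord (z.1.2 k)], [ffun i => inord (z.2 i)]).
  rewrite -(card_in_imset (f := cut)) ?max_card // => z z'; rewrite !inE => Hz Hz' E.
  have lek (z1 : I * {ffun 'I_N -> 'I_(p ^ ee)} * {ffun 'I_c -> 'I_(p ^ ee)}) k :
    (bd z1.1.1 + gam * \sum_k z1.1.2 k + \sum_i z1.2 i * e i < D.+1)%N -> (z1.1.2 k < D.+1)%N.
    apply: leq_ltn_trans; rewrite -addnA; apply: leq_trans (leq_addl _ _); apply: leq_trans (leq_addr _ _).
    by rewrite (leq_trans _ (leq_pmull _ gam_gt0)) // (bigD1 k) //= leq_addr.
  have lei (z1 : I * {ffun 'I_N -> 'I_(p ^ ee)} * {ffun 'I_c -> 'I_(p ^ ee)}) i :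
    (bd z1.1.1 + gam * \sum_k z1.1.2 k + \sum_i z1.2 i * e i < D.+1)%N -> (z1.2 i < D.+1)%N.
    apply: leq_ltn_trans; apply: leq_trans (leq_addl _ _).
    by rewrite (bigD1 i) //= (leq_trans _ (leq_addr _ _)) // leq_pmulr.
  have E1 : z.1.1 = z'.1.1 by move: E => /(congr1 (fun z => z.1.1)).
  have E2 : z.1.2 = z'.1.2.
    apply/ffunP => k; apply/val_inj => /=.
    have : val ((cut z).1.2 k) = val ((cut z').1.2 k) by rewrite E.
    rewrite /= !ffunE !inordK //; exact: lek.
  have E3 : z.2 = z'.2.
    apply/ffunP => k; apply/val_inj => /=.
    have : val ((cut z).2 k) = val ((cut z').2 k) by rewrite E.
    rewrite /= !ffunE !inordK //; exact: lei.
  by case: z z' {Hz Hz' E} E1 E2 E3 => [[? ?] ?] [[? ?] ?] /= -> -> ->.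
move=> i ltij.
have tm j' : (tau j' <= taum)%N by apply: leq_bigmax.
have lt_i : (bd i0 + i * sg + sg < p ^ ee)%N.
  apply: leq_ltn_trans ltQ; rewrite /ee; have : (i * sg <= j * sg)%N by rewrite leq_mul2r ltnW ?orbT.
  by clear; set u := (i * sg)%N; set v := (j * sg)%N; lia.
have H1 D : (D + gam < p ^ ee)%N -> (Pd D + Z0 (D + gam) <= Pd (D + gam))%N.
  exact: Pd_shift.
have H2 d : (d + gam < p ^ ee)%N -> (forall j, d + gam + tau j < p ^ ee)%N -> (del <= d + gam)%N ->
    (Pd (d + gam) + Pd (d + gam - del) <= Pd d + #|J| * \sum_j Z0 (d + gam + tau j))%N.
  move=> l1 l2 l3.
  exact: (growth_step charK sb fb sb' fb' ker_f e_gt0 gam_gt0 hom_f hom_r hom_h hb BB BM AB Bwc Bsat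
    TRZ TRA TRX TRwc TR_A TR_K xx_B yy_hom s_B s_hom s_ind l1 l2 l3).
have := growth_inequality H1 H2 le_gam_del tm lt_i; rewrite -/(G _) -/sg -/(G _).
have -> : (bd i0 + i.+1 * sg = bd i0 + i * sg + sg)%N by clear; ring.
have GM : (G (bd i0 + i * sg) <= G (bd i0 + i * sg + sg))%N.
  move: (bd i0 + i * sg)%N => x; rewrite /G -[(x + sg).+1]addSn big_split_ord /=; exact: leq_addr.
rewrite /C; move: GM; set x := G _; set y := G _; set z := (#|J| * #|J|)%N; clear; nia.
Qed.
End GrowthAbsurd.

(** * Hilbert basis theorem, specialisation and Nullstellensatz *)

Lemma nat_min (P : nat -> Prop) : (exists n, P n) -> exists2 n, P n & forall k, P k -> (n <= k)%N.
Proof.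
move=> [n Pn]; apply: NNPP => H.
suff Q k : forall i, (i < k)%N -> ~ P i by apply: (Q n.+1 n).
elim: k => [|k IH] i //; rewrite ltnS leq_eqVlt => /orP[/eqP ->|/IH //] Pk.
by apply: H; exists k => // j Pj; rewrite leqNgt; apply/negP => /IH; apply.
Qed.

Lemma dep_choice (T : Type) (R : T -> T -> Prop) (x0 : T) : (forall x, exists y, R x y) ->
  exists s : nat -> T, s 0%N = x0 /\ forall i, R (s i) (s i.+1).
Proof.
move=> H; pose nx x := proj1_sig (constructive_indefinite_description _ (H x)).
exists (fun i => iter i nx x0); split=> // i.
by rewrite iterS /nx; case: (constructive_indefinite_description _ _).
Qed.

Lemma monotone_subsequence (u : nat -> nat) : exists s : nat -> nat,
  (forall i, s i < s i.+1)%N /\ forall i j, (i <= j)%N -> (u (s i) <= u (s j))%N.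
Proof.
pose good a := forall k, (a <= k)%N -> (u a <= u k)%N.
have good_ex b : exists2 a, (b <= a)%N & good a.
  have [|n [a ab <-] na] := @nat_min (fun n => exists2 a, (b <= a)%N & u a = n); first by exists (u b), b.
  by exists a => // k ak; apply: na; exists k => //; apply: leq_trans ak.
have [a0 _ ga0] := good_ex 0%N.
have [|s [s0 sS]] := @dep_choice {a | good a} (fun a b => (proj1_sig a < proj1_sig b)%N) (exist _ a0 ga0).
  by move=> [a ga]; have [b ab gb] := good_ex a.+1; exists (exist _ b gb).
exists (fun i => proj1_sig (s i)); split=> // i j ij; apply: (proj2_sig (s i)).
elim: j ij => [|j IH]; first by rewrite leqn0 => /eqP ->.
by rewrite leq_eqVlt => /orP[/eqP -> //|/IH le]; apply: (leq_trans le); apply: ltnW.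
Qed.

Lemma dickson n (mu : nat -> 'X_{1..n}) : exists i j, (i < j)%N /\ (mu i <= mu j)%MM.
Proof.
have H b : (b <= n)%N -> exists s : nat -> nat, (forall i, s i < s i.+1)%N /\
    forall k : 'I_n, (k < b)%N -> forall i j, (i <= j)%N -> (mu (s i) k <= mu (s j) k)%N.
  elim: b => [_|b IH lb]; first by exists id.
  have [s [sS sm]] := IH (ltnW lb); pose k0 : 'I_n := Ordinal lb.
  have [t [tS tm]] := monotone_subsequence (fun i => mu (s i) k0).
  have s_mono f : (forall i, f i < f i.+1)%N -> forall i j, (i <= j)%N -> (f i <= f j)%N.
    move=> fS i j; elim: j => [|j IHj]; first by rewrite leqn0 => /eqP ->.
    by rewrite leq_eqVlt => /orP[/eqP -> //|/IHj le]; apply: (leq_trans le); apply: ltnW.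
  exists (s \o t); split=> [i|k] /=.
    by apply: leq_trans (s_mono _ sS _ _ (tS i)); apply: sS.
  rewrite ltnS leq_eqVlt => /orP[/eqP kb|lt] i j ij.
    by have -> : k = k0 by [apply/val_inj]; exact: tm.
  by apply: sm => //; apply: s_mono.
have [s [sS sm]] := H n (leqnn n).
exists (s 0%N), (s 1%N); split=> //; apply/mnm_lepP => k; exact: sm.
Qed.

Definition is_ideal (R : comNzRingType) (I : R -> Prop) :=
  [/\ I 0, forall x y, I x -> I y -> I (x + y) & forall a x, I x -> I (a * x)].

Section IsIdeal.
Variables (R : comNzRingType) (I : R -> Prop) (hI : is_ideal I).
Lemma ideal0 : I 0. Proof. by case: hI. Qed.
Lemma idealD x y : I x -> I y -> I (x + y). Proof. by case: hI => _ + _; apply. Qed.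
Lemma idealMl a x : I x -> I (a * x). Proof. by case: hI => _ _; apply. Qed.
Lemma idealMr a x : I x -> I (x * a). Proof. by rewrite mulrC; apply: idealMl. Qed.
Lemma idealN x : I x -> I (- x). Proof. by rewrite -mulN1r; apply: idealMl. Qed.
Lemma idealB x y : I x -> I y -> I (x - y). Proof. by move=> ? /idealN; apply: idealD. Qed.
Lemma ideal_sum (J : Type) (r : seq J) (P : pred J) F : (forall j, P j -> I (F j)) ->
  I (\sum_(j <- r | P j) F j).
Proof. by move=> HF; elim/big_ind: _ => //; [exact: ideal0|exact: idealD]. Qed.
Lemma ideal_in_ideal l (t : 'I_l -> R) x : (forall i, I (t i)) -> in_ideal t x -> I x.
Proof. by move=> It [q ->]; apply: ideal_sum => j _; apply: idealMr. Qed.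
Lemma idealBr x y : I (x - y) -> I y -> I x. Proof. by move=> a b; rewrite -(subrK y x); apply: idealD. Qed.
End IsIdeal.

Lemma in_ideal_ideal (R : comNzRingType) l (t : 'I_l -> R) : is_ideal (in_ideal t).
Proof. by split; [exact: in_ideal0|exact: in_idealD|move=> a x; exact: in_idealMl]. Qed.

(** Otherwise elements of minimal leading monomial outside the ideal generated so far can be chosen
    forever; by Dickson's lemma one leading monomial divides a later one, and subtracting the
    multiple contradicts minimality. *)
Theorem hilbert_basis (K : fieldType) n (I : {mpoly K[n]} -> Prop) : is_ideal I ->
  exists l (t : 'I_l -> {mpoly K[n]}), (forall i, I (t i)) /\ forall x, I x -> in_ideal t x.
Proof.
move=> hI; apply: NNPP => H.
pose idl (s : seq {mpoly K[n]}) := in_ideal (fun i : 'I_(size s) => s`_i).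
have ex s : (forall x, x \in s -> I x) -> exists x, [/\ I x, ~ idl s x &
    forall y, I y -> ~ idl s y -> ~ (mlead y < mlead x)%O].
  move=> Is; apply: NNPP => N.
  have A m : forall x, mlead x = m -> I x -> idl s x.
    elim/(@ltmwf n): m => m IH x xm Ix; apply: NNPP => nx; apply: N; exists x; split=> // y Iy ny lt.
    by apply: ny; apply: (IH (mlead y)); rewrite -?xm.
  apply: H; exists (size s), (fun i => s`_i); split=> [i|x Ix]; last exact: (A (mlead x)).
  by apply: Is; rewrite mem_nth.
pose T := {s : seq {mpoly K[n]} | forall x, x \in s -> I x}.
have I_nil x : x \in ([::] : seq {mpoly K[n]}) -> I x by [].
have [|f [f0 fS]] := @dep_choice T (fun s s' => exists x, [/\ proj1_sig s' = rcons (proj1_sig s) x, I x, ~ idl (proj1_sig s) x &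
    forall y, I y -> ~ idl (proj1_sig s) y -> ~ (mlead y < mlead x)%O]) (exist _ [::] I_nil).
  move=> [s Is]; have [x [Ix nx mx]] := ex s Is.
  have Is' y : y \in rcons s x -> I y by rewrite mem_rcons inE => /orP[/eqP ->|/Is].
  by exists (exist _ _ Is'), x.
have [x xE] : exists x : nat -> {mpoly K[n]}, forall i, [/\ proj1_sig (f i.+1) = rcons (proj1_sig (f i)) (x i), I (x i), ~ idl (proj1_sig (f i)) (x i) &
    forall y, I y -> ~ idl (proj1_sig (f i)) y -> ~ (mlead y < mlead (x i))%O].
  exists (fun i => proj1_sig (constructive_indefinite_description _ (fS i))) => i.
  by case: (constructive_indefinite_description _ _).
have [i [j [ij le]]] := dickson (fun i => mlead (x i)).
have mem k : (i < k)%N -> x i \in proj1_sig (f k).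
  elim: k => // k IH; rewrite ltnS leq_eqVlt; have [-> _ _ _] := xE k.
  by rewrite mem_rcons inE => /orP[/eqP ->|/IH ->]; rewrite ?eqxx ?orbT.
have idl_i a : idl (proj1_sig (f j)) (a * x i).
  have lt := mem j ij; rewrite -index_mem in lt.
  exists (fun k => if k == Ordinal lt then a else 0).
  rewrite (bigD1 (Ordinal lt)) //= eqxx nth_index -?index_mem // mulrC big1 ?addr0 // => k /negPf ->.
  by rewrite mulr0.
have [_ Ij nj mj] := xE j; have [_ Ii ni _] := xE i.
have nz_i : x i != 0 by apply/eqP => E; apply: ni; rewrite E; apply: in_ideal0.
have nz_j : x j != 0 by apply/eqP => E; apply: nj; rewrite E; apply: in_ideal0.
pose c := mleadc (x j) / mleadc (x i).
have c0 : mleadc (x i) != 0 by rewrite mleadc_eq0.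
pose q := (c *: 'X_[mlead (x j) - mlead (x i)]) * x i.
have c_nz : c != 0 by rewrite mulf_neq0 ?invr_eq0 ?mleadc_eq0.
have qE : q = c *: ('X_[mlead (x j) - mlead (x i)] * x i) by rewrite /q scalerAl.
have q_nz : q != 0.
  rewrite qE scaler_eq0 (negPf c_nz) mulf_eq0 (negPf nz_i) orbF.
  by apply/eqP => /(congr1 (fun u => u@_(mlead (x j) - mlead (x i)))); rewrite mcoeffX eqxx mcoeff0 => /eqP; rewrite oner_eq0.
have lq : mlead q = mlead (x j).
  rewrite qE mleadZ // mleadM ?mleadXm ?submK //.
  by apply/eqP => /(congr1 (fun u => u@_(mlead (x j) - mlead (x i)))); rewrite mcoeffX eqxx mcoeff0 => /eqP; rewrite oner_eq0.
have cq : q@_(mlead (x j)) = mleadc (x j).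
  rewrite qE mcoeffZ [_ * x i]mulrC -[X in _@_X](submK le) mcoeffMX /c divfK //.
have nz : x j - q != 0.
  by apply/eqP => /subr0_eq E; apply: nj; rewrite E; apply: idl_i.
apply: (mj (x j - q)).
- by apply: idealB => //; apply: idealMl.
- move=> Hq; apply: nj; rewrite -(subrK q (x j)); apply: in_idealD => //; exact: idl_i.
have le_lead : (mlead (x j - q) <= mlead (x j))%O.
  have := msuppB_le (mlead_supp nz); rewrite mem_cat => /orP[/msupp_le_mlead //|/msupp_le_mlead].
  by rewrite lq.
rewrite Order.POrderTheory.lt_neqAle le_lead andbT; apply/eqP => E.
by have := mlead_supp nz; rewrite E mcoeff_msupp mcoeffB cq subrr eqxx.
Qed.

(** Noetherian maximality by dependent choice: the union of a strictly increasing sequence of ideals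
    would be finitely generated. *)
Lemma maximal_ideal (K : fieldType) n (P : ({mpoly K[n]} -> Prop) -> Prop) I0 :
  is_ideal I0 -> P I0 ->
  exists I, [/\ is_ideal I, P I & forall I', is_ideal I' -> P I' -> (forall x, I x -> I' x) -> forall x, I' x -> I x].
Proof.
move=> h0 P0; apply: NNPP => H.
pose T := {I : {mpoly K[n]} -> Prop | is_ideal I /\ P I}.
have [|f [f0 fS]] := @dep_choice T (fun I I' => (forall x, proj1_sig I x -> proj1_sig I' x) /\ exists2 x, proj1_sig I' x & ~ proj1_sig I x)
   (exist _ I0 (conj h0 P0)).
  move=> [I [hI PI]]; apply: NNPP => N; apply: H; exists I; split=> // I' hI' PI' sub x I'x.
  by apply: NNPP => nx; apply: N; exists (exist _ I' (conj hI' PI')); split=> //; exists x.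
have mono i j x : (i <= j)%N -> proj1_sig (f i) x -> proj1_sig (f j) x.
  move=> ij Hi; elim: j ij => [|j IH]; first by rewrite leqn0 => /eqP <-.
  by rewrite leq_eqVlt => /orP[/eqP <- //|/IH]; case: (fS j) => + _; apply.
have hf i : is_ideal (proj1_sig (f i)) by case: (proj2_sig (f i)).
have [] := @hilbert_basis K n (fun x => exists i, proj1_sig (f i) x).
  split; first by exists 0%N; apply: ideal0.
    move=> x y [i Hi] [j Hj]; exists (maxn i j); apply: idealD => //.
      by apply: mono Hi; apply: leq_maxl.
    by apply: mono Hj; apply: leq_maxr.
  by move=> a x [i Hi]; exists i; apply: idealMl.
move=> l [t [/fin_all_exists[s st] gen]].
pose M := \max_i s i; have [_ [x Hx nx]] := fS M.
apply: nx; apply: (ideal_in_ideal (hf M) (t := t)) => [i|].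
  by apply: mono (st i); apply: leq_bigmax.
by apply: gen; exists M.+1.
Qed.

Definition is_prime_ideal (R : comNzRingType) (I : R -> Prop) :=
  [/\ is_ideal I, ~ I 1 & forall x y, I (x * y) -> I x \/ I y].

(** * Extension of homomorphisms by one variable *)

Section Extension.
Variables (D : comNzRingType) (P : {poly D} -> Prop).
Hypothesis prP : is_prime_ideal P.
Let hI : is_ideal P. Proof. by case: prP. Qed.
Let prM x y : P (x * y) -> P x \/ P y. Proof. by case: prP => _ _; apply. Qed.
Let p0 (a : D) := P a%:P.
Let p0M a b : ~ p0 a -> ~ p0 b -> ~ p0 (a * b).
Proof. by rewrite /p0 polyCM => na nb /prM[]. Qed.
Let p0X a k : ~ p0 a -> ~ p0 (a ^+ k).
Proof.
move=> na; elim: k => [|k IH]; last by rewrite exprS; apply: p0M.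
by rewrite expr0; case: prP => _ + _; rewrite /p0 polyC1.
Qed.
(** Congruence modulo [cf] is equality of polynomials over the residue domain of the contracted
    prime, which is never formed. *)
Let cf (F : {poly D}) := forall i, p0 F`_i.
Let cf_P F : cf F -> P F.
Proof.
move=> cF; rewrite -[F]coefK poly_def; apply: (ideal_sum hI) => i _.
by rewrite -mul_polyC; apply: idealMr => //; apply: cF.
Qed.
Let p0D a b : p0 a -> p0 b -> p0 (a + b). Proof. by rewrite /p0 polyCD; apply: idealD. Qed.
Let p0Ml a b : p0 b -> p0 (a * b). Proof. by rewrite /p0 polyCM; apply: idealMl. Qed.
Let cfD F G : cf F -> cf G -> cf (F + G). Proof. by move=> cF cG i; rewrite coefD; apply: p0D. Qed.
Let cfM F G : cf G -> cf (F * G).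
Proof.
move=> cG i; rewrite coefM /p0 raddf_sum; apply: (ideal_sum hI) => j _; exact: p0Ml.
Qed.
Let cfN F : cf F -> cf (- F). Proof. by rewrite -mulN1r; apply: cfM. Qed.

(* Dropping the top coefficients that lie in the contraction of the prime makes the leading coefficient a non-element. *)
Let trim F : ~ cf F -> exists2 G, cf (F - G) & ~ p0 (lead_coef G) /\ (size G <= size F)%N.
Proof.
have [k] := ubnP (size F); elim: k F => // k IH F ltk nF.
have [H|H] := classic (p0 (lead_coef F)); last first.
  by exists F; rewrite ?subrr //; move=> i; rewrite coef0 /p0 polyC0; apply: ideal0.
pose F' := F - (lead_coef F)%:P * 'X^((size F).-1).
have cl : cf ((lead_coef F)%:P * 'X^((size F).-1)).
  by move=> i; rewrite coefCM mulrC; apply: p0Ml.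
have F0 : F != 0.
  by apply/eqP => E; apply: nF => i; rewrite E coef0 /p0 polyC0; apply: ideal0.
have ltF : (size F' < size F)%N.
  rewrite -[X in (_ < X)%N]prednK ?size_poly_gt0 // ltnS; apply/leq_sizeP => j le.
  rewrite coefB coefCM coefXn; case: eqP => [->|ne]; first by rewrite mulr1 subrr.
  rewrite mulr0 subr0; apply: (leq_sizeP _ _ (leqnn _)).
  by move: ne le; rewrite -{2}(prednK (n := size F)) ?size_poly_gt0 //; lia.
have nF' : ~ cf F' by move=> c; apply: nF; rewrite -(subrK ((lead_coef F)%:P * 'X^((size F).-1)) F); apply: cfD.
have [|G cG [nG sG]] := IH F' _ nF'; first by apply: leq_trans ltF _; rewrite -ltnS.
exists G; last by split=> //; apply: leq_trans sG (ltnW ltF).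
have -> : F - G = (F' - G) + (lead_coef F)%:P * 'X^((size F).-1) by rewrite /F'; ring.
exact: cfD.
Qed.

Let pdiv (h : {poly D}) : h != 0 -> forall F, exists k q r,
  (lead_coef h ^+ k)%:P * F = q * h + r /\ (size r < size h)%N.
Proof.
move=> h0 F; have [k] := ubnP (size F); elim: k F => // k IH F ltk.
have [lt|ge] := ltnP (size F) (size h).
  by exists 0%N, 0, F; rewrite expr0 polyC1 mul1r mul0r add0r.
have F0 : F != 0 by rewrite -size_poly_gt0 (leq_trans _ ge) ?size_poly_gt0.
pose F' := (lead_coef h)%:P * F - (lead_coef F)%:P * 'X^(size F - size h) * h.
have ltF : (size F' < size F)%N.
  rewrite -[X in (_ < X)%N]prednK ?size_poly_gt0 // ltnS; apply/leq_sizeP => j le.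
  rewrite coefB coefCM -mulrA coefCM mulrC coefXnM.
  have ltj : (j < size F - size h)%N = false.
    by apply/negbTE; rewrite -leqNgt; move: le ge; rewrite -(size_poly_gt0 h) in h0; move: h0; clear; lia.
  rewrite ltj; case: (eqVneq j (size F).-1) => [->|ne].
    have -> : ((size F).-1 - (size F - size h) = (size h).-1)%N.
      by move: ge; rewrite -(size_poly_gt0 h) in h0; move: h0; clear; lia.
    by rewrite -!lead_coefE mulrC subrr.
  have lej : (size F <= j)%N by move: le ne; rewrite -(size_poly_gt0 F) in F0; move: F0; clear; lia.
  rewrite nth_default // mul0r nth_default ?mulr0 ?subrr //.
  by apply: leq_trans (leq_sub2r _ lej); rewrite subKn.
have [|k' [q [r [E lt]]]] := IH F'; first by apply: leq_trans ltF _; rewrite -ltnS.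
exists k'.+1, (q + (lead_coef h ^+ k')%:P * ((lead_coef F)%:P * 'X^(size F - size h))), r; split=> //.
rewrite mulrDl addrAC -E /F' exprSr polyCM; ring.
Qed.

Variables (b : {poly D}) (nb : ~ P b).

(** If the prime is extended from [D], the variable is free and [d] is a coefficient of [b].
    Otherwise let [g] have minimal degree in it: over the residue field of the contraction [g] is
    irreducible and prime to [b], so the Euclidean algorithm puts a constant [h] in the ideal of [b]
    and [g]. Any root of [g] works once its leading coefficient and [h] stay nonzero. *)
Lemma extension_step : exists2 d : D, ~ P d%:P &
  forall (W : closedFieldType) (psi : {rmorphism D -> W}),
  (forall c, P c%:P -> psi c = 0) -> psi d != 0 ->
  exists om, (forall F, P F -> (map_poly psi F).[om] = 0) /\ (map_poly psi b).[om] != 0.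
Proof.
have cf0 (W : closedFieldType) (psi : {rmorphism D -> W}) F : (forall c, P c%:P -> psi c = 0) -> cf F -> map_poly psi F = 0.
  by move=> k cF; apply/polyP => i; rewrite coef_map coef0; exact: k (cF i).
have [tr|nt] := classic (forall F, P F -> cf F).
  have [i ni] : exists i, ~ p0 b`_i.
    by apply: NNPP => H; apply: nb; apply: cf_P => i; apply: NNPP => H'; apply: H; exists i.
  exists b`_i => // W psi kP nz; have nb0 : map_poly psi b != 0.
    by apply/eqP => /polyP/(_ i); rewrite coef_map coef0 => /eqP; rewrite (negPf nz).
  have [om nr] := closed_nonrootP _ nb0.
  by exists om; split=> // F /tr cF; rewrite cf0 ?horner0.
have [sz [g [[Pg ng] gsz]] gmin] : exists2 n, (exists g, (P g /\ ~ cf g) /\ size g = n) &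
    forall k, (exists g, (P g /\ ~ cf g) /\ size g = k) -> (n <= k)%N.
  apply: nat_min; apply: NNPP => H; apply: nt => F PF; apply: NNPP => cF.
  by apply: H; exists (size F), F.
have {gmin}gmin F : P F -> ~ cf F -> (size g <= size F)%N by move=> PF nF; rewrite gsz; apply: gmin; exists F.
have ng1 : ~ p0 (lead_coef g).
  have [G cG [nG sG]] := trim ng.
  have PG : P G by rewrite -(opprK G) -[- G](addKr g); apply: (idealN hI); apply: (idealD hI); [apply: (idealN hI)|exact: cf_P].
  have nG' : ~ cf G by move=> c; apply: nG; apply: c.
  have sE : size G = size g by apply/eqP; rewrite eqn_leq sG gmin.
  move=> pg; apply: nG; rewrite lead_coefE sE.
  have -> : G`_(size g).-1 = lead_coef g + - (g - G)`_(size g).-1 by rewrite coefB lead_coefE opprB addrC subrK.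
  by apply: p0D => //; rewrite -coefN; apply: cfN.
(* Combinations of [b] and [g]; one of minimal degree plays the role of their greatest common
   divisor. *)
pose H h := exists u v, cf (h - u * b - v * g).
have Hg : H g by exists 0, 1; rewrite mul0r mul1r subr0 subrr => i; rewrite coef0 /p0 polyC0; apply: ideal0.
have [szh [h0 [[Hh0 nh0] hsz]] hmin0] : exists2 n, (exists h, (H h /\ ~ cf h) /\ size h = n) &
    forall k, (exists h, (H h /\ ~ cf h) /\ size h = k) -> (n <= k)%N.
  by apply: nat_min; exists (size g), g.
have Hcf x y : H x -> cf (x - y) -> H y.
  move=> [u [v c]] cxy; exists u, v; have -> : y - u * b - v * g = (x - u * b - v * g) + - (x - y) by ring.
  by apply: cfD => //; apply: cfN.
have [h cG [nh sG]] := trim nh0.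
have nh' : ~ cf h by move=> c; apply: nh; apply: c.
have Hh : H h by apply: Hcf cG.
have hmin x : H x -> ~ cf x -> (size h <= size x)%N.
  by move=> Hx nx; apply: leq_trans sG _; rewrite hsz; apply: hmin0; exists x.
have h_nz : h != 0 by apply/eqP => E; apply: nh; rewrite E lead_coef0 /p0 polyC0; apply: ideal0.
have rem x : H x -> exists k q, cf ((lead_coef h ^+ k)%:P * x - q * h).
  move=> [u [v c]]; have [k [q [r [E lt]]]] := pdiv h_nz x.
  exists k, q; have -> : (lead_coef h ^+ k)%:P * x - q * h = r by rewrite E addrC addKr.
  apply: NNPP => nr; have : (size h <= size r)%N; last by rewrite leqNgt lt.
  apply: hmin => //; have [u' [v' c']] := Hh.
  exists ((lead_coef h ^+ k)%:P * u - q * u'), ((lead_coef h ^+ k)%:P * v - q * v').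
  have -> : r - ((lead_coef h ^+ k)%:P * u - q * u') * b - ((lead_coef h ^+ k)%:P * v - q * v') * g =
      (lead_coef h ^+ k)%:P * (x - u * b - v * g) + (- q) * (h - u' * b - v' * g).
    have -> : r = (lead_coef h ^+ k)%:P * x - q * h by rewrite E addrC addKr.
    by ring.
  by apply: cfD; apply: cfM.
have [k [q cq]] := rem g Hg.
have Pqh : P (q * h).
  have -> : q * h = (lead_coef h ^+ k)%:P * g + - ((lead_coef h ^+ k)%:P * g - q * h) by ring.
  by apply: (idealD hI); [apply: idealMl|apply/(idealN hI)/cf_P].
(* The prime contains [q * h] but not [h], since [h] divides, modulo [cf], a multiple of [b] by an
   element outside the prime. *)
have Pq : P q.
  case: (prM Pqh) => // Ph.
  have [k' [q' cq']] : exists k q, cf ((lead_coef h ^+ k)%:P * b - q * h).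
    apply: rem; exists 1, 0; rewrite mul1r mul0r subrr subr0 => i; rewrite coef0 /p0 polyC0; exact: ideal0.
  have : P ((lead_coef h ^+ k')%:P * b).
    by apply: (idealBr hI (y := q' * h)); [exact: cf_P|apply: idealMl].
  by case/prM => // /(p0X nh).
have nq : ~ cf q.
  move=> c; have cg : cf ((lead_coef h ^+ k)%:P * g).
    by rewrite -(subrK (q * h) (_ * g)); apply: cfD => //; rewrite mulrC; apply: cfM.
  have := cg (size g).-1; rewrite coefCM -lead_coefE; exact: p0M (p0X nh) ng1.
have [q1 cq1 [nq1 sq1]] := trim nq.
have szq1 : (size g <= size q1)%N.
  apply: gmin; last by move=> c; apply: nq1; apply: c.
  by rewrite -(opprK q1) -[- q1](addKr q); apply: (idealN hI); apply: (idealD hI); [apply: (idealN hI)|exact: cf_P].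
(* [q] is in the prime, so its degree is at least that of [g]; comparing degrees in the division of
   a multiple of [g] by [h] leaves degree 0 for [h]. *)
have h1 : (size h <= 1)%N.
  rewrite leqNgt; apply/negP => h2.
  have c1 : cf ((lead_coef h ^+ k)%:P * g - q1 * h).
    have -> : (lead_coef h ^+ k)%:P * g - q1 * h = ((lead_coef h ^+ k)%:P * g - q * h) + h * (q - q1) by ring.
    by apply: cfD => //; apply: cfM.
  have q1_nz : q1 != 0 by apply/eqP => E; apply: nq1; rewrite E lead_coef0 /p0 polyC0; apply: ideal0.
  have := c1 (size q1 + size h).-2; rewrite coefB coefCM -mul_lead_coef.
  rewrite nth_default ?mulr0 ?sub0r; last first.
    by apply: leq_trans szq1 _; rewrite -subn2 -addnBA // leq_addr.
  move=> c2; apply: (p0M nq1 nh); rewrite -[_ * _]opprK -mulN1r; apply: p0Ml; exact: c2.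
have hC : h = (lead_coef h)%:P by rewrite [LHS](size1_polyC h1) lead_coefE; have -> : (size h).-1 = 0%N by move: h1; clear; case: (size h) => [|[|?]].
exists (lead_coef g * lead_coef h); first exact: p0M.
move=> W psi kP; rewrite rmorphM mulf_eq0 negb_or => /andP[ng0 nh0'].
have sg : (1 < size (map_poly psi g))%N.
  have g2 : (1 < size g)%N.
    rewrite ltnNge; apply/negP => g1; apply: ng1; rewrite /p0 lead_coefE.
    have -> : (size g).-1 = 0%N by move: g1; clear; case: (size g) => [|[|?]].
    by rewrite -(size1_polyC g1).
  suff -> : size (map_poly psi g) = size g by [].
  exact: size_map_poly_id0.
have /closed_rootP[om] : size (map_poly psi g) != 1%N by rewrite gtn_eqF.
rewrite rootE => /eqP go; exists om; split.
  move=> F PF.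
  have g_nz : g != 0 by apply/eqP => E; apply: ng1; rewrite E lead_coef0 /p0 polyC0; apply: ideal0.
  have [k' [q' [r [E lt]]]] := pdiv g_nz F.
  have cr : cf r.
    apply: NNPP => nr; suff Pr : P r by have := gmin r Pr nr; rewrite leqNgt lt.
    have -> : r = (lead_coef g ^+ k')%:P * F + - (q' * g) by rewrite E addrC addKr.
    by apply: (idealD hI); [exact: (idealMl hI)|apply/(idealN hI)/(idealMl hI)].
  have := congr1 (fun F => (map_poly psi F).[om]) E.
  rewrite rmorphM rmorphD rmorphM /= map_polyC /= (cf0 _ _ _ kP cr) addr0 !hornerM go mulr0 hornerC => /eqP.
  by rewrite mulf_eq0 rmorphXn expf_eq0 (negPf ng0) andbF => /eqP.
have [u [v c]] := Hh.
have := cf0 W psi _ kP c; rewrite !rmorphB !rmorphM /= => /(congr1 (horner^~ om)).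
rewrite horner0 !hornerD !hornerN !hornerM go mulr0 subr0 {1}hC map_polyC hornerC /= => E.
apply/eqP => E'; move: E; rewrite E' mulr0 subr0 => /eqP; by rewrite (negPf nh0').
Qed.
End Extension.

Lemma mmap_ext (R E : comNzRingType) n (phi psi : {rmorphism {mpoly R[n]} -> E}) :
  (forall c, phi c%:MP = psi c%:MP) -> (forall i, phi 'X_i = psi 'X_i) -> phi =1 psi.
Proof.
move=> HC HX F; elim/mpolyind: F => [|c mu F _ _ IH]; first by rewrite !rmorph0.
rewrite !rmorphD /= IH; congr (_ + _); rewrite -!mul_mpolyC !rmorphM /= HC; congr (_ * _).
by rewrite mpolyXE_id !rmorph_prod; apply: eq_bigr => i _; rewrite !rmorphXn /= HX.
Qed.

Section EvalSplit.
Variables (R E : comNzRingType) (n : nat) (j : {rmorphism R -> E}) (x : 'I_n.+1 -> E).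
Let jx : {rmorphism {mpoly R[n]} -> E} := mmap j (fun i => x (widen_ord (leqnSn n) i)).
Definition eval_last (F : {poly {mpoly R[n]}}) : E := (map_poly jx F).[x ord_max].
Fact eval_last_additive : additive eval_last.
Proof. by move=> F G; rewrite /eval_last !rmorphB /= hornerD hornerN. Qed.
Fact eval_last_mult : monoid_morphism eval_last.
Proof. by split=> [|F G]; rewrite /eval_last ?rmorph1 ?hornerC // rmorphM /= hornerM. Qed.
HB.instance Definition _ := GRing.isAdditive.Build _ _ eval_last eval_last_additive.
HB.instance Definition _ := GRing.isMonoidMorphism.Build _ _ eval_last eval_last_mult.

Lemma mmap_muni F : mmap j x F = eval_last (muni F).
Proof.
pose phi : {rmorphism {mpoly R[n.+1]} -> E} := mmap j x.
pose psi : {rmorphism {mpoly R[n.+1]} -> E} := eval_last \o muni (R := R) (n := n).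
apply: (@mmap_ext R E n.+1 phi psi) => [c|i]; rewrite /phi /psi /=.
  by rewrite mmapC muniC /eval_last map_polyC hornerC /= mmapC.
rewrite mmapX mmap1U muniE msuppX big_seq1 mcoeffX eqxx scale1r /eval_last.
rewrite -mul_polyC rmorphM /= map_polyC /= map_polyXn hornerM hornerC hornerXn mmapX.
have [->|ne] := eqVneq i ord_max.
  rewrite mnm1E eqxx expr1 /mmap1 big1 ?mul1r // => k _.
  rewrite mnmE mnm1E; case: eqP => [/(congr1 val) /= Ek|_]; last by rewrite expr0.
  by have := ltn_ord k; rewrite -Ek ltnn.
have lti : (i < n)%N by rewrite ltn_neqAle -ltnS ltn_ord andbT; apply: contra ne => /eqP E'; apply/eqP/val_inj.
rewrite mnm1E (negPf ne) expr0 mulr1 /mmap1 (bigD1 (Ordinal lti)) //= big1 ?mulr1 => [|k nk].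
  rewrite mnmE mnm1E; have -> : widen_ord (leqnSn n) (Ordinal lti) = i by apply/val_inj.
  by rewrite eqxx expr1.
rewrite mnmE mnm1E; case: eqP => [Ek|_]; last by rewrite expr0.
by case/eqP: nk; apply/val_inj; rewrite /= Ek.
Qed.
End EvalSplit.

(* Chevalley's theorem in the form needed for specialisation: homomorphisms extend from [R] to a finitely
   generated extension, keeping [b] nonzero, as soon as one element [d] of [R] stays nonzero. *)
Theorem extension_theorem (R E : comNzRingType) n (j : {rmorphism R -> E}) (x : 'I_n -> E)
    (P : E -> Prop) (b : {mpoly R[n]}) : is_prime_ideal P -> ~ P (mmap j x b) ->
  exists2 d : R, ~ P (j d) & forall (W : closedFieldType) (psi : {rmorphism R -> W}),
    (forall c, P (j c) -> psi c = 0) -> psi d != 0 ->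
    exists om : 'I_n -> W, (forall F, P (mmap j x F) -> mmap psi om F = 0) /\ mmap psi om b != 0.
Proof.
elim: n x b => [|n IH] x b prP nb.
  have bC (F : {mpoly R[0]}) : F = (F@_0)%:MP.
    apply/mpolyP => mu; rewrite mcoeffC; have -> : mu = 0%MM by apply/mnmP => -[].
    by rewrite eqxx mulr1.
  exists b@_0; first by move: nb; rewrite {1}(bC b) mmapC.
  move=> W psi kP nz; exists (fun _ => 0); split=> [F|].
    by rewrite {1 2}(bC F) !mmapC; exact: kP.
  by rewrite {1}(bC b) mmapC.
case: (prP) => hP nP1 prM.
pose Q (F : {poly {mpoly R[n]}}) := P (eval_last j x F).
have prQ : is_prime_ideal Q.
  split; rewrite /Q.
  - split=> [|F G HF HG|a F HF]; first by rewrite rmorph0; exact: ideal0.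
      by rewrite rmorphD; exact: idealD.
    by rewrite rmorphM; exact: idealMl.
  - by rewrite rmorph1.
  by move=> F G; rewrite rmorphM => /prM.
have nQ : ~ Q (muni b) by rewrite /Q -mmap_muni.
have [d nd dP] := extension_step prQ nQ.
have nd' : ~ P (mmap j (fun i => x (widen_ord (leqnSn n) i)) d).
  by move: nd; rewrite /Q /eval_last map_polyC hornerC.
have [d0 nd0 d0P] := IH _ _ prP nd'.
exists d0 => // W psi kP nz; have [om [omP omd]] := d0P W psi kP nz.
have [|//|omn [H1 H2]] := dP W (mmap psi om : {rmorphism {mpoly R[n]} -> W}).
  by move=> c; rewrite /Q /eval_last map_polyC hornerC; exact: omP.
pose om' (i : 'I_n.+1) := if insub (i : nat) is Some k then om k else omn.
have omE F : mmap psi om' F = (map_poly (mmap psi om) (muni F)).[omn].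
  rewrite mmap_muni /eval_last.
  have -> : om' ord_max = omn by rewrite /om' insubF //= ltnn.
  congr (_.[_]); apply: eq_map_poly => G; rewrite /mmap; apply: eq_bigr => mu _; congr (_ * _).
  apply: eq_bigr => i _; congr (_ ^+ _); rewrite /om' insubT //=.
  by move=> lt; congr (om _); apply/val_inj.
by exists om'; split=> [F|]; rewrite omE // mmap_muni; exact: H1.
Qed.

(** An ideal maximal among those containing the [f i] and no power of [g] is prime; the extension
    theorem over the field itself gives a zero of this ideal where [g] does not vanish. *)
Theorem nullstellensatz (K : closedFieldType) n l (f : 'I_l -> {mpoly K[n]}) g :
  (forall v : 'I_n -> K, (forall i, (f i).@[v] = 0) -> g.@[v] = 0) ->
  exists N, in_ideal f (g ^+ N).
Proof.
move=> Z; apply: NNPP => H.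
have [|I [hI PI mI]] := @maximal_ideal K n (fun I => (forall i, I (f i)) /\ forall N, ~ I (g ^+ N)) _ (in_ideal_ideal f).
  split=> [i|N]; last by move=> HN; apply: H; exists N.
  by exists (fun j => (j == i)%:R); rewrite (bigD1 i) //= eqxx mulr1 big1 ?addr0 // => k /negPf ->; rewrite mulr0.
case: PI => If Ig.
have adj a : ~ I a -> exists N y, I (g ^+ N - y * a).
  move=> na; apply: NNPP => N; apply: na.
  apply: (mI (fun z => exists y, I (z - y * a))).
  - split=> [|u v [y Hy] [y' Hy']|u v [y Hy]].
    + by exists 0; rewrite mul0r subrr; exact: ideal0.
    + by exists (y + y'); have -> : u + v - (y + y') * a = (u - y * a) + (v - y' * a) by [ring]; exact: idealD.
    + by exists (u * y); have -> : u * v - u * y * a = u * (v - y * a) by [ring]; exact: idealMl.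
  - split=> [i|k [y Hy]]; first by exists 0; rewrite mul0r subr0.
    by apply: N; exists k, y.
  - by move=> z Iz; exists 0; rewrite mul0r subr0.
  by exists 1; rewrite mul1r subrr; exact: ideal0.
have prI : is_prime_ideal I.
  split=> //; first by have := Ig 0%N; rewrite expr0.
  move=> a b Iab; apply: NNPP => /not_or_and[/adj[N [y Hy]] /adj[M [z Hz]]].
  apply: (Ig (N + M)%N); rewrite exprD.
  have -> : g ^+ N * g ^+ M = g ^+ M * (g ^+ N - y * a) + y * a * (g ^+ M - z * b) + y * z * (a * b) by ring.
  apply: (idealD hI); last exact: idealMl.
  by apply: (idealD hI); apply: idealMl.
have idE F : mmap (mpolyC n (R := K)) (fun i => 'X_i) F = F.
  have := @mmap_ext K {mpoly K[n]} n (mmap (mpolyC n (R := K)) (fun i => 'X_i) : {rmorphism _ -> _}) idfun.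
  by apply=> [c|i] /=; rewrite ?mmapC ?mmapX ?mmap1U.
have [|d nd dP] := @extension_theorem K {mpoly K[n]} n (mpolyC n (R := K) : {rmorphism K -> {mpoly K[n]}}) (fun i => 'X_i) I g prI.
  by rewrite idE; have := Ig 1%N; rewrite expr1.
have [||om [omP /eqP omg]] := dP K idfun.
- move=> c Ic; apply/eqP; apply: contraT => nz; case: prI => _ + _; case.
  by rewrite -mpolyC1 -(mulVf nz) mpolyCM; exact: idealMl.
- apply/eqP => /= d0; apply: nd; have -> : d = 0 by [].
  by rewrite /= mpolyC0; exact: ideal0.
apply: omg; have mE F : mmap idfun om F = F.@[om] by [].
rewrite mE; apply: Z => i; rewrite -mE; apply: omP; rewrite idE; exact: If.
Qed.

(** * Invariants have a Frobenius power in a separating subalgebra *)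

Lemma meval_subst (R : comNzRingType) n m (f : 'I_m -> {mpoly R[n]}) (F : {mpoly R[m]}) v :
  (F^$ f).@[v] = F.@[fun i => (f i).@[v]].
Proof. by rewrite comp_mpoly_meval; apply: meval_eq => i; rewrite tnth_mktuple. Qed.

Lemma substK (R : comNzRingType) a b c (f : 'I_a -> {mpoly R[b]}) (g : 'I_b -> {mpoly R[c]}) F :
  (F^$ f)^$ g = F^$ (fun i => (f i)^$ g).
Proof.
elim/mpolyind: F => [|x mu F _ _ IH]; first by rewrite !raddf0.
rewrite !comp_mpolyD IH; congr (_ + _); rewrite !comp_mpolyZ !substX rmorph_prod; congr (_ *: _).
by apply: eq_bigr => i _; rewrite rmorphXn.
Qed.

Lemma det_congr (R : comNzRingType) (A W : R -> Prop) N (M M' : 'M[R]_N) :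
  W 0 -> (forall x y, W x -> W y -> W (x + y)) -> (forall x y, A x -> W y -> W (x * y)) ->
  A (-1) -> A 1 -> (forall x y, A x -> A y -> A (x * y)) ->
  (forall i j, A (M i j)) -> (forall i j, A (M' i j)) -> (forall i j, W (M i j - M' i j)) ->
  W (\det M - \det M').
Proof.
move=> W0 WD WM AN1 A1 AM AMij AM'ij H; rewrite /determinant -sumrB.
elim/big_ind: _ => // s _; rewrite -mulrBr; apply: (WM).
  by case: (odd_perm s); rewrite ?expr1 ?expr0.
have AP (F : 'I_N -> R) (r : seq 'I_N) : (forall i, A (F i)) -> A (\prod_(i <- r) F i).
  by move=> HF; elim/big_ind: _.
elim: (index_enum _) => [|i r IH]; first by rewrite !big_nil subrr.
rewrite !big_cons.
have -> : M i (s i) * \prod_(j <- r) M j (s j) - M' i (s i) * \prod_(j <- r) M' j (s j) =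
   M i (s i) * (\prod_(j <- r) M j (s j) - \prod_(j <- r) M' j (s j)) + (\prod_(j <- r) M' j (s j)) * (M i (s i) - M' i (s i)).
  by rewrite !mulrBr; rewrite [(\prod_(j <- r) M' j (s j)) * M i _]mulrC [(\prod_(j <- r) M' j (s j)) * M' i _]mulrC addrA subrK.
by apply: (WD); apply: (WM) => //; apply: AP.
Qed.

(** Multiplication by [x] has a matrix with entries in [W], so its characteristic determinant at [x]
    is [x ^+ #|I|] modulo [W]. That determinant kills all [b i], one of which is 1, hence it is
    0. *)
Lemma cayley_hamilton (R : comNzRingType) (I : finType) (b : I -> R) (i0 : I) (B W : R -> Prop) (x : R)
    (F : I -> I -> R) : b i0 = 1 ->
  W 0 -> (forall x y, W x -> W y -> W (x + y)) -> (forall x y, B x -> W y -> W (x * y)) ->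
  (forall x y, B x -> B y -> B (x - y)) -> (forall x y, B x -> B y -> B (x * y)) -> B 1 -> B x ->
  (forall i j, B (F i j)) -> (forall i j, W (F i j)) -> (forall i, x * b i = \sum_j b j * F i j) ->
  W (x ^+ #|I|).
Proof.
move=> b0 W0 WD WM BB BM B1 Bx BF WF FE.
have B0 : B 0 by rewrite -(subrr 1); apply: (BB).
pose N := #|I|; pose M := \matrix_(j < N, i < N) F (enum_val i) (enum_val j).
have detM : \det (x%:M - M) = 0.
  pose bv : 'rV[R]_N := \row_j b (enum_val j).
  have bM : bv *m (x%:M - M) = 0.
    rewrite mulmxBr mul_mx_scalar; apply/rowP => i; rewrite !mxE; apply/eqP; rewrite subr_eq0; apply/eqP.
    rewrite FE (reindex (@enum_val I predT)) /=; last first.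
      by exists enum_rank => j _; rewrite ?enum_valK ?enum_rankK.
    by apply: eq_bigr => j _; rewrite !mxE.
  have := congr1 (fun v => v *m \adj (x%:M - M)) bM; rewrite -mulmxA mul_mx_adj mul0mx mul_mx_scalar.
  by move/rowP/(_ (enum_rank i0)); rewrite !mxE enum_rankK b0 mulr1.
have -> : x ^+ N = - (\det (x%:M - M) - \det (x%:M : 'M_N)) by rewrite detM det_scalar sub0r opprK.
have BN1 : B (-1) by rewrite -sub0r; apply: (BB).
rewrite -mulN1r; apply: (WM) => //.
apply: (@det_congr _ B W) => // i j; rewrite !mxE.
- by apply: (BB) => //; rewrite -mulr_natr; case: (i == j); rewrite ?mulr1 ?mulr0.
- by rewrite -mulr_natr; case: (i == j); rewrite ?mulr1 ?mulr0.
by rewrite addrAC subrr sub0r -mulN1r; apply: (WM).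
Qed.

Lemma high_monomials_of_powers (K : fieldType) n m (w : 'I_n -> nat) (f : 'I_m -> {mpoly K[n]}) (N : 'I_n -> nat) :
  (forall i, in_ideal f ('X_i ^+ N i)) ->
  exists D, forall mu : 'X_{1..n}, (D <= wdeg w mu)%N -> in_ideal f 'X_[mu].
Proof.
move=> NE; exists (\sum_i w i * N i).+1 => mu lt.
have [i le] : exists i, (N i <= mu i)%N.
  apply: NNPP => H; move: lt; rewrite ltnNge => /negP; apply; apply: leq_sum => i _; rewrite leq_mul2l.
  by rewrite [X in _ || X]leqNgt; apply/orP; right; apply/negP => lti; apply: H; exists i; apply: ltnW.
have -> : 'X_[mu] = 'X_i ^+ N i * 'X_[mu - U_(i) *+ N i] :> {mpoly K[n]}.
  rewrite mpolyXn -mpolyXD addmC submK //; apply/mnm_lepP => j; rewrite mulmnE mnm1E.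
  by have [<-|_] := eqVneq i j; rewrite ?mul1n ?mul0n.
exact: in_idealMr.
Qed.

Section Dominion.
Local Opaque comp_mpoly.
Variables (K : closedFieldType) (p : nat) (charK : p \in [pchar K]) (n m : nat).
Local Notation S := {mpoly K[n]}.
Local Notation P := {mpoly K[m]}.
Variables (f : 'I_m -> S) (w : 'I_m -> nat).
Hypothesis w_gt0 : forall i, (0 < w i)%N.
Hypothesis hom_f : forall i, whom (fun=> 1%N) (w i) (f i).
Local Notation A := (imf f).
Local Notation phi y := ((y : P)^$ f).
Hypothesis null_f : forall v : 'I_n -> K, (forall i, (f i).@[v] = 0) -> forall i, v i = 0.
Variable T : S -> Prop.
Hypothesis TM : forall x y, T x -> T y -> T (x * y).
Hypothesis T1 : T 1.
Hypothesis T_sep : forall s, T s -> forall u v : 'I_n -> K,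
  (forall i, (f i).@[u] = (f i).@[v]) -> s.@[u] = s.@[v].

Let pp : prime p := pcharf_prime charK.
Let charS : p \in [pchar S]. Proof. exact: pchar_mpoly. Qed.
Let TX s k : T s -> T (s ^+ k).
Proof. by move=> Ts; elim: k => [|k IH]; rewrite ?expr0 ?exprS //; apply: TM. Qed.

Lemma high_monomials : exists D, forall mu : 'X_{1..n}, (D <= wdeg (fun=> 1%N) mu)%N -> in_ideal f 'X_[mu].
Proof.
have [N NE] := fin_all_exists (fun i => @nullstellensatz K n m f 'X_i (fun v H => etrans (mevalXU _ _) (null_f H i))).
exact: high_monomials_of_powers NE.
Qed.

Lemma module_generators : exists (I : finType) (b : I -> S) (i0 : I), b i0 = 1 /\
  forall x, exists F : I -> P, x = \sum_i b i * phi (F i).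
Proof.
have [D DP] := high_monomials.
have one_gt0 (i : 'I_n) : (0 < (fun=> 1) i)%N by [].
have [I [b [bd [_ _ sp]]]] := graded_basis one_gt0 w_gt0 hom_f DP.
exists ('I_1 + I)%type, (fun o => if o is inr i then b i else 1), (inl ord0); split=> // x.
have [F ->] := sp x; exists (fun o => if o is inr i then F i else 0).
by rewrite big_sumType big_ord1 /= comp_mpoly0 mulr0 add0r.
Qed.

Let U (x : S) : {mpoly K[n + n]} := x^$ (fun i => 'X_(lshift n i)).
Let V (x : S) : {mpoly K[n + n]} := x^$ (fun i => 'X_(rshift n i)).
Let J := in_ideal (fun i => U (f i) - V (f i)).

(** s(u) - s(v) vanishes wherever all f_i(u) - f_i(v) do, so by the Nullstellensatz one of its
    powers lies in [J]. The elements with some p-power in [J] form an ideal, as Frobenius is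
    additive, and finite generation of it makes the exponent uniform in [s]. *)
Lemma diagonal_power : exists k, forall s, T s -> forall e, (k <= e)%N -> J (U (s ^+ (p ^ e)) - V (s ^+ (p ^ e))).
Proof.
pose rJ x := exists N, J (x ^+ (p ^ N)).
have hJ : is_ideal J := in_ideal_ideal _.
have charM : p \in [pchar {mpoly K[n + n]}] by apply: pchar_mpoly.
have up N M x : (N <= M)%N -> J (x ^+ (p ^ N)) -> J (x ^+ (p ^ M)).
  move=> le Jx; rewrite -(subnKC le) expnD exprM; have : (0 < p ^ (M - N))%N by rewrite expn_gt0 prime_gt0.
  by case: (p ^ (M - N))%N => // k _; rewrite exprS; apply: in_idealMr.
have [] := @hilbert_basis K (n + n) rJ.
  split.
  - by exists 0%N; rewrite expn0 expr1; exact: ideal0.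
  - move=> x y [N HN] [M HM]; exists (maxn N M); rewrite pchar_expD //.
    by apply: idealD => //; [refine (up _ _ _ _ HN); apply: leq_maxl|refine (up _ _ _ _ HM); apply: leq_maxr].
  by move=> a x [N HN]; exists N; rewrite exprMn; apply: idealMl.
move=> l [t [/fin_all_exists[N HN] gen]]; pose k := \max_i N i; exists k => s Ts e ke.
rewrite {1}/U {1}/V !rmorphXn -pchar_expB // -/(U s) -/(V s); refine (up _ _ _ ke _).
have [q ->] : in_ideal t (U s - V s).
  apply: (gen); have [v|N0 HN0] := @nullstellensatz K (n + n) m (fun i => U (f i) - V (f i)) (U s - V s).
    move=> Z; rewrite mevalB !meval_subst; apply/eqP; rewrite subr_eq0; apply/eqP.
    apply: (T_sep Ts) => i; have := Z i; rewrite mevalB !meval_subst => /eqP.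
    by rewrite subr_eq0 => /eqP.
  exists N0; have le : (N0 <= p ^ N0)%N by apply/ltnW/ltn_expl/prime_gt1.
  by rewrite -(subnKC le) exprD; apply: in_idealMr.
rewrite pchar_exp_sum //; apply: (ideal_sum hJ) => i _; rewrite exprMn.
by apply: in_idealMr; refine (up _ _ _ _ (HN i)); apply: leq_bigmax.
Qed.

Let d_ (Q : nat) (y : P) := forall s, T s -> A (phi y * s ^+ (p ^ Q)).
Let dd (y : P) := exists Q, d_ Q y.
Let phiD (x y : P) : phi (x + y) = phi x + phi y. Proof. exact: comp_mpolyD. Qed.
Let phiM (x y : P) : phi (x * y) = phi x * phi y. Proof. exact: rmorphM. Qed.
Let AD x y : A x -> A y -> A (x + y). Proof. exact: imfD. Qed.

Let d_S Q Q' y : (Q <= Q')%N -> d_ Q y -> d_ Q' y.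
Proof.
by move=> le H s Ts; rewrite -(subnK le) expnD exprM; apply: H; apply: TX.
Qed.

Let dd_ideal : is_ideal dd.
Proof.
split.
- by exists 0%N => s _; rewrite comp_mpoly0 mul0r; exact: imf0.
- move=> x y [Q HQ] [Q' HQ']; exists (maxn Q Q') => s Ts; rewrite phiD mulrDl; apply: AD.
    by apply: d_S HQ _ Ts; apply: leq_maxl.
  by apply: d_S HQ' _ Ts; apply: leq_maxr.
by move=> a x [Q HQ]; exists Q => s Ts; rewrite phiM -mulrA; apply: imfM; [exact: imf_subst|exact: HQ].
Qed.

(** If the ideal [dd] is proper, some colon ideal of it is a prime [pr]. Generically along [pr] the
    ambient ring is free over [A]; contracting the diagonal relation by a coordinate shows that
    Frobenius powers of [T] lie in [A] modulo [pr], up to a factor outside [pr]. Cayley-Hamilton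
    turns this congruence into membership, which puts the factor in [pr]. *)
Theorem dominion : exists Q, forall s, T s -> A (s ^+ (p ^ Q)).
Proof.
suff [Q HQ] : dd 1 by exists Q => s Ts; have := HQ s Ts; rewrite rmorph1 mul1r.
apply: NNPP => n1.
have [Q0 dE] : exists Q, forall y, dd y -> d_ Q y.
  have [l [t [/fin_all_exists[N HN] gen]]] := hilbert_basis dd_ideal.
  exists (\max_i N i) => y /gen[q ->] s Ts; rewrite raddf_sum mulr_suml.
  apply: imf_sum => i; rewrite /= phiM mulrAC mulrC; apply: imfM; first exact: imf_subst.
  by apply: d_S (HN i) _ Ts; apply: leq_bigmax.
have [|pr [hpr [a [na prE]] maxp]] := @maximal_ideal K m (fun I => exists a, ~ dd a /\ forall y, I y <-> dd (y * a)) dd dd_ideal.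
  by exists 1; split; [exact: n1|move=> y; rewrite mulr1; exact: iff_refl].
have prM x y : pr (x * y) -> pr x \/ pr y.
  move=> pxy; apply: NNPP => /not_or_and[nx ny]; apply: ny.
  apply: (maxp (fun y => dd (y * (x * a)))).
  - split=> [|u v Hu Hv|u v Hv]; first by rewrite mul0r; exact: ideal0.
      by rewrite mulrDl; exact: idealD.
    by rewrite -mulrA; exact: idealMl.
  - by exists (x * a); split; [move/prE; exact: nx|move=> z; exact: iff_refl].
  - by move=> z /prE Hz; rewrite mulrCA; exact: idealMl.
  by rewrite mulrA [y * x]mulrC; apply/prE.
have pr1 : ~ pr 1 by move/prE; rewrite mul1r.
have prX x k : pr (x ^+ k) -> pr x.
  by elim: k => [|k IH]; [rewrite expr0|rewrite exprS => /prM[|/IH]].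
have ker_pr y : phi y = 0 -> pr y.
  by move=> y0; apply/prE; exists 0%N => s _; rewrite phiM y0 !mul0r; exact: imf0.
have [I [b [i0 [b0 sp]]]] := module_generators.
(* The extension of [pr] to the ambient ring, described by coefficients on the module generators. *)
pose pS x := exists F : I -> P, (forall i, pr (F i)) /\ x = \sum_i b i * phi (F i).
have pSD x y : pS x -> pS y -> pS (x + y).
  move=> [F [HF ->]] [G [HG ->]]; exists (fun i => F i + G i); split=> [i|]; first exact: idealD.
  by rewrite -big_split; apply: eq_bigr => i _; rewrite phiD mulrDr.
have pS0 : pS 0.
  by exists (fun=> 0); split=> [i|]; [exact: ideal0|rewrite big1 // => i _; rewrite comp_mpoly0 mulr0].
have pS_sum (X : Type) (r : seq X) (R : pred X) F : (forall i, R i -> pS (F i)) -> pS (\sum_(i <- r | R i) F i).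
  by move=> HF; elim/big_ind: _.
have pS_pr y x : pr y -> pS (phi y * x).
  move=> py; have [F ->] := sp x; exists (fun i => y * F i); split=> [i|]; first exact: idealMr.
  by rewrite mulr_sumr; apply: eq_bigr => i _; rewrite phiM mulrCA.
have pSM x y : pS y -> pS (x * y).
  move=> [F [HF ->]]; rewrite mulr_sumr; apply: (pS_sum) => i _.
  by rewrite mulrA mulrC; apply: pS_pr.
have pSN x : pS x -> pS (- x) by move=> Hx; rewrite -mulN1r; apply: (pSM).
(* Cayley-Hamilton: multiplication by an element of [pS] has a matrix with entries in [pr]. *)
have cayley (B W : S -> Prop) x : W 0 -> (forall x y, W x -> W y -> W (x + y)) ->
    (forall x y, B x -> W y -> W (x * y)) -> (forall y, B (phi y)) ->
    (forall x y, B x -> B y -> B (x - y)) -> (forall x y, B x -> B y -> B (x * y)) ->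
    (forall y, pr y -> W (phi y)) -> B x -> pS x -> forall k, (#|I| <= k)%N -> W (x ^+ k).
  move=> W0 WD WM BA BB BM WA Bx px.
  have B1 : B 1 by have := BA 1; rewrite rmorph1.
  have B0 : B 0 by rewrite -(subrr 1); apply: (BB).
  have MP i : exists F : I -> P, (forall j, pr (F j)) /\ x * b i = \sum_j b j * phi (F j).
    by have [F [HF E]] : pS (x * b i) by [rewrite mulrC; apply: (pSM)]; exists F.
  have [F FE] := fin_all_exists MP.
  move=> k Nk; rewrite -(subnK Nk) exprD.
  have BX j : B (x ^+ j) by elim: j => [|j IH]; rewrite ?expr0 ?exprS //; apply: (BM).
  apply: (WM) => //; apply: (cayley_hamilton b0 (F := fun i j => phi (F i j)) W0 WD WM) => //.
  - by move=> i j; apply: (WA); case: (FE i).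
  - by move=> i; case: (FE i).
have phi_sum (Tt : {set I}) y (c : I -> P) :
    phi y * \sum_(i in Tt) b i * phi (c i) = \sum_(i in Tt) b i * phi (y * c i).
  rewrite big_distrr; apply: eq_bigr => i _; rewrite phiM; exact: mulrCA.
(* Lying over: an element of [A] in the extended ideal has a power in the image of [pr], by
   Cayley-Hamilton. *)
have free0 y : pS (phi y) -> pr y.
  move=> py; pose W x := exists2 y, pr y & x = phi y.
  have : W (phi y ^+ #|I|).
    apply: (cayley A) => //.
    - by exists 0; [exact: ideal0|rewrite comp_mpoly0].
    - by move=> _ _ [u pu ->] [v pv ->]; exists (u + v); [exact: idealD|rewrite phiD].
    - by move=> _ _ [u ->] [v pv ->]; exists (u * v); [exact: idealMl|rewrite phiM].
    - by move=> z; exact: imf_subst.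
    - exact: imfB.
    - exact: imfM.
    - by move=> z pz; exists z.
    - exact: imf_subst.
  move=> [z pz E]; apply: (prX _ #|I|); rewrite -(subrK z (y ^+ #|I|)); apply: idealD => //.
  by apply: ker_pr; rewrite comp_mpolyB -E rmorphXn subrr.
have free_i0 : forall c : I -> P, pS (\sum_(i in [set i0]) b i * phi (c i)) -> forall i, i \in [set i0] -> pr (c i).
  by move=> c; rewrite big_set1 b0 mul1r => /free0 pc i; rewrite inE => /eqP ->.
(* A largest set of generators independent modulo [pr]. It is kept to contain the generator 1, so
   that after multiplication by some [e] outside [pr] every element has a coordinate along 1. *)
pose free (Tt : {set I}) := forall c : I -> P, pS (\sum_(i in Tt) b i * phi (c i)) -> forall i, i \in Tt -> pr (c i).
have [k [Tt [iT fT kE]] kmin] : exists2 k, (exists Tt : {set I}, [/\ i0 \in Tt, free Tt & #|~: Tt| = k]) &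
    forall k', (exists Tt : {set I}, [/\ i0 \in Tt, free Tt & #|~: Tt| = k']) -> (k <= k')%N.
  by apply: nat_min; exists #|~: [set i0]|, [set i0]; rewrite inE eqxx.
have eP j : exists e, ~ pr e /\ exists c : I -> P, pS (phi e * b j - \sum_(i in Tt) b i * phi (c i)).
  have [jT|jT] := boolP (j \in Tt).
    exists 1; split=> //; exists (fun i => (i == j)%:R); rewrite (bigD1 j) //= eqxx rmorph1 mul1r mulr1 big1.
      by rewrite addr0 subrr.
    by move=> i /andP[_ /negPf ->]; rewrite comp_mpoly0 mulr0.
  have nf : ~ free (j |: Tt).
    move=> fj; have : (k <= #|~: (j |: Tt)|)%N.
      by apply: kmin; exists (j |: Tt); split=> //; rewrite in_setU1 iT orbT.
    rewrite -kE leqNgt => /negP; apply; apply: proper_card; rewrite properEneq subCset setCK subsetU1 andbT.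
    by rewrite (inj_eq (can_inj (@setCK _))); apply: contraNneq jT => <-; rewrite in_setU1 eqxx.
  have [c [pc [i [iT' ni]]]] : exists c : I -> P, pS (\sum_(i in j |: Tt) b i * phi (c i)) /\ exists i, i \in j |: Tt /\ ~ pr (c i).
    apply: NNPP => H; apply: nf => c pc i iT'; apply: NNPP => ni; apply: H; exists c; split=> //; by exists i.
  rewrite big_setU1 //= in pc; exists (c j); split.
    move=> pj; have pT : pS (\sum_(i in Tt) b i * phi (c i)).
      rewrite -(addKr (b j * phi (c j)) (\sum_(i in Tt) _)); apply: (pSD) => //; apply: (pSN); rewrite mulrC; exact: pS_pr.
    move: iT'; rewrite in_setU1 => /orP[/eqP E|iT']; [by rewrite E in ni|exact: (ni (fT c pT i iT'))].
  exists (fun i => - c i); rewrite (eq_bigr (fun i => - (b i * phi (c i)))) => [|i' _].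
    by rewrite sumrN opprK mulrC.
  by rewrite raddfN mulrN.
have [e1 e1P] := fin_all_exists eP.
pose e := \prod_j e1 j.
have ne : ~ pr e by rewrite /e; elim/big_ind: _ => // [x y nx ny /prM[]|j _] //; case: (e1P j).
have spe x : exists c : I -> P, pS (phi e * x - \sum_(i in Tt) b i * phi (c i)).
  have eb j : exists c : I -> P, pS (phi e * b j - \sum_(i in Tt) b i * phi (c i)).
    case: (e1P j) => _ [c pc]; exists (fun i => c i * \prod_(j' | j' != j) e1 j').
    set y := \prod_(j' | j' != j) e1 j'.
    have -> : e = e1 j * y by rewrite /e (bigD1 j).
    rewrite phiM.
    have -> : \sum_(i in Tt) b i * phi (c i * y) = phi y * \sum_(i in Tt) b i * phi (c i).
      by rewrite phi_sum; apply: eq_bigr => i _; rewrite [c i * y]mulrC.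
    by rewrite [phi (e1 j) * _]mulrC -mulrA -mulrBr; exact: pSM.
  have [C CP] := fin_all_exists eb; have [F ->] := sp x.
  exists (fun i => \sum_j C j i * F j).
  have -> : phi e * (\sum_i b i * phi (F i)) - \sum_(i in Tt) b i * phi (\sum_j C j i * F j) =
     \sum_j phi (F j) * (phi e * b j - \sum_(i in Tt) b i * phi (C j i)).
    under [RHS]eq_bigr => j _ do rewrite mulrBr; rewrite sumrB; congr (_ - _).
      by rewrite mulr_sumr; apply: eq_bigr => i _; ring.
    under [RHS]eq_bigr => j _ do rewrite mulr_sumr.
    rewrite exchange_big /=; apply: eq_bigr => i _; rewrite raddf_sum mulr_sumr; apply: eq_bigr => j _.
    by rewrite /= phiM; ring.
  by apply: (pS_sum) => j _; apply: (pSM).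
(* Coordinates are chosen on monomials and extended linearly: they are unique only modulo [pr], and
   true linearity over the field is needed to define [Lam]. *)
pose lm (mu : 'X_{1..n}) : I -> P := proj1_sig (constructive_indefinite_description _ (spe 'X_[mu])).
have lmP mu : pS (phi e * 'X_[mu] - \sum_(i in Tt) b i * phi (lm mu i)).
  by rewrite /lm; case: (constructive_indefinite_description _ _).
pose L (x : S) i : P := \sum_(mu <- msupp x) x@_mu *: lm mu i.
have LP x : pS (phi e * x - \sum_(i in Tt) b i * phi (L x i)).
  have -> : phi e * x - \sum_(i in Tt) b i * phi (L x i) =
      \sum_(mu <- msupp x) x@_mu *: (phi e * 'X_[mu] - \sum_(i in Tt) b i * phi (lm mu i)).
    under [RHS]eq_bigr => mu _ do rewrite scalerBr; rewrite sumrB; congr (_ - _).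
      by rewrite {1}(mpolyE x) mulr_sumr; apply: eq_bigr => mu _; rewrite scalerAr.
    under [RHS]eq_bigr => mu _ do rewrite scaler_sumr.
    rewrite exchange_big /=; apply: eq_bigr => i _; rewrite /L raddf_sum mulr_sumr; apply: eq_bigr => mu _.
    by rewrite /= comp_mpolyZ scalerAr.
  by apply: (pS_sum) => mu _; rewrite -mul_mpolyC; apply: (pSM).
have Luniq x c : pS (phi e * x - \sum_(i in Tt) b i * phi (c i)) -> pr (L x i0 - c i0).
  move=> pc; apply: (fT (fun i => L x i - c i)) iT.
  have -> : \sum_(i in Tt) b i * phi (L x i - c i) =
    (phi e * x - \sum_(i in Tt) b i * phi (c i)) - (phi e * x - \sum_(i in Tt) b i * phi (L x i)).
    rewrite opprB [RHS]addrC addrA subrK -sumrB; apply: eq_bigr => i _.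
    by rewrite comp_mpolyB mulrBr.
  by apply: (pSD) => //; apply: (pSN).
have L_A y x : pr (L (phi y * x) i0 - y * L x i0).
  apply: (Luniq _ (fun i => y * L x i)).
  by rewrite -phi_sum mulrCA -mulrBr; exact: pSM.
have L1 : pr (L 1 i0 - e).
  have := Luniq 1 (fun i => if i == i0 then e else 0); rewrite eqxx; apply.
  rewrite (bigD1 i0) //= eqxx b0 mul1r mulr1 big1 ?addr0 ?subrr // => i /andP[_ /negPf ->].
  by rewrite comp_mpoly0 mulr0.
pose ml (mu : 'X_{1..n + n}) := [multinom mu (lshift n i) | i < n].
pose mr (mu : 'X_{1..n + n}) := [multinom mu (rshift n i) | i < n].
(* Contraction of the first factor of the tensor square: it sends U x V y to phi (L x i0) y. *)
pose Lam (c : {mpoly K[n + n]}) : S := \sum_(mu <- msupp c) c@_mu *: (phi (lm (ml mu) i0) * 'X_[mr mu]).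
have Lam_big (c : {mpoly K[n + n]}) (r : seq 'X_{1..n + n}) : uniq r -> {subset msupp c <= r} ->
    Lam c = \sum_(mu <- r) c@_mu *: (phi (lm (ml mu) i0) * 'X_[mr mu]).
  move=> ur sub; rewrite [RHS](bigID (mem (msupp c))) /= [X in _ + X]big1 ?addr0; last first.
    by move=> mu /memN_msupp_eq0->; rewrite scale0r.
  rewrite -[RHS]big_filter; apply: perm_big.
  apply: uniq_perm; rewrite ?filter_uniq ?msupp_uniq // => mu; rewrite mem_filter.
  by case: (boolP (mu \in msupp c)) => [/sub ->|]; rewrite ?andbF ?andbT.
have LamP x c d : Lam (x *: c + d) = x *: Lam c + Lam d.
  pose r := undup (msupp (x *: c + d) ++ msupp c ++ msupp d).
  have ur : uniq r by apply: undup_uniq.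
  have inr mu : mu \in r = (mu \in msupp (x *: c + d)) || (mu \in msupp c) || (mu \in msupp d).
    by rewrite mem_undup !mem_cat orbA.
  rewrite !(@Lam_big _ r) // ?scaler_sumr; try by move=> mu ms; rewrite inr ms ?orbT.
  rewrite -big_split; apply: eq_bigr => mu _ /=.
  by rewrite mcoeffD mcoeffZ scalerDl scalerA.
have Lam0 : Lam 0 = 0 by rewrite /Lam msupp0 big_nil.
have LamD c d : Lam (c + d) = Lam c + Lam d by have := LamP 1 c d; rewrite !scale1r.
have LamZ x c : Lam (x *: c) = x *: Lam c by have := LamP x c 0; rewrite Lam0 !addr0.
have Lam_sum (X : Type) (r : seq X) F : Lam (\sum_(i <- r) F i) = \sum_(i <- r) Lam (F i).
  by elim: r => [|i r IH]; rewrite ?big_nil ?Lam0 // !big_cons LamD IH.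
have LamUV x y : Lam (U x * V y) = phi (L x i0) * y.
  have Ux : U x = \sum_(mu <- msupp x) x@_mu *: U 'X_[mu].
    by rewrite {1}(mpolyE x) /U raddf_sum; apply: eq_bigr => mu _; exact: comp_mpolyZ.
  have Vy : V y = \sum_(mu <- msupp y) y@_mu *: V 'X_[mu].
    by rewrite {1}(mpolyE y) /V raddf_sum; apply: eq_bigr => mu _; exact: comp_mpolyZ.
  have EL : phi (L x i0) = \sum_(mu <- msupp x) x@_mu *: phi (lm mu i0).
    by rewrite /L raddf_sum; apply: eq_bigr => mu _; exact: comp_mpolyZ.
  rewrite Ux Vy EL big_distrl Lam_sum [RHS]big_distrl; apply: eq_bigr => mu _.
  rewrite /= [X in Lam X]big_distrr Lam_sum [X in _ = _ * X](mpolyE y) [RHS]big_distrr; apply: eq_bigr => nu _.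
  rewrite /= -!scalerAl -!scalerAr !LamZ; congr (_ *: (_ *: _)); rewrite /U /V.
  pose mn := [multinom catf mu nu i | i < n + n].
  have -> : ('X_[mu])^$ (fun i => 'X_(lshift n i)) * ('X_[nu])^$ (fun i => 'X_(rshift n i)) = 'X_[mn] :> {mpoly K[n + n]}.
    rewrite !substX mpolyXE_id big_split_ord /=; congr (_ * _); apply: eq_bigr => i _.
      by rewrite mnmE catfL.
    by rewrite mnmE catfR.
  rewrite /Lam msuppX big_seq1 mcoeffX eqxx scale1r; congr (phi (lm _ i0) * 'X_[_]).
    by apply/mnmP => i; rewrite !mnmE catfL.
  by apply/mnmP => i; rewrite !mnmE catfR.
have UVdec c : exists X : seq (S * S), c = \sum_(xy <- X) U xy.1 * V xy.2.
  exists [seq ((c@_mu *: 'X_[ml mu]), 'X_[mr mu]) | mu <- msupp c]; rewrite big_map {1}(mpolyE c).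
  apply: eq_bigr => mu _ /=; rewrite /U comp_mpolyZ -scalerAl; congr (_ *: _).
  rewrite /V !substX mpolyXE_id big_split_ord /=; congr (_ * _); apply: eq_bigr => i _; by rewrite mnmE.
have UM x y : U (x * y) = U x * U y by apply: rmorphM.
have VM x y : V (x * y) = V x * V y by apply: rmorphM.
have [k1 k1P] := diagonal_power.
pose Q1 := maxn Q0 k1; pose q1 := (p ^ Q1)%N.
(* [diagonal_power] writes U (s^q1) - V (s^q1) through the differences U (f i) - V (f i), and [Lam]
   sends their multiples into [pS] because [L] is linear over [A] modulo [pr]. *)
have key s : T s -> pS (phi (L (s ^+ q1) i0) - phi (L 1 i0) * s ^+ q1).
  move=> Ts; have [c cE] := k1P s Ts Q1 (leq_maxr _ _).
  have -> : phi (L (s ^+ q1) i0) - phi (L 1 i0) * s ^+ q1 = Lam (U (s ^+ q1) - V (s ^+ q1)).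
    have U1 : U 1 = 1 by apply: rmorph1.
    have V1 : V 1 = 1 by apply: rmorph1.
    have -> : U (s ^+ q1) - V (s ^+ q1) = (-1) *: (U 1 * V (s ^+ q1)) + U (s ^+ q1) * V 1.
      by rewrite U1 V1 mul1r mulr1 scaleN1r addrC.
    by rewrite LamP !LamUV mulr1 scaleN1r addrC.
  rewrite cE Lam_sum; apply: (pS_sum) => i _; have [X ->] := UVdec (c i).
  rewrite mulr_sumr Lam_sum; apply: (pS_sum) => -[x y] _ /=.
  have -> : (U (f i) - V (f i)) * (U x * V y) = (-1) *: (U x * V (f i * y)) + U (f i * x) * V y.
    by rewrite UM VM scaleN1r; ring.
  rewrite LamP !LamUV scaleN1r; have := L_A 'X_i x; rewrite substXU => H.
  have -> : - (phi (L x i0) * (f i * y)) + phi (L (f i * x) i0) * y = phi (L (f i * x) i0 - 'X_i * L x i0) * y.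
    by rewrite comp_mpolyB phiM substXU; ring.
  exact: pS_pr.
have nL1 : ~ pr (L 1 i0) by move=> H; apply: ne; rewrite -[e](subKr (L 1 i0)); apply: idealB.
pose e2 := L 1 i0.
apply: nL1; apply: (prX _ (p ^ #|I|)%N); apply/prE; exists (Q1 + #|I|)%N => s Ts.
pose z := s ^+ q1; pose x := phi e2 * z - phi (L z i0).
have px : pS x by rewrite -[x]opprK opprB; apply: (pSN); exact: key.
(* All powers of [z] are included so that [W] is stable under [z], hence under [x]. *)
pose W y := forall j, A (phi a * (y * z ^+ j)).
have WB u v : W u -> W v -> W (u - v).
  by move=> Hu Hv j; rewrite mulrBl mulrBr; apply: imfB; [exact: Hu|exact: Hv].
have BA y v : W v -> W (phi y * v).
  by move=> Hv j; rewrite -mulrA mulrCA; apply: imfM; [exact: imf_subst|exact: Hv].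
have Wx : W (x ^+ (p ^ #|I|)).
  apply: (cayley (fun y => forall v, W v -> W (y * v)) W x) => //.
  - by move=> j; rewrite mul0r mulr0; exact: imf0.
  - by move=> u v Hu Hv j; rewrite mulrDl mulrDr; apply: imfD; [exact: Hu|exact: Hv].
  - by move=> u v Hu Hv; exact: Hu.
  - by move=> u v Hu Hv t Wt; rewrite mulrBl; apply: WB; [exact: Hu|exact: Hv].
  - by move=> u v Hu Hv t Wt; rewrite -mulrA; apply/Hu/Hv.
  - move=> y /prE dy j; rewrite mulrA [phi a * _]mulrC -phiM -exprM mulnC exprM.
    by apply: (d_S (leq_maxl Q0 k1) (dE _ dy)); apply: TX.
  - move=> v Wv; rewrite /x mulrBl; apply: WB; last exact: BA.
    rewrite -mulrA; apply: BA => j; have := Wv j.+1; rewrite exprS.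
    by have -> : v * (z * z ^+ j) = z * v * z ^+ j by ring.
  - by apply/ltnW/ltn_expl/prime_gt1.
have := Wx 0%N; rewrite expr0 mulr1 /x pchar_expB // mulrBr => HA.
have -> : phi (L 1 i0 ^+ (p ^ #|I|) * a) * s ^+ (p ^ (Q1 + #|I|)) =
    (phi a * (phi e2 * z) ^+ (p ^ #|I|) - phi a * phi (L z i0) ^+ (p ^ #|I|)) + phi a * phi (L z i0) ^+ (p ^ #|I|).
  rewrite subrK phiM rmorphXn /= exprMn /z -exprM -expnD; ring.
apply: imfD => //; apply: imfM; first exact: imf_subst.
by rewrite -rmorphXn; exact: imf_subst.
Qed.
End Dominion.

(** * Generic forms and Galois coordinates *)

Lemma mpoly_nonzero (K : closedFieldType) n (F : {mpoly K[n]}) : F != 0 -> exists v, F.@[v] != 0.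
Proof.
move=> F0; apply: NNPP => H.
have [v _|N [q E]] := @nullstellensatz K n 0 (fun=> 0) F.
  by apply/eqP/negPn/negP => nz; apply: H; exists v.
by move: E; rewrite big_ord0 => /eqP; rewrite expf_eq0 (negPf F0) andbF.
Qed.

Section LinearAction.
Variables (K : fieldType) (n : nat).
Local Notation S := {mpoly K[n]}.
Local Notation wc := (wcomp (fun=> 1%N)).
Local Notation sh := (whom (fun=> 1%N)).

(** The action on functions; on linear forms [M] multiplies the coefficient column from the left, so
    matrix products and compositions have the same order. *)
Definition mact (M : 'M[K]_n) (x : S) : S := x^$ (fun i => \sum_j M j i *: 'X_j).
Fact mact_additive M : additive (mact M). Proof. by move=> x y; rewrite /mact raddfB. Qed.
Fact mact_mult M : monoid_morphism (mact M).
Proof. by split=> [|x y]; rewrite /mact ?rmorph1 ?rmorphM. Qed.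
HB.instance Definition _ M := GRing.isAdditive.Build S S (mact M) (mact_additive M).
HB.instance Definition _ M := GRing.isMonoidMorphism.Build S S (mact M) (mact_mult M).

Definition lf (a : 'cV[K]_n) : S := \sum_j a j 0 *: 'X_j.

Lemma mactZ M c x : mact M (c *: x) = c *: mact M x. Proof. exact: comp_mpolyZ. Qed.
Lemma mactXn M x k : mact M (x ^+ k) = mact M x ^+ k. Proof. exact: rmorphXn. Qed.

Lemma mact_lf M a : mact M (lf a) = lf (M *m a).
Proof.
rewrite /mact /lf raddf_sum /=; under eq_bigr => j _ do rewrite comp_mpolyZ substXU scaler_sumr.
rewrite exchange_big /=; apply: eq_bigr => i _; rewrite mxE scaler_suml; apply: eq_bigr => j _.
by rewrite scalerA mulrC.
Qed.

Lemma mact_comp M N x : mact M (mact N x) = mact (M *m N) x.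
Proof.
rewrite /mact substK; congr (_ \mPo _); apply/eq_from_tnth => i; rewrite !tnth_mktuple.
rewrite raddf_sum /=; under eq_bigr => j _ do rewrite comp_mpolyZ substXU scaler_sumr.
rewrite exchange_big /=; apply: eq_bigr => l _; rewrite mxE scaler_suml; apply: eq_bigr => j _.
by rewrite scalerA mulrC.
Qed.

Lemma mact1 x : mact 1%:M x = x.
Proof.
rewrite /mact; have -> : [tuple \sum_j (1%:M : 'M[K]_n) j i *: 'X_j | i < n] = [tuple 'X_i | i < n].
  apply/eq_from_tnth => i; rewrite !tnth_mktuple (bigD1 i) //= mxE eqxx scale1r big1 ?addr0 // => j /negPf ji.
  by rewrite mxE ji scale0r.
exact: comp_mpoly_id.
Qed.

Lemma mact_inj M : M \in unitmx -> injective (mact M).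
Proof.
by move=> uM x y E; rewrite -(mact1 x) -(mact1 y) -(mulVmx uM) -!mact_comp E.
Qed.

Lemma mact_eval M x v : (mact M x).@[v] = x.@[fun i => \sum_j M j i * v j].
Proof.
rewrite meval_subst; apply: meval_eq => i; rewrite raddf_sum /=; apply: eq_bigr => j _.
by rewrite mevalZ mevalXU.
Qed.

Lemma homU j : sh 1%N ('X_j : S).
Proof. by have := whomX K (fun _ : 'I_n => 1%N) U_(j)%MM; rewrite wdegU. Qed.

Lemma mact_wc M d x : mact M (wc d x) = wc d (mact M x).
Proof.
apply: wcomp_subst => i; apply: whom_sum => j _; apply: whomZ.
exact: homU.
Qed.

Lemma lf_hom a : sh 1%N (lf a).
Proof.
apply: whom_sum => j _; apply: whomZ.
exact: homU.
Qed.

Lemma lfB a b : lf (a - b) = lf a - lf b.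
Proof. by rewrite /lf -sumrB; apply: eq_bigr => j _; rewrite !mxE scalerBl. Qed.

Lemma lf_eval a v : (lf a).@[v] = \sum_j a j 0 * v j.
Proof. by rewrite /lf raddf_sum /=; apply: eq_bigr => j _; rewrite mevalZ mevalXU. Qed.
End LinearAction.

(** * Generic linear forms *)

Section GenericForms.
Variables (K : closedFieldType) (n : nat).

(** Greedy choice: the image of [D k] has dimension above k, so it is not contained in the span of
    the k vectors chosen before. *)
Lemma independent_images (D : 'I_n -> 'M[K]_n) : (forall k : 'I_n, k < \rank (D k))%N ->
  exists a : 'I_n -> 'cV[K]_n, \det (\matrix_(k, i) (D k *m a k) i 0) != 0.
Proof.
move=> rD; pose Mx (a : 'I_n -> 'cV[K]_n) (k : nat) : 'M[K]_n :=
  \matrix_(i, j) (if (i < k)%N then (D i *m a i) j 0 else 0).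
suff H k : (k <= n)%N -> exists a, (k <= \rank (Mx a k))%N.
  have [a ra] := H n (leqnn n); exists a; rewrite -unitfE -unitmxE -row_full_unit -col_leq_rank.
  suff -> : \matrix_(k, i) (D k *m a k) i 0 = Mx a n by [].
  by apply/matrixP => i j; rewrite !mxE ltn_ord.
elim: k => [_|k IH kn]; first by exists (fun=> 0).
have [a ra] := IH (ltnW kn); pose k0 : 'I_n := Ordinal kn.
have [le|lt] := leqP k.+1 (\rank (Mx a k)).
  exists (fun i => if i == k0 then 0 else a i).
  apply: leq_trans le _; apply: mxrankS; apply/row_subP => i.
  have [ltik|geik] := ltnP i k; last first.
    have -> : row i (Mx a k) = 0 by apply/rowP => j; rewrite !mxE ltnNge geik.
    exact: sub0mx.
  have -> : row i (Mx a k) = row i (Mx (fun i => if i == k0 then 0 else a i) k.+1).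
    apply/rowP => j; rewrite !mxE ltik ltnS (ltnW ltik).
    by case: eqP => [E|//]; move: ltik; rewrite E ltnn.
  exact: row_sub.
have rk : \rank (Mx a k) = k by apply/eqP; rewrite eqn_leq ra andbT -ltnS.
have : ~~ ((D k0)^T <= Mx a k)%MS.
  have rDk : (k < \rank (D k0))%N := rD k0.
  by apply/negP => /mxrankS; rewrite mxrank_tr rk leqNgt rDk.
case/row_subPn => i0 ni.
pose a' i := if i == k0 then delta_mx i0 0 else a i.
exists a'.
have col0 : (D k0 *m delta_mx i0 (0 : 'I_1))^T = row i0 (D k0)^T.
  by rewrite -colE tr_col.
have rowk : row k0 (Mx a' k.+1) = row i0 (D k0)^T.
  by rewrite -col0; apply/rowP => j; rewrite [LHS]mxE [LHS]mxE [RHS]mxE /= ltnS leqnn /a' eqxx.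
have sub : (Mx a k <= Mx a' k.+1)%MS.
  apply/row_subP => i; have [ltik|geik] := ltnP i k; last first.
    have -> : row i (Mx a k) = 0 by apply/rowP => j; rewrite !mxE ltnNge geik.
    exact: sub0mx.
  have -> : row i (Mx a k) = row i (Mx a' k.+1).
    apply/rowP => j; rewrite !mxE ltik ltnS (ltnW ltik) /a'.
    by case: eqP => [E|//]; move: ltik; rewrite E ltnn.
  exact: row_sub.
rewrite ltnNge; apply/negP => le.
have eqr : (Mx a' k.+1 <= Mx a k)%MS.
  have /eqmxP E : (Mx a k == Mx a' k.+1)%MS by rewrite -(geq_leqif (mxrank_leqif_eq sub)) rk.
  by rewrite E.
by move/negP: ni; apply; rewrite -rowk; apply: submx_trans (row_sub _ _) eqr.
Qed.

(** Each determinant is a polynomial in the coordinates of all the [a k], nonzero by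
    [independent_images]; a point where the finite product does not vanish serves all choices [c] at
    once. *)
Lemma generic_forms (X : 'I_n -> finType) (D : forall k, X k -> 'M[K]_n) :
  (forall (k : 'I_n) (x : X k), k < \rank (D k x))%N -> exists a : 'I_n -> 'cV[K]_n,
  forall c : {dffun forall k, X k}, \det (\matrix_(k, i) (D k (c k) *m a k) i 0) != 0.
Proof.
move=> rD; pose V (k j : 'I_n) : {mpoly K[n * n]} := 'X_(mxvec_index k j).
pose F (c : {dffun forall k, X k}) := \det (\matrix_(k, i) \sum_j (D k (c k) i j) *: V k j).
pose pt (a : 'I_n -> 'cV[K]_n) (i : 'I_(n * n)) : K := mxvec (\matrix_(k, j) a k j 0) 0 i.
have Fpt c a : (F c).@[pt a] = \det (\matrix_(k, i) (D k (c k) *m a k) i 0).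
  rewrite /F -det_map_mx; congr (\det _); apply/matrixP => k i; rewrite !mxE raddf_sum /=.
  by apply: eq_bigr => j _; rewrite mevalZ mevalXU /pt mxvecE mxE.
have [v] : exists v, (\prod_c F c).@[v] != 0.
  apply: mpoly_nonzero; apply/prodf_neq0 => c _; apply/eqP => F0.
  have [a] := @independent_images (fun k => D k (c k)) (fun k => rD k (c k)).
  by rewrite -Fpt F0 meval0 eqxx.
pose a (k : 'I_n) : 'cV[K]_n := \col_j v (mxvec_index k j).
rewrite rmorph_prod /= => /prodf_neq0 H; exists a => c; rewrite -Fpt.
have -> : (F c).@[pt a] = (F c).@[v]; last exact: H.
by apply: meval_eq => i; case/mxvec_indexP: i => k j; rewrite /pt mxvecE !mxE.
Qed.

Lemma forms_no_zero (X : 'I_n -> finType) (u : forall k, X k -> 'cV[K]_n) (v : 'I_n -> K) :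
  (forall c : {dffun forall k, X k}, \det (\matrix_(k, i) (u k (c k)) i 0) != 0) ->
  (forall k, exists x : X k, (lf (u k x)).@[v] = 0) -> forall i, v i = 0.
Proof.
move=> H zk.
pose c : {dffun forall k, X k} := [ffun k => proj1_sig (constructive_indefinite_description _ (zk k))].
have cE k : (lf (u k (c k))).@[v] = 0.
  by rewrite ffunE; case: (constructive_indefinite_description _ _).
pose M := \matrix_(k, i) (u k (c k)) i 0.
have Mv : M *m (\col_i v i) = 0.
  apply/colP => k; rewrite !mxE -[RHS](cE k) lf_eval; apply: eq_bigr => j _; by rewrite !mxE.
have uM : M \in unitmx by rewrite unitmxE unitfE; apply: H.
have v0 : \col_i v i = 0 by rewrite -(mulKmx uM (\col_i v i)) Mv mulmx0.
by move=> i; have /colP/(_ i) := v0; rewrite !mxE.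
Qed.
End GenericForms.

(** * Coordinates separating a subgroup from its complement *)

Section GaloisCoordinates.
Variables (K : fieldType) (n : nat) (gT : finGroupType) (G H : {group gT}).
Hypothesis sHG : H \subset G.
Variable rG : mx_representation K G n.
Local Notation S := {mpoly K[n]}.
Local Notation wc := (wcomp (fun=> 1%N)).
Local Notation sh := (whom (fun=> 1%N)).
Local Notation act g := (mact (rG g)).

Lemma actM g h x : g \in G -> h \in G -> act g (act h x) = act (g * h)%g x.
Proof. by move=> Gg Gh; rewrite mact_comp repr_mxM. Qed.
Lemma act1 x : act 1%g x = x. Proof. by rewrite repr_mx1 mact1. Qed.

Definition inv_under (L : {group gT}) (x : S) := forall g, g \in L -> act g x = x.

Variable l : S.
(** A kind of relative different of H-invariants over G-invariants: it vanishes only where a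
    conjugate of [l] under H agrees with one under an element outside H. *)
Definition split_product := \prod_(s in H) \prod_(t in G :\: H) (act s l - act t l).

(* With [M(T) = \prod_t (T - t l)] over [t] outside [H], the product of the values of [gM] at the conjugates
   [s l], [s] in [H], vanishes for [g] outside [H] and does not depend on [g] in [H]; expanding it separates
   the variables. *)
Lemma galois_coordinates : exists L : seq (S * S),
  (forall xy, xy \in L -> [/\ inv_under H xy.1, inv_under H xy.2 & exists d, sh d xy.2]) /\
  forall g, g \in G -> \sum_(xy <- L) xy.1 * act g xy.2 = if g \in H then split_product else 0.
Proof.
have Hs s : s \in H -> s \in G by apply: (subsetP sHG).
have GHt t : t \in G :\: H -> t \in G by rewrite inE => /andP[].
pose M : {poly S} := \prod_(t in G :\: H) ('X - (act t l)%:P).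
pose d := size M.
(* Evaluated at the coefficients of a polynomial of size at most [d], it gives the product of the
   values at the conjugates of [l] under H. *)
pose Xi : {mpoly S[d]} := \prod_(s in H) \sum_(j < d) (act s l) ^+ j *: 'X_j.
pose tau (j : 'I_d) := M`_j.
pose mP (h : gT) : {rmorphism {poly S} -> {poly S}} := map_poly (act h).
have mPM h : h \in H -> mP h M = M.
  move=> Hh; rewrite /M rmorph_prod /=.
  rewrite [RHS](reindex_inj (mulgI h)) /=.
  apply: eq_big => [t|t tGH]; first by rewrite !inE (groupMl _ Hh) (groupMl _ (Hs _ Hh)).
  by rewrite (rmorphB (mP h)) /= map_polyX map_polyC /= actM //; [exact: Hs|exact: GHt].
have tauH j : inv_under H (tau j).
  by move=> h Hh; rewrite /tau -{2}(mPM h Hh) coef_map.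
have XiH h : h \in H -> map_mpoly (act h) Xi = Xi.
  move=> Hh; rewrite /Xi rmorph_prod /= [RHS](reindex_inj (mulgI h)) /=.
  apply: eq_big => [s|s Hs']; first by rewrite groupMl.
  rewrite raddf_sum; apply: eq_bigr => j _.
  by rewrite /= map_mpolyZ map_mpolyX /= mactXn actM ?Hs.
have ev g : g \in G -> Xi.@[fun j => act g (tau j)] = if g \in H then split_product else 0.
  move=> Gg; rewrite /Xi rmorph_prod /=.
  have fE s : s \in H -> (\sum_(j < d) (act s l) ^+ j *: 'X_j : {mpoly S[d]}).@[fun j => act g (tau j)] =
      \prod_(t in G :\: H) (act s l - act (g * t)%g l).
    move=> Hs'; rewrite raddf_sum /=.
    have -> : \prod_(t in G :\: H) (act s l - act (g * t)%g l) = (mP g M).[act s l].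
      rewrite /M rmorph_prod horner_prod; apply: eq_bigr => t /GHt Gt.
      by rewrite (rmorphB (mP g)) /= map_polyX map_polyC /= hornerD hornerX hornerN hornerC actM.
    have sz : size (mP g M) = d by apply: size_map_inj_poly; rewrite ?rmorph0 //; apply: mact_inj; apply: repr_mx_unit.
    rewrite horner_coef sz; apply: eq_bigr => j _.
    by rewrite mevalZ mevalXU coef_map mulrC.
  rewrite (eq_bigr _ fE); case: ifP => [gH|/negbT gH].
    apply: eq_bigr => s _; rewrite [RHS](reindex_inj (mulgI g)) /=.
    by apply: eq_bigl => t; rewrite !inE (groupMl _ gH) (groupMl _ Gg).
  (* For [g] outside H the factor with s = 1 and t the inverse of g vanishes. *)
  rewrite (bigD1 1%g) ?group1 //= (bigD1 g^-1%g) /=; last by rewrite !inE groupV gH groupV.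
  by rewrite mulgV subrr !mul0r.
pose y0 (mu : 'X_{1..d}) := \prod_j tau j ^+ mu j.
have y0H mu : inv_under H (y0 mu).
  by move=> h Hh; rewrite /y0 rmorph_prod; apply: eq_bigr => j _; rewrite /= mactXn tauH.
have BP mu : exists B, y0 mu = \sum_(e < B) wc e (y0 mu) by apply: wcomp_decomp.
pose Bd mu := proj1_sig (constructive_indefinite_description _ (BP mu)).
have BdE mu : y0 mu = \sum_(e < Bd mu) wc e (y0 mu).
  by rewrite /Bd; case: (constructive_indefinite_description _ _).
exists (flatten [seq [seq (Xi@_mu, wc e (y0 mu)) | e <- iota 0 (Bd mu)] | mu <- msupp Xi]).
split=> [xy /flattenP[s /mapP[mu _ ->] /mapP[e _ ->]]|g Gg] /=.
  split; last by exists e; apply: wcomp_idem.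
    by move=> h Hh; rewrite -{2}(XiH h Hh) mcoeff_map_mpoly.
  by move=> h Hh; rewrite mact_wc y0H.
rewrite -ev // big_flatten big_map /= mevalE; apply: eq_bigr => mu _.
rewrite big_map /= -mulr_sumr; congr (_ * _).
have -> : \prod_j act g (tau j) ^+ mu j = act g (y0 mu).
  by rewrite /y0 rmorph_prod; apply: eq_bigr => j _; rewrite /= mactXn.
rewrite {2}(BdE mu) raddf_sum -(big_mkord xpredT (fun e => act g (wc e (y0 mu)))).
by rewrite /index_iota subn0.
Qed.
End GaloisCoordinates.

(** * Prime characteristic *)

(** Pads lists of different lengths to a common index set, as the three parameters share one type
    [J]. *)
Lemma sum_nth_pad (V : nmodType) (T : Type) (d : T) (L : seq T) M (F : T -> V) : (size L <= M)%N -> F d = 0 ->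
  \sum_(j < M) F (nth d L j) = \sum_(x <- L) F x.
Proof.
move=> le Fd; rewrite (big_nth d) -(big_mkord xpredT (fun j => F (nth d L j))).
rewrite (@big_cat_nat _ _ _ (size L)) //= [X in _ + X]big_nat_cond [X in _ + X]big1 ?addr0 // => j.
by rewrite andbT => /andP[lej _]; rewrite nth_default.
Qed.

Lemma eval0_hom (F : fieldType) n d (x : {mpoly F[n]}) : (0 < d)%N -> whom (fun=> 1%N) d x -> x.@[fun=> 0] = 0.
Proof.
move=> d0 /whomP hx; rewrite mevalE big_seq big1 // => mu; rewrite mcoeff_msupp => /hx E.
have [i mi] : exists i, (0 < mu i)%N.
  apply: NNPP => Hn; move: d0; rewrite -E /wdeg big1 // => i _; rewrite mul1n.
  by case: (posnP (mu i)) => // mi; case: Hn; exists i.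
by rewrite (bigD1 i) //= expr0n gtn_eqF // mul0r mulr0.
Qed.

Section CharP.
Variables (K : closedFieldType) (p : nat) (charK : p \in [pchar K]).
Variables (gT : finGroupType) (G H : {group gT}) (n m c : nat).
Local Notation N := (3 + n)%N.
Local Notation S := {mpoly K[N]}.
Local Notation P := {mpoly K[m]}.
Variables (rG : mx_representation K G N) (f : 'I_m -> S) (r : 'I_c -> P).
Variables (w : 'I_m -> nat) (e : 'I_c -> nat).
Local Notation wc := (wcomp (fun=> 1%N)).
Local Notation sh := (whom (fun=> 1%N)).
Local Notation A := (imf f).
Local Notation act g := (mact (rG g)).
Hypothesis w_gt0 : forall i, (0 < w i)%N.
Hypothesis e_gt0 : forall i, (0 < e i)%N.
Hypothesis hom_f : forall i, sh (w i) (f i).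
Hypothesis inv_f : forall i, inv_under rG G (f i).
Hypothesis hom_r : forall i, whom w (e i) (r i).
Hypothesis ker_f : forall x : P, x^$ f = 0 <-> in_ideal r x.
Hypothesis le_cNm : (c + N <= m)%N.
Hypothesis sep_f : forall u v : 'I_N -> K, (forall i, (f i).@[u] = (f i).@[v]) ->
  exists2 g, g \in G & forall i, v i = \sum_j rG g j i * u j.
Hypothesis sHG : H \subset G.
Hypothesis rank3 : forall g, g \in G -> g \notin H -> (3 <= \rank ((rG g - 1%:M)%R))%N.
Variable g0 : gT.
Hypothesis g0G : g0 \in G.
Hypothesis g0H : g0 \notin H.

Let HG s : s \in H -> s \in G. Proof. exact: (subsetP sHG). Qed.
Let pp : prime p := pcharf_prime charK.
Let charS : p \in [pchar S]. Proof. exact: pchar_mpoly. Qed.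
Let TG := inv_under rG G.
Let TH := inv_under rG H.

Let inv1 (L : {group gT}) : inv_under rG L 1. Proof. by move=> g _; rewrite rmorph1. Qed.
Let invM (L : {group gT}) x y : inv_under rG L x -> inv_under rG L y -> inv_under rG L (x * y).
Proof. by move=> Hx Hy g Lg; rewrite rmorphM /= Hx ?Hy. Qed.
Let invB (L : {group gT}) x y : inv_under rG L x -> inv_under rG L y -> inv_under rG L (x - y).
Proof. by move=> Hx Hy g Lg; rewrite rmorphB /= Hx ?Hy. Qed.
Let invX (L : {group gT}) x k : inv_under rG L x -> inv_under rG L (x ^+ k).
Proof. by move=> Hx g Lg; rewrite rmorphXn /= Hx. Qed.
Let inv_wc (L : {group gT}) x d : inv_under rG L x -> inv_under rG L (wc d x).
Proof. by move=> Hx g Lg; rewrite mact_wc Hx. Qed.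
Let TGH x : TG x -> TH x. Proof. by move=> Hx g Hg; apply/Hx/HG. Qed.
Let A_TG x : A x -> TG x.
Proof.
move=> [y ->] g Gg; rewrite /mact substK; congr (_ \mPo _); apply/eq_from_tnth => i.
by rewrite !tnth_mktuple; exact: inv_f.
Qed.

Let null_f v : (forall i, (f i).@[v] = 0) -> forall i, v i = 0.
Proof.
move=> Z; have [|g _ E] := @sep_f (fun=> 0) v.
  by move=> i; rewrite Z (eval0_hom (w_gt0 i) (hom_f i)).
by move=> i; rewrite E big1 // => j _; rewrite mulr0.
Qed.

Let TG_sep s : TG s -> forall u v : 'I_N -> K, (forall i, (f i).@[u] = (f i).@[v]) -> s.@[u] = s.@[v].
Proof.
move=> Ts u v /sep_f[g Gg E]; rewrite -{1}(Ts g Gg) mact_eval; apply: meval_eq => i.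
by rewrite E.
Qed.

(** The relative trace from H to G: canonical on H-invariants by [act_repr], and linear over
    G-invariants for any choice of representatives. *)
Let TR_raw (x : S) := \sum_(C in lcosets H G) act (repr C) x.
Fact TR_additive : additive TR_raw.
Proof. by move=> x y; rewrite /TR_raw -sumrB; apply: eq_bigr => C _; rewrite raddfB. Qed.
HB.instance Definition _ := GRing.isAdditive.Build S S TR_raw TR_additive.
Let TR : {additive S -> S} := TR_raw.

Let reprG C : C \in lcosets H G -> repr C \in G.
Proof.
case/lcosetsP=> x Gx ->; have := mem_repr x (lcoset_refl H x).
by case/lcosetP=> s Hs ->; exact: groupM Gx (HG Hs).
Qed.
Let act_repr g x : g \in G -> TH x -> act (repr (g *: H)%g) x = act g x.
Proof.
move=> Gg Hx; have := mem_repr g (lcoset_refl H g); case/lcosetP=> s Hs ->.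
by rewrite -(actM rG x Gg (HG Hs)) Hx.
Qed.
Let TR_inv x : TH x -> TG (TR x).
Proof.
move=> Hx h Gh; rewrite /TR /= /TR_raw raddf_sum /=.
rewrite [RHS](reindex_inj (can_inj (lcosetK h))) /=; apply: eq_big => [C|C].
  apply/lcosetsP/lcosetsP => [[x' Gx ->]|[x' Gx E]].
    by exists (h * x')%g; rewrite ?groupM // lcosetM.
  exists (h^-1 * x')%g; first by rewrite groupM ?groupV.
  by rewrite lcosetM -E lcosetK.
case/lcosetsP=> x' Gx ->; rewrite -lcosetM !act_repr ?groupM // actM //.
Qed.
Let TR_TG a x : TG a -> TR (a * x) = a * TR x.
Proof.
move=> Ha; rewrite /TR /= /TR_raw mulr_sumr; apply: eq_bigr => C /reprG Gr.
by rewrite rmorphM /= Ha.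
Qed.
Let TRX q x : TR (x ^+ (p ^ q)) = TR x ^+ (p ^ q).
Proof.
rewrite /TR /= /TR_raw pchar_exp_sum //; apply: eq_bigr => C _; exact: rmorphXn.
Qed.
Let TRwc d x : TR (wc d x) = wc d (TR x).
Proof. by rewrite /TR /= /TR_raw raddf_sum /=; apply: eq_bigr => C _; rewrite mact_wc. Qed.
Let TRZ a x : TR (a *: x) = a *: TR x.
Proof. by rewrite /TR /= /TR_raw scaler_sumr; apply: eq_bigr => C _; rewrite mactZ. Qed.

(** Totalised with default members of G, H and the complement of H, so that the generic forms are
    indexed by all triples of group elements. *)
Let cG g := if g \in G then g else 1%g.
Let cH s := if s \in H then s else 1%g.
Let cT t := if t \in G :\: H then t else g0.
(** The first three matrices are the differences behind the factors of the split products, of rank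
    at least 3; from the fourth on, invertible matrices suffice. *)
Let D (k : 'I_N) (x : gT * gT * gT) : 'M[K]_N :=
  if (k < 3)%N then rG (cG x.1.1 * cH x.1.2)%g - rG (cG x.1.1 * cT x.2)%g else rG (cG x.1.1).

Let cGG g : cG g \in G. Proof. by rewrite /cG; case: ifP. Qed.
Let cHH s : cH s \in H. Proof. by rewrite /cH; case: ifP. Qed.
Let cTT t : cT t \in G :\: H. Proof. by rewrite /cT; case: ifP => // _; rewrite inE g0G g0H. Qed.

Let rankD (k : 'I_N) x : (k < \rank (D k x))%N.
Proof.
rewrite /D; case: ifP => k3; last by rewrite mxrank_unit ?repr_mx_unit.
apply: leq_trans k3 _; have := cTT x.2; rewrite inE => /andP[tH tG].
set g := cG _; set s := cH _; set t := cT _ in tH tG *.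
have Gg : g \in G := cGG _; have Hs : s \in H := cHH _.
have -> : rG (g * s)%g - rG (g * t)%g = rG (g * t)%g *m (rG (t^-1 * s)%g - 1%:M).
  have Gs := HG Hs; rewrite mulmxBr mulmx1 -repr_mxM ?groupM ?groupV //; congr (rG _ - _).
  by rewrite -mulgA mulKVg.
rewrite (eqmxMfull _ _); last by rewrite row_full_unit repr_mx_unit ?groupM.
apply: rank3; first by rewrite groupM ?groupV ?(HG Hs).
by rewrite groupMr // groupV.
Qed.

Lemma charp_core : False.
Proof.
have [Q0 domP] := dominion charK w_gt0 hom_f null_f (@invM G) (@inv1 G) TG_sep.
pose q0 := (p ^ Q0)%N; have q0_gt0 : (0 < q0)%N by rewrite expn_gt0 prime_gt0.
have [a detP] := @generic_forms K N (fun=> (gT * gT * gT)%type) D rankD.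
(* The first three parameters come from split products, so that traces recover them; the others are
   bare generic forms. *)
pose hl (k : 'I_N) : S := if (k < 3)%N then split_product H rG (lf (a k)) else lf (a k).
pose h0 k := \prod_(g in G) act g (hl k).
have h0_TG k : TG (h0 k).
  move=> g Gg; rewrite /h0 rmorph_prod /= [RHS](reindex_inj (mulgI g)) /=.
  by apply: eq_big => [x|x Gx]; rewrite ?groupMl // actM.
have zero (E : idomainType) (phi : {rmorphism S -> E}) k : phi (h0 k) = 0 ->
    exists x : gT * gT * gT, phi (lf (D k x *m a k)) = 0.
  rewrite /h0 rmorph_prod => /eqP/prodf_eq0[g Gg /eqP].
  rewrite /hl; case: ifP => k3 /=; last first.
    rewrite mact_lf => E0; exists (g, g, g); rewrite /D k3 /cG Gg; exact: E0.
  rewrite /split_product !rmorph_prod => /eqP/prodf_eq0[s Hs].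
  rewrite !rmorph_prod => /prodf_eq0[t GHt /eqP].
  have Gt : t \in G by move: GHt; rewrite inE => /andP[].
  rewrite [X in phi X = _]rmorphB /= (actM rG _ Gg (HG Hs)) (actM rG _ Gg Gt).
  rewrite !mact_lf -lfB -mulmxBl => E0; exists (g, s, t); rewrite /D k3 /cG /cH /cT Gg Hs GHt; exact: E0.
have no_zero v : (forall k, (h0 k).@[v] = 0) -> forall i, v i = 0.
  move=> Z; apply: (forms_no_zero (X := fun=> (gT * gT * gT)%type) (u := fun k x => D k x *m a k)).
    exact: detP.
  by move=> k; have [x E0] := zero _ (meval v) k (Z k); exists x.
have h0_neq0 k : h0 k != 0.
  apply/eqP => /(zero _ idfun)[x /= E0].
  have /eqP[] := detP [ffun=> x]; rewrite (expand_det_row _ k) big1 // => i _.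
  rewrite mxE ffunE; have := lf_eval (D k x *m a k) (fun j => (j == i)%:R).
  rewrite E0 meval0 (bigD1 i) //= eqxx mulr1 big1 ?addr0 => [<-|j /negPf ->]; by rewrite ?mul0r ?mulr0.
have act_hom g d x : sh d x -> sh d (act g x) by move=> hx; rewrite /whom -mact_wc hx.
have hom_hl k : exists d, (0 < d)%N /\ sh d (hl k).
  rewrite /hl; case: ifP => _; last by exists 1%N; split=> //; exact: lf_hom.
  exists (\sum_(s in H) \sum_(t in G :\: H) 1)%N; split.
    rewrite (bigD1 1%g) ?group1 //= (bigD1 g0) //=; by rewrite inE g0G g0H.
  by do 2!apply: whom_prod => ? _; apply: whomB; apply/act_hom/lf_hom.
have [dl dlP] := fin_all_exists hom_hl.
pose dk k := (\sum_(g in G) dl k)%N.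
have dk_gt0 k : (0 < dk k)%N.
  by rewrite /dk sum_nat_const muln_gt0 cardG_gt0; case: (dlP k).
have hom_h0 k : sh (dk k) (h0 k).
  by apply: whom_prod => g _; apply: act_hom; case: (dlP k).
(* [M k] brings all norms to the common degree [gam0]; the power [q0] then puts them in [A]. *)
pose M k := (\prod_(l | l != k) dk l)%N; pose gam0 := (\prod_l dk l)%N.
have M_gt0 k : (0 < M k)%N by apply: prodn_cond_gt0.
have gamE k : (dk k * M k = gam0)%N by rewrite /gam0 (bigD1 k).
pose gam := (gam0 * q0)%N.
have gam_gt0 : (0 < gam)%N by rewrite muln_gt0 q0_gt0 andbT; apply: prodn_gt0.
have hE k : exists hk, whom w gam hk /\ hk^$ f = h0 k ^+ M k ^+ q0.
  have [y yE] := domP _ (invX (M k) (h0_TG k)).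
  exists (wcomp w gam y); split; first exact: wcomp_idem.
  rewrite (wcomp_subst _ _ hom_f) -yE -/q0.
  have := whomXn q0 (whomXn (M k) (hom_h0 k)); rewrite gamE; exact.
have {hE}[h hP] := fin_all_exists hE.
have hom_h k : whom w gam (h k) by case: (hP k).
have gE k : (h k)^$ f = h0 k ^+ M k ^+ q0 by case: (hP k).
pose g k := (h k)^$ f.
have [DS DS_g] : exists DS, forall mu : 'X_{1..N}, (DS <= wdeg (fun=> 1%N) mu)%N -> in_ideal g 'X_[mu].
  apply: high_monomials => v Z; apply: no_zero => k; have := Z k; rewrite /g gE.
  by rewrite !rmorphXn => /eqP; rewrite !expf_eq0 q0_gt0 M_gt0 /= => /eqP.
(* Powers of the f_i lie in the ideal generated by the g in the ambient ring; Cayley-Hamilton over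
   the module generators brings further powers into the ideal generated in [A]. *)
have [DP DP_t] : exists DP, forall mu, (DP <= wdeg w mu)%N -> in_ideal (catf r h) 'X_[mu].
  have [I [b [i0 [b0 sp]]]] := module_generators w_gt0 hom_f null_f.
  apply: (@high_monomials_of_powers K m _ w (catf r h) (fun=> DS * #|I|)%N) => i.
  have xg : in_ideal g (f i ^+ DS).
    have hx := whomXn DS (hom_f i); rewrite (mpolyE (f i ^+ DS)) big_seq.
    elim/big_ind: _ => [|u v|mu]; [exact: in_ideal0|exact: in_idealD|].
    rewrite mcoeff_msupp => nz; rewrite -mul_mpolyC; apply: in_idealMl; apply: DS_g.
    by rewrite ((whomP _ _ _).1 hx _ nz) leq_pmull.
  pose W (x : S) := exists2 y, in_ideal h y & x = y^$ f.
  have bF j : exists F : I -> P, (forall l, in_ideal h (F l)) /\ f i ^+ DS * b j = \sum_l b l * (F l)^$ f.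
    have [q ->] := xg; have [F FE] := fin_all_exists (fun k => sp (q k * b j)).
    exists (fun l => \sum_k h k * F k l); split=> [l|]; first by exists (fun k => F k l).
    rewrite mulr_suml; under eq_bigr => k _ do rewrite -mulrA FE mulr_sumr.
    rewrite exchange_big /=; apply: eq_bigr => l _; rewrite raddf_sum mulr_sumr; apply: eq_bigr => k _.
    by rewrite /= rmorphM /= mulrCA.
  have [F FE] := fin_all_exists bF.
  have [y hy yE] : W ((f i ^+ DS) ^+ #|I|).
    apply: (@cayley_hamilton _ _ b i0 A W _ (fun j l => (F j l)^$ f)) => //.
    - by exists 0; [exact: in_ideal0|rewrite comp_mpoly0].
    - by move=> _ _ [u pu ->] [v pv ->]; exists (u + v); [exact: in_idealD|rewrite comp_mpolyD].
    - by move=> _ _ [u ->] [v pv ->]; exists (u * v); [exact: in_idealMl|rewrite rmorphM].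
    - exact: imfB.
    - exact: imfM.
    - exact: imf1.
    - by exists ('X_i ^+ DS); rewrite rmorphXn /= substXU.
    - by move=> j l; exact: imf_subst.
    - by move=> j l; exists (F j l) => //; case: (FE j).
    - by move=> j; case: (FE j).
  have /ker_f[q qE] : ('X_i ^+ (DS * #|I|) - y)^$ f = 0.
    by rewrite comp_mpolyB -yE rmorphXn /= substXU exprM subrr.
  have [q' q'E] := hy; exists (catf q q'); rewrite big_split_ord /=.
  apply/eqP; rewrite -subr_eq0; apply/eqP; rewrite -[X in X - _](subrK y) qE {1}q'E.
  rewrite [X in _ - (X + _)](eq_bigr (fun j => r j * q j)) => [|j _]; last by rewrite !catfL.
  rewrite [X in _ - (_ + X)](eq_bigr (fun j => h j * q' j)) => [|j _]; last by rewrite !catfR.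
  by rewrite subrr.
have g_A k : A (g k) by exact: imf_subst.
have gTG k : TG (g k) := A_TG (g_A k).
have g_neq0 k : g k != 0 by rewrite /g gE !expf_neq0.
pose rest k := \prod_(x in G | x != 1%g) act x (hl k).
have h0E k : h0 k = hl k * rest k by rewrite /h0 (bigD1 1%g) ?group1 //= act1.
have hl_neq0 k : hl k != 0 by have := h0_neq0 k; rewrite h0E mulf_eq0 negb_or => /andP[].
have hlE (k : 'I_3) : hl (lshift n k) = split_product H rG (lf (a (lshift n k))).
  by rewrite /hl /= ltn_ord.
have hl_TH (k : 'I_3) : TH (hl (lshift n k)).
  move=> s' Hs'; rewrite hlE /split_product rmorph_prod [RHS](reindex_inj (mulgI s')) /=.
  apply: eq_big => [s|s Hs]; first by rewrite groupMl.
  rewrite rmorph_prod [RHS](reindex_inj (mulgI s')) /=.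
  apply: eq_big => [t|t]; first by rewrite !inE (groupMl _ Hs') (groupMl _ (HG Hs')).
  by rewrite inE => /andP[_ Gt]; rewrite rmorphB /= (actM rG _ (HG Hs') (HG Hs)) (actM rG _ (HG Hs') Gt).
have rest_TH (k : 'I_3) : TH (rest (lshift n k)).
  move=> s Hs; apply: (mulfI (hl_neq0 (lshift n k))); rewrite -h0E -{1}(hl_TH k s Hs) -rmorphM -h0E.
  exact/h0_TG/HG.
have [L LP] := fin_all_exists (fun k : 'I_3 => galois_coordinates sHG rG (lf (a (lshift n k)))).
pose SZ := (\sum_(k < 3) size (L k))%N.
have le_sz k : (size (L k) <= SZ)%N by rewrite /SZ (bigD1 k) //= leq_addr.
pose elt k j := nth (0, 0) (L k) j.
have eltP k j : [/\ TH (elt k j).1, TH (elt k j).2 & exists d, sh d (elt k j).2].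
  case: (ltnP j (size (L k))) => lt; first by apply: (LP k).1; exact: mem_nth.
  rewrite /elt nth_default //=; split; [by move=> s _; rewrite raddf0|by move=> s _; rewrite raddf0|].
  by exists 0%N; exact: whom0.
have L_sum (k : 'I_3) x : x \in G ->
    \sum_(j < SZ) (elt k j).1 * act x (elt k j).2 = if x \in H then hl (lshift n k) else 0.
  move=> Gx; rewrite hlE -((LP k).2 x Gx).
  by rewrite -(@sum_nth_pad _ _ (0, 0) (L k) SZ (fun z => z.1 * act x z.2)) //= mul0r.
(* Normalised so that the sums over [j] give h0 k to the power [M k] on H, and 0 outside H; their
   [q0]-th powers are then [g] and 0. *)
pose xh (k : 'I_3) j := (elt k j).1 * rest (lshift n k) * h0 (lshift n k) ^+ (M (lshift n k)).-1.
pose xx (k : 'I_3) (j : 'I_SZ) := xh k j ^+ q0.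
pose yy (k : 'I_3) (j : 'I_SZ) := (elt k j).2 ^+ q0.
have xh_TH k j : TH (xh k j).
  case: (eltP k j) => H1 _ _; apply: invM; first exact: invM H1 (rest_TH k).
  exact/invX/TGH/h0_TG.
have K0 (k : 'I_3) x : x \in G ->
    \sum_(j < SZ) xx k j * act x (yy k j) = if x \in H then g (lshift n k) else 0.
  move=> Gx; under eq_bigr => j _ do rewrite /xx /yy rmorphXn -exprMn.
  rewrite -(pchar_exp_sum Q0 _ _ _ charS) -/q0.
  have -> : \sum_(j < SZ) xh k j * act x (elt k j).2 =
      (\sum_(j < SZ) (elt k j).1 * act x (elt k j).2) * (rest (lshift n k) * h0 (lshift n k) ^+ (M (lshift n k)).-1).
    by rewrite mulr_suml; apply: eq_bigr => j _; rewrite /xh; ring.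
  rewrite L_sum //; case: ifP => _; last by rewrite mul0r expr0n gtn_eqF.
  by rewrite /g gE mulrA -h0E -exprS prednK.
have TR_K0 q (k : 'I_3) x : TH x -> \sum_(j < SZ) xx k j ^+ (p ^ q) * TR (yy k j ^+ (p ^ q) * x) = g (lshift n k) ^+ (p ^ q) * x.
  move=> Hx; have pq0 : (0 < p ^ q)%N by rewrite expn_gt0 prime_gt0.
  under eq_bigr => j _ do rewrite /TR /= /TR_raw mulr_sumr.
  rewrite exchange_big /=.
  have E C : C \in lcosets H G -> \sum_(j < SZ) xx k j ^+ (p ^ q) * act (repr C) (yy k j ^+ (p ^ q) * x)
      = (if repr C \in H then g (lshift n k) else 0) ^+ (p ^ q) * act (repr C) x.
    move=> CL; rewrite -(K0 k _ (reprG CL)) (pchar_exp_sum q _ _ _ charS) mulr_suml; apply: eq_bigr => j _.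
    by rewrite rmorphM rmorphXn /= exprMn mulrA.
  rewrite (eq_bigr _ E) (bigD1 (gval H)) /=; last first.
    by apply/lcosetsP; exists 1%g; rewrite ?group1 // lcoset_id ?group1.
  rewrite repr_group group1 act1 big1 ?addr0 // => C /andP[/lcosetsP[y Gy CE] CH].
  have : repr C \in (y *: H)%g by rewrite CE; exact: mem_repr (lcoset_refl H y).
  move/lcoset_eqP => E'; case: ifP => Hr; last by rewrite expr0n gtn_eqF // mul0r.
  by move: CH; rewrite CE -E' lcoset_id ?eqxx.
(* Traces of H-invariants are G-invariants and may miss [A]; tracing against [q0]-th powers gives a
   condition that holds for [A] and for all [q0]-th powers of H-invariants. *)
pose B b := TH b /\ forall s, TH s -> A (TR (s ^+ q0 * b)).
have A_wc d x : A x -> A (wc d x).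
  by move=> [y ->]; exists (wcomp w d y); rewrite (wcomp_subst _ _ hom_f).
have A_TRX s : TH s -> A (TR (s ^+ q0)).
  by move=> Hs; rewrite /q0 TRX; apply/domP/TR_inv.
have powB x : TH x -> B (x ^+ q0).
  move=> Hx; split; first exact: invX.
  by move=> s Hs; rewrite -exprMn; apply/A_TRX/invM.
have AB x : A x -> B x.
  move=> Ax; split; first exact/TGH/A_TG.
  by move=> s Hs; rewrite mulrC (TR_TG _ (A_TG Ax)); apply: imfM Ax _; exact: A_TRX.
have BB x y : B x -> B y -> B (x - y).
  move=> [Hx Ax] [Hy Ay]; split; first exact: invB.
  by move=> s Hs; rewrite mulrBr raddfB; apply: imfB; [apply: Ax|apply: Ay].
have Bwc d x : B x -> B (wc d x).
  move=> [Hx Ax]; split; first exact: inv_wc.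
  move=> s Hs; have [Bs ->] := wcomp_decomp (fun=> 1%N) s.
  rewrite {1}/q0 (pchar_exp_sum Q0 _ _ _ charS) -/q0 mulr_suml raddf_sum; apply: imf_sum => e0 /=.
  have he := whomXn q0 (wcomp_idem (fun=> 1%N) e0 s).
  have := wcompM (e0 * q0 + d)%N x he; rewrite leq_addr addKn => <-.
  by rewrite TRwc; apply/A_wc/Ax/inv_wc.
have TRg i k s x : TR (s * (g k ^+ i * x)) = g k ^+ i * TR (s * x).
  have -> : s * (g k ^+ i * x) = g k ^+ i * (s * x) by rewrite mulrCA.
  exact: (TR_TG _ (invX i (gTG k))).
have Bsat i j z : B (g (lshift n 1) ^+ i * z) -> B (g (lshift n 0) ^+ j * z) -> B z.
  move=> [Hz1 Az1] [_ Az0]; split.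
    move=> s Hs; have /= := Hz1 s Hs; rewrite rmorphM rmorphXn /= (gTG _ s (HG Hs)).
    by apply: mulfI; rewrite expf_neq0.
  move=> s Hs; apply: (imf_saturated charK ker_f le_cNm w_gt0 e_gt0 gam_gt0 hom_f hom_r hom_h DP_t DS_g (i := i) (j := j)).
    by rewrite -/(g _) -TRg; apply: Az1.
  by rewrite -/(g _) -TRg; apply: Az0.
(* By [TR_K0] a parameter times [x] is a combination of [q0]-th powers with coefficients in [A], and
   the condition on [y] absorbs the powers; saturation for two parameters removes the parameter. *)
have BM x y : B x -> B y -> B (x * y).
  move=> [Hx Ax] [Hy Ay]; split; first exact: invM.
  have key (k : 'I_3) s : TH s -> A (g (lshift n k) ^+ 1 * TR (s ^+ q0 * (x * y))).
    move=> Hs; rewrite -TRg.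
    have -> : s ^+ q0 * (g (lshift n k) ^+ 1 * (x * y)) = s ^+ q0 * (g (lshift n k) ^+ (p ^ 0) * x * y).
      by rewrite expn0; ring.
    rewrite -(TR_K0 0%N k x Hx).
    rewrite mulr_suml mulr_sumr raddf_sum; apply: imf_sum => j /=.
    have [_ Hy2 _] := eltP k j.
    have -> : s ^+ q0 * (xx k j ^+ (p ^ 0) * TR (yy k j ^+ (p ^ 0) * x) * y) = TR (yy k j * x) * ((s * xh k j) ^+ q0 * y).
      by rewrite expn0 !expr1 exprMn /xx; ring.
    have Ay2 : A (TR (yy k j * x)) := Ax _ Hy2.
    rewrite (TR_TG _ (A_TG Ay2)).
    exact: (imfM Ay2 (Ay _ (invM Hs (xh_TH k j)))).
  move=> s Hs; apply: (imf_saturated charK ker_f le_cNm w_gt0 e_gt0 gam_gt0 hom_f hom_r hom_h DP_t DS_g (i := 1%N) (j := 1%N));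
    exact: key.
have TR_A q k j x : B x -> A (TR (yy k j ^+ (p ^ q) * x)).
  move=> [_ Ax]; rewrite /yy exprAC; apply/Ax/invX; by case: (eltP k j).
have xx_B k j : B (xx k j) by exact/powB/xh_TH.
have yy_hom0 (j : 'I_SZ) : exists t, sh t (yy 1 j).
  have [_ _ [d hd]] := eltP 1 j; exists (d * q0)%N; exact: whomXn.
have [tau yy_hom] := fin_all_exists yy_hom0.
(* If [g0] fixed every coordinate, the sums for [g0] and for 1 would agree, but they are 0 and a
   nonzero product. *)
have [j jP] : exists j : 'I_SZ, act g0 (elt 0 j).2 != (elt 0 j).2.
  apply: NNPP => Hn; have /eqP[] := hl_neq0 (lshift n 0).
  have := L_sum 0 _ g0G; rewrite (negPf g0H) => <-.
  have := L_sum 0 _ (group1 G); rewrite group1 => <-.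
  apply: eq_bigr => j _; congr (_ * _); rewrite act1; apply/eqP/negPn/negP => H1; apply: Hn; exists j.
  by rewrite eq_sym.
(* The factor [g (lshift n 0)] raises the degree of [s] to at least [gam]. *)
pose s := yy 0 j * g (lshift n 0).
have [_ y_TH [dy hy]] := eltP 0 j.
have s_B : B s by apply: BM (AB _ (g_A _)); exact: powB.
have hg0 : sh gam (g (lshift n 0)) by rewrite /whom /g -(wcomp_subst _ _ hom_f) hom_h.
have s_hom : sh (dy * q0 + gam)%N s by apply: whomM hg0; exact: whomXn.
(* [g0] fixes [A] pointwise and moves [s]. *)
have s_ind x y : A x -> A y -> x + s * y = 0 -> y = 0.
  move=> Ax Ay E0; apply/eqP; apply: contraNT jP => y0.
  have sE : s * y = - x by apply/eqP; rewrite -addr_eq0 addrC E0.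
  have : act g0 (s * y) = s * y by rewrite sE raddfN /= (A_TG Ax g0G).
  rewrite /s /yy !rmorphM rmorphXn /= (gTG _ _ g0G) (A_TG Ay g0G) => /(mulIf y0)/(mulIf (g_neq0 _)).
  by move/(pchar_exp_inj charS) => ->.
exact: (pullback_absurd charK ker_f le_cNm w_gt0 e_gt0 gam_gt0 hom_f hom_r hom_h DP_t DS_g BB BM AB Bwc Bsat
  TRZ (fun a x Aa => TR_TG x (A_TG Aa)) TRX TRwc TR_A (fun q k x Bx => TR_K0 q k x Bx.1) xx_B yy_hom s_B s_hom s_ind (leq_addl _ _)).
Qed.
End CharP.

(** An element of G outside H would force N >= 3, the shape 3 + n on which [charp_core] runs. *)
Theorem complete_intersection_prime_char (K : closedFieldType) p (charK : p \in [pchar K])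
    (gT : finGroupType) (G H : {group gT}) (N m c : nat) (rG : mx_representation K G N)
    (f : 'I_m -> {mpoly K[N]}) (r : 'I_c -> {mpoly K[m]}) (w : 'I_m -> nat) (e : 'I_c -> nat) :
  (forall i, 0 < w i)%N -> (forall i, 0 < e i)%N -> (forall i, whom (fun=> 1%N) (w i) (f i)) ->
  (forall i, inv_under rG G (f i)) -> (forall i, whom w (e i) (r i)) ->
  (forall x, x^$ f = 0 <-> in_ideal r x) -> (c + N <= m)%N ->
  (forall u v : 'I_N -> K, (forall i, (f i).@[u] = (f i).@[v]) ->
     exists2 g, g \in G & forall i, v i = \sum_j rG g j i * u j) ->
  H \subset G -> (forall g, g \in G -> g \notin H -> (3 <= \rank ((rG g - 1%:M)%R))%N) -> G \subset H.
Proof.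
move=> w0 e0 hf invf hr kf le sep sHG rk; apply/subsetP => g0 Gg0; apply/negPn/negP => Hg0.
have N3 : (3 <= N)%N := leq_trans (rk _ Gg0 Hg0) (rank_leq_row _).
case: N N3 rG f hf invf kf le sep rk => [|[|[|n]]] // _ rG f hf invf kf le sep rk.
exact: (@charp_core K p charK gT G H n m c rG f r w e w0 e0 hf invf hr kf le sep sHG rk g0 Gg0 Hg0).
Qed.

(** * A certificate for the kernel of a presentation *)

Section Reduction.
Variables (K : fieldType) (N m c : nat).
Local Notation S := {mpoly K[N]}.
Local Notation P := {mpoly K[m]}.
Local Notation R := {mpoly K[N + m]}.
Local Notation mon := 'X_{1..(N + m)}.
Variables (f : 'I_m -> S) (r : 'I_c -> P) (w : 'I_m -> nat).
Hypothesis w_gt0 : forall i, (0 < w i)%N.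
Hypothesis hom_f : forall i, whom (fun=> 1%N) (w i) (f i).
Local Notation one := ((fun=> 1%N) : 'I_N -> nat).

(** Its kernel is the ideal of the graph of [f]; the part of it in the second group of variables is
    the kernel of the presentation. *)
Definition eval_graph (z : R) : S := z^$ (catf (fun j => 'X_j) f).
Definition graph_weight : 'I_(N + m) -> nat := catf (fun=> 1%N) w.
Definition xdeg N' m' (mu : 'X_{1..(N' + m')}) := (\sum_(i < N') mu (lshift m' i))%N.
(** An elimination order: reducing a monomial free of the first group of variables never brings them
    back. *)
Definition elim_lt N' m' (mu nu : 'X_{1..(N' + m')}) :=
  (xdeg mu < xdeg nu)%N || (xdeg mu == xdeg nu) && (mu < nu)%O.
Definition embY (y : P) : R := y^$ (fun i => 'X_(rshift N i)).
Local Notation Phi := eval_graph.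
Local Notation W := graph_weight.

Fact eval_graph_additive : additive Phi. Proof. by move=> x y; rewrite /Phi raddfB. Qed.
Fact eval_graph_mult : monoid_morphism Phi.
Proof. by split=> [|x y]; rewrite /Phi ?rmorph1 ?rmorphM. Qed.
HB.instance Definition _ := GRing.isAdditive.Build R S Phi eval_graph_additive.
HB.instance Definition _ := GRing.isMonoidMorphism.Build R S Phi eval_graph_mult.
Lemma eval_graphZ a x : Phi (a *: x) = a *: Phi x. Proof. exact: comp_mpolyZ. Qed.

Lemma xdegD (mu nu : mon) : xdeg (mu + nu)%MM = (xdeg mu + xdeg nu)%N.
Proof. by rewrite /xdeg -big_split; apply: eq_bigr => i _; rewrite mnmDE. Qed.
Lemma elim_lt_total (mu nu : mon) : mu != nu -> elim_lt mu nu || elim_lt nu mu.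
Proof.
move=> ne; rewrite /elim_lt; case: (ltngtP (xdeg mu) (xdeg nu)) => //= _.
by apply: Order.TotalTheory.lt_total.
Qed.
Lemma elim_lt_trans (nu mu rho : mon) : elim_lt mu nu -> elim_lt nu rho -> elim_lt mu rho.
Proof.
rewrite /elim_lt => /orP[l1|/andP[/eqP e1 l1]] /orP[l2|/andP[/eqP e2 l2]].
- by rewrite (ltn_trans l1 l2).
- by rewrite -e2 l1.
- by rewrite e1 l2.
- by rewrite e1 e2 eqxx (Order.POrderTheory.lt_trans l1 l2) orbT.
Qed.
Lemma elim_lt_add (rho mu nu : mon) : elim_lt (rho + mu)%MM (rho + nu)%MM = elim_lt mu nu.
Proof. by rewrite /elim_lt !xdegD ltn_add2l eqn_add2l ltmc_add2r. Qed.
Lemma elim_lt_wf (Q : mon -> Prop) : (forall mu, (forall nu, elim_lt nu mu -> Q nu) -> Q mu) -> forall mu, Q mu.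
Proof.
move=> H mu; have [b] := ubnP (xdeg mu); elim: b mu => // b IH mu.
elim/(ltmwf (n := N + m)): mu => mu IHmu lb; apply: H => nu; rewrite /elim_lt.
case/orP=> [lt|/andP[/eqP E lt]]; first by apply: IH; rewrite -ltnS; exact: leq_trans lt lb.
by apply: IHmu lt _; rewrite E.
Qed.

Lemma elim_lead (s : seq mon) : s != [::] -> exists2 mu, mu \in s & forall nu, nu \in s -> nu != mu -> elim_lt nu mu.
Proof.
elim: s => // mu [_ _|nu s IH _]; first by exists mu => [|nu]; rewrite inE // => ->.
have [//|la las lam] := IH; have [E|ne] := eqVneq mu la.
  exists la; first by rewrite inE las orbT.
  by move=> x; rewrite inE E => /orP[->//|]; exact: lam.
case/orP: (elim_lt_total ne) => lt.
  exists la; first by rewrite inE las orbT.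
  by move=> x; rewrite inE => /orP[/eqP -> //|]; exact: lam.
exists mu; first by rewrite inE eqxx.
move=> x; rewrite inE => /orP[->//|xs _]; have [-> //|nx] := eqVneq x la.
exact: elim_lt_trans (lam x xs nx) lt.
Qed.

Variables (t : nat) (la : 'I_t -> mon) (tail : 'I_t -> R).
Definition standard mu := ~~ [exists k, (la k <= mu)%MM].
Definition std_mon d := {b : 'X_{1..(N + m) < d.+1} | (wdeg W b == d) && standard b}.
Definition x_mon d := {a : 'X_{1..N < d.+1} | wdeg one a == d}.

Lemma W_gt0 i : (0 < W i)%N.
Proof. by rewrite /W; case: (split_ordP i) => j ->; rewrite ?catfL ?catfR. Qed.
Lemma hom_graph d z : whom W d z -> whom one d (Phi z).
Proof.
move=> hz; rewrite /whom /Phi -(@wcomp_subst _ _ _ one W) ?hz // => i.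
rewrite /W; case: (split_ordP i) => j ->; rewrite ?catfL ?catfR //.
by have := @whomX K N one U_(j)%MM; rewrite wdegU.
Qed.

Lemma x_span d z : whom one d z -> exists C : x_mon d -> K, z = \sum_a C a *: 'X_[val (val a)].
Proof.
move=> hz; have hm mu : z@_mu != 0 -> wdeg one mu = d by move/whomP: hz => /[apply].
exists (fun a => z@_(val (val a))); apply/mpolyP => mu; rewrite raddf_sum /=.
under eq_bigr => a _ do rewrite mcoeffZ mcoeffX.
have [z0|nz] := eqVneq z@_mu 0.
  by rewrite z0 big1 // => a _; case: eqP => [->|_]; rewrite ?z0 ?mul0r ?mulr0.
have dmu := hm _ nz; have lt : (mdeg mu < d.+1)%N by rewrite ltnS -dmu; apply: mdeg_wdeg.
have pa : wdeg one (BMultinom lt) == d by apply/eqP.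
rewrite (bigD1 (exist _ (BMultinom lt) pa : x_mon d)) //= eqxx mulr1 big1 ?addr0 // => a ne.
case: eqP => [E|_]; last by rewrite mulr0.
by case/eqP: ne; apply/val_inj/val_inj.
Qed.

Lemma x_indep d : indep_mod (fun x : S => x = 0) (fun a : x_mon d => 'X_[val (val a)] : S).
Proof.
move=> C E a; have := congr1 (fun z : S => z@_(val (val a))) E; rewrite mcoeff0 raddf_sum /=.
under eq_bigr => b _ do rewrite mcoeffZ mcoeffX.
rewrite (bigD1 a) //= eqxx mulr1 big1 ?addr0 // => b ne.
case: eqP => [E'|_]; last by rewrite mulr0.
by case/eqP: ne; apply/val_inj/val_inj.
Qed.

Section Kernel.
Hypothesis tail_hom : forall k, whom W (wdeg W (la k)) (tail k).
Hypothesis tail_lt : forall k mu, (tail k)@_mu != 0 -> elim_lt mu (la k).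
Hypothesis graph0 : forall k, Phi ('X_[la k] + tail k) = 0.
Hypothesis pure : forall k, xdeg (la k) = 0%N -> exists2 y, in_ideal r y & 'X_[la k] + tail k = embY y.
Hypothesis count : forall d, (#|{: std_mon d}| <= #|{: x_mon d}|)%N.
Hypothesis r0 : forall j, (r j)^$ f = 0.

(** Division by the elements with leading monomials [la k], by well-founded induction; the predicate
    [Q] carries an invariant along, such as being free of the first group of variables. *)
Lemma std_reduction (Q : mon -> Prop) (V : R -> Prop) d : subsp V ->
  (forall mu nu, elim_lt nu mu -> Q mu -> Q nu) ->
  (forall mu, Q mu -> standard mu -> wdeg W mu = d -> V 'X_[mu]) ->
  (forall k rho, Q (la k + rho)%MM -> V (('X_[la k] + tail k) * 'X_[rho])) ->
  forall mu, Q mu -> wdeg W mu = d -> V 'X_[mu].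
Proof.
move=> hV Qlt Vstd Vla; apply: elim_lt_wf => mu IH Qmu dmu.
have [st|] := boolP (standard mu); first exact: Vstd.
rewrite negbK => /existsP[k le]; have [_ VD VZ] := hV.
have mE : mu = (la k + (mu - la k))%MM by rewrite addmC submK.
have -> : 'X_[mu] = ('X_[la k] + tail k) * 'X_[mu - la k] + (-1) *: (tail k * 'X_[mu - la k]) :> R.
  by rewrite mulrDl -mpolyXD -mE scaleN1r addrK.
apply: (VD); first by apply: Vla; rewrite -mE.
apply: (VZ); rewrite (mpolyE (tail k)) mulr_suml big_seq.
elim/big_ind: _ => [|x y|nu]; [by case: hV|exact: VD|].
rewrite mcoeff_msupp => nz; rewrite -scalerAl -mpolyXD; apply: (VZ).
have lt : elim_lt (nu + (mu - la k))%MM mu by rewrite {2}mE addmC [X in elim_lt _ X]addmC elim_lt_add tail_lt.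
apply: IH => //; first exact: Qlt lt Qmu.
by rewrite wdegD ((whomP _ _ _).1 (tail_hom k) _ nz) -wdegD -mE.
Qed.

Lemma std_span d mu : wdeg W mu = d -> exists C : std_mon d -> K, Phi 'X_[mu] = \sum_b C b *: Phi 'X_[val (val b)].
Proof.
pose V (z : R) := exists C : std_mon d -> K, Phi z = \sum_b C b *: Phi 'X_[val (val b)].
have hV : subsp V.
  split=> [|x y [C E] [C' E']|a x [C E]].
  - by exists (fun=> 0); rewrite raddf0 big1 // => b _; rewrite scale0r.
  - exists (fun b => C b + C' b); rewrite raddfD /= E E' -big_split; apply: eq_bigr => b _.
    by rewrite scalerDl.
  - exists (fun b => a * C b); rewrite eval_graphZ E scaler_sumr; apply: eq_bigr => b _.
    by rewrite scalerA.
apply: (@std_reduction (fun=> True) V d hV) => // [nu _ st dn|k rho _].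
  have lt : (mdeg nu < d.+1)%N by rewrite ltnS -dn; apply: mdeg_wdeg W_gt0 _.
  have pb : (wdeg W (BMultinom lt) == d) && standard (BMultinom lt) by rewrite /= st dn eqxx.
  pose b0 : std_mon d := exist _ (BMultinom lt) pb.
  exists (fun b => (b == b0)%:R); rewrite (bigD1 b0) //= eqxx scale1r big1 ?addr0 // => b.
  by move/negPf ->; rewrite scale0r.
by exists (fun=> 0); rewrite rmorphM /= graph0 mul0r big1 // => b _; rewrite scale0r.
Qed.

Lemma mon_x_graph d (a : x_mon d) : exists2 mu, wdeg W mu = d & Phi 'X_[mu] = 'X_[val (val a)].
Proof.
case: a => a /= /eqP ha; exists [multinom catf a (fun=> 0%N) i | i < N + m].
  transitivity (wdeg one a); last exact: ha.
  rewrite /wdeg big_split_ord /= [X in (_ + X)%N]big1 ?addn0 => [|i _]; last by rewrite mnmE catfR muln0.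
  by apply: eq_bigr => i _; rewrite mnmE /W !catfL.
rewrite /Phi substX big_split_ord /= [X in _ * X]big1 ?mulr1 => [|i _]; last by rewrite mnmE !catfR expr0.
by rewrite [RHS]mpolyXE_id; apply: eq_bigr => i _; rewrite mnmE !catfL.
Qed.

(** The standard monomials span degree [d] and are not more numerous than its monomial basis, hence
    independent; this numerical argument replaces Buchberger's criterion. *)
Lemma std_indep d : indep_mod (fun x : S => x = 0) (fun b : std_mon d => Phi 'X_[val (val b)]).
Proof.
apply: (exchange_indep (subsp0 _) (@x_indep d) _ (count d)) => a.
have [mu dmu <-] := mon_x_graph a; have [C ->] := std_span dmu.
by exists C; rewrite subrr.
Qed.

Lemma embY_graph y : Phi (embY y) = y^$ f.
Proof.
rewrite /Phi /embY substK; congr (_ \mPo _); apply/eq_from_tnth => i.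
by rewrite !tnth_mktuple substXU catfR.
Qed.

(** A kernel element, written in the second variables, reduces to an element of (r) plus standard
    monomials, since the elimination order only lets rules free of the first variables apply;
    independence of the standard monomials kills the remainder. *)
Lemma kernel_in_ideal (y : P) : y^$ f = 0 <-> in_ideal r y.
Proof.
split; last first.
  by move=> [q ->]; rewrite raddf_sum big1 // => j _; rewrite /= rmorphM /= r0 mul0r.
suff H d (z : P) : whom w d z -> z^$ f = 0 -> in_ideal r z.
  move=> y0; have [B ->] := wcomp_decomp w y; apply: in_ideal_sum => d _.
  by apply: H (wcomp_idem w d y) _; rewrite (wcomp_subst _ _ hom_f) y0 raddf0.
move=> hz z0.
pose V (x : R) := exists2 q, in_ideal r q & exists C : std_mon d -> K, x = embY q + \sum_b C b *: 'X_[val (val b)].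
have embD a b : embY (a + b) = embY a + embY b by rewrite /embY raddfD.
have embZ a b : embY (a *: b) = a *: embY b by exact: comp_mpolyZ.
have embM a b : embY (a * b) = embY a * embY b by rewrite /embY rmorphM.
have hV : subsp V.
  split=> [|_ _ [q hq [C ->]] [q' hq' [C' ->]]|a _ [q hq [C ->]]].
  - exists 0; first exact: in_ideal0.
    by exists (fun=> 0); rewrite /embY raddf0 add0r big1 // => b _; rewrite scale0r.
  - exists (q + q'); first exact: in_idealD.
    exists (fun b => C b + C' b); rewrite embD addrACA -big_split; congr (_ + _).
    by apply: eq_bigr => b _; rewrite scalerDl.
  - exists (a *: q); first by rewrite -mul_mpolyC; exact: in_idealMl.
    exists (fun b => a * C b); rewrite embZ scalerDr [X in _ + X = _]scaler_sumr; congr (_ + _).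
    by apply: eq_bigr => b _; rewrite scalerA.
pose emon (nu : 'X_{1..m}) : mon := [multinom catf (fun=> 0%N) nu i | i < N + m].
have embX nu : embY 'X_[nu] = 'X_[emon nu].
  rewrite /embY substX [RHS]mpolyXE_id big_split_ord /= [X in X * _]big1 ?mul1r => [|i _].
    by apply: eq_bigr => i _; rewrite mnmE catfR.
  by rewrite mnmE catfL expr0.
have pureE (mu : mon) : xdeg mu = 0%N -> mu = emon [multinom mu (rshift N i) | i < m].
  move=> /eqP; rewrite /xdeg sum_nat_eq0 => /forallP H; apply/mnmP => i; rewrite mnmE.
  by case: (split_ordP i) => j ->; rewrite ?catfL ?catfR ?mnmE //; apply/eqP/H.
have Vz : V (embY z).
  rewrite (mpolyE z) /embY raddf_sum big_seq; have [V0 VD VZ] := hV.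
  elim/big_ind: _ => [|x y'|nu]; [exact: V0|exact: VD|].
  rewrite mcoeff_msupp => nz; rewrite /= comp_mpolyZ; apply: (VZ); rewrite -/(embY _) embX.
  apply: (@std_reduction (fun mu => xdeg mu = 0%N) V d hV).
  - move=> mu nu' + x0; rewrite /elim_lt x0 ltn0 /= => /andP[/eqP -> _]; by [].
  - move=> mu _ st dmu.
    have lt : (mdeg mu < d.+1)%N by rewrite ltnS -dmu; apply: mdeg_wdeg W_gt0 _.
    have pb : (wdeg W (BMultinom lt) == d) && standard (BMultinom lt) by rewrite /= st dmu eqxx.
    exists 0; first exact: in_ideal0.
    pose b0 : std_mon d := exist _ (BMultinom lt) pb.
    exists (fun b => (b == b0)%:R); rewrite /embY raddf0 add0r.
    rewrite (bigD1 b0) //= eqxx scale1r big1 ?addr0 // => b.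
    by move/negPf ->; rewrite scale0r.
  - move=> k rho; rewrite xdegD => /eqP; rewrite addn_eq0 => /andP[/eqP lk /eqP rk].
    have [y' hy ->] := pure lk; rewrite (pureE _ rk) -embX -embM.
    exists (y' * 'X_[[multinom rho (rshift N i) | i < m]]); first exact: in_idealMr.
    by exists (fun=> 0); rewrite big1 ?addr0 // => b _; rewrite scale0r.
  - rewrite /xdeg big1 // => i _; by rewrite mnmE catfL.
  rewrite -((whomP _ _ _).1 hz _ nz) /wdeg big_split_ord /= [X in (X + _)%N]big1 => [|i _].
    by rewrite add0n; apply: eq_bigr => i _; rewrite mnmE /W !catfR.
  by rewrite mnmE catfL muln0.
have [q hq [C E]] := Vz.
have q0 : q^$ f = 0.
  by case: hq => a ->; rewrite raddf_sum big1 // => j _; rewrite /= rmorphM /= r0 mul0r.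
have C0 : forall b, C b = 0.
  apply: std_indep; have := congr1 Phi E; rewrite raddfD /= !embY_graph z0 q0 add0r raddf_sum /= => {2}->.
  by apply: eq_bigr => b _; rewrite eval_graphZ.
have : embY z = embY q by rewrite E big1 ?addr0 // => b _; rewrite C0 scale0r.
move/(congr1 (fun x : R => x^$ (catf (fun=> 0) (fun i => 'X_i) : 'I_(N + m) -> P))).
have K1 y' : (embY y')^$ (catf (fun=> 0) (fun i => 'X_i) : 'I_(N + m) -> P) = y'.
  rewrite /embY substK -[RHS]comp_mpoly_id; congr (_ \mPo _); apply/eq_from_tnth => i.
  by rewrite !tnth_mktuple substXU catfR.
by rewrite !K1 => ->.
Qed.
End Kernel.
End Reduction.

(** The polynomials all of whose monomials lie above members of [La] form an ideal, and the
    monomials of its finitely many generators lead to the [la k]. *)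
Lemma monomial_dickson n (La : 'X_{1..n} -> Prop) : exists t (la : 'I_t -> 'X_{1..n}),
  (forall k, La (la k)) /\ forall mu, La mu -> exists k, (la k <= mu)%MM.
Proof.
pose I (F : {mpoly rat[n]}) := forall mu, F@_mu != 0 -> exists2 nu, La nu & (nu <= mu)%MM.
have hI : is_ideal I.
  split=> [mu|x y Hx Hy mu|x y Hy mu]; first by rewrite mcoeff0 eqxx.
    rewrite mcoeffD; have [->|/Hx //] := eqVneq x@_mu 0; rewrite add0r; exact: Hy.
  rewrite -mcoeff_msupp => /msuppM_le/allpairsP[[a b] /= [_ + ->]].
  rewrite mcoeff_msupp => /Hy[nu Ln le]; exists nu => //; apply: lepm_trans le _; exact: lem_addl.
have [l [g [gI gE]]] := hilbert_basis hI.
pose ss := flatten [seq (msupp (g i) : seq 'X_{1..n}) | i : 'I_l].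
have ssP mu : mu \in ss -> exists nu, La nu /\ (nu <= mu)%MM.
  by move/flatten_mapP=> [i _]; rewrite mcoeff_msupp => /gI[nu Ln le]; exists nu.
have laE (k : 'I_(size ss)) : exists nu, La nu /\ (nu <= nth 0%MM ss k)%MM by apply/ssP/mem_nth.
have [la laP] := fin_all_exists laE.
exists (size ss), la; split=> [k|mu Lmu]; first by case: (laP k).
have [|q] := gE 'X_[mu].
  by move=> nu; rewrite mcoeffX; case: (mu =P nu) => [<- _|_]; [exists mu => //; apply: lepm_refl|rewrite eqxx].
move/(congr1 (mcoeff mu)); rewrite mcoeffX eqxx raddf_sum /= => E.
have [i nz] : exists i, (g i * q i)@_mu != 0.
  apply: NNPP => H; move/eqP: E; rewrite big1 ?oner_eq0 // => i _.
  by apply/eqP/negPn/negP => nz; apply: H; exists i.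
move: nz; rewrite -mcoeff_msupp => /msuppM_le/allpairsP[[a b] /= [ga _ ->]].
have sa : a \in ss by apply/flatten_mapP; exists i; rewrite ?mem_enum.
have lt : (index a ss < size ss)%N by rewrite index_mem.
exists (Ordinal lt); case: (laP (Ordinal lt)) => _ le; apply: lepm_trans le _.
by rewrite /= nth_index //; exact: lem_addr.
Qed.

Section Certificate.
Variables (K : fieldType) (N m c : nat).
Local Notation S := {mpoly K[N]}.
Local Notation P := {mpoly K[m]}.
Local Notation R := {mpoly K[N + m]}.
Local Notation mon := 'X_{1..(N + m)}.
Variables (f : 'I_m -> S) (r : 'I_c -> P) (w : 'I_m -> nat).
Hypothesis w_gt0 : forall i, (0 < w i)%N.
Hypothesis hom_f : forall i, whom (fun=> 1%N) (w i) (f i).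
Hypothesis ker_f : forall x : P, x^$ f = 0 <-> in_ideal r x.
Local Notation W := (@graph_weight N m w).
Local Notation Phi := (eval_graph f).

(** The [la k] generate the leading monomials of the graph ideal. Standard monomials stay
    independent under evaluation, as a relation would have its leading monomial there; this yields
    the count, which mentions no field and so holds verbatim after specialisation. *)
Theorem kernel_certificate : exists t (la : 'I_t -> mon) (tail : 'I_t -> R),
  [/\ forall k, whom W (wdeg W (la k)) (tail k),
      forall k mu, (tail k)@_mu != 0 -> elim_lt mu (la k),
      forall k, Phi ('X_[la k] + tail k) = 0,
      forall k, xdeg (la k) = 0%N -> exists2 y, in_ideal r y & 'X_[la k] + tail k = embY N y &
      forall d, (#|{: std_mon w la d}| <= #|{: x_mon N d}|)%N].
Proof.
pose La (mu : mon) := exists tl : R, [/\ whom W (wdeg W mu) tl,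
  forall nu, tl@_nu != 0 -> elim_lt nu mu & Phi ('X_[mu] + tl) = 0].
have [t [la [laP laE]]] := monomial_dickson La.
have [tail tP] := fin_all_exists laP.
exists t, la, tail; split=> [k|k|k|k lk|d]; try by case: (tP k).
  case: (tP k) => _ tlt g0; set z := 'X_[la k] + _ in g0 *.
  pose y : P := z^$ (catf (fun=> 0) (fun i => 'X_i) : 'I_(N + m) -> P).
  have zE : z = embY N y.
    have Z0 (mu : mon) : xdeg mu = 0%N -> 'X_[mu] = embY N ('X_[mu]^$ (catf (fun=> 0) (fun i => 'X_i) : 'I_(N + m) -> P)) :> R.
      move=> /eqP; rewrite /xdeg sum_nat_eq0 => /forallP H.
      rewrite /embY substK substX mpolyXE_id; apply: eq_bigr => i _.
      case: (split_ordP i) => j ->; rewrite ?catfL ?catfR ?substXU //.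
      by have /eqP -> := H j; rewrite !expr0.
    pose Q (x : R) := x = embY N (x^$ (catf (fun=> 0) (fun i => 'X_i) : 'I_(N + m) -> P)).
    suff : Q z by [].
    rewrite (mpolyE z) big_seq; elim/big_ind: _ => [|a b Ha Hb|mu].
    - by rewrite /Q /embY !raddf0.
    - by rewrite /Q /embY !raddfD /= {1}Ha {1}Hb.
    rewrite mcoeff_msupp => nz; rewrite /Q /embY !comp_mpolyZ; congr (_ *: _); apply: Z0.
    move: nz; rewrite mcoeffD mcoeffX; case: (la k =P mu) => [<- _|_] //.
    by rewrite add0r => /tlt; rewrite /elim_lt lk ltn0 /= => /andP[/eqP].
  exists y => //; apply/ker_f; rewrite -(embY_graph f) -zE; exact: g0.
apply: (@exchange_leq _ S (fun x => x = 0) _ _ (fun b => Phi 'X_[val (val b)]) (fun a => 'X_[val (val a)])).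
- exact: subsp0.
- move=> C E b0; apply/eqP/negPn/negP => nz.
  pose z : R := \sum_b C b *: 'X_[val (val b)].
  have zc (b : std_mon w la d) : z@_(val (val b)) = C b.
    rewrite /z raddf_sum (bigD1 b) //= mcoeffZ mcoeffX eqxx mulr1 big1 ?addr0 // => b' ne.
    rewrite mcoeffZ mcoeffX; case: eqP => [E'|_]; last by rewrite mulr0.
    by case/eqP: ne; apply/val_inj/val_inj.
  have zs mu : z@_mu != 0 -> exists b : std_mon w la d, mu = val (val b).
    move=> nzm; apply: NNPP => Hn; case/eqP: nzm; rewrite /z raddf_sum big1 // => b _.
    by rewrite /= mcoeffZ mcoeffX; case: eqP => [E'|_]; [case: Hn; exists b|rewrite mulr0].
  have Pz : Phi z = 0 by rewrite -E /z raddf_sum; apply: eq_bigr => b _; rewrite /= eval_graphZ.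
  have [|mu mz lmu] := @elim_lead N m (msupp z).
    by apply/eqP => s0; move: (zc b0); rewrite memN_msupp_eq0 ?s0 // => E0; rewrite -E0 eqxx in nz.
  move: mz; rewrite mcoeff_msupp => mz; have [bm bmE] := zs _ mz.
  have dW (b : std_mon w la d) : wdeg W (val (val b)) = d by case: b => b /= /andP[/eqP].
  have : La mu.
    exists ((z@_mu)^-1 *: z - 'X_[mu]); split.
    - rewrite bmE dW; apply: whomB.
        apply/whomZ/whomP => nu /zs[b ->]; exact: dW.
      by have := @whomX K _ W (val (val bm)); rewrite dW.
    - move=> nu; rewrite mcoeffB mcoeffZ mcoeffX => nzn; apply: lmu.
        rewrite mcoeff_msupp; apply: contraNneq nzn => E0; rewrite E0 mulr0 sub0r.
        by case: (mu =P nu) => [E1|_]; rewrite ?oppr0 //; rewrite E1 E0 eqxx in mz.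
      by apply: contraNneq nzn => ->; rewrite eqxx mulVf // subrr.
    - by rewrite addrC subrK eval_graphZ Pz scaler0.
  move/laE => [k le]; case: bm bmE => b /= /andP[_ /negP st] bE; apply: st; apply/existsP; exists k.
  by rewrite -bE.
move=> b; have hb : whom (fun=> 1%N) d (Phi 'X_[val (val b)]).
  apply: (hom_graph hom_f); have := @whomX K _ W (val (val b)).
  by have -> : wdeg W (val (val b)) = d by case: b => b /= /andP[/eqP].
by have [C ->] := x_span hb; exists C; rewrite subrr.
Qed.
End Certificate.

(** * Reduction of characteristic zero to prime characteristic *)

(** The coefficients generate a ring over the integers; the extension theorem maps it to a closure
    of the prime field as soon as p exceeds a certain integer. Both [ev] and [sg] start from a
    polynomial ring over the integers, and the last clause says that [sg] factors through the image
    of [ev]. *)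
Theorem specialization (L : closedFieldType) (cs : seq L) B : [pchar L] =i pred0 ->
  exists (R0 : comNzRingType) (ev : {rmorphism R0 -> L}) (lc : L -> R0) (p : nat) (W : closedFieldType)
    (sg : {rmorphism R0 -> W}),
  [/\ p \in [pchar W], (B < p)%N, forall c, c \in cs -> ev (lc c) = c, lc 0 = 0 & forall F, ev F = 0 -> sg F = 0].
Proof.
move=> L0; pose j : {rmorphism int -> L} := intr.
pose x (i : 'I_(size cs)) := nth 0 cs i.
have prL : is_prime_ideal (fun z : L => z = 0).
  split; [|by apply/eqP; rewrite oner_eq0|].
    by split=> // [a b -> ->|a b ->]; rewrite ?addr0 ?mulr0.
  by move=> a b /eqP; rewrite mulf_eq0 => /orP[]/eqP; [left|right].
have n1 : mmap j x 1 <> 0 by apply/eqP; rewrite rmorph1 oner_eq0.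
have [d d0 dP] := extension_theorem prL n1.
have dn0 : d != 0 by apply/eqP => E; apply: d0; rewrite E rmorph0.
have [p pB pp] := prime_above (maxn B `|d|).
have [W [FW _]] := countable_algebraic_closure 'F_p.
have pW : p \in [pchar W] by apply: (rmorph_pchar FW); exact: pchar_Fp.
pose psi : {rmorphism int -> W} := intr.
have intr0 (c : int) : j c = 0 -> c = 0.
  have jn (k : nat) : j k = 0 -> k = 0%N.
    by move=> E; apply/eqP; rewrite -((pcharf0P L).1 L0); apply/eqP.
  case: c => c; first by move/jn ->.
  by rewrite NegzE rmorphN => /eqP; rewrite oppr_eq0 => /eqP/jn.
have pd : psi d != 0.
  rewrite /psi /= -(dvdz_pcharf pW) dvdzE /=; apply/negP => /dvdn_leq; rewrite absz_gt0 dn0 => /(_ isT).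
  by rewrite leqNgt (leq_ltn_trans (leq_maxr B _) pB).
have [|om [omP _]] := dP W psi _ pd; first by move=> c /intr0 ->; rewrite rmorph0.
(* 0 lifts to 0, so that lifting a polynomial does not enlarge its support; the other listed
   coefficients lift to variables. *)
pose lc (c : L) : {mpoly int[size cs]} := if (c != 0) =P true is ReflectT _ then
  (if insub (index c cs) is Some i then 'X_i else 0) else 0.
exists {mpoly int[size cs]}, (mmap j x : {rmorphism _ -> L}), lc, p, W, (mmap psi om : {rmorphism _ -> W}).
split=> //; first exact: leq_ltn_trans (leq_maxl _ _) pB.
  move=> c ccs; rewrite /lc; case: eqP => [c0|]; last by move/negP; rewrite negbK => /eqP ->; rewrite rmorph0.
  by rewrite insubT ?index_mem // => lt /=; rewrite mmapX mmap1U /x /= nth_index.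
by rewrite /lc; case: eqP => //; rewrite eqxx.
Qed.

Lemma map_subst (R T : comNzRingType) (tau : {rmorphism R -> T}) n m (f : 'I_m -> {mpoly R[n]}) (F : {mpoly R[m]}) :
  map_mpoly tau (F^$ f) = (map_mpoly tau F)^$ (fun i => map_mpoly tau (f i)).
Proof.
elim/mpolyind: F => [|c mu F _ _ IH]; first by rewrite !raddf0.
rewrite !raddfD /= IH; congr (_ + _); rewrite comp_mpolyZ !map_mpolyZ comp_mpolyZ map_mpolyX !substX rmorph_prod.
by congr (_ *: _); apply: eq_bigr => i _; rewrite rmorphXn.
Qed.

Lemma map_catf (R T : comNzRingType) (tau : {rmorphism R -> T}) n a b (f : 'I_a -> {mpoly R[n]}) g :
  forall i : 'I_(a + b), map_mpoly tau (catf f g i) = catf (fun k => map_mpoly tau (f k)) (fun k => map_mpoly tau (g k)) i.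
Proof. by move=> i; case: (split_ordP i) => j ->; rewrite ?catfL ?catfR. Qed.

Lemma eq_subst (R : comNzRingType) n m (f g : 'I_m -> {mpoly R[n]}) F : f =1 g -> F^$ f = F^$ g.
Proof. by move=> E; congr (_ \mPo _); apply/eq_from_tnth => i; rewrite !tnth_mktuple E. Qed.

(** Makes orbit separation a polynomial condition: the product over G of the combinations, with
    coefficients 1, t, t^2, .., of the coordinates of v - g u. Vanishing for enough values of t
    forces v into the orbit of u. *)
Definition orbit_norm (R : comNzRingType) (gT : finGroupType) (G : {set gT}) N (rho : gT -> 'M[R]_N) (t : nat) :
    {mpoly R[N + N]} :=
  \prod_(g in G) \sum_(i < N) (t%:R ^+ i) *: ('X_(rshift N i) - \sum_(j < N) rho g j i *: 'X_(lshift N j)).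

Lemma orbit_norm_map (R T : comNzRingType) (tau : {rmorphism R -> T}) (gT : finGroupType) (G : {set gT}) N
    (rho : gT -> 'M[R]_N) t :
  map_mpoly tau (orbit_norm G rho t) = orbit_norm G (fun g => map_mx tau (rho g)) t.
Proof.
rewrite /orbit_norm rmorph_prod; apply: eq_bigr => g _; rewrite raddf_sum; apply: eq_bigr => i _.
rewrite /= map_mpolyZ rmorphXn rmorph_nat; congr (_ *: _); rewrite raddfB /= map_mpolyX; congr (_ - _).
by rewrite raddf_sum; apply: eq_bigr => j _; rewrite /= map_mpolyZ map_mpolyX mxE.
Qed.

Lemma orbit_norm_eval (R : comNzRingType) (gT : finGroupType) (G : {set gT}) N (rho : gT -> 'M[R]_N) t u v :
  (orbit_norm G rho t).@[catf u v] = \prod_(g in G) \sum_(i < N) t%:R ^+ i * (v i - \sum_(j < N) rho g j i * u j).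
Proof.
rewrite /orbit_norm rmorph_prod; apply: eq_bigr => g _; rewrite raddf_sum; apply: eq_bigr => i _.
rewrite /= mevalZ mevalB mevalXU catfR; congr (_ * (_ - _)).
by rewrite raddf_sum; apply: eq_bigr => j _; rewrite /= mevalZ mevalXU catfL.
Qed.

(** For fixed u and v the norm is a polynomial in t of degree at most |G| N; p exceeds the number of
    values used, so these are distinct roots, and some factor vanishes identically. *)
Lemma orbit_norm_separates (W : closedFieldType) p (gT : finGroupType) (G : {group gT}) N (rho : gT -> 'M[W]_N) u v :
  p \in [pchar W] -> ((#|G| * N).+1 < p)%N ->
  (forall t, (t < (#|G| * N).+1)%N -> (orbit_norm G rho t).@[catf u v] = 0) ->
  exists2 g, g \in G & forall i, v i = \sum_(j < N) rho g j i * u j.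
Proof.
move=> pW lt Z; pose z g (i : 'I_N) := v i - \sum_(j < N) rho g j i * u j.
pose q g : {poly W} := \sum_(i < N) (z g i)%:P * 'X^i.
have qE g t : (q g).[t%:R] = \sum_(i < N) t%:R ^+ i * z g i.
  by rewrite /q horner_sum; apply: eq_bigr => i _; rewrite hornerCM hornerXn mulrC.
have sq g : (size (q g) <= N)%N.
  apply: leq_trans (size_sum _ _ _) _; apply/bigmax_leqP => i _.
  by rewrite mul_polyC (leq_trans (size_scale_leq _ _)) // size_polyXn.
have /eqP/prodf_eq0[g Gg /eqP q0] : \prod_(g in G) q g = 0.
  apply/eqP/negPn/negP => nz.
  have := max_poly_roots (rs := [seq (t%:R : W) | t <- iota 0 (#|G| * N).+1]) nz.
  rewrite size_map size_iota => H; suff : ((#|G| * N).+1 < (#|G| * N).+1)%N by rewrite ltnn.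
  apply: (@leq_trans (size (\prod_(g in G) q g))); last first.
    apply: leq_trans (size_prod_leq _ _) _; apply: leq_trans (leq_subr _ _) _.
    by rewrite ltnS -sum_nat_const; apply: leq_sum.
  apply: H; first by apply/allP => _ /mapP[t + ->]; rewrite mem_iota add0n /= => lt'; rewrite rootE horner_prod;
    rewrite -(Z _ lt') orbit_norm_eval; apply/eqP/eq_bigr => g _; rewrite qE.
  rewrite map_inj_in_uniq ?iota_uniq // => a b; rewrite !mem_iota !add0n /= => la lb.
  wlog le : a b la lb / (a <= b)%N.
    by move=> H' E; case: (leqP a b) => [|/ltnW] le; [apply: H'|apply/esym; apply: H'].
  move=> E; have : (p %| b - a)%N by rewrite (dvdn_pcharf pW) natrB // E subrr.
  case: (posnP (b - a)) => [e0 _|ba /(dvdn_leq ba)]; first by apply/eqP; rewrite eqn_leq le -subn_eq0 e0 eqxx.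
  move=> le'; have := leq_trans lt (leq_trans le' (leq_subr _ _)).
  by rewrite ltnNge (ltnW lb).
exists g => // i; apply/eqP; rewrite -subr_eq0 -/(z g i); apply/eqP.
have := congr1 (fun x : {poly W} => x`_i) q0; rewrite coef0 /q coef_sum (bigD1 i) //= coefCM coefXn eqxx mulr1.
rewrite big1 ?addr0 // => j ne; rewrite coefCM coefXn [_ == _](_ : _ = false) ?mulr0 //.
by apply/negP => /eqP E; case/eqP: ne; apply/val_inj.
Qed.

(** A rank bound becomes a matrix identity, which survives any ring homomorphism. *)
Lemma rank_certificate (K : fieldType) n k (M : 'M[K]_n) : (k <= \rank M)%N <->
  exists (X : 'M_(k, n)) (Y : 'M_(n, k)), X *m M *m Y = 1%:M.
Proof.
split=> [le|[X [Y E]]]; last first.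
  by rewrite -(mxrank1 K k) -E; apply: leq_trans (mxrankM_maxl _ _) (mxrankM_maxr _ _).
exists (pid_mx k *m invmx (col_ebase M)), (invmx (row_ebase M) *m pid_mx k).
rewrite -{2}(mulmx_ebase M) !mulmxA mulmxKV ?col_ebase_unit // mulmxK ?row_ebase_unit //.
have kn : (k <= n)%N := leq_trans le (rank_leq_row _).
by rewrite !mul_pid_mx (minn_idPl le) (minn_idPr kn) minnn (minn_idPr kn) pid_mx_1.
Qed.

(** * Transfer of identities along the specialisation *)

Section Lift.
Variables (L : fieldType) (R0 : comNzRingType) (W : fieldType).
Variables (ev : {rmorphism R0 -> L}) (sg : {rmorphism R0 -> W}) (lc : L -> R0).
Hypothesis lc0 : lc 0 = 0.
Hypothesis ker_ev : forall F, ev F = 0 -> sg F = 0.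

Definition coefs n (z : {mpoly L[n]}) := [seq z@_mu | mu <- msupp z].
Definition mpoly_lift n (z : {mpoly L[n]}) : {mpoly R0[n]} := \sum_(mu <- msupp z) lc z@_mu *: 'X_[mu].

Lemma mcoeff_lift n (z : {mpoly L[n]}) mu : (mpoly_lift z)@_mu = lc z@_mu.
Proof.
rewrite /mpoly_lift raddf_sum /=; under eq_bigr => nu _ do rewrite mcoeffZ mcoeffX.
have [mz|mz] := boolP (mu \in msupp z).
  rewrite (bigD1_seq mu) ?msupp_uniq //= eqxx mulr1 big1 ?addr0 // => nu /negPf ->; by rewrite mulr0.
rewrite (memN_msupp_eq0 mz) lc0 big1_seq // => nu /andP[_ nz].
by case: eqP => [E|_]; [rewrite -E nz in mz|rewrite mulr0].
Qed.

Lemma lift_ev n (z : {mpoly L[n]}) : (forall c, c \in coefs z -> ev (lc c) = c) -> map_mpoly ev (mpoly_lift z) = z.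
Proof.
move=> H; apply/mpolyP => mu; rewrite mcoeff_map_mpoly mcoeff_lift.
have [mz|mz] := boolP (mu \in msupp z); first by apply: (H _ _); exact: map_f.
by rewrite (memN_msupp_eq0 mz) lc0; exact: (rmorph0 ev).
Qed.

Lemma lift_supp n (z : {mpoly L[n]}) mu : (map_mpoly sg (mpoly_lift z))@_mu != 0 -> z@_mu != 0.
Proof. by rewrite mcoeff_map_mpoly mcoeff_lift; apply: contraNneq => ->; rewrite lc0; apply/eqP/(rmorph0 sg). Qed.

Lemma transfer n (F F' : {mpoly R0[n]}) : map_mpoly ev F = map_mpoly ev F' -> map_mpoly sg F = map_mpoly sg F'.
Proof.
move=> E; apply/mpolyP => mu; rewrite !mcoeff_map_mpoly; apply/eqP; rewrite -subr_eq0 -rmorphB; apply/eqP.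
apply: ker_ev; rewrite rmorphB; apply/eqP; rewrite subr_eq0; apply/eqP.
by have := congr1 (mcoeff mu) E; rewrite !mcoeff_map_mpoly.
Qed.

Lemma transfer_mx a b (F F' : 'M[R0]_(a, b)) : map_mx ev F = map_mx ev F' -> map_mx sg F = map_mx sg F'.
Proof.
move=> E; apply/matrixP => i j; rewrite !mxE; apply/eqP; rewrite -subr_eq0 -rmorphB; apply/eqP.
by apply: ker_ev; rewrite rmorphB; have /matrixP/(_ i j) := E; rewrite !mxE => ->; rewrite subrr.
Qed.

Definition mx_coefs a b (M : 'M[L]_(a, b)) := [seq M ij.1 ij.2 | ij : 'I_a * 'I_b].
Lemma mx_lift_ev a b (M : 'M[L]_(a, b)) : (forall c, c \in mx_coefs M -> ev (lc c) = c) -> map_mx ev (map_mx lc M) = M.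
Proof.
move=> H; apply/matrixP => i j; rewrite !mxE H //; apply/mapP; exists (i, j) => //; exact: mem_enum.
Qed.
End Lift.

Lemma finite_cover (T : eqType) (I : finType) (F : I -> seq T) : exists s : seq T, forall i, {subset F i <= s}.
Proof.
exists (flatten [seq F i | i : I]) => i x xF; apply/flatten_mapP; exists i => //; exact: mem_enum.
Qed.

(** Each hypothesis is encoded by identities: the kernel by its certificate, separation by powers of
    orbit norms in the ideal of differences, the ranks by left and right factors. These are lifted,
    transferred to characteristic p and decoded there. *)
Theorem complete_intersection_char0 (L : closedFieldType) (L0 : [pchar L] =i pred0)
    (gT : finGroupType) (G H : {group gT}) (N m c : nat) (rG : mx_representation L G N)
    (f : 'I_m -> {mpoly L[N]}) (r : 'I_c -> {mpoly L[m]}) (w : 'I_m -> nat) (e : 'I_c -> nat) :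
  (forall i, 0 < w i)%N -> (forall i, 0 < e i)%N -> (forall i, whom (fun=> 1%N) (w i) (f i)) ->
  (forall i, inv_under rG G (f i)) -> (forall i, whom w (e i) (r i)) ->
  (forall x, x^$ f = 0 <-> in_ideal r x) -> (c + N <= m)%N ->
  (forall u v : 'I_N -> L, (forall i, (f i).@[u] = (f i).@[v]) ->
     exists2 g, g \in G & forall i, v i = \sum_j rG g j i * u j) ->
  H \subset G -> (forall g, g \in G -> g \notin H -> (3 <= \rank ((rG g - 1%:M)%R))%N) -> G \subset H.
Proof.
move=> w0 e0 hf invf hr kf le sep sHG rk.
pose W_ := @graph_weight N m w.
have [t [la [tail [tlh tllt gr0 pu cnt]]]] := kernel_certificate hf kf.
have pu' k : exists q : 'I_c -> {mpoly L[m]}, xdeg (la k) = 0%N ->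
    'X_[la k] + tail k = embY N (\sum_j r j * q j).
  have [x0|nx] := eqVneq (xdeg (la k)) 0%N; last by exists (fun=> 0) => x0; rewrite x0 in nx.
  by have [y [q ->] E] := pu k x0; exists q.
have [q qP] := fin_all_exists pu'.
(* One more value than the degree of the orbit norm in t; it is also the lower bound imposed on
   p. *)
pose T := (#|G| * N).+1.
pose fd i : {mpoly L[N + N]} := (f i)^$ (fun k => 'X_(lshift N k)) - (f i)^$ (fun k => 'X_(rshift N k)).
have ns (s : 'I_T) : exists na : nat * ('I_m -> {mpoly L[N + N]}),
    orbit_norm G rG s ^+ na.1 = \sum_i fd i * na.2 i.
  have [|n [a aE]] := @nullstellensatz L (N + N) m fd (orbit_norm G rG s); last by exists (n, a).
  move=> x Z; pose u k := x (lshift N k); pose v k := x (rshift N k).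
  have xE : x =1 catf u v by move=> i; case: (split_ordP i) => k ->; rewrite ?catfL ?catfR.
  have [|g Gg gE] := sep u v.
    move=> i; have := Z i; rewrite /fd mevalB !meval_subst => /eqP; rewrite subr_eq0 => /eqP E.
    transitivity ((f i).@[fun k => ('X_(lshift N k)).@[x]]); first by apply: meval_eq => k; rewrite mevalXU.
    by rewrite E; apply: meval_eq => k; rewrite mevalXU.
  have -> : (orbit_norm G rG s).@[x] = (orbit_norm G rG s).@[catf u v] by apply: meval_eq.
  rewrite orbit_norm_eval; apply/eqP; rewrite prodf_seq_eq0; apply/hasP; exists g; first exact: mem_index_enum.
  by rewrite Gg /= big1 // => i _; rewrite gE subrr mulr0.
have [na naE] := fin_all_exists ns.
have rc (g : gT) : exists XY : 'M[L]_(3, N) * 'M[L]_(N, 3), g \in G -> g \notin H ->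
    XY.1 *m (rG g - 1%:M) *m XY.2 = 1%:M.
  case: (boolP ((g \in G) && (g \notin H))) => [/andP[Gg Hg]|nn].
    by have /rank_certificate[X [Y E]] := rk g Gg Hg; exists (X, Y).
  by exists (0, 0) => Gg Hg; rewrite Gg Hg in nn.
have [XY XYE] := fin_all_exists rc.
have [c1 H1] := finite_cover (fun i => coefs (f i)).
have [c2 H2] := finite_cover (fun i => coefs (r i)).
have [c3 H3] := finite_cover (fun i => coefs (tail i)).
have [c4 H4] := finite_cover (fun kj : 'I_t * 'I_c => coefs (q kj.1 kj.2)).
have [c5 H5] := finite_cover (fun si : 'I_T * 'I_m => coefs ((na si.1).2 si.2)).
have [c6 H6] := finite_cover (fun g => mx_coefs (rG g)).
have [c7 H7] := finite_cover (fun g => mx_coefs (XY g).1).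
have [c8 H8] := finite_cover (fun g => mx_coefs (XY g).2).
have [R0 [ev [lc [p [W [sg [pW ltp evlc lc0 kerev]]]]]]] :=
  specialization (c1 ++ c2 ++ c3 ++ c4 ++ c5 ++ c6 ++ c7 ++ c8) T L0.
have Lf i : map_mpoly ev (mpoly_lift lc (f i)) = f i.
  by apply: (lift_ev lc0) => x /H1 xc; apply: evlc; rewrite !mem_cat xc ?orbT.
have Lr i : map_mpoly ev (mpoly_lift lc (r i)) = r i.
  by apply: (lift_ev lc0) => x /H2 xc; apply: evlc; rewrite !mem_cat xc ?orbT.
have Lt i : map_mpoly ev (mpoly_lift lc (tail i)) = tail i.
  by apply: (lift_ev lc0) => x /H3 xc; apply: evlc; rewrite !mem_cat xc ?orbT.
have Lq k j : map_mpoly ev (mpoly_lift lc (q k j)) = q k j.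
  by apply: (lift_ev lc0) => x xc; apply: evlc; rewrite !mem_cat (H4 (k, j) x xc) ?orbT.
have La s i : map_mpoly ev (mpoly_lift lc ((na s).2 i)) = (na s).2 i.
  by apply: (lift_ev lc0) => x xc; apply: evlc; rewrite !mem_cat (H5 (s, i) x xc) ?orbT.
have LG g : map_mx ev (map_mx lc (rG g)) = rG g.
  by apply: mx_lift_ev => x /H6 xc; apply: evlc; rewrite !mem_cat xc ?orbT.
have LX g : map_mx ev (map_mx lc (XY g).1) = (XY g).1.
  by apply: mx_lift_ev => x /H7 xc; apply: evlc; rewrite !mem_cat xc ?orbT.
have LY g : map_mx ev (map_mx lc (XY g).2) = (XY g).2.
  by apply: mx_lift_ev => x /H8 xc; apply: evlc; rewrite !mem_cat xc ?orbT.
pose rW g : 'M[W]_N := map_mx sg (map_mx lc (rG g)).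
have rW_repr : mx_repr G rW.
  split=> [|g h Gg Gh]; rewrite /rW.
    by rewrite -(map_mx1 sg); apply: (transfer_mx kerev); rewrite LG map_mx1 repr_mx1.
  by rewrite -map_mxM; apply: (transfer_mx kerev); rewrite map_mxM !LG repr_mxM.
pose rGW := MxRepresentation rW_repr.
pose bf i : {mpoly W[N]} := map_mpoly sg (mpoly_lift lc (f i)).
pose br i : {mpoly W[m]} := map_mpoly sg (mpoly_lift lc (r i)).
have bhom (n : nat) (u : 'I_n -> nat) d (z : {mpoly L[n]}) : whom u d z -> whom u d (map_mpoly sg (mpoly_lift lc z)).
  by move/whomP => hz; apply/whomP => mu /(lift_supp lc0)/hz.
have hbf i : whom (fun=> 1%N) (w i) (bf i) by exact: bhom.
have invbf i : inv_under rGW G (bf i).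
  move=> g Gg; have := invf i g Gg; rewrite /mact => E.
  transitivity (map_mpoly sg ((mpoly_lift lc (f i))^$ (fun i => \sum_j (map_mx lc (rG g)) j i *: 'X_j))).
    rewrite map_subst; apply: eq_subst => k; rewrite raddf_sum; apply: eq_bigr => j _.
    by rewrite /= map_mpolyZ map_mpolyX !mxE.
  apply: (transfer kerev); rewrite map_subst Lf -[RHS]E; apply: eq_subst => k; rewrite raddf_sum; apply: eq_bigr => j _.
  by rewrite /= map_mpolyZ map_mpolyX; congr (_ *: _); have /matrixP/(_ j k) := LG g; rewrite !mxE.
have hbr i : whom w (e i) (br i) by exact: bhom.
have graphT (X : {mpoly R0[N + m]}) : eval_graph f (map_mpoly ev X) = 0 -> eval_graph bf (map_mpoly sg X) = 0.
  have gE (K' : comNzRingType) (tau : {rmorphism R0 -> K'}) : map_mpoly tau (X^$ (catf (fun k => 'X_k) (fun i => mpoly_lift lc (f i))))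
      = (map_mpoly tau X)^$ (catf (fun k => 'X_k) (fun i => map_mpoly tau (mpoly_lift lc (f i)))).
    rewrite map_subst; apply: eq_subst => i; rewrite map_catf.
    by case: (split_ordP i) => k ->; rewrite ?catfL ?catfR // map_mpolyX.
  move=> E; rewrite /eval_graph -gE -(raddf0 (map_mpoly sg)); apply: (transfer kerev); rewrite gE raddf0 -[RHS]E.
  apply: eq_subst => i; case: (split_ordP i) => k ->; rewrite ?catfL ?catfR //.
have kbf : forall x, x^$ bf = 0 <-> in_ideal br x.
  apply: (@kernel_in_ideal W N m c bf br w w0 hbf t la (fun k => map_mpoly sg (mpoly_lift lc (tail k)))).
  - by move=> k; exact: bhom.
  - by move=> k mu /(lift_supp lc0); exact: tllt.
  - move=> k; have := graphT ('X_[la k] + mpoly_lift lc (tail k)); rewrite !raddfD /= !map_mpolyX Lt -raddfD; apply.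
    exact: gr0.
  - move=> k x0; exists (\sum_j br j * map_mpoly sg (mpoly_lift lc (q k j))).
      by exists (fun j => map_mpoly sg (mpoly_lift lc (q k j))).
    have eE (K' : comNzRingType) (tau : {rmorphism R0 -> K'}) (y : {mpoly R0[m]}) :
        map_mpoly tau (y^$ (fun i => 'X_(rshift N i))) = (map_mpoly tau y)^$ (fun i => 'X_(rshift N i)).
      by rewrite map_subst; apply: eq_subst => i; rewrite map_mpolyX.
    have -> : \sum_j br j * map_mpoly sg (mpoly_lift lc (q k j)) = map_mpoly sg (\sum_j mpoly_lift lc (r j) * mpoly_lift lc (q k j)).
      by rewrite raddf_sum; apply: eq_bigr => j _; rewrite /= rmorphM.
    rewrite /embY -eE -(map_mpolyX sg) -raddfD; apply: (transfer kerev).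
    rewrite raddfD /= map_mpolyX Lt qP // eE /embY; congr (_ \mPo _).
    by rewrite raddf_sum; apply: eq_bigr => j _; rewrite /= rmorphM /= Lr Lq.
  - exact: cnt.
  - move=> j; rewrite /bf /br -map_subst -(raddf0 (map_mpoly sg)); apply: (transfer kerev).
    rewrite map_subst Lr raddf0; have [_] := kf (r j); move=> <-; last by apply: in_ideal_gen.
    by apply: eq_subst => i; rewrite Lf.
have sepW (u v : 'I_N -> W) : (forall i, (bf i).@[u] = (bf i).@[v]) ->
    exists2 g, g \in G & forall i, v i = \sum_j rGW g j i * u j.
  move=> E; apply: (orbit_norm_separates pW ltp) => s ls.
  pose Fd i : {mpoly R0[N + N]} := (mpoly_lift lc (f i))^$ (fun k => 'X_(lshift N k)) - (mpoly_lift lc (f i))^$ (fun k => 'X_(rshift N k)).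
  have Fdm (K' : comNzRingType) (tau : {rmorphism R0 -> K'}) i : map_mpoly tau (Fd i) =
      (map_mpoly tau (mpoly_lift lc (f i)))^$ (fun k => 'X_(lshift N k)) - (map_mpoly tau (mpoly_lift lc (f i)))^$ (fun k => 'X_(rshift N k)).
    by rewrite rmorphB /= !map_subst; congr (_ - _); apply: eq_subst => k; rewrite map_mpolyX.
  have : map_mpoly sg (orbit_norm G (fun g => map_mx lc (rG g)) s ^+ (na (Ordinal ls)).1) =
         map_mpoly sg (\sum_i Fd i * mpoly_lift lc ((na (Ordinal ls)).2 i)).
    apply: (transfer kerev); rewrite rmorphXn /= orbit_norm_map.
    have -> : orbit_norm G (fun g => map_mx ev (map_mx lc (rG g))) s = orbit_norm G rG s.
      by apply: eq_bigr => g _; rewrite LG.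
    rewrite (naE (Ordinal ls)) raddf_sum; apply: eq_bigr => i _.
    by rewrite /= rmorphM /= La Fdm Lf.
  have -> : map_mpoly sg (\sum_i Fd i * mpoly_lift lc ((na (Ordinal ls)).2 i)) =
      \sum_i map_mpoly sg (Fd i) * map_mpoly sg (mpoly_lift lc ((na (Ordinal ls)).2 i)).
    by rewrite raddf_sum; apply: eq_bigr => i _; rewrite /= rmorphM.
  have Z i : (map_mpoly sg (Fd i)).@[catf u v] = 0.
    rewrite Fdm mevalB !meval_subst; apply/eqP; rewrite subr_eq0; apply/eqP.
    transitivity ((bf i).@[u]); first by apply: meval_eq => k; rewrite mevalXU catfL.
    by rewrite E; apply: meval_eq => k; rewrite mevalXU catfR.
  rewrite rmorphXn /= orbit_norm_map => /(congr1 (meval (catf u v))).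
  rewrite raddf_sum [X in _ = X]big1 => [|i _]; last by rewrite /= mevalM Z mul0r.
  by move/eqP; rewrite rmorphXn expf_eq0 => /andP[_ /eqP].
apply: (complete_intersection_prime_char pW w0 e0 hbf invbf hbr kbf le sepW sHG) => g Gg Hg.
apply/rank_certificate; exists (map_mx sg (map_mx lc (XY g).1)), (map_mx sg (map_mx lc (XY g).2)).
rewrite /= /rW -(map_mx1 sg N) -map_mxB -!map_mxM -(map_mx1 sg 3); apply: (transfer_mx kerev).
by rewrite !map_mxM map_mxB LX LY LG !map_mx1 XYE.
Qed.

(** * Length of a regular sequence presenting a subalgebra *)

Definition deg_le (R : nzRingType) n d (p : {mpoly R[n]}) := forall mu, p@_mu != 0 -> (mdeg mu <= d)%N.

Section DegLe.
Variables (k : fieldType) (n : nat).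
Implicit Types p q : {mpoly k[n]}.
Lemma deg_leW d d' p : (d <= d')%N -> deg_le d p -> deg_le d' p.
Proof. by move=> le H mu /H le'; apply: leq_trans le. Qed.
Lemma deg_le0 d : deg_le d (0 : {mpoly k[n]}). Proof. by move=> mu; rewrite mcoeff0 eqxx. Qed.
Lemma deg_leD d p q : deg_le d p -> deg_le d q -> deg_le d (p + q).
Proof.
move=> Hp Hq mu; rewrite mcoeffD; have [->|/Hp //] := eqVneq p@_mu 0; rewrite add0r; exact: Hq.
Qed.
Lemma deg_le_sum d (I : finType) (F : I -> {mpoly k[n]}) : (forall i, deg_le d (F i)) -> deg_le d (\sum_i F i).
Proof. by move=> H; elim/big_ind: _ => *; [exact: deg_le0|exact: deg_leD|exact: H]. Qed.
Lemma deg_leM d e p q : deg_le d p -> deg_le e q -> deg_le (d + e) (p * q).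
Proof.
move=> Hp Hq mu; rewrite -mcoeff_msupp => /msuppM_le/allpairsP[[a b] /= []]; rewrite !mcoeff_msupp.
by move=> /Hp la /Hq lb ->; rewrite mdegD leq_add.
Qed.
Lemma deg_le1 : deg_le 0 (1 : {mpoly k[n]}).
Proof. by move=> mu; rewrite mcoeff1; case: (mu =P 0%MM) => [-> _|_]; rewrite ?mdeg0 ?eqxx. Qed.
Lemma deg_leXn d p j : deg_le d p -> deg_le (j * d) (p ^+ j).
Proof.
by move=> Hp; elim: j => [|j IH]; [rewrite expr0; exact: deg_le1|rewrite exprS mulSn; exact: deg_leM].
Qed.
Lemma deg_le_ex (I : finType) (F : I -> {mpoly k[n]}) : exists d, forall i, deg_le d (F i).
Proof.
exists (\max_i msize (F i))%N => i mu; rewrite -mcoeff_msupp => /msize_mdeg_lt/ltnW le.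
exact: leq_trans le (leq_bigmax i).
Qed.
Lemma deg_le_span d p : deg_le d p -> exists C : {ffun 'I_n -> 'I_d.+1} -> k, p = \sum_a C a *: 'X_[mbox a].
Proof.
move=> Hp; exists (fun a => p@_(mbox a)); apply/mpolyP => mu; rewrite raddf_sum /=.
under eq_bigr => a _ do rewrite mcoeffZ mcoeffX.
have inj (a b : {ffun 'I_n -> 'I_d.+1}) : mbox a = mbox b -> a = b.
  by move=> E; have [|->] := @mbox_inj d.+1 n a b 0%MM 0%MM; rewrite ?E.
have [p0|nz] := eqVneq p@_mu 0.
  by rewrite p0 big1 // => a _; case: eqP => [->|_]; rewrite ?p0 ?mul0r ?mulr0.
have lt i : (mu i < d.+1)%N.
  by rewrite ltnS; apply: leq_trans (Hp _ nz); rewrite mdegE (bigD1 i) //= leq_addr.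
have aE : mbox [ffun i => Ordinal (lt i)] = mu by apply/mnmP => i; rewrite mnmE ffunE.
rewrite (bigD1 [ffun i => Ordinal (lt i)]) //= aE eqxx mulr1 big1 ?addr0 // => a ne.
by case: eqP => [E|_]; rewrite ?mulr0 //; case/eqP: ne; apply: inj; rewrite E aE.
Qed.
Lemma box_indep t : indep_mod (fun x : {mpoly k[n]} => x = 0) (fun a : {ffun 'I_n -> 'I_t} => 'X_[mbox a]).
Proof.
move=> C E a; have := congr1 (mcoeff (mbox a)) E; rewrite mcoeff0 raddf_sum (bigD1 a) //= mcoeffZ mcoeffX eqxx mulr1.
rewrite big1 ?addr0 // => b ne; rewrite mcoeffZ mcoeffX; case: eqP => [E'|_]; rewrite ?mulr0 //.
by case/eqP: ne; have [|->] := @mbox_inj t n b a 0%MM 0%MM; rewrite ?E'.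
Qed.
End DegLe.

(** In a relation the terms with exponent 0 vanish by independence modulo [rho], and the rest can be
    divided by [rho]. *)
Lemma regular_step (k : fieldType) (R : comAlgType k) (I : R -> Prop) (rho : R) (U : finType) (u : U -> R) t :
  (forall h, I (h * rho) -> I h) ->
  indep_mod (fun x => exists y, I (x - y * rho)) u ->
  indep_mod I (fun jx : 'I_t * U => rho ^+ jx.1 * u jx.2).
Proof.
move=> reg ind C; rewrite sum_pair.
suff H : forall F : nat -> U -> k, I (\sum_(j < t) \sum_x F j x *: (rho ^+ j * u x)) -> forall j x, (j < t)%N -> F j x = 0.
  pose F j x := if insub j is Some i then C (i, x) else 0.
  have FE (i : 'I_t) x : F i x = C (i, x) by rewrite /F valK.
  move=> E [j x]; rewrite -FE; apply: (H F) => //.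
  move: E; congr (I _); apply: eq_bigr => i _; apply: eq_bigr => y _; by rewrite FE.
elim: t {C} => [|t IH] F // E.
have E0 : \sum_(j < t.+1) \sum_x F j x *: (rho ^+ j * u x) =
    \sum_x F 0%N x *: u x + (\sum_(j < t) \sum_x F j.+1 x *: (rho ^+ j * u x)) * rho.
  rewrite big_ord_recl; congr (_ + _); first by apply: eq_bigr => x _; rewrite expr0 mul1r.
  rewrite mulr_suml; apply: eq_bigr => j _; rewrite mulr_suml; apply: eq_bigr => x _.
  change (F j.+1 x *: (rho ^+ j.+1 * u x) = F j.+1 x *: (rho ^+ j * u x) * rho).
  by rewrite -scalerAl exprS -mulrA [rho * _]mulrC.
have F0 : forall x, F 0%N x = 0.
  apply: ind; exists (- \sum_(j < t) \sum_x F j.+1 x *: (rho ^+ j * u x)).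
  by rewrite mulNr opprK -E0.
move: E; rewrite E0 big1 ?add0r => [/reg E [|j] x lt|x _]; [exact: F0| |by rewrite F0 scale0r].
exact: (IH (fun j => F j.+1) E).
Qed.

Section RegularCount.
Variables (k : fieldType) (m c : nat) (r : 'I_c -> {mpoly k[m]}).
Local Notation P := {mpoly k[m]}.
Hypothesis reg : regular_sequence r.
Variables (J : finType) (sg : J -> P) (t D d0 : nat).
Hypothesis ind : indep_mod (in_ideal_prefix r c) sg.
Hypothesis degr : forall i, deg_le D (r i).
Hypothesis degs : forall s, deg_le d0 (sg s).

(** [regular_step], applied from the last element of the sequence to the first, multiplies the count
    by t each time; the dimension of polynomials of bounded degree in m variables bounds the
    result. *)
Lemma regular_family : (t ^ c * #|J| <= (c * (t * D) + d0).+1 ^ m)%N.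
Proof.
have H i : (i <= c)%N -> exists (U : finType) (u : U -> P),
    [/\ #|U| = (t ^ i * #|J|)%N, indep_mod (in_ideal_prefix r (c - i)) u & forall x, deg_le (i * (t * D) + d0) (u x)].
  elim: i => [_|i IH lt]; first by exists J, sg; rewrite expn0 mul1n subn0 mul0n add0n.
  have [U [u [cU iU dU]]] := IH (ltnW lt).
  have lc : (c - i.+1 < c)%N by rewrite ltn_subrL /=; exact: leq_ltn_trans (leq0n i) lt.
  pose j0 : 'I_c := Ordinal lc.
  exists ('I_t * U)%type, (fun jx : 'I_t * U => r j0 ^+ jx.1 * u jx.2); split.
  - by rewrite card_prod card_ord cU expnS mulnA.
  - apply: regular_step; first exact: (reg.2 j0).
    move=> C [y [a E]]; apply: iU; exists (fun j => if j == j0 then y else a j).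
    have cE : (c - i = (c - i.+1).+1)%N by rewrite subnSK.
    rewrite (bigD1 j0) /=; last by rewrite cE ltnS.
    rewrite eqxx -[LHS](subrK (y * r j0)) E addrC; congr (_ + _).
    apply: eq_big => [j|j lj].
      by rewrite cE ltnS -val_eqE /=; case: ltngtP.
    by rewrite -val_eqE /= ltn_eqF.
  move=> [j x] /=; have := deg_leM (deg_leXn (j := j) (@degr j0)) (dU x); apply: deg_leW.
  by rewrite mulSn -addnA leq_add2r leq_mul2r ltnW ?orbT.
have [U [u [<- iU dU]]] := H c (leqnn c).
have := @exchange_leq k P (fun x => x = 0) U {ffun 'I_m -> 'I_(c * (t * D) + d0).+1} u (fun a => 'X_[mbox a]) (subsp0 _).
rewrite card_ffun !card_ord; apply.
- move=> C E; apply: iU; rewrite subnn E; exists (fun=> 0); by rewrite big1 // => j _; rewrite mul0r.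
- by move=> x; have [C ->] := deg_le_span (dU x); exists C; rewrite subrr.
Qed.
End RegularCount.

Section DimensionCount.
Variables (k : fieldType) (n m c : nat) (f : 'I_m -> {mpoly k[n]}) (r : 'I_c -> {mpoly k[m]}).
Hypothesis reg : regular_sequence r.
Hypothesis ker : forall y, in_ideal_prefix r c y -> y^$ f = 0.
Variables (I : finType) (b : I -> {mpoly k[n]}).
Hypothesis span : forall x, exists F : I -> {mpoly k[m]}, x = \sum_i b i * (F i)^$ f.

(** The ambient ring is finite over [A], so [A] has at least t^n / |I| independent elements of
    degree O(t); stacking powers of the sequence gives t^(c+n) / |I| independent polynomials of
    degree O(t) in m variables, where only O(t^m) fit. *)
Theorem regular_sequence_length : (c + n <= m)%N.
Proof.
have xb j := fin_all_exists (fun i => span ('X_j * b i)).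
have [F FE] := fin_all_exists xb.
have [F1 F1E] := span 1.
have [D DF] := deg_le_ex (fun z : 'I_n * I * I => F z.1.1 z.1.2 z.2).
have [D1 DF1] := deg_le_ex F1.
have [Dr Drr] := deg_le_ex r.
have mon t : forall d (mu : 'X_{1..n}), mdeg mu = d -> (d <= t)%N ->
    exists G : I -> {mpoly k[m]}, (forall i, deg_le (t * D + D1) (G i)) /\ 'X_[mu] = \sum_i b i * (G i)^$ f.
  move=> d mu dmu le; suff [G [GD GE]] : exists G : I -> {mpoly k[m]},
      (forall i, deg_le (d * D + D1) (G i)) /\ 'X_[mu] = \sum_i b i * (G i)^$ f.
    by exists G; split=> // i; apply: deg_leW (GD i); rewrite leq_add2r leq_mul2r le orbT.
  elim: d mu dmu {le} => [|d IH] mu dmu.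
    move/eqP: dmu; rewrite mdeg_eq0 => /eqP ->; exists F1; split=> [i|]; first by rewrite mul0n add0n.
    by rewrite mpolyX0.
  have [j mj] : exists j, (0 < mu j)%N.
    apply: NNPP => Hn; move: dmu; rewrite mdegE big1 // => j _; case: (posnP (mu j)) => // H'; case: Hn; by exists j.
  have le1 : (U_(j) <= mu)%MM by apply/mnm_lepP => i; rewrite mnm1E; case: eqP => [<-|_].
  have [|G [GD GE]] := IH (mu - U_(j))%MM.
    by move: dmu; rewrite -{1}(submK le1) mdegD mdeg1 addn1 => -[].
  exists (fun l => \sum_i F j i l * G i); split=> [l|].
    apply: deg_le_sum => i; rewrite mulSn -addnA; apply: deg_leM; [exact: (DF (j, i, l))|exact: GD].
  rewrite -(submK le1) mpolyXD mulrC GE mulr_sumr.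
  under eq_bigr => i _ do rewrite mulrA FE mulr_suml.
  rewrite exchange_big /=; apply: eq_bigr => l _; rewrite raddf_sum mulr_sumr; apply: eq_bigr => i _.
  by rewrite /= rmorphM mulrA.
have key t : (0 < t)%N -> (t ^ (c + n) <= #|I| * ((c * Dr + m * (n * D + D1).+1).+1 ^ m) * t ^ m)%N.
  move=> t0; pose T := (n * t * D + D1)%N.
  have [B [iB sB]] := indep_subset (subsp0 {mpoly k[n]}) (fun a : {ffun 'I_m -> 'I_T.+1} => ('X_[mbox a] : {mpoly k[m]})^$ f).
  pose J := {a | a \in B}.
  have boxdeg q N' (a : {ffun 'I_N' -> 'I_q}) : (mdeg (mbox a) <= N' * q)%N.
    rewrite mdegE; apply: (@leq_trans (\sum_(i < N') q)); last by rewrite sum_nat_const card_ord.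
    by apply: leq_sum => i _; rewrite mnmE; exact: ltnW.
  have le1 : (t ^ c * #|{: J}| <= (c * (t * Dr) + m * T.+1).+1 ^ m)%N.
    apply: (regular_family reg (sg := fun s : J => 'X_[mbox (val s)])) => // [C /ker E|s mu].
      apply: iB; have E' := E; rewrite raddf_sum in E'; rewrite -[RHS]E'; apply: eq_bigr => s _.
      by rewrite /= comp_mpolyZ.
    by rewrite mcoeffX; case: (mbox (val s) =P mu) => [<- _|_]; [exact: boxdeg|rewrite eqxx].
  have le2 : (t ^ n <= #|I| * #|{: J}|)%N.
    have := @exchange_leq k _ (fun x : {mpoly k[n]} => x = 0) {ffun 'I_n -> 'I_t} (I * J)%type (fun a => 'X_[mbox a])
      (fun z => b z.1 * ('X_[mbox (val z.2)])^$ f) (subsp0 _) (@box_indep k n t).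
    rewrite card_ffun !card_ord card_prod; apply=> a.
    have [G [GD ->]] := mon (n * t)%N _ _ (erefl _) (boxdeg _ _ a).
    have GC i : exists C : J -> k, (G i)^$ f = \sum_s C s *: ('X_[mbox (val s)])^$ f.
      have [C ->] := deg_le_span (GD i).
      have [C' C'E] := fin_all_exists sB.
      exists (fun s => \sum_a C a * C' a s); rewrite raddf_sum /=.
      under [RHS]eq_bigr => s _ do rewrite scaler_suml.
      rewrite [RHS]exchange_big /=; apply: eq_bigr => a' _; rewrite comp_mpolyZ.
      have /eqP := C'E a'; rewrite subr_eq0 => /eqP ->; rewrite scaler_sumr; apply: eq_bigr => s _.
      by rewrite scalerA.
    have [C CE] := fin_all_exists GC.
    exists (fun z => C z.1 z.2); rewrite sum_pair; apply/eqP; rewrite subr_eq0; apply/eqP.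
    apply: eq_bigr => i _; rewrite CE mulr_sumr; apply: eq_bigr => s _; by rewrite /= scalerAr.
  rewrite expnD; apply: leq_trans (leq_mul (leqnn _) le2) _; rewrite mulnCA -mulnA leq_mul2l.
  apply/orP; right; apply: leq_trans le1 _; rewrite -expnMn.
  have le3 : ((c * (t * Dr) + m * T.+1).+1 <= (c * Dr + m * (n * D + D1).+1).+1 * t)%N.
    rewrite /T; move: t0; clear; case: t => // t _.
    have e1 : (c * (t.+1 * Dr) = c * Dr * t.+1)%N by ring.
    have e2 : (m * (n * t.+1 * D + D1).+1 <= m * (n * D + D1).+1 * t.+1)%N.
      by rewrite -[X in (_ <= X)%N]mulnA leq_mul2l; apply/orP; right; nia.
    by rewrite e1 -[(_ + _).+1]addn1 mulSn mulnDl; lia.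
  by case: (m) le3 => // m' le3; rewrite leq_exp2r.
apply: NNPP => /negP; rewrite -ltnNge => lt.
(* At t = C + 1 the inequality t ^ (c + n) <= C * t ^ m fails as soon as c + n > m. *)
pose C := (#|I| * ((c * Dr + m * (n * D + D1).+1).+1 ^ m))%N.
have := key C.+1 isT; rewrite -/C -(subnKC lt) expnD addnC expnS.
have p0 : (0 < C.+1 ^ m)%N by rewrite expn_gt0.
move=> H; have : (C.+1 ^ m.+1 <= C * C.+1 ^ m)%N.
  apply: leq_trans H; rewrite expnS leq_pmulr // expn_gt0 //.
by rewrite expnS leq_pmul2r // ltnn.
Qed.
End DimensionCount.

(** * Homogeneous generators, base change and the theorem *)

Section HomogeneousGenerators.
Variables (k : fieldType) (m c : nat) (w : 'I_m -> nat) (r : 'I_c -> {mpoly k[m]}).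
Local Notation P := {mpoly k[m]}.
Hypothesis w_gt0 : forall i, (0 < w i)%N.
Hypothesis graded : forall d x, in_ideal r x -> in_ideal r (wcomp w d x).
Hypothesis proper : ~ in_ideal r 1.

Lemma wcomp0 (x : P) : wcomp w 0 x = (x@_0%MM)%:MP.
Proof.
apply/mpolyP => mu; rewrite mcoeff_wcomp mcoeffC; have [->|ne] := eqVneq mu 0%MM; first by rewrite wdeg0 eqxx mulr1.
rewrite mulr0 ifF //; apply/negP => /eqP E; case/eqP: ne; apply/mnmP => i; rewrite mnm0E.
move/eqP: E; rewrite /wdeg sum_nat_eq0 => /forallP/(_ i) /=; rewrite muln_eq0 => /orP[/eqP E|/eqP -> //].
by have := w_gt0 i; rewrite E.
Qed.

Let good l := exists (rho : 'I_l -> P) (e : 'I_l -> nat),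
  [/\ forall i, (0 < e i)%N, forall i, whom w (e i) (rho i) & forall x, in_ideal rho x <-> in_ideal r x].

Let good_ex : exists l, good l.
Proof.
have [B BE] := fin_all_exists (fun j => wcomp_decomp w (r j)).
pose T : finType := {j : 'I_c & 'I_(B j)}.
pose rho (i : 'I_#|T|) : P := wcomp w (tagged (enum_val i)) (r (tag (enum_val i))).
have he (i : 'I_#|T|) : exists e, (0 < e)%N /\ whom w e (rho i).
  rewrite /rho; case: (enum_val i) => j [[|d] ld] /=; last by exists d.+1; split=> //; exact: wcomp_idem.
  (* A component of degree 0 is a constant in a proper ideal, hence 0, and 0 is homogeneous of the
     positive degree 1 as well. *)
  exists 1%N; split=> //; have H := graded 0 (in_ideal_gen r j); rewrite wcomp0 in H *.
  have [->|nz] := eqVneq (r j)@_0%MM 0; first by rewrite mpolyC0; exact: whom0.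
  case: proper; have := in_idealMl (((r j)@_(0%MM))^-1)%:MP H; by rewrite -mpolyCM mulVf.
have [e eP] := fin_all_exists he.
exists #|T|, rho, e; split=> [i|i|x]; [by case: (eP i)|by case: (eP i)|split=> [[q ->]|[q ->]]].
  by apply: in_ideal_sum => i _; apply/in_idealMr/graded/in_ideal_gen.
apply: in_ideal_sum => j _; apply: in_idealMr; rewrite (BE j); apply: in_ideal_sum => d _.
have := in_ideal_gen rho (enum_rank (Tagged (fun j => 'I_(B j)) d : T)).
by rewrite /rho enum_rankK.
Qed.

(** In a homogeneous generating set of minimal size no relation has a nonzero constant coefficient,
    since a component of it would eliminate a generator; expressing more than c generators through
    the [r j] and back would produce such a relation. The bound on their number is what keeps the
    inequality between variables and relations. *)
Theorem homogeneous_generators : exists l, (l <= c)%N /\ good l.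
Proof.
have [l gl lmin] := nat_min good_ex; exists l; split=> //; rewrite leqNgt; apply/negP => lt.
have [rho [e [e0 hr rE]]] := gl.
have qE j : exists q : 'I_l -> P, r j = \sum_i rho i * q i by apply/rE/in_ideal_gen.
have pE i : exists q : 'I_c -> P, rho i = \sum_j r j * q j by apply/rE/in_ideal_gen.
have [q {}qE] := fin_all_exists qE; have [p {}pE] := fin_all_exists pE.
pose Q : 'M[k]_(l, c) := \matrix_(i, j) (q j i)@_0%MM.
pose Pm : 'M[k]_(c, l) := \matrix_(j, i) (p i j)@_0%MM.
(* The matrices of constant terms have rank at most c < l, so their product is not the identity; a
   wrong entry makes a constant coefficient of the relation [Nn] nonzero. *)
have [i0 [i ne]] : exists i0 i, (Q *m Pm) i0 i != (i0 == i)%:R.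
  apply: NNPP => Hn; have E : Q *m Pm = 1%:M.
    by apply/matrixP => i0 i; rewrite [RHS]mxE; apply/eqP/negPn/negP => H; apply: Hn; exists i0, i.
  have := mxrankM_maxl Q Pm; rewrite E mxrank1 => le; have := leq_trans le (rank_leq_col Q).
  by rewrite leqNgt lt.
pose Nn (i' : 'I_l) : P := (i' == i)%:R - \sum_j q j i' * p i j.
have N0 : \sum_i' rho i' * Nn i' = 0.
  rewrite /Nn; under eq_bigr => i' _ do rewrite mulrBr mulr_sumr.
  rewrite sumrB (bigD1 i) //= eqxx mulr1 big1 ?addr0 => [|i' /negPf ->]; last by rewrite mulr0.
  rewrite exchange_big /= {1}pE -sumrB big1 // => j _; rewrite {1}qE mulr_suml -sumrB big1 // => i' _.
  by rewrite mulrA subrr.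
have a0 : (Nn i0)@_0%MM != 0.
  rewrite /Nn mcoeffB raddf_sum /= -mpolyC_nat mcoeffC eqxx mulr1 subr_eq0 eq_sym; move: ne; rewrite mxE.
  congr (_ != _); apply: eq_bigr => j _; rewrite !mxE.
  by rewrite -[RHS]/(mcoeff 0%MM (q j i0 * p i j)) rmorphM.
(* The component of degree [e i0] of the relation: there the coefficient of [rho i0] is exactly its
   constant term. *)
have rel : \sum_i' rho i' * (if (e i' <= e i0)%N then wcomp w (e i0 - e i')%N (Nn i') else 0) = 0.
  have := congr1 (wcomp w (e i0)) N0; rewrite raddf0 raddf_sum => E; rewrite -[RHS]E; apply: eq_bigr => i' _.
  by rewrite /= (wcompM _ _ (hr i')); case: ifP; rewrite ?mulr0.
case: l lt rho e e0 hr rE q qE p pE Q Pm i0 i ne Nn N0 a0 rel gl lmin => // l lt rho e e0 hr rE q qE p pE Q Pm i0 i ne Nn N0 a0 rel gl lmin.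
suff /lmin : good l by rewrite ltnn.
have mem0 : in_ideal (fun j => rho (lift i0 j)) (rho i0).
  move: rel; rewrite (bigD1_ord i0) //= leqnn subnn wcomp0 => /eqP; rewrite addr_eq0 => /eqP E.
  have -> : rho i0 = (((Nn i0)@_(0%MM))^-1)%:MP * (rho i0 * ((Nn i0)@_0%MM)%:MP).
    by rewrite mulrCA -mpolyCM mulVf // mpolyC1 mulr1.
  rewrite E; apply/in_idealMl/in_idealN/in_ideal_sum => j _; apply: in_idealMr.
  exact: (in_ideal_gen (fun j => rho (lift i0 j))).
exists (fun j => rho (lift i0 j)), (fun j => e (lift i0 j)); split=> // x; rewrite -rE; split=> [[a ->]|[a ->]].
  by apply: in_ideal_sum => j _; apply/in_idealMr/in_ideal_gen.
apply: in_ideal_sum => j _; apply: in_idealMr; case: (unliftP i0 j) => [j' ->|->] //.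
exact: (in_ideal_gen (fun j => rho (lift i0 j))).
Qed.
End HomogeneousGenerators.

(** * Descent between a field and its extension *)

Section BaseChange.
Variables (k L : fieldType) (iota : {rmorphism k -> L}).
Local Notation mp := (map_mpoly iota).

Definition indep_over s (e : 'I_s -> L) := forall a : 'I_s -> k, \sum_l iota (a l) * e l = 0 -> forall l, a l = 0.

(** The basis of the span is made to start with 1, so that the coordinate along 1 splits the
    inclusion of [k]. *)
Lemma independent_span (cs : seq L) : exists s (e : 'I_s.+1 -> L), [/\ e ord0 = 1, indep_over e &
  forall x, x \in cs -> exists a, x = \sum_l iota (a l) * e l].
Proof.
elim: cs => [|x cs [s [e [e0 ie se]]]].
  exists 0%N, (fun=> 1); split=> // a; rewrite big_ord1 mulr1 => /eqP; rewrite fmorph_eq0 => /eqP E l.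
  by rewrite ord1.
have [xs|nx] := classic (exists a, x = \sum_l iota (a l) * e l).
  by exists s, e; split=> // y; rewrite inE => /orP[/eqP ->|/se].
pose e' (l : 'I_s.+2) := if (l < s.+1)%N then e (inord l) else x.
have eW (l : 'I_s.+1) : e' (widen_ord (leqnSn _) l) = e l by rewrite /e' /= ltn_ord inord_val.
have eM : e' ord_max = x by rewrite /e' /= ltnn.
exists s.+1, e'; split=> [|a|y].
- by rewrite /e' /= -e0; congr e; apply/val_inj; rewrite /= inordK.
- rewrite big_ord_recr /= eM; under eq_bigr => l _ do rewrite eW; move=> E.
  have am : a ord_max = 0.
    apply/eqP/negPn/negP => nz; apply: nx; exists (fun l => - (a ord_max)^-1 * a (widen_ord (leqnSn _) l)).
    move/eqP: E; rewrite addr_eq0 => /eqP E.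
    under eq_bigr => l _ do rewrite rmorphM -mulrA; rewrite -mulr_sumr E rmorphN mulrNN mulrA -rmorphM mulVf //.
    by rewrite rmorph1 mul1r.
  move: E; rewrite am rmorph0 mul0r addr0 => /ie aW l.
  have [lt|ge] := ltnP l s.+1.
    by rewrite -(aW (Ordinal lt)); congr a; apply/val_inj.
  by rewrite -am; congr a; apply/val_inj/eqP; rewrite /= eqn_leq ge -ltnS ltn_ord.
- rewrite inE => /orP[/eqP ->|/se[a ->]].
    exists (fun l => if l == ord_max then 1 else 0); rewrite (bigD1 ord_max) //= eqxx rmorph1 mul1r eM big1 ?addr0 // => l.
    by move/negPf ->; rewrite rmorph0 mul0r.
  pose a' (l : 'I_s.+2) := if (l < s.+1)%N then a (inord l) else 0.
  have aW (l : 'I_s.+1) : a' (widen_ord (leqnSn _) l) = a l by rewrite /a' /= ltn_ord inord_val.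
  have aM : a' ord_max = 0 by rewrite /a' /= ltnn.
  exists a'; rewrite [RHS]big_ord_recr /= aM rmorph0 mul0r addr0.
  by apply: eq_bigr => l _; rewrite aW eW.
Qed.

Lemma mpoly_expand n (I : finType) (F : I -> {mpoly L[n]}) : exists s (e : 'I_s.+1 -> L) (G : I -> 'I_s.+1 -> {mpoly k[n]}),
  [/\ e ord0 = 1, indep_over e & forall i, F i = \sum_l e l *: mp (G i l)].
Proof.
have [cs cP] := finite_cover (fun i => coefs (F i)).
have [s [e [e0 ie se]]] := independent_span cs.
have se' x : exists a, x \in cs -> x = \sum_l iota (a l) * e l.
  by have [/se[a E]|nx] := boolP (x \in cs); [exists a|exists (fun=> 0)].
pose a x := proj1_sig (constructive_indefinite_description _ (se' x)).
have aP x : x \in cs -> x = \sum_l iota (a x l) * e l.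
  by rewrite /a; case: (constructive_indefinite_description _ _).
exists s, e, (fun i l => \sum_(mu <- msupp (F i)) a (F i)@_mu l *: 'X_[mu]); split=> // i.
rewrite {1}(mpolyE (F i)); under [RHS]eq_bigr => l _ do rewrite [X in _ *: X]raddf_sum /= scaler_sumr.
rewrite exchange_big /= !big_seq; apply: eq_bigr => mu mF.
have xc : (F i)@_mu \in cs by apply: (cP i); exact: map_f.
rewrite {1}(aP _ xc) scaler_suml; apply: eq_bigr => l _.
by rewrite map_mpolyZ map_mpolyX scalerA mulrC.
Qed.

Lemma mpoly_indep n s (e : 'I_s -> L) (G : 'I_s -> {mpoly k[n]}) : indep_over e ->
  \sum_l e l *: mp (G l) = 0 -> forall l, G l = 0.
Proof.
move=> ie E l; apply/mpolyP => mu; rewrite mcoeff0; apply: (ie (fun l => (G l)@_mu)).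
have := congr1 (mcoeff mu) E; rewrite mcoeff0 raddf_sum => E'; rewrite -[RHS]E'; apply: eq_bigr => j _.
by rewrite /= mcoeffZ mcoeff_map_mpoly mulrC.
Qed.

Variables (n m : nat) (f : 'I_m -> {mpoly k[n]}).
Local Notation fL := (fun i => mp (f i)).

(** Expanded over a [k]-independent family of scalars, each component of a kernel element is a
    kernel element over [k]. *)
Lemma kernel_base_change c (r : 'I_c -> {mpoly k[m]}) : (forall x, x^$ f = 0 <-> in_ideal r x) ->
  forall x : {mpoly L[m]}, x^$ fL = 0 <-> in_ideal (fun j => mp (r j)) x.
Proof.
move=> kf x; split=> [x0|[a ->]]; last first.
  rewrite raddf_sum big1 // => j _; rewrite /= rmorphM /= -map_subst; have [_ ->] := kf (r j); last exact: in_ideal_gen.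
  by rewrite raddf0 mul0r.
have [s [e [G [_ ie xE]]]] := mpoly_expand (fun _ : 'I_1 => x).
have G0 l : (G ord0 l)^$ f = 0.
  apply: (mpoly_indep (G := fun l => (G ord0 l)^$ f) ie); rewrite -[RHS]x0 [in RHS](xE ord0) raddf_sum.
  by apply: eq_bigr => j _; rewrite /= comp_mpolyZ map_subst.
rewrite (xE ord0); apply: in_ideal_sum => l _; rewrite -mul_mpolyC; apply: in_idealMl.
have /kf[a ->] := G0 l; rewrite raddf_sum; apply: in_ideal_sum => j _; rewrite /= rmorphM; apply: in_idealMr.
exact: (in_ideal_gen (fun j => mp (r j))).
Qed.

(** The components of the coefficients [a i] along [e ord0 = 1] are coefficients over [k]. *)
Lemma ideal_descent x : in_ideal fL (mp x) -> in_ideal f x.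
Proof.
move=> [a aE]; have [s [e [G [e0 ie aG]]]] := mpoly_expand a.
have : \sum_l e l *: mp (\sum_i f i * G i l - (if l == ord0 then x else 0)) = 0.
  have E1 l : e l *: mp (\sum_i f i * G i l - (if l == ord0 then x else 0)) =
      \sum_i e l *: mp (f i * G i l) - e l *: mp (if l == ord0 then x else 0).
    by rewrite rmorphB /= scalerBr; congr (_ - _); rewrite [X in _ *: X]raddf_sum /= scaler_sumr.
  rewrite (eq_bigr _ (fun l _ => E1 l)).
  rewrite sumrB exchange_big /= [X in _ - X](bigD1 ord0) //= e0 scale1r [X in _ - (_ + X)]big1 => [|l /negPf ->];
    last by rewrite raddf0 scaler0.
  rewrite addr0 aE -sumrB big1 // => i _; rewrite aG mulr_sumr -sumrB big1 // => l _.
  by rewrite rmorphM /= scalerAr subrr.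
move/(mpoly_indep ie)/(_ ord0)/eqP; rewrite eqxx subr_eq0 => /eqP <-; by exists (fun i => G i ord0).
Qed.
End BaseChange.

(** The coefficients of the product over G of X - sum_i (g x_i) T^i are invariants, and at a point
    its roots encode the orbit of the point. *)
Lemma invariants_separate (k : fieldType) (gT : finGroupType) (G : {group gT}) n (rG : mx_representation k G n)
    (L : closedFieldType) (iota : {rmorphism k -> L}) u v :
  (forall f, Defs.invariant rG f -> evalbar iota f u = evalbar iota f v) ->
  exists2 g, g \in G & forall i, v i = \sum_j iota (rG g j i) * u j.
Proof.
move=> H; pose S := {mpoly k[n]}; pose act g : {rmorphism S -> S} := mact (rG g).
pose ell g : {poly S} := \sum_(i < n) (act g 'X_i)%:P * 'X^i.
pose B : {poly {poly S}} := \prod_(g in G) ('X - (ell g)%:P).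
have actB h : h \in G -> map_poly (map_poly (act h)) B = B.
  move=> Gh; rewrite /B rmorph_prod [RHS](reindex_inj (mulgI h)) /=.
  apply: eq_big => [x|x Gx]; first by rewrite groupMl.
  rewrite rmorphB /= map_polyX map_polyC /=; congr (_ - _%:P); rewrite /ell raddf_sum; apply: eq_bigr => i _.
  by rewrite /= rmorphM /= map_polyC map_polyXn /= actM.
have invB a b : Defs.invariant rG (B`_a)`_b.
  by move=> h Gh; have := congr1 (fun z : {poly {poly S}} => (z`_a)`_b) (actB h Gh); rewrite !coef_map.
pose ev x : {rmorphism S -> L} := meval x \o map_mpoly iota.
pose Z (x : 'I_n -> L) : {poly L} := \sum_(i < n) (x i)%:P * 'X^i.
pose gu g (x : 'I_n -> L) i := \sum_j iota (rG g j i) * x j.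
have evB x : map_poly (map_poly (ev x)) B = \prod_(g in G) ('X - (Z (gu g x))%:P).
  rewrite /B rmorph_prod; apply: eq_bigr => g Gg.
  rewrite rmorphB /= map_polyX map_polyC /=; congr (_ - _%:P); rewrite /ell raddf_sum; apply: eq_bigr => i _.
  rewrite /= rmorphM /= map_polyC map_polyXn /=; congr (_%:P * _).
  rewrite /act /mact /= substXU [X in meval x X]raddf_sum raddf_sum; apply: eq_bigr => j _.
  by rewrite /= map_mpolyZ map_mpolyX mevalZ mevalXU.
have E : map_poly (map_poly (ev u)) B = map_poly (map_poly (ev v)) B.
  by apply/polyP => a; apply/polyP => b; rewrite !coef_map; exact: H (invB a b).
have Zinj x y : Z x = Z y -> forall i, x i = y i.
  move=> /(congr1 (fun z : {poly L} => fun i : nat => z`_i)) E' i; have := congr1 (fun h => h (i : nat)) E'.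
  have Zc z : (Z z)`_i = z i.
    rewrite /Z coef_sum (bigD1 i) //= coefCM coefXn eqxx mulr1 big1 ?addr0 // => j ne.
    rewrite coefCM coefXn [_ == _](_ : _ = false) ?mulr0 //.
    by apply/negP => /eqP E1; case/eqP: ne; apply/val_inj.
  by rewrite /= !Zc.
have : (map_poly (map_poly (ev u)) B).[Z v] = 0.
  rewrite E evB horner_prod; apply/eqP; rewrite prodf_seq_eq0; apply/hasP; exists 1%g; first exact: mem_index_enum.
  rewrite group1 /= hornerXsubC subr_eq0; apply/eqP; rewrite /Z; apply: eq_bigr => i _; congr (_%:P * _).
  rewrite /gu (bigD1 i) //= repr_mx1 mxE eqxx rmorph1 mul1r big1 ?addr0 // => j /negPf ne.
  by rewrite mxE ne rmorph0 mul0r.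
rewrite evB horner_prod => /eqP/prodf_eq0[g Gg]; rewrite hornerXsubC subr_eq0 => /eqP/Zinj E'.
by exists g.
Qed.

Lemma closed_field_pchar (L : closedFieldType) : (exists p, p \in [pchar L]) \/ [pchar L] =i pred0.
Proof.
have [|n] := classic (exists p, p \in [pchar L]); [by left|right => p].
by rewrite [RHS]inE; apply/negP => H; apply: n; exists p.
Qed.

Lemma in_ideal_prefixE (R : comNzRingType) c (r : 'I_c -> R) x : in_ideal_prefix r c x <-> in_ideal r x.
Proof.
split=> -[a ->]; exists a; [|symmetry]; apply: eq_big => j; rewrite ?ltn_ord // => _; exact: mulrC.
Qed.

Theorem theorem1p3 (k : fieldType) (gT : finGroupType) (G : {group gT})
  (n : nat) (rG : mx_representation k G n)
  (L : closedFieldType) (iota : {rmorphism k -> L})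
  (HL : is_algebraic_closure iota) :
  (exists A : {mpoly k[n]} -> Prop,
     [/\ graded_subalgebra_of_invariants rG A,
         geometric_separating rG iota A &
         graded_complete_intersection A]) ->
  generated_by_bireflections rG.
Proof.
move=> [A [[A_inv _ _ _ _] sep [m [f [w [c [r [fP AE kerE reg]]]]]]]].
have w0 i : (0 < w i)%N by case: (fP i).
have hf i : whom (fun=> 1%N) (w i) (f i).
  apply/whomP => mu; rewrite -mcoeff_msupp => mf; have [_ /dhomogP/(_ _ mf) E _] := fP i.
  have {}E : mdeg mu = w i := E; by rewrite -E /wdeg mdegE; apply: eq_bigr => j _; rewrite mul1n.
have kf x : x^$ f = 0 <-> in_ideal r x by rewrite -in_ideal_prefixE; exact: kerE.
pose fL i : {mpoly L[n]} := map_mpoly iota (f i).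
have bhom N (u : 'I_N -> nat) d (z : {mpoly k[N]}) : whom u d z -> whom u d (map_mpoly iota z).
  move/whomP => hz; apply/whomP => mu; rewrite mcoeff_map_mpoly => nz; apply: hz.
  by apply: contraNneq nz => ->; apply/eqP; exact: rmorph0.
have hfL i : whom (fun=> 1%N) (w i) (fL i) by exact: bhom.
pose rL g : 'M[L]_n := map_mx iota (rG g).
have rL_repr : mx_repr G rL.
  by split=> [|g h Gg Gh]; rewrite /rL ?repr_mx1 ?map_mx1 ?repr_mxM ?map_mxM.
pose rGL := MxRepresentation rL_repr.
have invL i : inv_under rGL G (fL i).
  move=> g Gg; have [_ _ /A_inv/(_ g Gg) E] := fP i; rewrite /fL -[in RHS]E [RHS]map_subst /mact; apply: eq_subst => j.
  by rewrite raddf_sum; apply: eq_bigr => l _; rewrite /= map_mpolyZ map_mpolyX mxE.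
(* [A] separates what the invariants separate, and the invariants separate orbits; the generators f
   therefore do so too. *)
have sepL (u v : 'I_n -> L) : (forall i, (fL i).@[u] = (fL i).@[v]) ->
    exists2 g, g \in G & forall i, v i = \sum_j rGL g j i * u j.
  move=> E; have [|g Gg gE] := @invariants_separate k gT G n rG L iota u v.
    apply/sep => h /AE[p ->]; rewrite /evalbar [map_mpoly _ _]map_subst !meval_subst; exact: meval_eq.
  by exists g => // i; rewrite gE; apply: eq_bigr => j _; rewrite /= mxE.
have null_fL (v : 'I_n -> L) : (forall i, (fL i).@[v] = 0) -> forall i, v i = 0.
  move=> Z; have [|g _ gE] := sepL (fun=> 0) v; last by move=> i; rewrite gE big1 // => j _; rewrite mulr0.
  by move=> i; rewrite Z (eval0_hom (w0 i) (hfL i)).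
(* Over [L] only the origin annuls all the f_i, so powers of the variables lie in their ideal; the
   membership descends to [k], where the length of the regular sequence is counted. *)
have [M ME] := fin_all_exists (fun i => @nullstellensatz L n m fL 'X_i (fun v H => etrans (mevalXU _ _) (null_fL v H i))).
have ME' i : in_ideal f ('X_i ^+ M i).
  by apply: (@ideal_descent k L iota); rewrite rmorphXn /= map_mpolyX.
have [D DP] := high_monomials_of_powers (fun=> 1%N) ME'.
have one_gt0 (i : 'I_n) : (0 < (fun=> 1) i)%N by [].
have [I [b [bd [_ _ sp]]]] := graded_basis one_gt0 w0 hf DP.
have cnm : (c + n <= m)%N by apply: (@regular_sequence_length k n m c f r reg _ I b sp) => y /in_ideal_prefixE/kf.
have grd d x : in_ideal r x -> in_ideal r (wcomp w d x).
  by move=> /kf x0; apply/kf; rewrite (wcomp_subst _ _ hf) x0 raddf0.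
have prop : ~ in_ideal r 1 by move/kf/eqP; rewrite rmorph1 oner_eq0.
have [l [lc [rho [e [e0 hrho rhoE]]]]] := homogeneous_generators w0 grd prop.
have kL : forall x : {mpoly L[m]}, x^$ fL = 0 <-> in_ideal (fun j => map_mpoly iota (rho j)) x.
  by apply: kernel_base_change => x; rewrite rhoE.
have lnm : (l + n <= m)%N by apply: leq_trans cnm; rewrite leq_add2r.
pose H := <<[set b in G | bireflection rG b]>>%G.
have sHG : H \subset G by rewrite gen_subG; apply/subsetP => x; rewrite inE => /andP[].
(* The codimension of the fixed space is the rank of g - 1, unchanged by extension of scalars;
   outside H it exceeds 2. *)
have rk g : g \in G -> g \notin H -> (3 <= \rank ((rGL g - 1%:M)%R))%N.
  move=> Gg Hg; have : ~~ bireflection rG g.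
    by apply: contra Hg => bg; apply: mem_gen; rewrite inE Gg.
  rewrite /bireflection -ltnNge mxrank_ker subKn ?rank_leq_row //.
  by rewrite /= /rL -(map_mx1 iota n) -map_mxB mxrank_map.
have hrL i : whom w (e i) (map_mpoly iota (rho i)) by exact: bhom.
have sGH : G \subset H.
  have [[p pL]|L0] := closed_field_pchar L.
    exact: (complete_intersection_prime_char pL w0 e0 hfL invL hrL kL lnm sepL sHG rk).
  exact: (complete_intersection_char0 L0 w0 e0 hfL invL hrL kL lnm sepL sHG rk).
by move=> g Gg; exists g => //; exact: (subsetP sGH).
Qed.
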